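(* Let $\mathfrak h\in\mathrm{UC}_c$, $\alpha_1<\cdots<\alpha_m$ and $\beta_1,\dots,\beta_m\in\mathbb R$. Let $\mathbf T_{\mathfrak h}$ be the operator on $L^2(\{1,\dots,m\}\times\Gamma_{1,\mathrm R})$ with kernel $$\mathbf T_{\mathfrak h}(i,\zeta;j,\eta)=\Big(\prod_{\ell=1}^i\int_{\Gamma_{\ell,\mathrm L}^{\mathrm{in}}}\frac{\mathrm d\xi_\ell}{2\pi\mathrm i}\Big)\frac{\prod_{\ell=1}^i\mathrm F_\ell(\xi_\ell)\cdot\chi_{\mathfrak h}(\eta,\xi_1)}{\prod_{\ell=1}^{i-1}(\xi_\ell-\xi_{\ell+1})\cdot(\xi_i-\zeta)}\cdot\frac{1}{\mathrm f_j(\eta)},$$ and let $$\mathbf S_{\mathfrak h}=-\mathbf K^{\mathrm{hypo}(\mathfrak h)}_{1,\alpha_1}+\mathbf 1_{\le\beta_1}\mathrm e^{(\alpha_2-\alpha_1)\partial^2}\mathbf 1_{\le\beta_2}\mathrm e^{(\alpha_3-\alpha_2)\partial^2}\cdots\mathbf 1_{\le\beta_m}\mathrm e^{(\alpha_1-\alpha_m)\partial^2}\mathbf K^{\mathrm{hypo}(\mathfrak h)}_{1,\alpha_1}$$ be the path integral kernel of Matetski–Quastel–Remenik on $L^2(\mathbb R)$. Then $$\det(\mathrm I+\mathbf S_{\mathfrak h})_{L^2(\mathbb R)}=\det(\mathrm I+\mathbf T_{\mathfrak h})_{L^2(\{1,\dots,m\}\times\Gamma_{1,\mathrm R})}.$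$
   Context: $\mathrm{UC}_c$ is the set of upper semicontinuous $\mathfrak h:\mathbb R\to[-\infty,\infty)$, $\mathfrak h\not\equiv-\infty$, equal to $-\infty$ outside a compact set. **Hitting times and $\chi_{\mathfrak h}$.** Let $\mathbf B$ be a two-sided Brownian motion with diffusivity constant $2$ (i.e. $\mathrm{Var}(\mathbf B(t)-\mathbf B(s))=2|t-s|$), $\boldsymbol\tau_+=\inf\{\alpha\ge0:\mathbf B(\alpha)\le\mathfrak h(\alpha)\}$, $\boldsymbol\tau_-=\sup\{\alpha\le0:\mathbf B(\alpha)\le\mathfrak h(\alpha)\}$. For $\mathrm{Re}\,\eta>0>\mathrm{Re}\,\xi$ put $E^+(s)=\mathbb E_{\mathbf B(0)=s}[e^{-\boldsymbol\tau_+\xi^2-\mathbf B(\boldsymbol\tau_+)\xi}\mathbf 1_{\boldsymbol\tau_+<\infty}]$, $E^-(s)=\mathbb E_{\mathbf B(0)=s}[e^{\boldsymbol\tau_-\eta^2+\mathbf B(\boldsymbol\tau_-)\eta}\mathbf 1_{\boldsymbol\tau_->-\infty}]$ and $\chi_{\mathfrak h}(\eta,\xi)=\int_{\mathbb R}(e^{s\eta}E^+(s)+e^{-s\xi}E^-(s)-E^+(s)E^-(s))\,\mathrm ds$. **Contours and functions.** $\Gamma_{1,\mathrm L}^{\mathrm{in}}=\Gamma_{1,\mathrm L},\Gamma_{2,\mathrm L}^{\mathrm{in}},\dots,\Gamma_{m,\mathrm L}^{\mathrm{in}}$ are disjoint contours in $\{\mathrm{Re}<0\}$ ordered from right to left,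 each from $\infty e^{-2\pi\mathrm i/3}$ to $\infty e^{2\pi\mathrm i/3}$; $\Gamma_{1,\mathrm R}$ is a contour in $\{\mathrm{Re}>0\}$ from $\infty e^{-\pi\mathrm i/5}$ to $\infty e^{\pi\mathrm i/5}$. $\mathrm f_i(\zeta)=e^{-\frac13\zeta^3+\alpha_i\zeta^2+\beta_i\zeta}$ ($1\le i\le m$), $\mathrm F_1=\mathrm f_1$, $\mathrm F_i=\mathrm f_i/\mathrm f_{i-1}$ for $i\ge2$. **Operators (given by integral kernels on $\mathbb R$).** $\mathbf 1_{\le\beta}$ is multiplication by the indicator of $(-\infty,\beta]$. For $t>0$, $\mathrm e^{t\partial^2}(p,q)=\frac{1}{\sqrt{4\pi t}}e^{-(p-q)^2/(4t)}$. For $t>0$, $x\in\mathbb R$: $S_{t,x}(p,q)=\int_{\Gamma_{1,\mathrm R}}\frac{\mathrm d\eta}{2\pi\mathrm i}e^{\frac t3\eta^3+x\eta^2+(p-q)\eta}$; $A^*(p,q)=A(q,p)$; $$S^{\mathrm{hypo}(\mathfrak h^+)}_{t,x}(p,q)=\mathbb E_{\mathbf B(0)=p}[S_{t,x-\boldsymbol\tau_+}(\mathbf B(\boldsymbol\tau_+),q)\mathbf 1_{\boldsymbol\tau_+<\infty}],\qquad S^{\mathrm{hypo}(\mathfrak h^-)}_{t,x}(p,q)=\mathbb E_{\mathbf B(0)=p}[S_{t,x+\boldsymbol\tau_-}(\mathbf B(\boldsymbol\tau_-),q)\mathbf 1_{\boldsymbol\tau_->-\infty}].$$ For $a\in\mathbb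 R$ put $$\mathbf K[a]=\big(S^{\mathrm{hypo}(\mathfrak h^-)}_{1,-a}\big)^*S_{1,\alpha_1}+S^*_{1,-a}S^{\mathrm{hypo}(\mathfrak h^+)}_{1,\alpha_1}-\big(S^{\mathrm{hypo}(\mathfrak h^-)}_{1,-a}\big)^*S^{\mathrm{hypo}(\mathfrak h^+)}_{1,\alpha_1}.$$ Then $\mathbf K^{\mathrm{hypo}(\mathfrak h)}_{1,\alpha_1}=\mathbf K[\alpha_1]$, and for $a\ge\alpha_1$ the backward heat flow $\mathrm e^{(\alpha_1-a)\partial^2}\mathbf K^{\mathrm{hypo}(\mathfrak h)}_{1,\alpha_1}$ is by definition $\mathbf K[a]$ (consistent with $\mathrm e^{-b\partial^2}S^*_{1,-x}=S^*_{1,-x-b}$). For $m=1$, $\mathbf S_{\mathfrak h}=-\mathbf K[\alpha_1]+\mathbf 1_{\le\beta_1}\mathbf K[\alpha_1]$. **Fredholm determinants** are understood as Fredholm series $\sum_{k\ge0}\frac1{k!}\int\cdots\int\det[K(x_a,x_b)]_{a,b=1}^k$, with Lebesgue measure on $\mathbb R$, and with counting measure times $\frac{\mathrm d\eta}{2\pi\mathrm i}$ on $\{1,\dots,m\}\times\Gamma_{1,\mathrm R}$. *)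

(* Defs.v *)
From HB Require Import structures.
From mathcomp Require Import all_boot all_order all_algebra.
From mathcomp Require Import complex.
From mathcomp Require Import all_classical all_reals all_analysis.

Set Implicit Arguments.
Unset Strict Implicit.
Unset Printing Implicit Defensive.

Import Order.TTheory GRing.Theory Num.Theory.
Import numFieldNormedType.Exports.

Local Open Scope classical_set_scope.
Local Open Scope ring_scope.
Local Open Scope complex_scope.

Local Notation Re := complex.Re.
Local Notation Im := complex.Im.

Section ComplexIntegrals.
Context {R : realType}.
Implicit Types (z : R[i]) (gamma : R -> R[i]).

Definition cexp z : R[i] :=
  (expR (Re z))%:C * (cos (Im z) +i* sin (Im z)).

Definition cint d (T : measurableType d) (mu : {measure set T -> \bar R})
    (f : T -> R[i]) : R[i] :=
  (\int[mu]_x Re (f x)) +i* (\int[mu]_x Im (f x)).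

Definition velocity gamma (t : R) : R[i] :=
  derive1 (fun u => Re (gamma u)) t +i* derive1 (fun u => Im (gamma u)) t.

(* The integral of f(z) dz / (2 pi i) along gamma, parametrized by the whole
   real line.  Corners of gamma form a null set, so the arbitrary value of the
   velocity there is harmless. *)
Definition contour_int gamma (f : R[i] -> R[i]) : R[i] :=
  (0 +i* (2 * pi))^-1 *
    cint lebesgue_measure (fun t : R => f (gamma t) * velocity gamma t).

(* The iterated integral over the contours gs`_0, gs`_1, ..., the first one
   being the outermost; the integrand receives the list of the variables. *)
Fixpoint contour_ints (gs : seq (R -> R[i])) (F : seq R[i] -> R[i]) : R[i] :=
  if gs is g :: gs' then
    contour_int g (fun z => contour_ints gs' (fun zs => F (z :: zs)))
  else F [::].

Definition piecewise_C1 (f : R -> R) : Prop :=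
  continuous f /\
  exists s : seq R,
    (forall t, t \notin s -> derivable f t 1 /\ {for t, continuous (derive1 f)}) /\
    (forall t, t \in s ->
       cvg (derive1 f x @[x --> t^'-]) /\ cvg (derive1 f x @[x --> t^'+])).

(* gamma goes from infinity * e^{- i theta} to infinity * e^{i theta}: it is
   piecewise C^1 and, in a suitable parametrization, its velocity tends to
   e^{i theta} at +oo and to - e^{- i theta} at -oo.  A condition on the
   position alone would allow the arc length to grow so fast that the contour
   integrals diverge. *)
Definition is_contour (theta : R) gamma : Prop :=
  [/\ piecewise_C1 (fun t => Re (gamma t)) /\
      piecewise_C1 (fun t => Im (gamma t)),
      Re (velocity gamma t) @[t --> +oo] --> cos theta,
      Im (velocity gamma t) @[t --> +oo] --> sin theta,
      Re (velocity gamma t) @[t --> -oo] --> - cos theta &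
      Im (velocity gamma t) @[t --> -oo] --> sin theta].

(* z can be joined, without meeting gamma, to the end of the ray sgn * [0, +oo[
   of the real axis (sgn = 1 or -1). *)
Definition joined_to_infinity gamma (sgn : R) z : Prop :=
  exists p : R -> R[i],
    [/\ continuous (fun t => Re (p t)), continuous (fun t => Im (p t)),
        p 0 = z,
        forall t u, 0 <= t -> p t <> gamma u &
        \forall t \near +oo, p t = (sgn * t)%:C].

(* gamma2 lies to the left of gamma1, hence is disjoint from it: gamma2 is in
   the component of the complement of gamma1 that contains the far negative
   real axis, and gamma1 is in the component of the complement of gamma2 that
   contains the far positive real axis. *)
Definition left_of gamma2 gamma1 : Prop :=
  (forall u, joined_to_infinity gamma1 (-1) (gamma2 u)) /\
  (forall u, joined_to_infinity gamma2 1 (gamma1 u)).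

End ComplexIntegrals.

Section Fredholm.
Context {R : realType}.

(* Here X is a space with a complex measure, given by its integral I. *)
Context {X : Type} (I : (X -> R[i]) -> R[i]) (K : X -> X -> R[i]).

Fixpoint iterated_int (k : nat) : (k.-tuple X -> R[i]) -> R[i] :=
  if k is k'.+1 then
    fun F => I (fun x => iterated_int (fun xs : k'.-tuple X => F [tuple of x :: xs]))
  else fun F => F [tuple].

Definition fredholm_sum (n : nat) : R[i] :=
  \sum_(k < n) (k`!%:R)^-1 *
    iterated_int (fun xs : k.-tuple X =>
      \det (\matrix_(a < k, b < k) K (tnth xs a) (tnth xs b))).

Definition fredholm_cvg : Prop :=
  cvgn (fun n => Re (fredholm_sum n)) /\ cvgn (fun n => Im (fredholm_sum n)).

(* det (I + K) *)
Definition fredholm_det : R[i] :=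
  limn (fun n => Re (fredholm_sum n)) +i* limn (fun n => Im (fredholm_sum n)).

End Fredholm.

Section InitialData.
Context {R : realType}.

Definition UCc (h : R -> \bar R) : Prop :=
  [/\ lower_semicontinuous (fun x => - h x)%E,
      forall x, h x != +oo%E,
      exists x, h x != -oo%E &
      exists A : set R, compact A /\ forall x, ~ A x -> h x = -oo%E].

(* Two-sided Brownian motion with diffusivity 2, started at 0 at time 0. *)
Definition two_sided_brownian d (Omega : measurableType d)
    (P : probability Omega R) (W : R -> {RV P >-> R}) : Prop :=
  [/\ forall w, W 0 w = 0,
      forall w, continuous (fun t => W t w),
      forall (s t : R) (A : set R), s < t -> measurable A ->
        P [set w | A (W t w - W s w)] =
        normal_prob 0 (Num.sqrt (2 * (t - s))) A &
      forall (n : nat) (t : nat -> R) (A : nat -> set R),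
        (forall i, (i < n)%N -> t i < t i.+1) ->
        (forall i, measurable (A i)) ->
        P (\bigcap_(i in `I_n) [set w | A i (W (t i.+1) w - W (t i) w)]) =
        (\prod_(i < n) fine (P [set w | A i (W (t i.+1) w - W (t i) w)]))%:E].

(* Hitting times of the hypograph of h by the path b; the infimum of the empty
   set is +oo and its supremum is -oo. *)
Definition tau_plus (h : R -> \bar R) (b : R -> R) : \bar R :=
  ereal_inf [set a%:E | a in [set a : R | 0 <= a /\ ((b a)%:E <= h a)%E]].

Definition tau_minus (h : R -> \bar R) (b : R -> R) : \bar R :=
  ereal_sup [set a%:E | a in [set a : R | a <= 0 /\ ((b a)%:E <= h a)%E]].

End InitialData.

Section Kernels.
Context {R : realType} d (Omega : measurableType d) (P : probability Omega R).
Context (W : R -> {RV P >-> R}) (h : R -> \bar R).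
(* gR is the contour Gamma_{1,R} *)
Context (gR : R -> R[i]).
Implicit Types (p q s t x a : R) (xi eta : R[i]) (A B : R -> R -> R[i]).

(* E_{B(0) = s} [ Phi (tau, B tau) ; tau_+ < +oo ], where B = s + W *)
Definition expect_hit_plus (Phi : R -> R -> R[i]) s : R[i] :=
  cint P (fun w =>
    let B := fun t => s + W t w in
    let tau := tau_plus h B in
    if (tau < +oo)%E then Phi (fine tau) (B (fine tau)) else 0).

Definition expect_hit_minus (Phi : R -> R -> R[i]) s : R[i] :=
  cint P (fun w =>
    let B := fun t => s + W t w in
    let tau := tau_minus h B in
    if (-oo < tau)%E then Phi (fine tau) (B (fine tau)) else 0).

Definition Eplus xi s : R[i] :=
  expect_hit_plus (fun tau b => cexp (- tau%:C * xi ^+ 2 - b%:C * xi)) s.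

Definition Eminus eta s : R[i] :=
  expect_hit_minus (fun tau b => cexp (tau%:C * eta ^+ 2 + b%:C * eta)) s.

Definition chi eta xi : R[i] :=
  cint lebesgue_measure (fun s : R =>
    cexp (s%:C * eta) * Eplus xi s + cexp (- s%:C * xi) * Eminus eta s
    - Eplus xi s * Eminus eta s).

Definition kcomp A B p q : R[i] :=
  cint lebesgue_measure (fun s : R => A p s * B s q).

Definition kadj A p q : R[i] := A q p.

Definition kindic (beta : R) A p q : R[i] := if p <= beta then A p q else 0.

Definition heat t p q : R[i] :=
  ((Num.sqrt (4 * pi * t))^-1 * expR (- (p - q) ^+ 2 / (4 * t)))%:C.

Definition Sk t x p q : R[i] :=
  contour_int gR (fun eta =>
    cexp ((t / 3)%:C * eta ^+ 3 + x%:C * eta ^+ 2 + (p - q)%:C * eta)).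

Definition Shypo_plus t x p q : R[i] :=
  expect_hit_plus (fun tau b => Sk t (x - tau) b q) p.

Definition Shypo_minus t x p q : R[i] :=
  expect_hit_minus (fun tau b => Sk t (x + tau) b q) p.

(* The kernel K[a] for the initial parameter alpha1; for a >= alpha1 it is by
   definition the backward heat flow e^{(alpha1 - a) d^2} of K[alpha1]. *)
Definition Kback (alpha1 a : R) p q : R[i] :=
  kcomp (kadj (Shypo_minus 1 (- a))) (Sk 1 alpha1) p q
  + kcomp (kadj (Sk 1 (- a))) (Shypo_plus 1 alpha1) p q
  - kcomp (kadj (Shypo_minus 1 (- a))) (Shypo_plus 1 alpha1) p q.

(* With m = i + k:
   1_{<= beta_i} e^{(alpha_{i+1} - alpha_i) d^2} 1_{<= beta_{i+1}} ...
     1_{<= beta_m} e^{(alpha_1 - alpha_m) d^2} K[alpha_1] *)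
Fixpoint path_kernel (alpha beta : nat -> R) (i k : nat) : R -> R -> R[i] :=
  kindic (beta i)
    (if k is k'.+1 then
       kcomp (heat (alpha i.+1 - alpha i)) (path_kernel alpha beta i.+1 k')
     else Kback (alpha 1%N) (alpha i)).

(* The sequences alpha, beta are indexed from 1 to m. *)
Definition Sker (m : nat) (alpha beta : nat -> R) p q : R[i] :=
  - Kback (alpha 1%N) (alpha 1%N) p q + path_kernel alpha beta 1 m.-1 p q.

Definition fexp (alpha beta : nat -> R) (i : nat) (z : R[i]) : R[i] :=
  cexp (- (3^-1)%:C * z ^+ 3 + (alpha i)%:C * z ^+ 2 + (beta i)%:C * z).

Definition Fratio (alpha beta : nat -> R) (i : nat) (z : R[i]) : R[i] :=
  if (i <= 1)%N then fexp alpha beta i z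
  else fexp alpha beta i z / fexp alpha beta i.-1 z.

(* gL 1, ..., gL m are the left contours; xi l below is the variable xi_l. *)
Definition Tker (alpha beta : nat -> R) (gL : nat -> R -> R[i])
    (x y : nat * R[i]) : R[i] :=
  let: (i, zeta) := x in
  let: (j, eta) := y in
  contour_ints [seq gL l | l <- iota 1 i] (fun xis =>
    let xi := fun l : nat => nth 0 xis l.-1 in
    (\prod_(1 <= l < i.+1) Fratio alpha beta l (xi l)) * chi eta (xi 1%N)
    / ((\prod_(1 <= l < i) (xi l - xi l.+1)) * (xi i - zeta)))
  * (fexp alpha beta j eta)^-1.

(* The measure on {1, ..., m} x Gamma_{1,R} *)
Definition sum_contour_int (m : nat) (F : nat * R[i] -> R[i]) : R[i] :=
  \sum_(1 <= i < m.+1) contour_int gR (fun z => F (i, z)).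

End Kernels.

(* Main.v *)
(* The kernels S^hypo are Airy integrals of E^+ and E^-, so K[a](p, q) is the double
   contour integral of
     e^{eta^3/3 - a eta^2 - p eta} e^{-xi^3/3 + alpha_1 xi^2 + q xi} chi(eta, xi).
   Heat flow acts on it by shifting a, and commuting the indicators 1_{<= beta_i}
   past it one at a time gives S = - A B on L^2 of R, where A(p; j, eta) is
     1_{<= beta_1} e^{(alpha_2 - alpha_1) d^2} ... e^{(alpha_j - alpha_(j-1)) d^2}
   applied to 1_{> beta_j} e^{- (. - beta_j) eta} and B carries 1 / f_j(eta) and the
   xi-integral of chi.  In T the contours of xi_2, ..., xi_i can be moved to vertical
   lines far to the left, where 1 / (xi_l - xi_{l+1}) is a Laplace integral; the
   nested integral then becomes the Laplace transform of A, whence T = - (B A)^T.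
   Expanding the determinants over permutations, Fubini identifies the two Fredholm
   series term by term, and Hadamard's inequality makes them converge. *)

From HB Require Import structures.
From mathcomp Require Import all_boot all_order all_algebra fingroup perm.
From mathcomp Require Import complex.
From mathcomp Require Import all_classical all_reals all_analysis measurable_realfun.
From mathcomp Require Import ring lra.
Require Import Defs.

Set Implicit Arguments.
Unset Strict Implicit.
Unset Printing Implicit Defensive.

Import Order.TTheory GRing.Theory Num.Theory.
Import numFieldNormedType.Exports.

Local Open Scope classical_set_scope.
Local Open Scope ring_scope.
Local Open Scope complex_scope.

Local Notation Re := complex.Re.
Local Notation Im := complex.Im.
Local Notation nrm := ComplexField.Normc.normc.

(** * Complex-valued integrals *)

(** Two obstacles shape the proof. The order [left_of] is purely topological, so a straight homotopy
    from a contour to a standard one may sweep over the point $\xi_{\ell-1}$ where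
    $1/(\xi_{\ell-1}-\xi_\ell)$ is singular. Instead the point is moved: multiplied by
    $e^{-tz^2-bz}$, the Cauchy integral of $e^{tw^2+bw}$ has a $z$-derivative that is the same for
    all contours, so the difference of two such integrals is constant while $z$ follows its joining
    path to the far right. The first standard contours are not vertical lines, which the left
    contours would cross, but wedges of slope $3/4$: this lies between the slope $1/\sqrt3$ of the
    directions $e^{\pm2\pi i/3}$ and the slope $1$ at which $e^{tz^2}$ ceases to decay.

    The bound on $B$ grows like $e^{\epsilon q^2}$ as $q\to-\infty$, with any $\epsilon>0$, while
    $A$ decays like a Gaussian of a fixed rate. So $\epsilon$ is set to that rate, and Hadamard's
    inequality is applied after division by weights. The bounds on $\chi_{\mathfrak h}$ come from an
    exponential moment of $(\mathbf B(\tau)-s)^2$, obtained by dyadic chaining. *)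

Section Cplx.
Context {R : realType}.
Implicit Types (z w : R[i]) (x y : R).

Lemma ReAdd z w : Re (z + w) = Re z + Re w. Proof. by case: z w => ? ? []. Qed.
Lemma ImAdd z w : Im (z + w) = Im z + Im w. Proof. by case: z w => ? ? []. Qed.
Lemma ReOpp z : Re (- z) = - Re z. Proof. by case: z. Qed.
Lemma ImOpp z : Im (- z) = - Im z. Proof. by case: z. Qed.
Lemma ReMul z w : Re (z * w) = Re z * Re w - Im z * Im w.
Proof. by case: z w => ? ? []. Qed.
Lemma ImMul z w : Im (z * w) = Re z * Im w + Im z * Re w.
Proof. by case: z w => ? ? []. Qed.
Lemma ReC x : Re x%:C = x. Proof. by []. Qed.
Lemma ImC x : Im x%:C = 0. Proof. by []. Qed.
Lemma Re0 : Re 0 = 0 :> R. Proof. by []. Qed.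
Lemma Im0 : Im 0 = 0 :> R. Proof. by []. Qed.
Lemma Re1 : Re 1 = 1 :> R. Proof. by []. Qed.
Lemma Im1 : Im 1 = 0 :> R. Proof. by []. Qed.
Definition ReImE := (ReAdd, ImAdd, ReOpp, ImOpp, ReMul, ImMul, ReC, ImC, Re0, Im0, Re1, Im1).

Lemma cplxP z w : Re z = Re w -> Im z = Im w -> z = w.
Proof. by case: z w => ? ? [? ?] /= -> ->. Qed.

Lemma nrmE z : nrm z = Num.sqrt (Re z ^+ 2 + Im z ^+ 2).
Proof. by case: z. Qed.
Lemma nrm_ge0 z : 0 <= nrm z. Proof. by rewrite nrmE sqrtr_ge0. Qed.
Lemma nrm_sqr z : nrm z ^+ 2 = Re z ^+ 2 + Im z ^+ 2.
Proof. by rewrite nrmE sqr_sqrtr// addr_ge0// sqr_ge0. Qed.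
Lemma Re_le_nrm z : `|Re z| <= nrm z.
Proof.
rewrite -(@ler_pXn2r _ 2)// ?nnegrE ?nrm_ge0// nrm_sqr real_normK ?num_real//.
by rewrite lerDl sqr_ge0.
Qed.
Lemma Im_le_nrm z : `|Im z| <= nrm z.
Proof.
rewrite -(@ler_pXn2r _ 2)// ?nnegrE ?nrm_ge0// nrm_sqr real_normK ?num_real//.
by rewrite lerDr sqr_ge0.
Qed.
Lemma nrm_le_ReIm z : nrm z <= `|Re z| + `|Im z|.
Proof.
rewrite -(@ler_pXn2r _ 2)// ?nnegrE ?nrm_ge0 ?addr_ge0// nrm_sqr sqrrD.
rewrite !real_normK ?num_real// -addrA lerD2l lerDr.
by rewrite mulrn_wge0// mulr_ge0.
Qed.
Lemma nrmC x : nrm x%:C = `|x|.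
Proof. by rewrite nrmE /= expr0n addr0 sqrtr_sqr. Qed.
Lemma nrmM z w : nrm (z * w) = nrm z * nrm w.
Proof. exact: ComplexField.Normc.normcM. Qed.
Lemma nrmV z : nrm z^-1 = (nrm z)^-1.
Proof. exact: ComplexField.Normc.normcV. Qed.
Lemma nrmD z w : nrm (z + w) <= nrm z + nrm w.
Proof. exact: le_normcD. Qed.
Lemma nrmN z : nrm (- z) = nrm z. Proof. exact: normcN. Qed.
Lemma nrmB z w : nrm (z - w) <= nrm z + nrm w.
Proof. by rewrite -(nrmN w) nrmD. Qed.
Lemma nrm0 : nrm 0 = 0 :> R. Proof. by rewrite nrmC normr0. Qed.
Lemma nrm1 : nrm 1 = 1 :> R. Proof. by rewrite nrmC normr1. Qed.
Lemma nrmX z n : nrm (z ^+ n) = nrm z ^+ n.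
Proof. by elim: n => [|n IH]; rewrite ?expr0 ?nrm1// !exprS nrmM IH. Qed.
Lemma nrm_eq0 z : nrm z = 0 -> z = 0.
Proof. exact: ComplexField.Normc.eq0_normc. Qed.
Lemma nrm_gt0 z : z != 0 -> 0 < nrm z.
Proof.
by move=> z0; rewrite lt0r nrm_ge0 andbT; apply: contraNN z0 => /eqP/nrm_eq0->.
Qed.
Lemma nrm_distC z w : nrm (z - w) = nrm (w - z).
Proof. by rewrite -nrmN opprB. Qed.
Lemma nrm_lerB z w : nrm z - nrm w <= nrm (z - w).
Proof. by rewrite lerBlDr (le_trans _ (nrmD _ _))// subrK. Qed.
Lemma nrm_sum (I : Type) (r : seq I) (P : pred I) (F : I -> R[i]) :
  nrm (\sum_(i <- r | P i) F i) <= \sum_(i <- r | P i) nrm (F i).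
Proof.
elim/big_ind2 : _ => [|a b c d ab cd|//]; first by rewrite nrm0.
by rewrite (le_trans (nrmD _ _))// lerD.
Qed.
Lemma nrm_prod (I : Type) (r : seq I) (P : pred I) (F : I -> R[i]) :
  nrm (\prod_(i <- r | P i) F i) = \prod_(i <- r | P i) nrm (F i).
Proof.
elim/big_rec2 : _ => [|i a b _ ab]; first by rewrite nrm1.
by rewrite nrmM ab.
Qed.

Lemma cexpD z w : cexp (z + w) = cexp z * cexp w.
Proof.
apply: cplxP; rewrite /cexp !ReImE /= expRD ?cosD ?sinD; ring.
Qed.
Lemma cexp0 : cexp (0 : R[i]) = 1.
Proof. by apply: cplxP; rewrite /cexp !ReImE /= ?expR0 ?cos0 ?sin0; ring. Qed.
Lemma nrm_cexp z : nrm (cexp z) = expR (Re z).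
Proof.
rewrite /cexp nrmM nrmC ger0_norm ?expR_ge0// nrmE /= cos2Dsin2 sqrtr1.
by rewrite mulr1.
Qed.
Lemma cexp_neq0 z : cexp z != 0.
Proof.
apply/eqP => h; have := nrm_cexp z; rewrite h nrm0 => /esym/eqP.
by rewrite gt_eqF ?expR_gt0.
Qed.
Lemma cexpN z : cexp (- z) = (cexp z)^-1.
Proof.
by apply: (mulfI (cexp_neq0 z)); rewrite -cexpD subrr cexp0 divff ?cexp_neq0.
Qed.
Lemma cexpB z w : cexp (z - w) = cexp z / cexp w.
Proof. by rewrite cexpD cexpN. Qed.
Lemma cexpC x : cexp x%:C = (expR x)%:C.
Proof. by apply: cplxP; rewrite /cexp !ReImE /= ?cos0 ?sin0; ring. Qed.
Lemma realCD x y : (x + y)%:C = x%:C + y%:C. Proof. exact: rmorphD. Qed.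
Lemma realCM x y : (x * y)%:C = x%:C * y%:C. Proof. exact: rmorphM. Qed.
Lemma realCN x : (- x)%:C = - x%:C. Proof. exact: rmorphN. Qed.
Lemma realCX x n : (x ^+ n)%:C = x%:C ^+ n. Proof. exact: rmorphXn. Qed.
Lemma realCV x : (x^-1)%:C = x%:C^-1. Proof. exact: fmorphV. Qed.
Lemma realC_eq0 x : (x%:C == 0) = (x == 0). Proof. exact: fmorph_eq0. Qed.
Definition rCE := (realCD, realCM, realCN, realCX, realCV).
Lemma Re_inv z : Re z^-1 = Re z / (Re z ^+ 2 + Im z ^+ 2). Proof. by case: z. Qed.
Lemma Im_inv z : Im z^-1 = - (Im z / (Re z ^+ 2 + Im z ^+ 2)).
Proof. by case: z. Qed.

End Cplx.

(** * Measurability and integration of complex-valued functions *)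

Section CMeas.
Context {R : realType}.

Definition cmeas d (T : measurableType d) (f : T -> R[i]) :=
  measurable_fun setT (fun x => Re (f x)) /\
  measurable_fun setT (fun x => Im (f x)).

Context d (T : measurableType d).
Implicit Types (f g : T -> R[i]).

Lemma cmeas_cst (c : R[i]) : cmeas (fun _ : T => c).
Proof. by split; exact: measurable_cst. Qed.

Lemma cmeasD f g : cmeas f -> cmeas g -> cmeas (fun x => f x + g x).
Proof.
move=> [f1 f2] [g1 g2]; split; under eq_fun do rewrite ReImE;
  exact: measurable_funD.
Qed.

Lemma cmeasN f : cmeas f -> cmeas (fun x => - f x).
Proof.
move=> [f1 f2]; split; under eq_fun do rewrite ReImE;
  exact: measurableT_comp.
Qed.

Lemma cmeasB f g : cmeas f -> cmeas g -> cmeas (fun x => f x - g x).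
Proof. by move=> mf mg; apply: cmeasD => //; apply: cmeasN. Qed.

Lemma cmeasM f g : cmeas f -> cmeas g -> cmeas (fun x => f x * g x).
Proof.
move=> [f1 f2] [g1 g2]; split; under eq_fun do rewrite ReImE.
- by apply: measurable_funB; apply: measurable_funM.
- by apply: measurable_funD; apply: measurable_funM.
Qed.

(** Inversion is continuous off $0$; at the remaining point it takes the default value $0$, so the
    two pieces are treated separately. *)
Lemma measurable_inv : measurable_fun setT (fun x : R => x^-1).
Proof.
have -> : (fun x : R => x^-1) = (fun x => if x == 0 then 0 else x^-1).
  by apply/funext => x; case: eqP => // ->; rewrite invr0.
pose D := [set~ (0:R)].
have oD : open D by apply: closed_openC; exact: closed_eq.
have mD : measurable D by exact: open_measurable.
rewrite (_ : setT = D `|` ~` D); last by rewrite setUv.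
apply/measurable_funU => //; first exact: measurableC.
split.
  apply: (@eq_measurable_fun _ _ _ _ _ (fun x : R => x^-1)).
    by move=> x; rewrite inE /D /= => /eqP/negbTE ->.
  apply: open_continuous_measurable_fun => //.
  by move=> x; rewrite inE => /eqP x0; exact: inv_continuous.
apply: (@eq_measurable_fun _ _ _ _ _ (cst (0:R))) => //.
move=> x; rewrite inE /D => /= h; case: eqP => //.
Qed.

Lemma cmeasV f : cmeas f -> cmeas (fun x => (f x)^-1).
Proof.
move=> [f1 f2].
have m : measurable_fun setT (fun x => (Re (f x) ^+ 2 + Im (f x) ^+ 2)^-1).
  apply: (measurableT_comp measurable_inv).
  by apply: measurable_funD; apply: measurable_funX.
split; [under eq_fun do rewrite Re_inv|under eq_fun do rewrite Im_inv].
  exact: measurable_funM.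
by apply: measurableT_comp => //; exact: measurable_funM.
Qed.

Lemma cmeasX f n : cmeas f -> cmeas (fun x => f x ^+ n).
Proof.
move=> mf; elim: n => [|n IH]; first by under eq_fun do rewrite expr0; exact: cmeas_cst.
by under eq_fun do rewrite exprS; exact: cmeasM.
Qed.

Lemma cmeasC (f : T -> R) : measurable_fun setT f -> cmeas (fun x => (f x)%:C).
Proof. by move=> mf; split => //=; exact: measurable_cst. Qed.

Lemma cmeas_cexp f : cmeas f -> cmeas (fun x => cexp (f x)).
Proof.
move=> [f1 f2]; apply: cmeasM; first by apply: cmeasC; exact: measurableT_comp.
split => /=; apply: measurableT_comp => //; apply: continuous_measurable_fun;
  [exact: continuous_cos|exact: continuous_sin].
Qed.

Lemma cmeas_if f g (b : T -> bool) : measurable_fun setT b ->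
  cmeas f -> cmeas g -> cmeas (fun x => if b x then f x else g x).
Proof.
move=> mb [f1 f2] [g1 g2]; split.
  under eq_fun do rewrite (fun_if (@Re R)); exact: measurable_fun_ifT.
under eq_fun do rewrite (fun_if (@Im R)); exact: measurable_fun_ifT.
Qed.

Lemma cmeas_nrm f : cmeas f -> measurable_fun setT (fun x => nrm (f x)).
Proof.
move=> [f1 f2]; under eq_fun do rewrite nrmE.
apply: measurableT_comp.
  by apply: continuous_measurable_fun; exact: sqrt_continuous.
by apply: measurable_funD; apply: measurable_funX.
Qed.

Lemma cmeas_sum (I : Type) (r : seq I) (P : pred I) (F : I -> T -> R[i]) :
  (forall i, cmeas (F i)) -> cmeas (fun x => \sum_(i <- r | P i) F i x).
Proof.
move=> mF; elim: r => [|a r IH].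
  by under eq_fun do rewrite big_nil; exact: cmeas_cst.
under eq_fun do rewrite big_cons; case: (P a) => //.
exact: cmeasD.
Qed.

Lemma cmeas_prod (I : Type) (r : seq I) (P : pred I) (F : I -> T -> R[i]) :
  (forall i, cmeas (F i)) -> cmeas (fun x => \prod_(i <- r | P i) F i x).
Proof.
move=> mF; elim: r => [|a r IH].
  by under eq_fun do rewrite big_nil; exact: cmeas_cst.
under eq_fun do rewrite big_cons; case: (P a) => //.
exact: cmeasM.
Qed.

End CMeas.

Lemma cmeas_comp {R : realType} d d' (T : measurableType d)
    (T' : measurableType d') (f : T -> R[i]) (g : T' -> T) :
  cmeas f -> measurable_fun setT g -> cmeas (fun x => f (g x)).
Proof. by move=> [f1 f2] mg; split; [apply: (measurableT_comp f1 mg)|apply: (measurableT_comp f2 mg)]. Qed.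

Section CInt.
Context {R : realType} d (T : measurableType d) (mu : {measure set T -> \bar R}).
Implicit Types (f g : T -> R[i]).

Definition rint (f : T -> R) := mu.-integrable setT (EFin \o f).
Definition cintble f := rint (fun x => Re (f x)) /\ rint (fun x => Im (f x)).

Lemma rint_le (f g : T -> R) : measurable_fun setT f -> rint g ->
  (forall x, `|f x| <= g x) -> rint f.
Proof.
move=> mf ig fg; apply: (le_integrable _ _ _ ig) => //.
  by apply/measurable_EFinP.
by move=> x _ /=; rewrite lee_fin (le_trans (fg x))// ler_norm.
Qed.

Lemma rintD (f g : T -> R) : rint f -> rint g -> rint (fun x => f x + g x).
Proof. by move=> h1 h2; have := integrableD measurableT h1 h2. Qed.

Lemma rintZ (c : R) (f : T -> R) : rint f -> rint (fun x => c * f x).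
Proof. by move=> h1; have := integrableZl measurableT c h1. Qed.

Lemma rint_meas (f : T -> R) : rint f -> measurable_fun setT f.
Proof. by move=> /measurable_int /measurable_EFinP. Qed.

Lemma cintble_dom f (g : T -> R) : cmeas f -> rint g ->
  (forall x, nrm (f x) <= g x) -> cintble f.
Proof.
move=> [f1 f2] ig fg; split; apply: (rint_le _ ig) => // x;
  apply: (le_trans _ (fg x)); [exact: Re_le_nrm|exact: Im_le_nrm].
Qed.

Lemma cintble_meas f : cintble f -> cmeas f.
Proof. by move=> [/rint_meas h1 /rint_meas h2]. Qed.

Lemma cintble_nrm f : cintble f -> rint (fun x => nrm (f x)).
Proof.
move=> [h1 h2]; apply: (@rint_le _ (fun x => `|Re (f x)| + `|Im (f x)|)).
- by apply: cmeas_nrm; exact: cintble_meas.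
- apply: rintD.
    by have := integrable_norm h1.
  by have := integrable_norm h2.
- by move=> x; rewrite ger0_norm ?nrm_ge0// nrm_le_ReIm.
Qed.

Lemma eq_cint f g : (forall x, f x = g x) -> cint mu f = cint mu g.
Proof. by move=> /funext ->. Qed.

Lemma cintD f g : cintble f -> cintble g ->
  cint mu (fun x => f x + g x) = cint mu f + cint mu g.
Proof.
move=> [f1 f2] [g1 g2]; apply: cplxP => /=.
  by under eq_Rintegral do rewrite ReAdd; rewrite RintegralD.
by under eq_Rintegral do rewrite ImAdd; rewrite RintegralD.
Qed.

Lemma cintbleD f g : cintble f -> cintble g -> cintble (fun x => f x + g x).
Proof.
move=> [f1 f2] [g1 g2]; split; under eq_fun do rewrite ReImE;
  exact: rintD.
Qed.

Lemma cintbleZ c f : cintble f -> cintble (fun x => c * f x).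
Proof.
move=> [f1 f2]; split; under eq_fun do rewrite ReImE.
  under eq_fun do rewrite -mulNr; apply: rintD; exact: rintZ.
by apply: rintD; exact: rintZ.
Qed.

Lemma cintZ c f : cintble f -> cint mu (fun x => c * f x) = c * cint mu f.
Proof.
move=> [f1 f2]; apply: cplxP; rewrite !ReImE /=.
  transitivity (\int[mu]_x (Re c * Re (f x) + (- Im c) * Im (f x))).
    by apply: eq_Rintegral => x _; rewrite ReMul mulNr.
  by rewrite RintegralD ?RintegralZl ?mulNr//; exact: rintZ.
transitivity (\int[mu]_x (Re c * Im (f x) + Im c * Re (f x))).
  by apply: eq_Rintegral => x _; rewrite ImMul.
rewrite RintegralD ?RintegralZl//; exact: rintZ.
Qed.

Lemma cintZr c f : cintble f -> cint mu (fun x => f x * c) = cint mu f * c.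
Proof. by move=> hf; rewrite mulrC -cintZ//; apply: eq_cint => x; rewrite mulrC. Qed.

Lemma cintbleN f : cintble f -> cintble (fun x => - f x).
Proof. by move=> hf; under eq_fun do rewrite -mulN1r; exact: cintbleZ. Qed.

Lemma cintN f : cintble f -> cint mu (fun x => - f x) = - cint mu f.
Proof. by move=> hf; rewrite -mulN1r -cintZ//; apply: eq_cint => x; rewrite mulN1r. Qed.

Lemma cintbleB f g : cintble f -> cintble g -> cintble (fun x => f x - g x).
Proof. by move=> hf hg; apply: cintbleD => //; exact: cintbleN. Qed.

Lemma cintB f g : cintble f -> cintble g ->
  cint mu (fun x => f x - g x) = cint mu f - cint mu g.
Proof. by move=> hf hg; rewrite cintD ?cintN//; exact: cintbleN. Qed.

Lemma cintble0 : cintble (fun _ : T => 0).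
Proof. by split; exact: integrable0. Qed.

Lemma cint0 : cint mu (fun _ : T => 0) = 0.
Proof. by apply: cplxP => /=; rewrite /Rintegral integral0. Qed.

Lemma cintble_sum (I : Type) (r : seq I) (P : pred I) (F : I -> T -> R[i]) :
  (forall i, P i -> cintble (F i)) -> cintble (fun x => \sum_(i <- r | P i) F i x).
Proof.
move=> iF; elim: r => [|a r IH].
  by under eq_fun do rewrite big_nil; exact: cintble0.
under eq_fun do rewrite big_cons; case Pa: (P a) => //.
by apply: cintbleD => //; exact: iF.
Qed.

Lemma cint_sum (I : Type) (r : seq I) (P : pred I) (F : I -> T -> R[i]) :
  (forall i, P i -> cintble (F i)) ->
  cint mu (fun x => \sum_(i <- r | P i) F i x) = \sum_(i <- r | P i) cint mu (F i).
Proof.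
move=> iF; elim: r => [|a r IH].
  by under eq_cint do rewrite big_nil; rewrite big_nil cint0.
under eq_cint do rewrite big_cons; rewrite big_cons; case Pa: (P a) => //.
by rewrite cintD ?IH//; [exact: iF|exact: cintble_sum].
Qed.

(** Real and imaginary parts are estimated separately, hence the factor $2$; only the order of
    magnitude of such bounds matters later. *)
Lemma nrm_cint f (g : T -> R) : cmeas f -> rint g ->
  (forall x, nrm (f x) <= g x) -> nrm (cint mu f) <= 2 * Rintegral mu setT g.
Proof.
move=> mf ig fg; have [h1 h2] := cintble_dom mf ig fg.
rewrite (le_trans (nrm_le_ReIm _))//= mulr_natl mulr2n lerD//.
  rewrite (le_trans (le_normr_Rintegral _ _))// le_Rintegral//.
    by have := integrable_norm h1.
  by move=> x _; rewrite (le_trans _ (fg x))// Re_le_nrm.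
rewrite (le_trans (le_normr_Rintegral _ _))// le_Rintegral//.
  by have := integrable_norm h2.
by move=> x _; rewrite (le_trans _ (fg x))// Im_le_nrm.
Qed.

End CInt.

Section CFubini.
Context {R : realType} d1 d2 (T1 : measurableType d1) (T2 : measurableType d2).
Context (m1 : {sigma_finite_measure set T1 -> \bar R}).
Context (m2 : {sigma_finite_measure set T2 -> \bar R}).

Lemma rint_prod (g1 : T1 -> R) (g2 : T2 -> R) :
  (forall x, 0 <= g1 x) -> (forall x, 0 <= g2 x) ->
  rint m1 g1 -> rint m2 g2 -> rint (m1 \x m2)%E (fun xy => g1 xy.1 * g2 xy.2).
Proof.
move=> g10 g20 i1 i2.
have m : measurable_fun setT (fun xy : T1 * T2 => g1 xy.1 * g2 xy.2).
  apply: measurable_funM.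
    exact: (measurableT_comp (rint_meas i1) measurable_fst).
  exact: (measurableT_comp (rint_meas i2) measurable_snd).
apply/integrable12ltyP; first exact/measurable_EFinP.
rewrite (eq_integral (fun x => (g1 x)%:E * \int[m2]_y (g2 y)%:E)%E); last first.
  move=> x _ /=; rewrite -integralZl//.
  by apply: eq_integral => y _; rewrite /= ger0_norm ?mulr_ge0// EFinM.
rewrite -(@fineK _ (\int[m2]_y (g2 y)%:E)%E); last exact: integrable_fin_num.
rewrite integralZr//.
rewrite -(@fineK _ (\int[m1]_x (g1 x)%:E)%E); last exact: integrable_fin_num.
by rewrite -EFinM ltry.
Qed.

Lemma rint_fubini_meas (F : T1 * T2 -> R) : measurable_fun setT F ->
  measurable_fun setT (fun x => Rintegral m2 setT (fun y => F (x, y))).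
Proof.
move=> mF; apply: measurableT_comp => //.
have mE : measurable_fun setT (EFin \o F) by exact/measurable_EFinP.
rewrite (_ : (fun x => _) = (fun x => fubini_F m2 (EFin \o F)^\+ x -
   fubini_F m2 (EFin \o F)^\-%E x)%E).
  apply: emeasurable_funB; apply: measurable_fun_fubini_tonelli_F => //.
    exact: measurable_funepos.
  exact: measurable_funeneg.
apply/funext => x; rewrite /fubini_F [LHS]integralE.
congr (adde _ (oppe _)); apply: eq_integral => y _.
  by rewrite !funeposE.
by rewrite !funenegE.
Qed.

Lemma cmeas_cint (F : T1 * T2 -> R[i]) : cmeas F ->
  cmeas (fun x => cint m2 (fun y => F (x, y))).
Proof.
by move=> [h1 h2]; split => /=; [exact: (rint_fubini_meas h1)|exact: (rint_fubini_meas h2)].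
Qed.

(** The inner integrals are real numbers obtained through [fine]; they agree with the extended-real
    ones almost everywhere, which suffices for the outer integral. *)
Lemma rint_fubini (F : T1 * T2 -> R) : rint (m1 \x m2)%E F ->
  Rintegral m1 setT (fun x => Rintegral m2 setT (fun y => F (x, y))) =
  Rintegral m2 setT (fun y => Rintegral m1 setT (fun x => F (x, y))).
Proof.
move=> iF; have mF := rint_meas iF.
have a1 := ae_integrable1 iF; have a2 := ae_integrable2 iF.
have e1 : (\int[m1]_x (Rintegral m2 setT (fun y => F (x, y)))%:E =
           \int[m1]_x \int[m2]_y (F (x, y))%:E)%E.
  apply: ae_eq_integral => //.
  - by apply/measurable_EFinP; exact: rint_fubini_meas.
  - exact: measurable_fubini_F iF.
  - apply: filterS a1 => x hx _; rewrite fineK//.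
    exact: integrable_fin_num.
have e2 : (\int[m2]_y (Rintegral m1 setT (fun x => F (x, y)))%:E =
           \int[m2]_y \int[m1]_x (F (x, y))%:E)%E.
  have mG := measurable_fubini_G iF.
  apply: ae_eq_integral => //.
  - apply/measurable_EFinP; apply: measurableT_comp => //.
  - apply: filterS a2 => x hx _; rewrite fineK//.
    exact: integrable_fin_num.
congr fine; exact: etrans e1 (etrans (Fubini iF) (esym e2)).
Qed.

(** A product of two integrable majorants gives integrability on the product space; the exchanges of
    integrals below are brought to this form. *)
Lemma cfubini (F : T1 * T2 -> R[i]) (g1 : T1 -> R) (g2 : T2 -> R) :
  cmeas F -> (forall x, 0 <= g1 x) -> (forall x, 0 <= g2 x) ->
  rint m1 g1 -> rint m2 g2 -> (forall x y, nrm (F (x, y)) <= g1 x * g2 y) ->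
  cint m1 (fun x => cint m2 (fun y => F (x, y))) =
  cint m2 (fun y => cint m1 (fun x => F (x, y))).
Proof.
move=> mF g10 g20 i1 i2 Fg.
have [h1 h2] : cintble (m1 \x m2)%E F.
  apply: (cintble_dom mF (rint_prod g10 g20 i1 i2)) => -[x y]; exact: Fg.
by apply: cplxP => /=; [rewrite (rint_fubini h1)|rewrite (rint_fubini h2)].
Qed.

End CFubini.

(** * The fundamental theorem of calculus with finitely many exceptional points *)

Section Calculus.
Context {R : realType}.
Local Notation leb := (@lebesgue_measure R).
Implicit Types (F f : R -> R) (s : seq R).

(** Induction on the exceptional points: one that lies inside the interval splits it in two, and
    continuity joins the halves. *)
Lemma ndecr_fin s F (a b : R) : a <= b ->
  (forall x, a <= x <= b -> {for x, continuous F}) ->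
  (forall x, a < x < b -> x \notin s -> derivable F x 1 /\ 0 <= derive1 F x) ->
  F a <= F b.
Proof.
elim: s a b => [|c s IH] a b ab cF dF.
  apply: (@ger0_derive1_ndecr _ F a b) => //.
  - by move=> x; rewrite in_itv /= => /dF [].
  - by move=> x; rewrite in_itv /= => /dF [].
  - apply: continuous_in_subspaceT => x; rewrite inE /= in_itv /=; exact: cF.
have [/andP[ac cb]|nc] := boolP (a < c < b).
  apply: (@le_trans _ _ (F c)); apply: IH.
  - exact: ltW.
  - move=> x /andP[ax xc]; apply: cF; rewrite ax /=; exact: le_trans (ltW cb).
  - move=> x /andP[ax xc] xs; apply: dF; first by rewrite ax (lt_trans xc).
    by rewrite inE negb_or xs andbT lt_eqF.
  - exact: ltW.
  - move=> x /andP[ax xc]; apply: cF; rewrite xc andbT; exact: le_trans (ltW ac) _.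
  - move=> x /andP[ax xc] xs; apply: dF; first by rewrite xc andbT (lt_trans ac).
    by rewrite inE negb_or xs andbT gt_eqF.
apply: IH => // x xab xs; apply: dF => //; rewrite inE negb_or xs andbT.
by apply: contra nc => /eqP <-.
Qed.

Lemma bounded_itv_int (a b M : R) f : measurable_fun setT f ->
  (forall x, `|f x| <= M) -> leb.-integrable `[a, b]%classic (EFin \o f).
Proof.
move=> mf fM.
apply: (@le_integrable _ _ _ _ _ _ _ (EFin \o cst M)) => //.
- apply/measurable_EFinP; exact: measurable_funTS.
- by move=> x _ /=; rewrite lee_fin (le_trans (fM x))// ler_norm.
- apply: continuous_compact_integrable; first exact: segment_compact.
  by apply: continuous_subspaceT => x; exact: cvg_cst.
Qed.

(** Off [s], the difference of [F] and the integral function of [f] has derivative $0$. By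
    [ndecr_fin] this difference and its opposite are both nondecreasing, hence constant. *)
Lemma FTC_fin s F f (a b M : R) : a <= b ->
  (forall x, {for x, continuous F}) ->
  measurable_fun setT f -> (forall x, `|f x| <= M) ->
  (forall x, x \notin s -> is_derive x 1 F (f x) /\ {for x, continuous f}) ->
  \int[leb]_(x in `[a, b]) f x = F b - F a.
Proof.
rewrite le_eqVlt => /predU1P[<- _ _ _ _|ab cF mf fM dF].
  by rewrite subrr set_itv1 Rintegral_set1.
have iF u v : leb.-integrable `[u, v]%classic (EFin \o f) by exact: bounded_itv_int mf fM.
pose G x := \int[leb]_(t in `[a, x]) f t.
have G0 : G a = 0 by rewrite /G set_itv1 Rintegral_set1.
have GB u v : a <= u -> u <= v -> `|G v - G u| <= M * (v - u).
  move=> au uv.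
  have -> : G v - G u = \int[leb]_(t in `]u, v]) f t.
    by rewrite /G Rintegral_itvB// bnd_simp.
  have ioc : leb.-integrable `]u, v]%classic (EFin \o f).
    by apply: integrableS (iF u v) => //; exact: subset_itv_oc_cc.
  rewrite (le_trans (le_normr_Rintegral _ _))//.
  have -> : M * (v - u) = \int[leb]_(t in `]u, v]) M.
    rewrite Rintegral_cst//.
    rewrite -[X in _ = _ * X]/(fine (lebesgue_measure `]u, v]%classic)).
    rewrite lebesgue_measure_itv /= lte_fin.
    by case: ltgtP uv => //= -> _; rewrite ?subrr.
  apply: le_Rintegral => //.
  - by have := integrable_norm ioc.
  - apply: (@integrableS _ _ _ leb `[u, v]%classic) => //; first exact: subset_itv_oc_cc.
    by apply: (@bounded_itv_int _ _ `|M|) => // x; exact: measurable_cst.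
have M0 : 0 <= M by apply: le_trans (fM a).
pose c := a + M + 1 + `|b|.
(* Continuing [G] by $0$ to the left of [a] makes continuity at [a] two-sided. *)
pose G1 x := if x <= a then 0 else G x.
have cG1 x : {for x, continuous G1}.
  have lip y z : `|G1 y - G1 z| <= M * `|y - z|.
    wlog yz : y z / y <= z.
      by move=> h; have [/h//|/ltW/h] := leP y z; rewrite distrC (distrC y).
    rewrite distrC (distrC y) (ger0_norm (_ : 0 <= z - y)) ?subr_ge0//.
    rewrite /G1; case: (leP z a) => za; case: (leP y a) => ya.
    - by rewrite subrr normr0 mulr_ge0 ?subr_ge0.
    - by have := lt_le_trans ya (le_trans yz za); rewrite ltxx.
    - have := GB a z (lexx _) (ltW za); rewrite G0 => h.
      by rewrite (le_trans h)// ler_wpM2l// lerB.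
    - exact: GB (ltW ya) yz.
  apply/cvgrPdist_lt => e e0 /=; near=> y.
  rewrite (le_lt_trans (lip _ _))// (@le_lt_trans _ _ ((M + 1) * `|x - y|))//.
    by rewrite ler_wpM2r// lerDl.
  rewrite -ltr_pdivlMl ?ltr_wpDl//.
  near: y; apply/nbhs_ballP; exists ((M + 1)^-1 * e) => //=.
  by rewrite mulr_gt0// invr_gt0 ltr_wpDl.
have dG1 x : a < x < b -> x \notin s -> is_derive x 1 G1 (f x).
  move=> /andP[ax xb] xs; have [_ cf] := dF x xs.
  have [d1 d2] := continuous_FTC1_closed xb (iF a b) ax cf.
  have dG : is_derive x 1 G (f x) by split; [exact: d1|rewrite -d2 derive1E].
  have eG : \forall y \near x, G y = G1 y.
    near=> y; rewrite /G1 leNgt ifF//; apply/negbTE; rewrite negbK.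
    by near: y; exact: lt_nbhsr.
  exact: near_eq_is_derive eG dG.
have e1 : F a - G1 a <= F b - G1 b.
  apply: (@ndecr_fin s (F - G1)) => //; first exact: ltW.
    by move=> x _; apply: cvgB; [exact: cF|exact: cG1].
  move=> x xab xs; have [dFx _] := dF x xs; have dGx := dG1 x xab xs.
  have hB := is_deriveB dFx dGx.
  by split => //; rewrite derive1E derive_val subrr.
have e2 : G1 a - F a <= G1 b - F b.
  apply: (@ndecr_fin s (G1 - F)) => //; first exact: ltW.
    by move=> x _; apply: cvgB; [exact: cG1|exact: cF].
  move=> x xab xs; have [dFx _] := dF x xs; have dGx := dG1 x xab xs.
  have hB := is_deriveB dGx dFx.
  by split => //; rewrite derive1E derive_val subrr.
have Ga : G1 a = 0 by rewrite /G1 lexx.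
have Gb : G1 b = \int[leb]_(x in `[a, b]) f x by rewrite /G1 leNgt ab.
rewrite -Gb; rewrite Ga in e1 e2; lra.
Unshelve. all: by end_near. Qed.

(** The theorem on $[-n,n]$ followed by dominated convergence; limits of [F] along the integers are
    therefore enough. *)
Lemma FTC_R s F f (M a b : R) :
  (forall x, {for x, continuous F}) ->
  (forall x, `|f x| <= M) -> rint leb f ->
  (forall x, x \notin s -> is_derive x 1 F (f x) /\ {for x, continuous f}) ->
  (F n%:R @[n --> \oo] --> a) -> (F (- n%:R) @[n --> \oo] --> b) ->
  \int[leb]_x f x = a - b.
Proof.
move=> cF fM irf dF c1 c2.
have mf := rint_meas irf.
pose g (n : nat) := f \_ `[- n%:R, n%:R]%classic.
have [_ _ h] : [/\ leb.-integrable setT (EFin \o f),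
    ([sequence \int[leb]_x `|(EFin \o g n) x - (EFin \o f) x|]_n @ \oo --> 0)%E &
    ([sequence \int[leb]_x (EFin \o g n) x]_n @ \oo --> \int[leb]_x (EFin \o f) x)%E].
  apply: (@dominated_convergence _ _ _ leb setT measurableT (fun n => EFin \o g n) (EFin \o f) (EFin \o (fun x => `|f x|))) => //.
  - move=> n; apply/measurable_EFinP; rewrite /g.
    by apply/(measurable_restrictT _ _).1 => //; exact: measurable_funTS.
  - by apply/measurable_EFinP.
  - apply: aeW => x _ /=.
    apply: cvg_near_cst; near=> n; rewrite /g patchE ifT//.
    rewrite inE /= in_itv /= -ler_norml.
    near: n; exact: nbhs_infty_ger.
  - by have := integrable_norm irf.
  - apply: aeW => x n _ /=; rewrite lee_fin /g patchE.
    by case: ifP => //; rewrite normr0.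
have e n : (\int[leb]_x (EFin \o g n) x = (F n%:R - F (- n%:R))%:E)%E.
  rewrite -(@FTC_fin s F f (- n%:R) n%:R M)//; last first.
    by rewrite (@le_trans _ _ 0)// oppr_le0.
  rewrite /Rintegral fineK; last first.
    by apply: integrable_fin_num => //; exact: bounded_itv_int mf fM.
  rewrite [RHS]integral_mkcond; apply: eq_integral => x _.
  by rewrite -restrict_EFin.
rewrite /Rintegral.
have : (\int[leb]_x (EFin \o g n) x @[n --> \oo] --> ((a - b)%:E : \bar R))%E.
  rewrite (_ : (fun n => _) = EFin \o (fun n => F n%:R - F (- n%:R))); last first.
    by apply/funext => n; rewrite e.
  apply: cvg_EFin; first by apply: nearW.
  exact: cvgB.
by move=> /(cvg_unique _ h) ->.
Unshelve. all: by end_near. Qed.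

End Calculus.

(** * Derivatives and continuity of complex functions of a real variable *)

Section ComplexDerivative.
Context {R : realType}.
Implicit Types (f g : R -> R[i]) (z w : R[i]) (t : R).

Definition cder f t z :=
  is_derive t 1 (fun u => Re (f u)) (Re z) /\
  is_derive t 1 (fun u => Im (f u)) (Im z).

Lemma cder_eq f t z w : cder f t z -> z = w -> cder f t w.
Proof. by move=> h <-. Qed.

Lemma cder_cst z t : cder (fun _ => z) t 0.
Proof. by split; exact: is_derive_cst. Qed.

Lemma cderD f g t z w : cder f t z -> cder g t w ->
  cder (fun u => f u + g u) t (z + w).
Proof.
move=> [f1 f2] [g1 g2]; split; rewrite ReImE; under eq_fun do rewrite ReImE;
  exact: is_deriveD.
Qed.

Lemma cderN f t z : cder f t z -> cder (fun u => - f u) t (- z).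
Proof.
move=> [f1 f2]; split; rewrite ReImE; under eq_fun do rewrite ReImE;
  exact: is_deriveN.
Qed.

Lemma cderB f g t z w : cder f t z -> cder g t w ->
  cder (fun u => f u - g u) t (z - w).
Proof. by move=> h1 h2; apply: cderD => //; exact: cderN. Qed.

Lemma is_deriveM' (f g : R -> R) (x a b : R) : is_derive x 1 f a -> is_derive x 1 g b ->
  is_derive x 1 (fun u => f u * g u) (a * g x + f x * b).
Proof.
move=> h1 h2; have := is_deriveM h1 h2.
by move/is_derive_eq; apply; rewrite /GRing.scale /=; ring.
Qed.

Lemma cderM f g t z w : cder f t z -> cder g t w ->
  cder (fun u => f u * g u) t (z * g t + f t * w).
Proof.
move=> [f1 f2] [g1 g2]; split; rewrite !ReImE; under eq_fun do rewrite ReImE.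
  have := is_deriveB (is_deriveM' f1 g1) (is_deriveM' f2 g2).
  by move/is_derive_eq; apply; ring.
have := is_deriveD (is_deriveM' f1 g2) (is_deriveM' f2 g1).
by move/is_derive_eq; apply; ring.
Qed.

Lemma is_derive_compr (f g : R -> R) (x a b : R) : is_derive (g x) 1 f a ->
  is_derive x 1 g b -> is_derive x 1 (fun u => f (g u)) (a * b).
Proof. by move=> h1 h2; have := is_derive1_comp h1 h2. Qed.

Lemma cder_cexp f t z : cder f t z -> cder (fun u => cexp (f u)) t (z * cexp (f t)).
Proof.
move=> [f1 f2].
have e1 := is_derive_compr (is_derive_expR _) f1.
have s1 := is_derive_compr (is_derive_sin _) f2.
have c1 := is_derive_compr (is_derive_cos _) f2.
split.
- rewrite (_ : (fun u => Re (cexp (f u))) =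
    fun u => expR (Re (f u)) * cos (Im (f u))); last first.
    by apply/funext => u; rewrite /cexp ReImE /=; ring.
  have := is_deriveM' e1 c1; move/is_derive_eq; apply.
  by rewrite /cexp !ReImE /=; ring.
- rewrite (_ : (fun u => Im (cexp (f u))) =
    fun u => expR (Re (f u)) * sin (Im (f u))); last first.
    by apply/funext => u; rewrite /cexp ReImE /=; ring.
  have := is_deriveM' e1 s1; move/is_derive_eq; apply.
  by rewrite /cexp !ReImE /=; ring.
Qed.

Lemma cderV f t z : f t != 0 -> cder f t z ->
  cder (fun u => (f u)^-1) t (- z / (f t) ^+ 2).
Proof.
move=> f0 [f1 f2].
have n0 : Re (f t) ^+ 2 + Im (f t) ^+ 2 != 0.
  by rewrite -nrm_sqr expf_neq0// gt_eqF// nrm_gt0.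
have q : is_derive t 1 (fun u => Re (f u) * Re (f u) + Im (f u) * Im (f u))
    (2 * (Re (f t) * Re z + Im (f t) * Im z)).
  have := is_deriveD (is_deriveM' f1 f1) (is_deriveM' f2 f2).
  by move/is_derive_eq; apply; ring.
have n0' : Re (f t) * Re (f t) + Im (f t) * Im (f t) != 0 by rewrite -!expr2.
have qV := @is_deriveV _ (fun u => Re (f u) * Re (f u) + Im (f u) * Im (f u)) t _ 1 n0' q.
split.
- rewrite (_ : (fun u => Re _) = fun u => Re (f u) *
      (Re (f u) * Re (f u) + Im (f u) * Im (f u))^-1); last first.
    by apply/funext => u; rewrite Re_inv !expr2.
  have := is_deriveM' f1 qV; move/is_derive_eq; apply.
  rewrite /GRing.scale /= ReMul Re_inv Im_inv !expr2 !ReImE.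
  field.
  apply/andP; split => //.
  rewrite (_ : _ + _ = (Re (f t) * Re (f t) + Im (f t) * Im (f t)) ^+ 2); last by ring.
  by rewrite expf_neq0.
- rewrite (_ : (fun u => Im _) = fun u => - (Im (f u) *
      (Re (f u) * Re (f u) + Im (f u) * Im (f u))^-1)); last first.
    by apply/funext => u; rewrite Im_inv !expr2.
  have := is_deriveN (is_deriveM' f2 qV); move/is_derive_eq; apply.
  rewrite /GRing.scale /= ImMul Re_inv Im_inv !expr2 !ReImE.
  field.
  apply/andP; split => //.
  rewrite (_ : _ + _ = (Re (f t) * Re (f t) + Im (f t) * Im (f t)) ^+ 2); last by ring.
  by rewrite expf_neq0.
Qed.

Lemma cder_lin z w t : cder (fun u => z + u%:C * w) t w.
Proof.
split.
- rewrite (_ : (fun u => Re _) = (fun u => Re z + u * Re w)); last first.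
    by apply/funext => u; rewrite !ReImE mul0r subr0.
  have := is_deriveD (is_derive_cst (Re z) t 1)
    (is_deriveM' (is_derive_id t 1) (is_derive_cst (Re w) t 1)).
  by move/is_derive_eq; apply; rewrite /= mul1r mulr0 addr0 add0r.
- rewrite (_ : (fun u => Im _) = (fun u => Im z + u * Im w)); last first.
    by apply/funext => u; rewrite !ReImE mul0r addr0.
  have := is_deriveD (is_derive_cst (Im z) t 1)
    (is_deriveM' (is_derive_id t 1) (is_derive_cst (Im w) t 1)).
  by move/is_derive_eq; apply; rewrite /= mul1r mulr0 addr0 add0r.
Qed.

End ComplexDerivative.

Section Continuity.
Context {R : realType}.
Implicit Types (f g : R -> R[i]) (t : R).

Definition ccontat f t :=
  (Re (f u) @[u --> t] --> Re (f t)) /\ (Im (f u) @[u --> t] --> Im (f t)).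

Lemma ccontat_cst z t : ccontat (fun _ => z) t.
Proof. by split; exact: cvg_cst. Qed.

Lemma ccontatD f g t : ccontat f t -> ccontat g t -> ccontat (fun u => f u + g u) t.
Proof.
move=> [f1 f2] [g1 g2]; split; rewrite ReImE; under eq_fun do rewrite ReImE;
  exact: cvgD.
Qed.

Lemma ccontatN f t : ccontat f t -> ccontat (fun u => - f u) t.
Proof.
move=> [f1 f2]; split; rewrite ReImE; under eq_fun do rewrite ReImE; exact: cvgN.
Qed.

Lemma ccontatB f g t : ccontat f t -> ccontat g t -> ccontat (fun u => f u - g u) t.
Proof. by move=> hf hg; apply: ccontatD => //; exact: ccontatN. Qed.

Lemma ccontatM f g t : ccontat f t -> ccontat g t -> ccontat (fun u => f u * g u) t.
Proof.
move=> [f1 f2] [g1 g2]; split; rewrite ReImE; under eq_fun do rewrite ReImE.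
  by apply: cvgB; apply: cvgM.
by apply: cvgD; apply: cvgM.
Qed.

Lemma ccontatX f n t : ccontat f t -> ccontat (fun u => f u ^+ n) t.
Proof.
move=> hf; elim: n => [|n IH]; first by under eq_fun do rewrite expr0; exact: ccontat_cst.
by under eq_fun do rewrite exprS; exact: ccontatM.
Qed.

Lemma ccontatC (f : R -> R) t : {for t, continuous f} -> ccontat (fun u => (f u)%:C) t.
Proof. by move=> hf; split => //; exact: cvg_cst. Qed.

Lemma ccontatV f t : f t != 0 -> ccontat f t -> ccontat (fun u => (f u)^-1) t.
Proof.
move=> f0 [f1 f2].
have n0 : Re (f t) ^+ 2 + Im (f t) ^+ 2 != 0.
  by rewrite -nrm_sqr expf_neq0// gt_eqF// nrm_gt0.
have h : (Re (f u) ^+ 2 + Im (f u) ^+ 2)^-1 @[u --> t] -->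
    (Re (f t) ^+ 2 + Im (f t) ^+ 2)^-1.
  by apply: cvgV => //; apply: cvgD; apply: cvgM.
split.
  by under eq_fun do rewrite Re_inv; rewrite Re_inv; exact: cvgM.
by under eq_fun do rewrite Im_inv; rewrite Im_inv; apply: cvgN; exact: cvgM.
Qed.

Lemma ccontat_cexp f t : ccontat f t -> ccontat (fun u => cexp (f u)) t.
Proof.
move=> [f1 f2]; apply: ccontatM.
  by apply: ccontatC; apply: continuous_comp f1 _; exact: continuous_expR.
split => /=; apply: continuous_comp f2 _;
  [exact: continuous_cos|exact: continuous_sin].
Qed.

Lemma cder_ccontat f t z : cder f t z -> ccontat f t.
Proof.
move=> [f1 f2]; split; apply: differentiable_continuous;
  apply/derivable1_diffP; [exact: (@ex_derive _ _ _ _ _ _ _ f1)|exact: (@ex_derive _ _ _ _ _ _ _ f2)].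
Qed.

Lemma ccont_meas f : (forall t, ccontat f t) -> cmeas (T := measurableTypeR R) f.
Proof.
by move=> cf; split; apply: continuous_measurable_fun => t; have [] := cf t.
Qed.

End Continuity.

(** * Integrals of complex derivatives and their dependence on a parameter *)

Section CFTC.
Context {R : realType}.
Local Notation leb := (@lebesgue_measure R).
Local Notation RR := (measurableTypeR R).

(** Outside the interval [F] is frozen at its boundary values and [f] is replaced by $0$; the two
    endpoints become the exceptional points of [FTC_fin]. *)
Lemma FTC_itv (F f : R -> R) (a b M : R) : a <= b ->
  (forall x, {for x, continuous F}) ->
  measurable_fun setT f -> (forall x, a <= x <= b -> `|f x| <= M) ->
  (forall x, a < x < b -> is_derive x 1 F (f x) /\ {for x, continuous f}) ->
  \int[leb]_(x in `[a, b]) f x = F b - F a.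
Proof.
move=> ab cF mf fM dF.
have M0 : 0 <= M by apply: le_trans (fM a _) => //; rewrite lexx.
pose F1 x := F (Num.max a (Num.min b x)).
pose f1 x := if (a < x) && (x < b) then f x else 0.
have mf1 : measurable_fun setT f1.
  apply: measurable_fun_ifT => //; apply: measurable_and.
    exact: measurable_fun_ltr.
  exact: measurable_fun_ltr.
have -> : \int[leb]_(x in `[a, b]) f x = \int[leb]_(x in `[a, b]) (f \_ `[a, b]%classic) x.
  by apply: eq_Rintegral => x xab; rewrite patchE xab.
have -> : \int[leb]_(x in `[a, b]) (f \_ `[a, b]%classic) x = \int[leb]_(x in `[a, b]) f1 x.
  rewrite [LHS](_ : _ = \int[leb]_(x in `]a, b[) f x).
    rewrite [RHS](_ : _ = \int[leb]_(x in `]a, b[) f1 x).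
      by apply: eq_Rintegral => x; rewrite inE /= in_itv /= /f1 => ->.
    rewrite /Rintegral [in RHS]integral_itv_bndo_bndc; last first.
      by apply/measurable_EFinP; exact: measurable_funTS.
    by rewrite integral_itv_obnd_cbnd//; apply/measurable_EFinP; exact: measurable_funTS.
  rewrite /Rintegral [in RHS]integral_itv_bndo_bndc; last first.
    by apply/measurable_EFinP; exact: measurable_funTS.
  rewrite integral_itv_obnd_cbnd; last first.
    by apply/measurable_EFinP; exact: measurable_funTS.
  by congr fine; apply: eq_integral => x xab; rewrite patchE xab.
rewrite (@FTC_fin R [:: a; b] F1 f1 a b M) //.
- rewrite /F1 (min_idPl (lexx b)) (max_idPr ab).
  by rewrite (min_idPr ab) (max_idPl (lexx a)).
- move=> x; apply: continuous_comp; last exact: cF.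
  apply: continuous_max; first exact: cvg_cst.
  by apply: continuous_min; [exact: cvg_cst|exact: cvg_id].
- move=> x; rewrite /f1; case: ifP => [/andP[ax xb]|_]; last by rewrite normr0.
  by apply: fM; rewrite !ltW.
- move=> x; rewrite !inE negb_or => /andP[xa xb].
  have [/andP[ax xb']|nx] := boolP (a < x < b).
    have [d1 c1] := dF x (introT andP (conj ax xb')).
    have e : \forall y \near x, a < y < b.
      near=> y; apply/andP; split; near: y; [exact: lt_nbhsr|exact: lt_nbhsl].
    split.
      have -> : f1 x = f x by rewrite /f1 ax xb'.
      apply: near_eq_is_derive d1.
      near=> y; have /andP[ay yb] : a < y < b by near: y.
      by rewrite /F1 (min_idPr (ltW yb)) (max_idPr (ltW ay)).
    rewrite /prop_for /continuous_at.
    have -> : f1 x = f x by rewrite /f1 ax xb'.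
    apply: cvg_trans c1; apply: near_eq_cvg.
    by near=> y; have yab : a < y < b by [near: y]; rewrite /f1 yab.
  have [xla|bx] : x < a \/ b < x.
    case: (ltgtP x a) xa => // [? _|ax _]; first by left.
    right; case: (ltgtP x b) xb => // xb' _.
    by rewrite ax xb' in nx.
  - have f1x : \forall y \near x, f1 y = 0.
      near=> y; rewrite /f1 ifF//; apply/negbTE; rewrite negb_and -leNgt.
      by apply/orP; left; apply: ltW; near: y; exact: lt_nbhsl.
    split.
      rewrite (nbhs_singleton f1x); apply: (@near_eq_is_derive _ _ _ (cst (F a))).
      near=> y; rewrite /F1; have ya : y < a by near: y; exact: lt_nbhsl.
      by rewrite (min_idPr _) ?(le_trans (ltW ya))// (max_idPl (ltW ya)).
    rewrite /prop_for /continuous_at (nbhs_singleton f1x).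
    by apply: cvg_near_cst.
  - have f1x : \forall y \near x, f1 y = 0.
      near=> y; rewrite /f1 ifF//; apply/negbTE; rewrite negb_and -!leNgt.
      by apply/orP; right; apply: ltW; near: y; exact: lt_nbhsr.
    split.
      rewrite (nbhs_singleton f1x); apply: (@near_eq_is_derive _ _ _ (cst (F b))).
      near=> y; rewrite /F1; have yb : b < y by near: y; exact: lt_nbhsr.
      by rewrite (min_idPl (ltW yb)) (max_idPr ab).
    rewrite /prop_for /continuous_at (nbhs_singleton f1x).
    by apply: cvg_near_cst.
Unshelve. all: by end_near. Qed.

Definition in01 (l : R) : bool := (0 <= l) && (l <= 1).

Lemma in01_meas : measurable_fun setT in01.
Proof. by apply: measurable_and; exact: measurable_fun_ler. Qed.

Lemma cFTC01 (A : R -> R[i]) (D : R -> R[i]) (M : R) :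
  cmeas (T := RR) D ->
  (forall l, in01 l -> nrm (D l) <= M) ->
  (forall l, in01 l -> cder A l (D l)) ->
  (forall l, in01 l -> ccontat D l) ->
  cint leb (fun l => if in01 l then D l else 0) = A 1 - A 0.
Proof.
move=> [m1 m2] DM dA cD.
(* Derivatives are known only on $[0,1]$; composition with the retraction onto $[0,1]$ supplies the
   global continuity that [FTC_itv] asks for. *)
pose cl (l : R) : R := Num.max 0 (Num.min 1 l).
have cl01 l : in01 (cl l).
  by rewrite /in01 /cl le_max lexx /= ge_max ler01 /= ge_min lexx.
have key (F f : R -> R) :
    measurable_fun setT f -> (forall l, in01 l -> `|f l| <= M) ->
    (forall l, in01 l -> is_derive l 1 F (f l) /\ {for l, continuous f}) ->
    \int[leb]_l (if in01 l then f l else 0) = F 1 - F 0.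
  move=> mf fM dF; have -> : F 1 - F 0 = F (cl 1) - F (cl 0).
    rewrite /cl (min_idPl (lexx 1)) (max_idPr ler01).
    by rewrite (min_idPr ler01) (max_idPl (lexx 0)).
  rewrite -(@FTC_itv (fun l => F (cl l)) f 0 1 M)//; last 2 first.
  - move=> x; apply: (@continuous_comp _ _ _ cl F); last first.
      apply: differentiable_continuous; apply/derivable1_diffP.
      by have [[]] := dF _ (cl01 x).
    apply: continuous_max; first exact: cvg_cst.
    by apply: continuous_min; [exact: cvg_cst|exact: cvg_id].
  - move=> x /andP[x0 x1]; have [] := dF x; first by rewrite /in01 !ltW.
    move=> d1 c1; split => //; apply: near_eq_is_derive d1.
    near=> y; have y0 : 0 < y by near: y; exact: lt_nbhsr.
    have y1 : y < 1 by near: y; exact: lt_nbhsl.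
    by rewrite /cl (min_idPr (ltW y1)) (max_idPr (ltW y0)).
  rewrite [RHS]Rintegral_mkcond; apply: eq_Rintegral => x _.
  by rewrite patchE mem_setE in_itv.
apply: cplxP; rewrite !ReImE /=.
  rewrite -(key (fun l => Re (A l)) (fun l => Re (D l)))//.
  - by apply: eq_Rintegral => x _; case: ifP.
  - by move=> l l1; rewrite (le_trans (Re_le_nrm _))// DM.
  - by move=> l l1; have [? _] := dA l l1; have [? _] := cD l l1.
rewrite -(key (fun l => Im (A l)) (fun l => Im (D l)))//.
- by apply: eq_Rintegral => x _; case: ifP.
- by move=> l l1; rewrite (le_trans (Im_le_nrm _))// DM.
- by move=> l l1; have [_ ?] := dA l l1; have [_ ?] := cD l l1.
Unshelve. all: by end_near. Qed.

Lemma nrm_cvg0 (h : R[i] -> R) (b : nat -> R[i]) : (forall z, `|h z| <= nrm z) ->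
  nrm (b n) @[n --> \oo] --> 0 -> h (b n) @[n --> \oo] --> 0.
Proof.
move=> hn cb; apply/norm_cvg0P.
apply: (@squeeze_cvgr _ _ _ _ (fun=> 0) (fun n => nrm (b n))) => //.
  by apply: nearW => n; rewrite normr_ge0 hn.
exact: cvg_cst.
Qed.

Lemma cFTC_lim (s : seq R) (B f : R -> R[i]) (g : R -> R) (M : R) (L1 L2 : R[i]) :
  (forall u, ccontat B u) -> cmeas (T := RR) f -> rint leb g ->
  (forall u, nrm (f u) <= g u) -> (forall u, g u <= M) ->
  (forall u, u \notin s -> cder B u (f u) /\ ccontat f u) ->
  nrm (B n%:R - L1) @[n --> \oo] --> 0 -> nrm (B (- n%:R) - L2) @[n --> \oo] --> 0 ->
  cint leb f = L1 - L2.
Proof.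
move=> cB mf ig fg gM dB c1 c2; have [i1 i2] := cintble_dom mf ig fg.
have lim0 (h : nat -> R) (l : R) : h n - l @[n --> \oo] --> 0 -> h n @[n --> \oo] --> l.
  by move=> hl; apply/subr_cvg0.
apply: cplxP; rewrite !ReImE /=.
- apply: (@FTC_R R s (fun u => Re (B u)) _ M) => //.
  + by move=> u; have [] := cB u.
  + by move=> u; rewrite (le_trans (Re_le_nrm _))// (le_trans (fg u)).
  + by move=> u us; have [[? _] [? _]] := dB u us.
  + by apply: lim0; have := nrm_cvg0 (@Re_le_nrm R) c1; under eq_fun do rewrite !ReImE.
  + by apply: lim0; have := nrm_cvg0 (@Re_le_nrm R) c2; under eq_fun do rewrite !ReImE.
- apply: (@FTC_R R s (fun u => Im (B u)) _ M) => //.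
  + by move=> u; have [] := cB u.
  + by move=> u; rewrite (le_trans (Im_le_nrm _))// (le_trans (fg u)).
  + by move=> u us; have [[_ ?] [_ ?]] := dB u us.
  + by apply: lim0; have := nrm_cvg0 (@Im_le_nrm R) c1; under eq_fun do rewrite !ReImE.
  + by apply: lim0; have := nrm_cvg0 (@Im_le_nrm R) c2; under eq_fun do rewrite !ReImE.
Qed.

Lemma cFTC_R (s : seq R) (B f : R -> R[i]) (g : R -> R) (M : R) :
  (forall u, ccontat B u) -> cmeas (T := RR) f -> rint leb g ->
  (forall u, nrm (f u) <= g u) -> (forall u, g u <= M) ->
  (forall u, u \notin s -> cder B u (f u) /\ ccontat f u) ->
  nrm (B n%:R) @[n --> \oo] --> 0 -> nrm (B (- n%:R)) @[n --> \oo] --> 0 ->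
  cint leb f = 0.
Proof.
move=> cB mf ig fg gM dB c1 c2; rewrite -(subr0 0).
by apply: (@cFTC_lim s B f g M) => //; under eq_fun do rewrite subr0.
Qed.

Lemma rint_in01 : rint leb (fun l : R => if in01 l then 1 else 0).
Proof.
have m : measurable (`[0 : R, 1]%classic : set RR) by exact: measurable_itv.
have h : leb.-integrable (`[0 : R, 1]%classic : set RR) (EFin \o (cst 1 : RR -> R)).
  apply: continuous_compact_integrable; first exact: segment_compact.
  by apply: continuous_subspaceT => x; exact: cvg_cst.
have := (@integrable_mkcond _ RR R leb _ (EFin \o cst 1) m).1 h.
rewrite /rint; apply: eq_integrable => // x _.
by rewrite patchE mem_setE in_itv /= /in01; case: ifP.
Qed.

(* If the l-derivative of A is the u-derivative of B plus E, then the integral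
   of A over u varies with l only through E. *)
Lemma param_deriv (s : seq R) (A B D E : R -> R -> R[i]) (g : R -> R) (M : R) :
  (forall l u, in01 l -> cder (A ^~ u) l (D l u)) ->
  (forall l u, in01 l -> ccontat (D ^~ u) l) ->
  (forall l u, in01 l -> ccontat (B l) u) ->
  (forall l u, in01 l -> u \notin s ->
     cder (B l) u (D l u - E l u) /\ ccontat (fun u => D l u - E l u) u) ->
  cmeas (fun lu : RR * RR => D lu.1 lu.2) ->
  cmeas (fun lu : RR * RR => E lu.1 lu.2) ->
  rint leb g -> (forall u, g u <= M) ->
  (forall l u, in01 l -> nrm (D l u) <= g u) ->
  (forall l u, in01 l -> nrm (E l u) <= g u) ->
  (forall l, in01 l -> nrm (B l n%:R) @[n --> \oo] --> 0) ->
  (forall l, in01 l -> nrm (B l (- n%:R)) @[n --> \oo] --> 0) ->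
  cintble leb (A 0) -> cintble leb (A 1) ->
  cint leb (A 1) - cint leb (A 0) =
  cint leb (fun l => if in01 l then cint leb (E l) else 0).
Proof.
move=> dA cD cB dB mD mE ig gM Dg Eg c1 c2 i0 i1.
have g0 u : 0 <= g u.
  by rewrite (le_trans (nrm_ge0 _) (Dg 0 u _))// /in01 lexx ler01.
have mDl l : cmeas (T := RR) (D l) by exact: (cmeas_comp mD (pair1_measurable l)).
have mEl l : cmeas (T := RR) (E l) by exact: (cmeas_comp mE (pair1_measurable l)).
have mDu u : cmeas (T := RR) (D ^~ u) by exact: (cmeas_comp mD (pair2_measurable u)).
rewrite -cintB//.
(* Write $A(1)-A(0)$ as the integral of $D$ over $l\in[0,1]$, exchange the two integrals, and for
   each fixed $l$ discard $D-E$, which is a $u$-derivative whose primitive vanishes at both ends. *)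
transitivity (cint leb (fun u => cint leb (fun l => if in01 l then D l u else 0))).
  apply: eq_cint => u; rewrite (@cFTC01 (A ^~ u) (D ^~ u) M)//.
  - by move=> l l1; rewrite (le_trans (Dg _ _ l1)).
  - by move=> l l1; exact: dA.
  - by move=> l l1; exact: cD.
pose F (lu : RR * RR) : R[i] := if in01 lu.1 then D lu.1 lu.2 else 0.
have mF : cmeas F.
  apply: (@cmeas_if _ _ _ (fun lu => D lu.1 lu.2) (fun=> 0) (fun lu => in01 lu.1)) => //.
  exact: (measurableT_comp in01_meas measurable_fst).
rewrite -(@cfubini R _ _ _ _ leb leb F (fun l => if in01 l then 1 else 0) g mF)//.
- apply: eq_cint => l; rewrite /F /=; case: ifP => l1; last by rewrite cint0.
  have iD : cintble leb (D l) by apply: (cintble_dom (mDl l) ig) => u; exact: Dg.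
  have iE : cintble leb (E l) by apply: (cintble_dom (mEl l) ig) => u; exact: Eg.
  have := @cFTC_R s (B l) (fun u => D l u - E l u) (fun u => g u + g u) (M + M).
  rewrite cintB// => h; apply/eqP; rewrite -subr_eq0; apply/eqP; apply: h.
  + by move=> u; exact: cB.
  + exact: cmeasB.
  + exact: rintD.
  + by move=> u; rewrite (le_trans (nrmB _ _))// lerD ?Dg ?Eg.
  + by move=> u; exact: lerD.
  + by move=> u; exact: dB.
  + exact: c1.
  + exact: c2.
- by move=> l; case: ifP.
- exact: rint_in01.
- by move=> l u; rewrite /F /=; case: ifP => l1; rewrite ?mul1r ?mul0r ?nrm0 ?Dg.
Qed.

(** Lebesgue measure is determined by its values on half-open intervals, and reflection preserves
    their length. *)
Lemma leb_opp (A : set (measurableTypeR R)) : measurable A ->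
  leb A = pushforward leb (-%R : R -> R) A.
Proof.
have mo : measurable_fun [set: measurableTypeR R] (-%R : R -> measurableTypeR R).
  exact: oppr_measurable.
apply: (@lebesgue_measure_unique R
  (measure_function_pushforward__canonical__measure_function_Measure leb mo)).
move=> _ [[a b] _ <-] /=.
transitivity (leb `[- b, - a[%classic); last first.
  congr (leb _); apply/seteqP; split=> x /=; rewrite !in_itv /= => /andP[? ?];
    apply/andP; split; lra.
rewrite !lebesgue_measure_itv /= !lte_fin ltrN2; case: ifP => // _.
by rewrite !EFinN oppeK addeC.
Qed.

Lemma rint_opp (f : R -> R) : rint leb f -> rint leb (fun x => f (- x)).
Proof.
move=> intf; have mf := rint_meas intf.
have mo : measurable_fun [set: measurableTypeR R] (-%R : R -> measurableTypeR R).
  exact: oppr_measurable.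
apply/integrableP; split; first by apply/measurable_EFinP; exact: measurableT_comp.
have := @ge0_integral_pushforward _ _ _ _ R _ mo leb setT (EFin \o (fun x => `|f x|)).
rewrite preimage_setT => <-//; last 2 first.
- by apply/measurable_EFinP; exact: measurableT_comp.
- by move=> x _; rewrite lee_fin.
rewrite (@eq_measure_integral _ _ _ _ leb)//; first by have /integrableP[_] := intf.
by move=> A mA _; exact: esym (leb_opp mA).
Qed.

Lemma Rintegral_opp (f : R -> R) : rint leb f ->
  \int[leb]_x f (- x) = \int[leb]_x f x.
Proof.
move=> intf; have mf := rint_meas intf.
have mo : measurable_fun [set: measurableTypeR R] (-%R : R -> measurableTypeR R).
  exact: oppr_measurable.
rewrite /Rintegral.
have := @integral_pushforward _ _ _ _ R _ mo leb setT (EFin \o f).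
rewrite preimage_setT => <-//; last 2 first.
- by apply/measurable_EFinP.
- exact: rint_opp.
congr fine; apply: (@eq_measure_integral _ _ _ _ leb) => A mA _.
exact: esym (leb_opp mA).
Qed.

Lemma cint_opp (f : R -> R[i]) : cintble leb f ->
  cint leb (fun x => f (- x)) = cint leb f.
Proof.
move=> [i1 i2]; apply: cplxP => /=.
  exact: (Rintegral_opp i1).
exact: (Rintegral_opp i2).
Qed.

End CFTC.

(** * Deformation of contours *)

Section Gauss.
Context {R : realType}.
Local Notation leb := (@lebesgue_measure R).
Local Notation RR := (measurableTypeR R).
Implicit Types (c m u K : R).

Definition gau c u : R := expR (- (c * u ^+ 2)).

Lemma gau_ge0 c u : 0 <= gau c u. Proof. exact: expR_ge0. Qed.

(** Reduces Gaussian integrals to the normal density of variance $1/(2c)$, whose total mass is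
    known. *)
Lemma gau_normal c m u : 0 < c ->
  expR (- (c * (u - m) ^+ 2)) =
  Num.sqrt (pi / c) * normal_pdf m (Num.sqrt (2 * c)^-1) u.
Proof.
move=> c0.
have s0 : Num.sqrt (2 * c)^-1 != 0 :> R by rewrite sqrtr_eq0 -ltNge invr_gt0 mulr_gt0.
rewrite normal_pdfE// /normal_peak /normal_fun sqr_sqrtr; last first.
  by rewrite invr_ge0 mulr_ge0// ltW.
have -> : (2 * c)^-1 * pi *+ 2 = pi / c by field; rewrite gt_eqF.
rewrite mulVKf; last by rewrite sqrtr_eq0 -ltNge divr_gt0// pi_gt0.
by congr expR; field; rewrite gt_eqF.
Qed.

Lemma rint_gauss c m : 0 < c -> rint leb (fun u => expR (- (c * (u - m) ^+ 2))).
Proof.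
move=> c0; rewrite (_ : (fun u => _) =
   (fun u => Num.sqrt (pi / c) * normal_pdf m (Num.sqrt (2 * c)^-1) u)).
  by apply: rintZ; exact: integrable_normal_pdf.
by apply/funext => u; rewrite gau_normal.
Qed.

Lemma Rint_gauss c m : 0 < c ->
  \int[leb]_u expR (- (c * (u - m) ^+ 2)) = Num.sqrt (pi / c).
Proof.
move=> c0; rewrite (_ : (fun u => _) =
   (fun u => Num.sqrt (pi / c) * normal_pdf m (Num.sqrt (2 * c)^-1) u)).
  rewrite RintegralZl//; last exact: integrable_normal_pdf.
  by rewrite /Rintegral integral_normal_pdf mulr1.
by apply/funext => u; rewrite gau_normal.
Qed.

Lemma rint_gau c : 0 < c -> rint leb (gau c).
Proof.
by move=> c0; have := rint_gauss 0 c0; under eq_fun do rewrite subr0.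
Qed.

Lemma gau_le1 c u : 0 < c -> gau c u <= 1.
Proof. by move=> c0; rewrite /gau expR_le1 oppr_le0 mulr_ge0 ?sqr_ge0// ltW. Qed.

(** Half of the exponent absorbs the linear factor: $|u|\le1+u^2$ and $u^2e^{-cu^2/2}\le2/c$, whence
    the constant $K(2+2/c)$. *)
Lemma lin_gau (c K : R) : 0 < c -> 0 <= K ->
  exists K', 0 <= K' /\ forall u, K * (1 + `|u|) * gau c u <= K' * gau (c / 2) u.
Proof.
move=> c0 K0; exists (K * (1 + (1 + (c / 2)^-1))).
split; first by rewrite mulr_ge0// !addr_ge0// invr_ge0 divr_ge0// ltW.
move=> u; have -> : gau c u = gau (c / 2) u * gau (c / 2) u.
  by rewrite /gau -expRD; congr expR; field.
rewrite mulrA ler_wpM2r ?gau_ge0// -mulrA ler_wpM2l//.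
have h1 : gau (c / 2) u <= 1 by rewrite gau_le1// divr_gt0.
have h2 : u ^+ 2 * gau (c / 2) u <= (c / 2)^-1.
  rewrite -ler_pdivlMr ?expR_gt0// /gau expRN invrK.
  have h := expR_ge1Dx (c / 2 * u ^+ 2).
  have c2 : 0 < c / 2 by rewrite divr_gt0.
  rewrite -(@ler_pM2l _ (c / 2))// mulVKf ?gt_eqF//.
  by apply: le_trans h; rewrite lerDr.
have h3 : `|u| <= 1 + u ^+ 2.
  rewrite -(real_normK (num_real u)); have := sqr_ge0 (`|u| - 1/2).
  by rewrite sqrrB; lra.
have h4 := gau_ge0 (c / 2) u.
have h5 : `|u| * gau (c / 2) u <= (1 + u ^+ 2) * gau (c / 2) u by rewrite ler_wpM2r.
rewrite mulrDl mul1r; lra.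
Qed.

Lemma cvg_gau c (x : nat -> R) : 0 < c -> (forall n, `|x n| = n%:R) ->
  gau c (x n) @[n --> \oo] --> 0.
Proof.
move=> c0 xn; apply: (@squeeze_cvgr _ _ _ _ (fun=> 0) (fun n => c^-1 * (n%:R)^-1)).
- near=> n.
  have n1 : (1 : R) <= n%:R by rewrite ler1n; near: n; exact: nbhs_infty_gt.
  have n0 : 0 < n%:R :> R by rewrite (lt_le_trans _ n1).
  rewrite gau_ge0 /= /gau expRN -invfM lef_pV2 ?posrE ?expR_gt0 ?mulr_gt0//.
  apply: (le_trans _ (expR_ge1Dx _)).
  rewrite -real_normK ?num_real// xn.
  apply: (@le_trans _ _ (c * n%:R ^+ 2)); last by rewrite lerDr.
  by rewrite ler_wpM2l// ?(ltW c0)// expr2 ler_peMr// ltW.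
- exact: cvg_cst.
- rewrite -(mulr0 c^-1); apply: cvgM; first exact: cvg_cst.
  apply/gtr0_cvgV0; first by near=> n; rewrite ltr0n; near: n; exact: nbhs_infty_gt.
  exact: cvgr_idn.
Unshelve. all: by end_near. Qed.

End Gauss.

Section Contours.
Context {R : realType}.
Local Notation leb := (@lebesgue_measure R).
Local Notation RR := (measurableTypeR R).
Implicit Types (g : R[i] -> R[i]) (gam v : R -> R[i]).

(** The factor $1/(2\pi i)$ is left out, and the velocity is a parameter of its own, so that
    explicit contours can come with an explicit velocity that is also chosen at their corners. *)
Definition pint gam v g : R[i] := cint leb (fun u : R => g (gam u) * v u).

Lemma contour_intE gam g :
  contour_int gam g = (0 +i* (2 * pi))^-1 * pint gam (velocity gam) g.
Proof. by []. Qed.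

Record adm gam v : Prop := Adm {
  adm_cont : forall t, ccontat gam t;
  adm_der : exists s : seq R, forall t, t \notin s ->
    cder gam t (v t) /\ ccontat v t;
  adm_meas : cmeas (T := RR) v;
  adm_bd : exists V : R, 0 <= V /\ forall u, nrm (v u) <= V }.

(** Mean value inequality: a bounded velocity gives linear growth, also across the finitely many
    corners. *)
Lemma adm_growth gam v : adm gam v ->
  exists C : R, 0 <= C /\ forall u, nrm (gam u) <= C * (1 + `|u|).
Proof.
move=> [cg [s ds] mg [V [V0 hV]]].
have half (f : R -> R) (f' : R -> R) : (forall t, f u @[u --> t] --> f t) ->
    (forall t, t \notin s -> is_derive t 1 f (f' t)) ->
    (forall t, `|f' t| <= V) -> forall u, `|f u - f 0| <= V * `|u|.
  move=> cf df fV.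
  have mono a b (e : R) : `|e| <= 1 -> a <= b -> e * (f b - f a) <= V * (b - a).
    move=> e1 ab.
    have := @ndecr_fin _ s (fun u => V * u - e * f u) a b ab.
    have -> : (V * a - e * f a <= V * b - e * f b) =
       (e * (f b - f a) <= V * (b - a)) by apply/idP/idP; lra.
    apply.
      move=> x _; apply: cvgB; apply: cvgM; try exact: cvg_cst; try exact: cvg_id.
      exact: cf.
    move=> x _ xs; have d := df x xs.
    have h : is_derive x 1 (fun u => V * u - e * f u) (V - e * f' x).
      have := is_deriveB (is_deriveM' (is_derive_cst V x 1) (is_derive_id x 1))
         (is_deriveM' (is_derive_cst e x 1) d).
      by move/is_derive_eq; apply; rewrite /= !mul0r !add0r mulr1.
    split; first exact: ex_derive.
    rewrite derive1E derive_val subr_ge0 (le_trans (ler_norm _))// normrM.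
    by rewrite (le_trans _ (fV x))// ler_piMl.
  move=> u; rewrite ler_norml; have [u0|u0] := leP 0 u.
    have h1 := mono 0 u 1; have h2 := mono 0 u (-1).
    rewrite ger0_norm//; rewrite normr1 in h1; rewrite normrN1 in h2.
    have := h1 (lexx _) u0; have := h2 (lexx _) u0; lra.
  have h1 := mono u 0 1; have h2 := mono u 0 (-1).
  rewrite ltr0_norm//; rewrite normr1 in h1; rewrite normrN1 in h2.
  have := h1 (lexx _) (ltW u0); have := h2 (lexx _) (ltW u0); lra.
have h1 := half (fun u => Re (gam u)) (fun u => Re (v u)).
have h2 := half (fun u => Im (gam u)) (fun u => Im (v u)).
have {}h1 u : `|Re (gam u) - Re (gam 0)| <= V * `|u|.
  apply: h1; first by move=> t; have [] := cg t.
    by move=> t /ds[[]].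
  by move=> t; rewrite (le_trans (Re_le_nrm _)).
have {}h2 u : `|Im (gam u) - Im (gam 0)| <= V * `|u|.
  apply: h2; first by move=> t; have [] := cg t.
    by move=> t /ds[[]].
  by move=> t; rewrite (le_trans (Im_le_nrm _)).
exists (`|Re (gam 0)| + `|Im (gam 0)| + 2 * V); split.
  by rewrite !addr_ge0// mulr_ge0.
move=> u; rewrite (le_trans (nrm_le_ReIm _))//.
have a1 : `|Re (gam u)| <= `|Re (gam 0)| + V * `|u|.
  by rewrite -{1}(subrK (Re (gam 0)) (Re (gam u))) (le_trans (ler_normD _ _))// addrC lerD2l.
have a2 : `|Im (gam u)| <= `|Im (gam 0)| + V * `|u|.
  by rewrite -{1}(subrK (Im (gam 0)) (Im (gam u))) (le_trans (ler_normD _ _))// addrC lerD2l.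
have p1 := normr_ge0 (Re (gam 0)); have p2 := normr_ge0 (Im (gam 0)).
have p3 := normr_ge0 u.
have p4 : 0 <= (`|Re (gam 0)| + `|Im (gam 0)|) * `|u| by rewrite mulr_ge0// addr_ge0.
by nra.
Qed.

Lemma adm_cmeas gam v : adm gam v -> cmeas (T := RR) gam.
Proof. by move=> [cg _ _ _]; exact: ccont_meas. Qed.

(* g is holomorphic at the points of S with derivative g', in a form that
   composes with paths. *)
Definition chol (S : set R[i]) g g' := forall (z : R -> R[i]) t z',
  S (z t) -> cder z t z' -> cder (fun u => g (z u)) t (g' (z t) * z').
Definition ccs (S : set R[i]) g := forall (z : R -> R[i]) t,
  S (z t) -> ccontat z t -> ccontat (fun u => g (z u)) t.
Definition cbor g := forall d (T : measurableType d) (f : T -> R[i]),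
  cmeas f -> cmeas (fun x => g (f x)).

Lemma velocity_cint gam v g (K c : R) : adm gam v -> cbor g -> 0 < c ->
  (forall u, nrm (g (gam u)) <= K * gau c u) ->
  cintble leb (fun u : R => g (gam u) * v u).
Proof.
move=> ag bg c0 gK; have [V [V0 hV]] := adm_bd ag.
apply: (@cintble_dom R _ RR leb _ (fun u => (K * V) * gau c u)).
- by apply: cmeasM; [apply: bg; exact: adm_cmeas ag|exact: adm_meas ag].
- by apply: rintZ; exact: rint_gau.
- move=> u; rewrite nrmM mulrAC ler_pM ?nrm_ge0//.
Qed.

Definition lhom (g0 g1 : R -> R[i]) (l u : R) := g0 u + l%:C * (g1 u - g0 u).

(** Cauchy's theorem in differential form. Along the straight homotopy $G(l,u)$ put
    $A=g(G)\,\partial_uG$ and $B=g(G)\,\partial_lG$; then $\partial_lA=\partial_uB$ off the corners,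
    so [param_deriv] applies with no remainder. The Gaussian bound beats the linear growth of
    $\partial_lG$ and makes $B$ vanish at both ends. *)
Lemma homotopy (g0 v0 g1 v1 : R -> R[i]) g g' (S : set R[i]) (K c : R) :
  adm g0 v0 -> adm g1 v1 -> 0 < c -> chol S g g' -> ccs S g -> ccs S g' ->
  cbor g -> cbor g' ->
  (forall l u, in01 l -> S (lhom g0 g1 l u)) ->
  (forall l u, in01 l -> nrm (g (lhom g0 g1 l u)) <= K * gau c u) ->
  (forall l u, in01 l -> nrm (g' (lhom g0 g1 l u)) <= K * gau c u) ->
  pint g0 v0 g = pint g1 v1 g.
Proof.
move=> a0 a1 c0 hg cg cg' bg bg' hS gK g'K.
have [V0 [V00 hV0]] := adm_bd a0; have [V1 [V10 hV1]] := adm_bd a1.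
have [C0 [C00 hC0]] := adm_growth a0; have [C1 [C10 hC1]] := adm_growth a1.
have [s0 hs0] := adm_der a0; have [s1 hs1] := adm_der a1.
pose G l u := lhom g0 g1 l u; pose dG l u := lhom v0 v1 l u.
pose A l u := g (G l u) * dG l u.
pose B l u := g (G l u) * (g1 u - g0 u).
pose D l u := g' (G l u) * (g1 u - g0 u) * dG l u + g (G l u) * (v1 u - v0 u).
have K0 : 0 <= K.
  have := gK 0 0; rewrite /in01 lexx ler01 => /(_ isT) h.
  by have := le_trans (nrm_ge0 _) h; rewrite pmulr_lge0 ?expR_gt0.
have mu1 : measurable_fun setT (@fst RR RR) by exact: measurable_fst.
have mu2 : measurable_fun setT (@snd RR RR) by exact: measurable_snd.
have mg0 := cmeas_comp (adm_cmeas a0) mu2; have mg1 := cmeas_comp (adm_cmeas a1) mu2.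
have mv0 := cmeas_comp (adm_meas a0) mu2; have mv1 := cmeas_comp (adm_meas a1) mu2.
have ml : cmeas (fun lu : RR * RR => lu.1%:C) by exact: (cmeasC mu1).
have mG : cmeas (fun lu : RR * RR => G lu.1 lu.2).
  by apply: cmeasD => //; apply: cmeasM => //; exact: cmeasB.
have mdG : cmeas (fun lu : RR * RR => dG lu.1 lu.2).
  by apply: cmeasD => //; apply: cmeasM => //; exact: cmeasB.
have mD : cmeas (fun lu : RR * RR => D lu.1 lu.2).
  apply: cmeasD; apply: cmeasM; [apply: cmeasM => //|by []|exact: bg|exact: cmeasB].
    exact: bg'.
  exact: cmeasB.
have hB u : nrm (g1 u - g0 u) <= (C0 + C1) * (1 + `|u|).
  by rewrite (le_trans (nrmB _ _))// mulrDl addrC lerD.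
have hv u : nrm (v1 u - v0 u) <= V0 + V1.
  by rewrite (le_trans (nrmB _ _))// addrC lerD.
have hdG l u : in01 l -> nrm (dG l u) <= V0 + (V0 + V1).
  move=> /andP[l0 l1]; rewrite (le_trans (nrmD _ _))// lerD//.
  by rewrite nrmM nrmC ger0_norm// (le_trans _ (hv u))// ler_piMl// nrm_ge0.
have [K1 [K10 hK1]] := @lin_gau R c (K * (C0 + C1) * (V0 + (V0 + V1)) + K * (V0 + V1)) c0
   (addr_ge0 (mulr_ge0 (mulr_ge0 K0 (addr_ge0 C00 C10)) (addr_ge0 V00 (addr_ge0 V00 V10)))
     (mulr_ge0 K0 (addr_ge0 V00 V10))).
have [K2 [K20 hK2]] := @lin_gau R c (K * (C0 + C1)) c0 (mulr_ge0 K0 (addr_ge0 C00 C10)).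
have c20 : 0 < c / 2 by rewrite divr_gt0.
have Dg l u : in01 l -> nrm (D l u) <= K1 * gau (c / 2) u.
  move=> l1; rewrite (le_trans _ (hK1 u))// !mulrDl (le_trans (nrmD _ _))//.
  have gu := gau_ge0 c u; have nu := normr_ge0 u.
  rewrite lerD// !nrmM.
    apply: (@le_trans _ _ ((K * gau c u) * ((C0 + C1) * (1 + `|u|)) * (V0 + (V0 + V1)))).
      by rewrite ler_pM ?mulr_ge0 ?nrm_ge0// ?hdG// ler_pM ?nrm_ge0// g'K.
    by apply/eqP/eqP; rewrite le_eqVlt; apply/orP; left; apply/eqP; ring.
  apply: (@le_trans _ _ ((K * gau c u) * (V0 + V1))).
    by rewrite ler_pM ?nrm_ge0// gK.
  have q : 0 <= K * (V0 + V1) * gau c u by rewrite !mulr_ge0// addr_ge0.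
  have := mulr_ge0 q nu; nra.
have Bn l (x : nat -> R) : in01 l -> (forall n, `|x n| = n%:R) ->
    nrm (B l (x n)) @[n --> \oo] --> 0.
  move=> l1 xn; apply: (@squeeze_cvgr _ _ _ _ (fun=> 0) (fun n => K2 * gau (c / 2) (x n))).
  - apply: nearW => n; rewrite nrm_ge0 /= (le_trans _ (hK2 (x n)))// /B nrmM.
    rewrite (_ : _ * gau c (x n) = (K * gau c (x n)) * ((C0 + C1) * (1 + `|x n|))); last by ring.
    by rewrite ler_pM ?nrm_ge0// gK.
  - exact: cvg_cst.
  - by rewrite -(mulr0 K2); apply: cvgM; [exact: cvg_cst|exact: cvg_gau].
have G0 u : G 0 u = g0 u by rewrite /G /lhom mul0r addr0.
have G1 u : G 1 u = g1 u by rewrite /G /lhom mul1r addrC subrK.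
have dG0 u : dG 0 u = v0 u by rewrite /dG /lhom mul0r addr0.
have dG1 u : dG 1 u = v1 u by rewrite /dG /lhom mul1r addrC subrK.
have in0 : in01 (0 : R) by rewrite /in01 lexx ler01.
have in1 : in01 (1 : R) by rewrite /in01 lexx ler01.
have i0 : cintble leb (fun u : R => g (g0 u) * v0 u).
  by apply: (@velocity_cint _ _ _ K c) => // u; rewrite -G0; exact: gK.
have i1 : cintble leb (fun u : R => g (g1 u) * v1 u).
  by apply: (@velocity_cint _ _ _ K c) => // u; rewrite -G1; exact: gK.
have clG u l : cder (fun l => G l u) l (g1 u - g0 u) by exact: cder_lin.
have cldG u l : cder (fun l => dG l u) l (v1 u - v0 u) by exact: cder_lin.
have := @param_deriv R (s0 ++ s1) A B D (fun _ _ => 0)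
   (fun u => K1 * gau (c / 2) u) K1.
rewrite (_ : cint leb (A 1) = pint g1 v1 g); last by apply: eq_cint => u; rewrite /A G1 dG1.
rewrite (_ : cint leb (A 0) = pint g0 v0 g); last by apply: eq_cint => u; rewrite /A G0 dG0.
rewrite (_ : cint leb (fun l => if in01 l then _ else _) = 0); last first.
  by rewrite -[RHS](@cint0 R _ _ leb); apply: eq_cint => l; rewrite cint0 if_same.
move=> h; apply/eqP; rewrite eq_sym -subr_eq0; apply/eqP; apply: h.
- move=> l u l1; have := cderM (hg (fun l => G l u) _ _ (hS l u l1) (clG u l)) (cldG u l).
  by [].
- move=> l u l1; have c1 := cder_ccontat (clG u l); have c2 := cder_ccontat (cldG u l).
  apply: ccontatD; apply: ccontatM; [apply: ccontatM|by []| |exact: ccontat_cst].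
  + by apply: (cg' (fun l => G l u)) => //; exact: hS.
  + exact: ccontat_cst.
  + by apply: (cg (fun l => G l u)) => //; exact: hS.
- move=> l u l1.
  have k0 := adm_cont a0 u; have k1 := adm_cont a1 u.
  have kG : ccontat (G l) u.
    by apply: ccontatD => //; apply: ccontatM; [exact: ccontat_cst|exact: ccontatB].
  by apply: ccontatM; [apply: (cg (G l)) => //; exact: hS|exact: ccontatB].
- move=> l u l1; rewrite mem_cat negb_or => /andP[us0 us1].
  have [d0 k0] := hs0 u us0; have [d1 k1] := hs1 u us1.
  have dGu : cder (G l) u (dG l u).
    have := cderD d0 (cderM (cder_cst l%:C u) (cderB d1 d0)).
    by move/cder_eq; apply; rewrite mul0r add0r.
  split.
    have := cderM (hg (G l) _ _ (hS l u l1) dGu) (cderB d1 d0).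
    by move/cder_eq; apply; rewrite subr0 /D mulrAC.
  have kG := cder_ccontat dGu; have q0 := cder_ccontat d0; have q1 := cder_ccontat d1.
  have kdG : ccontat (dG l) u.
    by apply: ccontatD => //; apply: ccontatM; [exact: ccontat_cst|exact: ccontatB].
  apply: ccontatB; last exact: ccontat_cst.
  apply: ccontatD; apply: ccontatM; [apply: ccontatM|by []| |exact: ccontatB].
  + by apply: (cg' (G l)) => //; exact: hS.
  + exact: ccontatB.
  + by apply: (cg (G l)) => //; exact: hS.
- exact: mD.
- exact: cmeas_cst.
- by apply: rintZ; exact: rint_gau.
- by move=> u; rewrite ler_piMr// gau_le1.
- by move=> l u l1; exact: Dg.
- by move=> l u l1; rewrite nrm0 mulr_ge0// gau_ge0.
- by move=> l l1; apply: Bn => // n; rewrite normr_nat.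
- by move=> l l1; apply: Bn => // n; rewrite normrN normr_nat.
- rewrite (_ : A 0 = fun u => g (g0 u) * v0 u)//.
  by apply/funext => u; rewrite /A G0 dG0.
- rewrite (_ : A 1 = fun u => g (g1 u) * v1 u)//.
  by apply/funext => u; rewrite /A G1 dG1.
Qed.

End Contours.

(** * Decay of Gaussian and Airy exponentials in cones around the imaginary axis *)

Section ContourGeometry.
Context {R : realType}.
Local Notation leb := (@lebesgue_measure R).
Local Notation RR := (measurableTypeR R).
Implicit Types (gam v : R -> R[i]) (e C k : R).

Definition sgn (u : R) : R := if 0 <= u then 1 else -1.

(* The point z at parameter u lies in a cone around the imaginary axis, whose
   upper half is used for u >= 0 and lower half for u < 0, up to a bounded
   error. *)
Definition cpt k1 k2 e C (u : R) (z : R[i]) := [/\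
  e * `|u| - C <= sgn u * Im z,
  k1 * (sgn u * Im z) - C <= - Re z &
  - Re z <= k2 * (sgn u * Im z) + C].
Definition cone k1 k2 e C gam := forall u, cpt k1 k2 e C u (gam u).

Lemma sgnM_norm u x : `|sgn u * x| = `|x|.
Proof. by rewrite normrM /sgn; case: ifP => _; rewrite ?normrN normr1 mul1r. Qed.

(** For fixed [u] each condition of [cpt] is a half-plane in $z$, hence convex. This is why the sign
    is taken from the parameter [u] and not from $\mathrm{Im}\,z$. *)
Lemma cpt_conv k1 k2 e C u z w (l : R) : in01 l ->
  cpt k1 k2 e C u z -> cpt k1 k2 e C u w -> cpt k1 k2 e C u (z + l%:C * (w - z)).
Proof.
move=> /andP[l0 l1] [z1 z2 z3] [w1 w2 w3].
rewrite /cpt !ReImE !mul0r subr0 addr0.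
set s := sgn u in z1 z2 z3 w1 w2 w3 *.
set x := Re z in z1 z2 z3 *; set y := Im z in z1 z2 z3 *.
set x' := Re w in w1 w2 w3 *; set y' := Im w in w1 w2 w3 *.
have h (a b c : R) : c <= a -> c <= b -> c <= a + l * (b - a).
  move=> h1 h2; have : 0 <= (1 - l) * (a - c) + l * (b - c).
    by rewrite addr_ge0// mulr_ge0 ?subr_ge0.
  by nra.
split.
- by have := h _ _ _ z1 w1; nra.
- have := h (- x - k1 * (s * y) ) (- x' - k1 * (s * y')) (- C); nra.
- have := h (x + k2 * (s * y) ) (x' + k2 * (s * y')) (- C); nra.
Qed.

Lemma cpt_weak k1 k2 e C e' C' u z : e' <= e -> C <= C' ->
  cpt k1 k2 e C u z -> cpt k1 k2 e' C' u z.
Proof.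
move=> h1 h2 [z1 z2 z3].
have p3 : e' * `|u| <= e * `|u| by rewrite ler_wpM2r.
by split; lra.
Qed.

Lemma cpt_facts k1 k2 e C u z : 0 < e -> 0 <= C -> cpt k1 k2 e C u z ->
  (- C <= sgn u * Im z) /\ e * `|u| - C <= `|Im z|.
Proof.
move=> e0 C0 [z1 _ _]; split.
  by apply: le_trans z1; rewrite lerDr mulr_ge0// ltW.
by rewrite (le_trans z1)// -(sgnM_norm u) ler_norm.
Qed.

(** From $(e|u|)^2\le(y+C)^2\le2y^2+2C^2$; decay in the imaginary part thus becomes decay in the
    parameter. *)
Lemma sqr_lower e C (u y : R) : 0 < e -> 0 <= C -> 0 <= y -> e * `|u| - C <= y ->
  e ^+ 2 / 2 * u ^+ 2 - C ^+ 2 <= y ^+ 2.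
Proof.
move=> e0 C0 y0 h.
have a0 : 0 <= e * `|u| by rewrite mulr_ge0// ltW.
have -> : u ^+ 2 = `|u| ^+ 2 by rewrite real_normK// num_real.
have : (e * `|u|) ^+ 2 <= (y + C) ^+ 2 by rewrite ler_pXn2r// ?nnegrE; lra.
have := sqr_ge0 (y - C); nra.
Qed.

Lemma quad_le (a L K y : R) : 0 < a -> - (2 * a) * y ^+ 2 + L * y + K <=
  - a * y ^+ 2 + (K + L ^+ 2 / (4 * a)).
Proof.
move=> a0; have : 0 <= a * (y - L / (2 * a)) ^+ 2 by rewrite mulr_ge0 ?sqr_ge0// ltW.
have -> : a * (y - L / (2 * a)) ^+ 2 = a * y ^+ 2 - L * y + L ^+ 2 / (4 * a).
  by field; rewrite gt_eqF.
by lra.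
Qed.

(** Up to bounded errors $|\mathrm{Re}\,z|\le\frac45|\mathrm{Im}\,z|$, so
    $t\,\mathrm{Re}\,z^2\le-\frac9{25}t(\mathrm{Im}\,z)^2$. Half of this, with coefficient [a]
    $=\frac9{50}t$, absorbs the linear terms, and the other half is the decay. *)
Lemma gauss_bound e C (t B : R) : 0 < e -> 0 <= C -> 0 < t -> 0 <= B ->
  exists K c : R, 0 < c /\ forall u z b, nrm b <= B -> cpt (-(4/5)) (4/5) e C u z ->
    Re (t%:C * z ^+ 2 + b * z) <= K - c * u ^+ 2.
Proof.
move=> e0 C0 t0 B0.
pose L := 16/5 * C * t + 9/5 * B.
pose K0 := t * (2 * C) ^+ 2 + B * (2 * C).
pose a := 9/50 * t; have a0 : 0 < a by rewrite /a mulr_gt0.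
exists (K0 + L ^+ 2 / (4 * a) + a * C ^+ 2), (a * (e ^+ 2 / 2)).
split; first by rewrite !mulr_gt0// exprn_gt0.
move=> u z b bB hz; have [YC yl] := cpt_facts e0 C0 hz; move: hz => [z1 z2 z3].
set Y := sgn u * Im z in YC z1 z2 z3; pose y := `|Im z|; pose x := Re z.
have yY : `|Y| = y by rewrite sgnM_norm.
have y0 : 0 <= y by exact: normr_ge0.
have Yy : Y <= y by rewrite -yY ler_norm.
have Yny : - y <= Y by rewrite -yY lerNl ler_normr lexx orbT.
have xb : `|x| <= 4/5 * y + 2 * C.
  by rewrite ler_norml; rewrite -/x in z2 z3; apply/andP; split; lra.
have x0 : 0 <= `|x| by exact: normr_ge0.
have ysq : Im z ^+ 2 = y ^+ 2 by rewrite /y real_normK// num_real.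
have xsq : x ^+ 2 = `|x| ^+ 2 by rewrite real_normK// num_real.
have h1 : Re b * x - Im b * Im z <= B * `|x| + B * y.
  have b1 := Re_le_nrm b; have b2 := Im_le_nrm b.
  rewrite lerD//.
    by rewrite (le_trans (ler_norm _))// normrM ler_wpM2r// (le_trans b1).
  by rewrite (le_trans (ler_norm _))// normrN normrM ler_wpM2r// (le_trans b2).
have -> : Re (t%:C * z ^+ 2 + b * z) = t * (x ^+ 2 - y ^+ 2) + (Re b * x - Im b * Im z).
  by rewrite -ysq expr2 !ReImE /x; ring.
have h2 : `|x| ^+ 2 <= (4/5 * y + 2 * C) ^+ 2.
  by rewrite ler_pXn2r// ?nnegrE; lra.
have h3 : t * (x ^+ 2 - y ^+ 2) <= t * ((4/5 * y + 2 * C) ^+ 2 - y ^+ 2).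
  by rewrite ler_wpM2l ?(ltW t0)// xsq lerD2r.
have h4 : B * `|x| <= B * (4/5 * y + 2 * C) by rewrite ler_wpM2l.
have h5 := quad_le L K0 y a0.
have h6 := sqr_lower e0 C0 y0 yl.
have h7 : a * (e ^+ 2 / 2 * u ^+ 2 - C ^+ 2) <= a * y ^+ 2 by rewrite ler_wpM2l ?(ltW a0).
have h8 : t * ((4/5 * y + 2 * C) ^+ 2 - y ^+ 2) + (B * (4/5 * y + 2 * C) + B * y) =
   - (2 * a) * y ^+ 2 + L * y + K0 by rewrite /a /L /K0; field.
by lra.
Qed.

(** With $X=-\mathrm{Re}\,z$ and $y=|\mathrm{Im}\,z|$ the cubic part is $X(X^2/3-y^2)$. In the cone
    $X$ is comparable to $y$ and below $\sqrt3\,y$, so this is at most a negative multiple of $y^3$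
    once $y$ is large, and beats every quadratic term. *)
Lemma airy_bound e C (A : R) : 0 < e -> 0 <= C -> 0 <= A ->
  exists K : R, forall u z, cpt (1/2) (3/2) e C u z ->
    Re (- (3^-1)%:C * z ^+ 3) + A * nrm z ^+ 2 <= K - u ^+ 2.
Proof.
move=> e0 C0 A0.
(* The extra $2/e^2$ pays for $u^2\le\frac2{e^2}(y^2+C^2)$, so that the final bound contains
   $-u^2$. *)
pose A1 := A + 2 / e ^+ 2.
have e2 : 0 < e ^+ 2 by rewrite exprn_gt0.
have A10 : 0 <= A1 by rewrite addr_ge0// divr_ge0// ltW.
(* Beyond [Y1] the error $C$ is below $y/20$, so $\frac9{20}y\le X\le\frac{31}{20}y$; and
   $A_1(X^2+y^2)\le4A_1y^2\le\frac4{50}y^3$, just below the cubic gain $\frac{171}{2000}y^3$. *)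
pose Y1 := 20 * C + 50 * A1.
have Y10 : 0 <= Y1 by rewrite /Y1; lra.
pose M := 3/2 * Y1 + 2 * C.
have M0 : 0 <= M by rewrite /M; lra.
have YM : Y1 <= M by rewrite /M; lra.
exists (2 * M ^+ 3 + 2 * A1 * M ^+ 2 + 2 / e ^+ 2 * C ^+ 2) => u z hz.
have [YC yl] := cpt_facts e0 C0 hz; move: hz => [z1 z2 z3].
set Y := sgn u * Im z in YC z1 z2 z3; pose y := `|Im z|; pose X := - Re z.
have yY : `|Y| = y by rewrite sgnM_norm.
have y0 : 0 <= y by exact: normr_ge0.
have Yy : Y <= y by rewrite -yY ler_norm.
have ysq : Im z ^+ 2 = y ^+ 2 by rewrite /y real_normK// num_real.
have -> : Re (- (3^-1)%:C * z ^+ 3) = X ^+ 3 / 3 - X * y ^+ 2.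
  by rewrite -ysq !exprS expr0 !ReImE /X; field.
rewrite nrm_sqr ysq -[Re z ^+ 2]sqrrN -/X.
rewrite -/X in z2 z3.
have h6 := sqr_lower e0 C0 y0 yl.
have h7 : u ^+ 2 <= 2 / e ^+ 2 * (y ^+ 2 + C ^+ 2).
  have : 2 / e ^+ 2 * (e ^+ 2 / 2 * u ^+ 2 - C ^+ 2) <= 2 / e ^+ 2 * y ^+ 2.
    by rewrite ler_wpM2l// divr_ge0// ltW.
  have -> : 2 / e ^+ 2 * (e ^+ 2 / 2 * u ^+ 2 - C ^+ 2) = u ^+ 2 - 2 / e ^+ 2 * C ^+ 2.
    by field; rewrite gt_eqF.
  by rewrite mulrDr; lra.
suff h : X ^+ 3 / 3 - X * y ^+ 2 + A1 * (X ^+ 2 + y ^+ 2) <= 2 * M ^+ 3 + 2 * A1 * M ^+ 2.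
  have ee : 0 <= 2 / e ^+ 2 by rewrite divr_ge0// ltW.
  have := mulr_ge0 ee (sqr_ge0 X); rewrite /A1 in h *; nra.
have X0 : 0 <= X ^+ 2 by exact: sqr_ge0.
have y20 : 0 <= y ^+ 2 by exact: sqr_ge0.
have [yl1|yg] := leP y Y1.
  have XM : `|X| <= M by rewrite ler_norml; apply/andP; split; rewrite /M; lra.
  have X2 : X ^+ 2 <= M ^+ 2.
    by rewrite -(real_normK (num_real X)) ler_pXn2r// ?nnegrE.
  have y2 : y ^+ 2 <= M ^+ 2 by rewrite ler_pXn2r// ?nnegrE//; lra.
  have X3 : X ^+ 3 <= M ^+ 3.
    rewrite (le_trans (ler_norm _))// normrX ler_pXn2r// nnegrE.
  have Xy : - X * y ^+ 2 <= M ^+ 3.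
    rewrite (_ : M ^+ 3 = M * M ^+ 2); last by rewrite -exprS.
    rewrite (le_trans (ler_norm _))// normrM normrN ler_pM// ger0_norm//.
  have M3 : 0 <= M ^+ 3 by rewrite exprn_ge0.
  have a1 : A1 * (X ^+ 2 + y ^+ 2) <= A1 * (2 * M ^+ 2) by rewrite ler_wpM2l//; lra.
  by lra.
have Yp : Y = y.
  have [Y0|Y0] := leP 0 Y; first by rewrite -yY ger0_norm.
  have : y <= C by rewrite -yY ltr0_norm//; lra.
  by rewrite /Y1 in yg; lra.
rewrite Yp in z2 z3.
have Xl : 9/20 * y <= X by rewrite /Y1 in yg; lra.
have Xu : X <= 31/20 * y by rewrite /Y1 in yg; lra.
have Xp : 0 <= X by lra.
have X2 : X ^+ 2 <= (31/20) ^+ 2 * y ^+ 2 by rewrite -exprMn ler_pXn2r// ?nnegrE; lra.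
have c1 : X * (X ^+ 2 / 3 - y ^+ 2) <= X * (- (19/100) * y ^+ 2).
  rewrite ler_wpM2l//; move: X2; rewrite expr2 => X2; lra.
have c2 : X * (- (19/100) * y ^+ 2) <= 9/20 * y * (- (19/100) * y ^+ 2).
  by rewrite ler_wnM2r// mulNr oppr_le0 mulr_ge0.
have c3 : A1 * (X ^+ 2 + y ^+ 2) <= A1 * (4 * y ^+ 2).
  by rewrite ler_wpM2l//; move: X2; rewrite expr2 => X2; lra.
have c4 : 50 * A1 * y ^+ 2 <= y * y ^+ 2.
  by rewrite ler_wpM2r//; rewrite /Y1 in yg; lra.
have c5 : 0 <= 2 * M ^+ 3 + 2 * A1 * M ^+ 2.
  by rewrite addr_ge0 ?mulr_ge0// exprn_ge0.
have e3 : X ^+ 3 / 3 - X * y ^+ 2 = X * (X ^+ 2 / 3 - y ^+ 2) by field.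
have A1y : 0 <= A1 * y ^+ 2 by rewrite mulr_ge0.
have : 9/20 * y * (- (19/100) * y ^+ 2) = - (171/2000) * (y * y ^+ 2) by field.
rewrite e3; rewrite -mulrA in c4; lra.
Qed.

End ContourGeometry.

(** * Asymptotics of contours deduced from their velocities *)

Section IsContour.
Context {R : realType}.
Local Notation leb := (@lebesgue_measure R).
Local Notation RR := (measurableTypeR R).
Implicit Types (gam v : R -> R[i]).

Lemma locally_bounded_itv (f : R -> R) (a b : R) :
  (forall t : R, exists M : R, \forall x \near t, `|f x| <= M) ->
  exists M, forall x, a <= x <= b -> `|f x| <= M.
Proof.
move=> lf.
have /compact_near_coveringP cov := @segment_compact R a b.
have [] := cov R (+oo)%R (fun M x => `|f x| <= M) _.
  move=> x _; have [M hM] := lf x.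
  exists ([set y | `|f y| <= M], [set m : R | M <= m]).
    by split; [exact: hM|exact: (nbhs_pinfty_ge (num_real M))].
  by move=> [y m] /= [h1 h2]; exact: le_trans h1 h2.
move=> M0 [_ hM]; exists (M0 + 1) => x xab.
apply: (hM (M0 + 1)); first by rewrite ltrDl.
by rewrite /= in_itv.
Qed.

Lemma cvg_bounded (T : Type) (F : set_system T) (FF : Filter F) (f : T -> R) (l : R) :
  f x @[x --> F] --> l -> \forall x \near F, `|f x| <= `|l| + 1.
Proof.
move=> /cvgrPdist_le /(_ 1 ltr01).
apply: filterS => x h; rewrite -lerBlDl (le_trans (lerB_dist _ _))//.
by rewrite distrC.
Qed.

(** The derivative is locally bounded everywhere, at corners because of the one-sided limits;
    compactness bounds it in the middle and the limits at infinity bound it at the ends. *)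
Lemma pC1_bounded (f : R -> R) (l1 l2 : R) : piecewise_C1 f ->
  derive1 f x @[x --> +oo] --> l1 -> derive1 f x @[x --> -oo] --> l2 ->
  exists M, forall t, `|derive1 f t| <= M.
Proof.
move=> [_ [s [h1 h2]]] /cvg_bounded [T1 [_ b1]] /cvg_bounded [T2 [_ b2]].
have lb (t : R) : exists M : R, \forall x \near t, `|derive1 f x| <= M.
  have [ts|ts] := boolP (t \in s).
    have [/cvg_ex [l /cvg_bounded c1] /cvg_ex [r /cvg_bounded c2]] := h2 t ts.
    exists (Num.max (Num.max (`|l| + 1) (`|r| + 1)) `|derive1 f t|).
    have n1 := c1; rewrite /at_left near_withinE in n1.
    have n2 := c2; rewrite /at_right near_withinE in n2.
    near=> x; rewrite !le_max.
    have [xt|tx|->] := ltgtP x t.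
    - by rewrite (near n1 x).
    - by rewrite (near n2 x) ?orbT.
    - by rewrite lexx !orbT.
  have [_ /cvg_bounded c] := h1 t ts.
  by exists (`|derive1 f t| + 1).
have [M hM] := locally_bounded_itv (T2 - 1) (T1 + 1) lb.
exists (Num.max M (Num.max (`|l1| + 1) (`|l2| + 1))) => t; rewrite !le_max.
have [t1|t1] := ltP T1 t; first by rewrite (b1 _ t1) orbT.
have [t2|t2] := ltP t T2; first by rewrite (b2 _ t2) !orbT.
by rewrite hM//; apply/andP; split; lra.
Unshelve. all: by end_near. Qed.

Lemma measurable_fun_fin (s : seq R) (f : R -> R) :
  {in [predC s], continuous f} -> measurable_fun [set: RR] f.
Proof.
move=> cf; pose S : set R := [set` s].
have cS : closed S by apply: (compact_closed (@Rhausdorff R)); apply: finite_compact; exact: finite_seq.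
have oS : open (~` S) by exact: closed_openC.
have mS : measurable (S : set RR) by exact: closed_measurable.
rewrite (_ : setT = S `|` ~` S); last by rewrite setUv.
apply/measurable_funU => //; first exact: measurableC.
split; last first.
  apply: open_continuous_measurable_fun => //.
  by move=> x; rewrite inE /= => /negP xs; apply: cf; rewrite inE.
move=> _ Y mY.
have : finite_set (S `&` f @^-1` Y).
  by apply: (@sub_finite_set _ _ S) => //; exact: finite_seq.
move=> /finite_compact h; apply: closed_measurable.
exact: compact_closed (@Rhausdorff R) h.
Qed.

Lemma pC1_meas (f : R -> R) : piecewise_C1 f -> measurable_fun [set: RR] (derive1 f).
Proof.
move=> [_ [s [h1 h2]]]; apply: (@measurable_fun_fin s) => x xs.
by have [] := h1 x xs.
Qed.

(* Asymptotic directions of the velocity: (c, s) at +oo and (-c, s) at -oo. *)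
Record vlim gam v (c s : R) : Prop := Vlim {
  vlim_adm : adm gam v;
  vlim_rp : Re (v t) @[t --> +oo] --> c;
  vlim_ip : Im (v t) @[t --> +oo] --> s;
  vlim_rn : Re (v t) @[t --> -oo] --> - c;
  vlim_in : Im (v t) @[t --> -oo] --> s }.

Lemma is_contour_vlim theta gam : is_contour theta gam ->
  vlim gam (velocity gam) (cos theta) (sin theta).
Proof.
move=> [[p1 p2] r1 i1 r2 i2]; split => //.
have [M1 hM1] := pC1_bounded p1 r1 r2.
have [M2 hM2] := pC1_bounded p2 i1 i2.
have m1 := pC1_meas p1; have m2 := pC1_meas p2.
move: p1 p2 => [c1 [s1 [h1 _]]] [c2 [s2 [h2 _]]].
split.
- by move=> t; split; [exact: c1|exact: c2].
- exists (s1 ++ s2) => t; rewrite mem_cat negb_or => /andP[t1 t2].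
  have [d1 k1] := h1 t t1; have [d2 k2] := h2 t t2.
  split; last by split; [exact: k1|exact: k2].
  split.
    by have := derivableP d1; rewrite /velocity /= derive1E.
  by have := derivableP d2; rewrite /velocity /= derive1E.
- by split.
- exists (M1 + M2); split.
    by rewrite addr_ge0// (le_trans _ (hM1 0), le_trans _ (hM2 0)).
  by move=> u; apply: (le_trans (nrm_le_ReIm _)); apply: lerD; [exact: hM1|exact: hM2].
Qed.

Lemma adm_lin_deriv gam v (s : seq R) (a b : R) t :
  cder gam t (v t) ->
  is_derive t 1 (fun u => a * Re (gam u) + b * Im (gam u)) (a * Re (v t) + b * Im (v t)).
Proof.
move=> [d1 d2].
have := is_deriveD (is_deriveM' (is_derive_cst a t 1) d1) (is_deriveM' (is_derive_cst b t 1) d2).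
by move/is_derive_eq; apply; rewrite /= !mul0r !add0r.
Qed.

Lemma adm_lin_cont gam v (a b : R) t : adm gam v ->
  {for t, continuous (fun u => a * Re (gam u) + b * Im (gam u))}.
Proof.
move=> /adm_cont /(_ t) [c1 c2].
by apply: cvgD; apply: cvgM => //; exact: cvg_cst.
Qed.

Lemma ray_lower (F F' : R -> R) (s : seq R) (e T : R) :
  (forall x, {for x, continuous F}) ->
  (forall x, x \notin s -> is_derive x 1 F (F' x)) ->
  (forall x, T <= x -> e <= F' x) ->
  forall x, T <= x -> F T + e * (x - T) <= F x.
Proof.
move=> cF dF eF x Tx.
have := @ndecr_fin R s (fun x => F x - e * x) T x Tx.
have -> : (F T - e * T <= F x - e * x) = (F T + e * (x - T) <= F x).
  by apply/idP/idP; lra.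
apply.
  move=> y _; apply: cvgB; first exact: cF.
  by apply: cvgM; [exact: cvg_cst|exact: cvg_id].
move=> y /andP[Ty _] ys; have d := dF y ys.
have h : is_derive y 1 (fun x => F x - e * x) (F' y - e).
  have := is_deriveB d (is_deriveM' (is_derive_cst e y 1) (is_derive_id y 1)).
  by move/is_derive_eq; apply; rewrite /= mul0r add0r mulr1.
split; first exact: ex_derive.
by rewrite derive1E derive_val subr_ge0 eF// ltW.
Qed.

(** A lower bound on the limiting slope of a real linear functional integrates to a lower bound on
    the functional. The factor [sgn u] treats both ends alike, because the limiting velocities are
    $(c,s)$ and $(-c,s)$. *)
Lemma vlim_lin gam v (c s a b e : R) : vlim gam v c s -> e < a * c + b * s ->
  exists C, 0 <= C /\ forall u, e * `|u| - C <= a * Re (gam u) + b * (sgn u * Im (gam u)).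
Proof.
move=> [ag r1 i1 r2 i2] es.
have [sq hs] := adm_der ag.
pose Fp u := a * Re (gam u) + b * Im (gam u).
pose Fn u := - a * Re (gam (- u)) + b * Im (gam (- u)).
have cp : a * Re (v t) + b * Im (v t) @[t --> +oo] --> a * c + b * s.
  by apply: cvgD; apply: cvgM => //; exact: cvg_cst.
have cn : a * Re (v t) + - b * Im (v t) @[t --> -oo] --> - (a * c + b * s).
  rewrite opprD -mulrN -mulNr.
  by apply: cvgD; apply: cvgM => //; exact: cvg_cst.
have [T1 [_ h1]] := cvgr_gt _ cp _ es.
have es' : - (a * c + b * s) < - e by rewrite ltrN2.
have [T2 [_ h2]] := cvgr_lt _ cn _ es'.
pose T := Num.max 0 (Num.max (T1 + 1) (1 - T2)).
have T0 : 0 <= T by rewrite /T le_max lexx.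
have TT1 : T1 + 1 <= T by rewrite /T !le_max lexx !orbT.
have TT2 : 1 - T2 <= T by rewrite /T !le_max lexx !orbT.
have g1 u : T <= u -> a * Re (gam T) + b * Im (gam T) + e * (u - T)
     <= a * Re (gam u) + b * Im (gam u).
  apply: (@ray_lower (fun u => a * Re (gam u) + b * Im (gam u))
     (fun u => a * Re (v u) + b * Im (v u)) sq).
  - by move=> x; exact: adm_lin_cont ag.
  - by move=> x /hs[d _]; apply: adm_lin_deriv.
  - by move=> x Tx; apply: ltW; apply: h1; lra.
have g2 u : T <= u -> a * Re (gam (- T)) + - b * Im (gam (- T)) + e * (u - T)
     <= a * Re (gam (- u)) + - b * Im (gam (- u)).
  pose G u := a * Re (gam u) + - b * Im (gam u).
  apply: (@ray_lower (fun u => G (- u))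
     (fun u => - (a * Re (v (- u)) + - b * Im (v (- u)))) (map -%R sq)).
  - move=> x; apply: (@continuous_comp _ _ _ -%R G); first exact: opp_continuous.
    exact: adm_lin_cont ag.
  - move=> x xs; have xs' : - x \notin sq.
      by apply: contra xs => xs; apply/mapP; exists (- x); rewrite ?opprK.
    have [d _] := hs _ xs'.
    have := is_derive_compr (adm_lin_deriv sq a (- b) d) (is_deriveNid x 1).
    by move/is_derive_eq; apply; rewrite mulrN1.
  - move=> x Tx; rewrite lerNr; apply: ltW; apply: h2; lra.
have [M hM] : exists M, forall x, - T <= x <= T -> `|nrm (gam x)| <= M.
  apply: locally_bounded_itv => t; have [C [C0 hC]] := adm_growth ag.
  exists (C * (1 + (`|t| + 1))).
  have h : \forall x \near t, `|x| <= `|t| + 1.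
    by apply: (@cvg_bounded _ (nbhs t) _ id); exact: cvg_id.
  apply: filterS h => x hx.
  by rewrite ger0_norm ?nrm_ge0// (le_trans (hC x))// ler_wpM2l// lerD2l.
have M0 : 0 <= M by apply: le_trans (hM 0 _); rewrite ?normr_ge0// oppr_le0 T0.
have Mb x a' b' : - T <= x <= T -> `|a' * Re (gam x) + b' * Im (gam x)| <= (`|a'| + `|b'|) * M.
  move=> /hM; rewrite ger0_norm ?nrm_ge0// => h.
  rewrite (le_trans (ler_normD _ _))// mulrDl !normrM lerD// ler_wpM2l//.
    by rewrite (le_trans (Re_le_nrm _)).
  by rewrite (le_trans (Im_le_nrm _)).
pose Q := (`|a| + `|b|) * M.
have Q0 : 0 <= Q by rewrite mulr_ge0// addr_ge0.
have eT : e * T <= `|e| * T by rewrite ler_wpM2r// ler_norm.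
have eT0 : 0 <= `|e| * T by rewrite mulr_ge0.
exists (Q + `|e| * T); split; first by rewrite addr_ge0.
move=> u; rewrite /sgn; case: ifPn => [u0|]; last rewrite -ltNge => u0.
  rewrite mul1r ger0_norm//.
  have [uT|Tu] := leP u T.
    have := Mb u a b; rewrite uT (le_trans _ u0) ?oppr_le0// => /(_ isT).
    rewrite ler_norml => /andP[]; rewrite -/Q => h3 _.
    have : e * u <= `|e| * T.
      rewrite (@le_trans _ _ (`|e| * u))//; first by rewrite ler_wpM2r ?ler_norm.
      by rewrite ler_wpM2l.
    lra.
  have := Mb T a b; rewrite lexx ge0_cp// => /(_ isT).
  rewrite ler_norml => /andP[]; rewrite -/Q => h3 _.
  have := g1 u (ltW Tu); rewrite mulrBr; lra.
rewrite mulN1r mulrN -mulNr ltr0_norm//.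
have [uT|Tu] := leP (- T) u.
  have := Mb u a (- b); rewrite uT (le_trans (ltW u0))// => /(_ isT).
  rewrite ler_norml normrN => /andP[]; rewrite -/Q => h3 _.
  have : e * - u <= `|e| * T.
    rewrite (@le_trans _ _ (`|e| * - u))//.
      by rewrite ler_wpM2r ?ler_norm// oppr_ge0 ltW.
    by rewrite ler_wpM2l//; lra.
  lra.
have := Mb (- T) a (- b); rewrite lexx ge0_cp// => /(_ isT).
rewrite ler_norml normrN => /andP[]; rewrite -/Q => h3 _.
have := g2 (- u); rewrite opprK mulrBr => h4.
have : T <= - u by lra.
move/h4; lra.
Qed.

Lemma vlim_refl gam v c s : vlim gam v c s ->
  vlim (fun u => - gam (- u)) (fun u => v (- u)) (- c) s.
Proof.
move=> [[cg [sq ds] mv [V hV]] r1 i1 r2 i2].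
have mo : measurable_fun [set: RR] (-%R : RR -> RR) by exact: oppr_measurable.
have cvN (f : R -> R) (l : R) : f t @[t --> -oo] --> l -> f (- t) @[t --> +oo] --> l.
  by move=> h; apply/cvgNy_compNP.
have cvP (f : R -> R) (l : R) : f t @[t --> +oo] --> l -> f (- t) @[t --> -oo] --> l.
  by move=> h; apply/cvgy_compNP.
have ccN (f : R -> R[i]) t : ccontat f (- t) -> ccontat (fun u => f (- u)) t.
  move=> [k1 k2]; split.
    by apply: (@continuous_comp _ _ _ -%R (fun u => Re (f u))) => //; exact: opp_continuous.
  by apply: (@continuous_comp _ _ _ -%R (fun u => Im (f u))) => //; exact: opp_continuous.
split; last 4 first.
- exact: (cvN (fun t => Re (v t))).
- exact: (cvN (fun t => Im (v t))).
- by rewrite opprK; exact: (cvP (fun t => Re (v t))).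
- exact: (cvP (fun t => Im (v t))).
split.
- by move=> t; apply: ccontatN; apply: ccN.
- exists (map -%R sq) => x xs.
  have xs' : - x \notin sq.
    by apply: contra xs => xs; apply/mapP; exists (- x); rewrite ?opprK.
  have [[d1 d2] k] := ds _ xs'; split; last exact: ccN.
  split; under eq_fun do rewrite ReImE.
    have := is_deriveN (is_derive_compr d1 (is_deriveNid x 1)).
    by move/is_derive_eq; apply; rewrite mulrN1 opprK.
  have := is_deriveN (is_derive_compr d2 (is_deriveNid x 1)).
  by move/is_derive_eq; apply; rewrite mulrN1 opprK.
- exact: (cmeas_comp mv mo).
- by exists V; split; [exact: hV.1|move=> u; exact: hV.2].
Qed.

(** The three conditions of [cone] are three linear functionals, each with a strict inequality
    between the limiting slopes. *)
Lemma vlim_cone gam v c s k1 k2 : vlim gam v c s -> 0 < s ->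
  k1 * s < - c -> - c < k2 * s ->
  exists e C, [/\ 0 < e, 0 <= C & cone k1 k2 e C gam].
Proof.
move=> vg s0 h1 h2.
have [C1 [C10 hC1]] := @vlim_lin _ _ _ _ 0 1 (s / 2) vg ltac:(lra).
have [C2 [C20 hC2]] := @vlim_lin _ _ _ _ (-1) (- k1) 0 vg ltac:(lra).
have [C3 [C30 hC3]] := @vlim_lin _ _ _ _ 1 k2 0 vg ltac:(lra).
exists (s / 2), (C1 + C2 + C3); split; [lra|lra|].
move=> u; have := hC1 u; have := hC2 u; have := hC3 u.
by rewrite !mul0r !sub0r add0r !mul1r !mulN1r => ? ? ?; split; lra.
Qed.

(** Since $c<0$ both ends run to the left, and on the remaining compact part the maximum of the real
    part is attained, hence negative. *)
Lemma vlim_neg gam v c s : vlim gam v c s -> c < 0 ->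
  (forall u, Re (gam u) < 0) -> exists del, 0 < del /\ forall u, Re (gam u) <= - del.
Proof.
move=> vg c0 hn.
have [C [C0 hC]] := @vlim_lin _ _ _ _ (-1) 0 (- c / 2) vg ltac:(lra).
pose T := (C + 1) / (- c / 2).
have cc : 0 < - c / 2 by lra.
have T0 : 0 <= T by rewrite divr_ge0//; lra.
have [||m mT hm] := @EVT_max R (fun u => Re (gam u)) (- T) T; first lra.
  by apply: continuous_subspaceT => t; have [] := adm_cont (vlim_adm vg) t.
exists (Num.min 1 (- Re (gam m))); split; first by rewrite lt_min ltr01 oppr_gt0 hn.
move=> u; rewrite lerNr ge_min.
have [uT|uT] := leP `|u| T.
  by apply/orP; right; rewrite lerN2; apply: hm; rewrite in_itv /= -ler_norml.
apply/orP; left; have := hC u; rewrite mul0r addr0 mulN1r.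
have : C + 1 <= - c / 2 * `|u|.
  by rewrite mulrC -ler_pdivrMr// ltW.
lra.
Qed.

End IsContour.

(** * Independence of the contour for Gaussian, Cauchy and Airy integrands *)

Section ExpContours.
Context {R : realType}.
Local Notation leb := (@lebesgue_measure R).
Local Notation RR := (measurableTypeR R).
Implicit Types (P Q : R[i] -> R[i]) (gam v : R -> R[i]).

Lemma lin2_gau (c K : R) : 0 < c -> 0 <= K ->
  exists K' c', [/\ 0 <= K', 0 < c' & forall u, K * (1 + `|u|) ^+ 2 * gau c u <= K' * gau c' u].
Proof.
move=> c0 K0; have [K1 [K10 h1]] := lin_gau c0 K0.
have c20 : 0 < c / 2 by rewrite divr_gt0.
have [K2 [K20 h2]] := lin_gau c20 K10.
exists K2, (c / 2 / 2); split => //; first by rewrite divr_gt0.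
move=> u; apply: le_trans (h2 u).
have u1 : 0 <= 1 + `|u| by rewrite addr_ge0.
have := ler_wpM2l u1 (h1 u).
by rewrite expr2; nra.
Qed.

(** Differentiation brings down $P'$, which grows quadratically in $u$; part of the Gaussian decay
    of $e^P$ absorbs it. *)
Lemma homotopy_exp P P' Q Q' (S : set R[i]) (g0 v0 g1 v1 : R -> R[i]) (K c D : R) :
  adm g0 v0 -> adm g1 v1 -> 0 < c -> 0 <= D ->
  chol S P P' -> chol S Q Q' -> ccs S P -> ccs S P' -> ccs S Q -> ccs S Q' ->
  cbor P -> cbor P' -> cbor Q -> cbor Q' ->
  (forall l u, in01 l -> S (lhom g0 g1 l u)) ->
  (forall l u, in01 l -> Re (P (lhom g0 g1 l u)) <= K - c * u ^+ 2) ->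
  (forall l u, in01 l -> nrm (P' (lhom g0 g1 l u)) <= D * (1 + `|u|) ^+ 2) ->
  (forall l u, in01 l -> nrm (Q (lhom g0 g1 l u)) <= D) ->
  (forall l u, in01 l -> nrm (Q' (lhom g0 g1 l u)) <= D) ->
  pint g0 v0 (fun z => cexp (P z) * Q z) = pint g1 v1 (fun z => cexp (P z) * Q z).
Proof.
move=> a0 a1 c0 D0 hP hQ kP kP' kQ kQ' bP bP' bQ bQ' hS PK P'D QD Q'D.
have E0 := expR_ge0 K.
have [K1 [c1 [K10 c10 hK]]] := @lin2_gau c (expR K * (D * D + D)) c0
  (mulr_ge0 E0 (addr_ge0 (mulr_ge0 D0 D0) D0)).
have ePK l u : in01 l -> nrm (cexp (P (lhom g0 g1 l u))) <= expR K * gau c u.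
  by move=> l1; rewrite nrm_cexp /gau -expRD ler_expR PK.
have u2 (u : R) : 1 <= (1 + `|u|) ^+ 2 by rewrite expr_ge1// ?addr_ge0// lerDl.
apply: (@homotopy R g0 v0 g1 v1 _
  (fun z => P' z * cexp (P z) * Q z + cexp (P z) * Q' z) S K1 c1) => //.
- move=> z t z' Sz dz.
  have := cderM (cder_cexp (hP z t z' Sz dz)) (hQ z t z' Sz dz).
  by move/cder_eq; apply; ring.
- by move=> z t Sz cz; apply: ccontatM; [apply: ccontat_cexp; exact: kP|exact: kQ].
- move=> z t Sz cz; apply: ccontatD; apply: ccontatM.
  + by apply: ccontatM; [exact: kP'|apply: ccontat_cexp; exact: kP].
  + exact: kQ.
  + by apply: ccontat_cexp; exact: kP.
  + exact: kQ'.
- by move=> d T f mf; apply: cmeasM; [apply: cmeas_cexp; exact: bP|exact: bQ].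
- move=> d T f mf; apply: cmeasD; apply: cmeasM.
  + by apply: cmeasM; [exact: bP'|apply: cmeas_cexp; exact: bP].
  + exact: bQ.
  + by apply: cmeas_cexp; exact: bP.
  + exact: bQ'.
- move=> l u l1; rewrite (le_trans _ (hK u))// nrmM.
  apply: (@le_trans _ _ (expR K * gau c u * D)); first by rewrite ler_pM ?nrm_ge0 ?ePK ?QD.
  have g0' := gau_ge0 c u.
  have h1 : D <= (D * D + D) * (1 + `|u|) ^+ 2.
    by have := u2 u; have := mulr_ge0 D0 D0; nra.
  have h2 : 0 <= expR K * gau c u by rewrite mulr_ge0.
  by have := ler_wpM2l h2 h1; nra.
- move=> l u l1; rewrite (le_trans _ (hK u))// (le_trans (nrmD _ _))//.
  rewrite (nrmM (P' _ * _)) (nrmM (P' _)) (nrmM _ (Q' _)).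
  have h2 : 0 <= expR K * gau c u by rewrite mulr_ge0// gau_ge0.
  apply: (@le_trans _ _ (D * (1 + `|u|) ^+ 2 * (expR K * gau c u) * D
     + expR K * gau c u * D)).
    by rewrite lerD// !ler_pM ?mulr_ge0 ?nrm_ge0 ?ePK ?QD ?Q'D ?P'D.
  have h3 : (1 + `|u|) ^+ 2 * D * D + D <= (D * D + D) * (1 + `|u|) ^+ 2.
    by have := u2 u; nra.
  by have := ler_wpM2l h2 h3; nra.
Qed.

Definition cubic (a b c : R[i]) (z : R[i]) := a * z ^+ 3 + b * z ^+ 2 + c * z.

Lemma chol_cubic a b c : chol setT (cubic a b c)
  (fun z => 3%:R%:C * a * z ^+ 2 + 2%:R%:C * b * z + c).
Proof.
move=> z t z' _ dz.
have d2 := cderM dz dz; have d3 := cderM dz d2.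
rewrite (_ : (fun u => _) = (fun u => a * (z u * (z u * z u)) + b * (z u * z u) + c * z u)).
  have := cderD (cderD (cderM (cder_cst a t) d3) (cderM (cder_cst b t) d2))
    (cderM (cder_cst c t) dz).
  by move/cder_eq; apply; rewrite !rmorph_nat; ring.
by apply/funext => u; rewrite /cubic; ring.
Qed.

Lemma ccs_cubic S a b c : ccs S (cubic a b c).
Proof.
move=> z t _ cz; apply: ccontatD; [apply: ccontatD|]; apply: ccontatM;
  try exact: ccontat_cst; by [exact: ccontatX|].
Qed.

Lemma ccs_dcubic S (a b c : R[i]) : ccs S (fun z => 3%:R%:C * a * z ^+ 2 + 2%:R%:C * b * z + c).
Proof.
move=> z t _ cz; apply: ccontatD; [apply: ccontatD|]; first apply: ccontatM.
- exact: ccontat_cst.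
- exact: ccontatX.
- by apply: ccontatM => //; exact: ccontat_cst.
- exact: ccontat_cst.
Qed.

Lemma cbor_cubic a b c : cbor (cubic a b c).
Proof.
move=> d T f mf; apply: cmeasD; [apply: cmeasD|]; apply: cmeasM;
  try exact: cmeas_cst; by [exact: cmeasX|].
Qed.

Lemma cbor_dcubic (a b c : R[i]) : cbor (fun z => 3%:R%:C * a * z ^+ 2 + 2%:R%:C * b * z + c).
Proof.
move=> d T f mf; apply: cmeasD; [apply: cmeasD|]; first apply: cmeasM.
- exact: cmeas_cst.
- exact: cmeasX.
- by apply: cmeasM => //; exact: cmeas_cst.
- exact: cmeas_cst.
Qed.

Lemma chol_sub S S' g g' : S `<=` S' -> @chol R S' g g' -> chol S g g'.
Proof. by move=> SS h z t z' Sz; apply: h; exact: SS. Qed.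

Lemma lhom_growth (g0 v0 g1 v1 : R -> R[i]) : adm g0 v0 -> adm g1 v1 ->
  exists C, 0 <= C /\ forall l u, in01 l -> nrm (lhom g0 g1 l u) <= C * (1 + `|u|).
Proof.
move=> a0 a1; have [C0 [C00 h0]] := adm_growth a0; have [C1 [C10 h1]] := adm_growth a1.
exists (C0 + (C0 + C1)); split; first by rewrite !addr_ge0.
move=> l u /andP[l0 l1]; rewrite mulrDl (le_trans (nrmD _ _))// lerD//.
rewrite nrmM nrmC ger0_norm// (@le_trans _ _ (nrm (g1 u - g0 u)))//.
  by rewrite ler_piMl// nrm_ge0.
by rewrite (le_trans (nrmB _ _))// mulrDl addrC lerD.
Qed.

Lemma dcubic_growth (a b c : R[i]) (C : R) : 0 <= C -> exists D, 0 <= D /\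
  forall z (u : R), nrm z <= C * (1 + `|u|) ->
  nrm (3%:R%:C * a * z ^+ 2 + 2%:R%:C * b * z + c) <= D * (1 + `|u|) ^+ 2.
Proof.
move=> C0; exists (3 * nrm a * C ^+ 2 + 2 * nrm b * C + nrm c).
have na := nrm_ge0 a; have nb := nrm_ge0 b; have nc := nrm_ge0 c.
split; first by rewrite !addr_ge0 ?mulr_ge0// exprn_ge0.
move=> z u hz; have nz := nrm_ge0 z.
have u1 : 1 <= 1 + `|u| by rewrite lerDl.
have u0 : 0 <= 1 + `|u| by lra.
have u2 : 1 + `|u| <= (1 + `|u|) ^+ 2 by rewrite expr2 ler_peMr.
have z2 : nrm z ^+ 2 <= C ^+ 2 * (1 + `|u|) ^+ 2 by rewrite -exprMn ler_pXn2r// nnegrE mulr_ge0.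
rewrite (le_trans (nrmD _ _))// (le_trans (lerD (nrmD _ _) (lexx _)))//.
rewrite (nrmM _ (z ^+ 2)) (nrmM _ z) (nrmM _ a) (nrmM _ b) (nrmX z 2).
rewrite !nrmC !normr_nat.
have h1 : nrm a * nrm z ^+ 2 <= nrm a * (C ^+ 2 * (1 + `|u|) ^+ 2) by rewrite ler_wpM2l.
have h2 : nrm b * nrm z <= nrm b * (C * (1 + `|u|) ^+ 2).
  by rewrite ler_wpM2l// (le_trans hz)// ler_wpM2l.
have h3 : nrm c <= nrm c * (1 + `|u|) ^+ 2 by rewrite ler_peMr// (le_trans u1).
by move: h1 h2 h3; set w := (1 + `|u|) ^+ 2 => h1 h2 h3; lra.
Qed.

(* e^{t z^2 + b z} is integrable along contours asymptotic to directions at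
   angle less than arctan (4/5) with the imaginary axis. *)
Record gcontour gam v : Prop := Gcontour {
  gc_adm : adm gam v;
  gc_cone : exists e C, [/\ 0 < e, 0 <= C & cone (-(4/5)) (4/5) e C gam] }.

Lemma two_cones k1 k2 (g0 g1 : R -> R[i]) :
  (exists e C, [/\ 0 < e, 0 <= C & cone k1 k2 e C g0]) ->
  (exists e C, [/\ 0 < e, 0 <= C & cone k1 k2 e C g1]) ->
  exists e C, [/\ 0 < e, 0 <= C & forall l u, in01 l -> cpt k1 k2 e C u (lhom g0 g1 l u)].
Proof.
move=> [e0 [C0 [e00 C00 h0]]] [e1 [C1 [e10 C10 h1]]].
exists (Num.min e0 e1), (Num.max C0 C1); split.
- by rewrite lt_min e00.
- by rewrite le_max C00.
- move=> l u l1; apply: cpt_conv => //.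
    by apply: cpt_weak (h0 u); rewrite ?ge_min ?le_max lexx.
  by apply: cpt_weak (h1 u); rewrite ?ge_min ?le_max lexx orbT.
Qed.

Definition gexp (t : R) (b : R[i]) (z : R[i]) := cexp (t%:C * z ^+ 2 + b * z).

Lemma gexpE t b z : gexp t b z = cexp (cubic 0 t%:C b z).
Proof. by rewrite /gexp /cubic mul0r add0r. Qed.

Lemma gauss_move (g0 v0 g1 v1 : R -> R[i]) (t : R) b : 0 < t ->
  gcontour g0 v0 -> gcontour g1 v1 -> pint g0 v0 (gexp t b) = pint g1 v1 (gexp t b).
Proof.
move=> t0 [a0 h0] [a1 h1].
have [e [C [e0 C0 hc]]] := two_cones h0 h1.
have [K [c [c0 hK]]] := gauss_bound e0 C0 t0 (nrm_ge0 b).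
have [C1 [C10 hC1]] := lhom_growth a0 a1.
have [D [D0 hD]] := dcubic_growth 0 t%:C b C10.
have D1 : 0 <= D + 1 by rewrite addr_ge0.
have := @homotopy_exp (cubic 0 t%:C b) _ (fun=> 1) (fun=> 0) setT g0 v0 g1 v1 K c (D + 1)
  a0 a1 c0 D1 (@chol_cubic _ _ _).
have -> : (fun z => cexp (cubic 0 t%:C b z) * 1) = gexp t b.
  by apply/funext => z; rewrite mulr1 gexpE.
apply.
- by move=> z s z' _ _; rewrite mul0r; exact: cder_cst.
- exact: ccs_cubic.
- exact: ccs_dcubic.
- by move=> z s _ _; exact: ccontat_cst.
- by move=> z s _ _; exact: ccontat_cst.
- exact: cbor_cubic.
- exact: cbor_dcubic.
- by move=> d T f _; exact: cmeas_cst.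
- by move=> d T f _; exact: cmeas_cst.
- by [].
- move=> l u l1; rewrite /cubic mul0r add0r; apply: hK => //; exact: hc.
- move=> l u l1; rewrite (le_trans (hD _ u (hC1 _ _ l1)))// ler_wpM2r ?sqr_ge0//.
  by rewrite lerDl.
- by move=> l u _; rewrite nrm1 lerDr.
- by move=> l u _; rewrite nrm0.
Qed.

Lemma pole_move (g0 v0 g1 v1 : R -> R[i]) (t : R) b w (d : R) : 0 < t -> 0 < d ->
  gcontour g0 v0 -> gcontour g1 v1 ->
  (forall l u, in01 l -> d <= nrm (lhom g0 g1 l u - w)) ->
  pint g0 v0 (fun z => gexp t b z / (z - w)) = pint g1 v1 (fun z => gexp t b z / (z - w)).
Proof.
move=> t0 d0 [a0 h0] [a1 h1] hw.
have [e [C [e0 C0 hc]]] := two_cones h0 h1.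
have [K [c [c0 hK]]] := gauss_bound e0 C0 t0 (nrm_ge0 b).
have [C1 [C10 hC1]] := lhom_growth a0 a1.
have [D [D0 hD]] := dcubic_growth 0 t%:C b C10.
have di : 0 <= d^-1 by rewrite invr_ge0 ltW.
have D1 : 0 <= D + d^-1 + d^-1 ^+ 2 by rewrite !addr_ge0// exprn_ge0.
pose S := [set z | z != w].
have Sw z : S z -> z - w != 0 by rewrite /S /= subr_eq0.
have dn x : d <= nrm x -> x != 0 /\ (nrm x)^-1 <= d^-1.
  move=> dx; have x0 : 0 < nrm x by exact: lt_le_trans dx.
  split; first by apply: contraTneq x0 => ->; rewrite nrm0 ltxx.
  by rewrite lef_pV2.
have := @homotopy_exp (cubic 0 t%:C b) _ (fun z => (z - w)^-1) (fun z => - (z - w)^-1 ^+ 2)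
  S g0 v0 g1 v1 K c (D + d^-1 + d^-1 ^+ 2) a0 a1 c0 D1
  (chol_sub (@subsetT _ _) (@chol_cubic _ _ _)).
have E : (fun z => cexp (cubic 0 t%:C b z) / (z - w)) = (fun z => gexp t b z / (z - w)).
  by apply/funext => z; rewrite gexpE.
rewrite E; apply.
- move=> z s z' Sz dz.
  have := cderV (Sw _ Sz) (cderB dz (cder_cst w s)).
  by move/cder_eq; apply; rewrite subr0 exprVn; ring.
- exact: ccs_cubic.
- exact: ccs_dcubic.
- move=> z s Sz cz; apply: ccontatV; first exact: Sw.
  by apply: ccontatB => //; exact: ccontat_cst.
- move=> z s Sz cz; apply: ccontatN; apply: ccontatX; apply: ccontatV; first exact: Sw.
  by apply: ccontatB => //; exact: ccontat_cst.
- exact: cbor_cubic.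
- exact: cbor_dcubic.
- by move=> d' T f mf; apply: cmeasV; apply: cmeasB => //; exact: cmeas_cst.
- move=> d' T f mf; apply: cmeasN; apply: cmeasX.
  by apply: cmeasV; apply: cmeasB => //; exact: cmeas_cst.
- move=> l u l1; rewrite /S /=; have [] := dn _ (hw l u l1).
  by rewrite subr_eq0.
- move=> l u l1; rewrite /cubic mul0r add0r; apply: hK => //; exact: hc.
- move=> l u l1; rewrite (le_trans (hD _ u (hC1 _ _ l1)))// ler_wpM2r ?sqr_ge0//.
  by rewrite -addrA lerDl addr_ge0// exprn_ge0.
- move=> l u l1; rewrite nrmV; have [_ h] := dn _ (hw l u l1).
  by rewrite (le_trans h)// addrAC lerDr addr_ge0// exprn_ge0.
- move=> l u l1; rewrite nrmN nrmX nrmV; have [h' h] := dn _ (hw l u l1).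
  rewrite (@le_trans _ _ (d^-1 ^+ 2))//; last by rewrite lerDr addr_ge0.
  by rewrite ler_pXn2r// nnegrE invr_ge0 nrm_ge0.
Qed.

Lemma airy_move (g0 v0 g1 v1 : R -> R[i]) (x y : R) :
  adm g0 v0 -> adm g1 v1 ->
  (exists e C, [/\ 0 < e, 0 <= C & cone (1/2) (3/2) e C g0]) ->
  (exists e C, [/\ 0 < e, 0 <= C & cone (1/2) (3/2) e C g1]) ->
  pint g0 v0 (fun z => cexp (- (3^-1)%:C * z ^+ 3 + x%:C * z ^+ 2 + y%:C * z)) =
  pint g1 v1 (fun z => cexp (- (3^-1)%:C * z ^+ 3 + x%:C * z ^+ 2 + y%:C * z)).
Proof.
move=> a0 a1 h0 h1.
have [e [C [e0 C0 hc]]] := two_cones h0 h1.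
(* The lower-order terms of the exponent are at most $(|x|+|y|)|z|^2+|y|$, because
   $|z|\le1+|z|^2$. *)
have A0 : 0 <= `|x| + `|y| by rewrite addr_ge0.
have [K hK] := airy_bound e0 C0 A0.
have [C1 [C10 hC1]] := lhom_growth a0 a1.
have [D [D0 hD]] := dcubic_growth (- (3^-1)%:C) x%:C y%:C C10.
have D1 : 0 <= D + 1 by rewrite addr_ge0.
have := @homotopy_exp (cubic (- (3^-1)%:C) x%:C y%:C) _ (fun=> 1) (fun=> 0) setT
  g0 v0 g1 v1 (K + `|y|) 1 (D + 1) a0 a1 ltr01 D1 (@chol_cubic _ _ _).
have -> : (fun z => cexp (cubic (- (3^-1)%:C) x%:C y%:C z) * 1) =
   (fun z => cexp (- (3^-1)%:C * z ^+ 3 + x%:C * z ^+ 2 + y%:C * z)).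
  by apply/funext => z; rewrite mulr1.
apply.
- by move=> z s z' _ _; rewrite mul0r; exact: cder_cst.
- exact: ccs_cubic.
- exact: ccs_dcubic.
- by move=> z s _ _; exact: ccontat_cst.
- by move=> z s _ _; exact: ccontat_cst.
- exact: cbor_cubic.
- exact: cbor_dcubic.
- by move=> d T f _; exact: cmeas_cst.
- by move=> d T f _; exact: cmeas_cst.
- by [].
- move=> l u l1; rewrite /cubic.
  set z := lhom g0 g1 l u; have := hK u z (hc l u l1).
  rewrite -addrA ReAdd mul1r => hz.
  have n0 := nrm_ge0 z.
  have b1 : Re (x%:C * z ^+ 2) <= `|x| * nrm z ^+ 2.
    by rewrite (le_trans (ler_norm _))// (le_trans (Re_le_nrm _))// nrmM nrmC nrmX.
  have b2 : Re (y%:C * z) <= `|y| * nrm z.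
    by rewrite (le_trans (ler_norm _))// (le_trans (Re_le_nrm _))// nrmM nrmC.
  have b3 : nrm z <= 1 + nrm z ^+ 2 by have := sqr_ge0 (nrm z - 1/2); rewrite sqrrB; lra.
  have b4 : `|y| * nrm z <= `|y| * (1 + nrm z ^+ 2) by rewrite ler_wpM2l.
  rewrite ReAdd; lra.
- move=> l u l1; rewrite (le_trans (hD _ u (hC1 _ _ l1)))// ler_wpM2r ?sqr_ge0//.
  by rewrite lerDl.
- by move=> l u _; rewrite nrm1 lerDr.
- by move=> l u _; rewrite nrm0.
Qed.

End ExpContours.

(** * Cauchy kernels along contours *)

Section CauchyKernel.
Context {R : realType}.
Local Notation leb := (@lebesgue_measure R).
Local Notation RR := (measurableTypeR R).
Implicit Types (gam v : R -> R[i]) (t d : R) (b z w : R[i]).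

Lemma gexp_bound gam v t (B : R) : 0 < t -> 0 <= B -> gcontour gam v ->
  exists K c, [/\ 0 <= K, 0 < c &
    forall u b, nrm b <= B -> nrm (gexp t b (gam u)) <= K * gau c u].
Proof.
move=> t0 B0 [ag [e [C [e0 C0 hc]]]].
have [K [c [c0 hK]]] := gauss_bound e0 C0 t0 B0.
exists (expR K), c; split => //.
move=> u b hb; rewrite /gexp nrm_cexp /gau -expRD ler_expR.
by apply: hK => //; exact: hc.
Qed.

Lemma gexp_cmeas (disp : measure_display) (T : measurableType disp) (f : T -> R[i]) t b :
  cmeas f -> cmeas (fun x => gexp t b (f x)).
Proof.
move=> mf; apply: cmeas_cexp; apply: cmeasD; apply: cmeasM; try exact: cmeas_cst.
  exact: cmeasX.
by [].
Qed.

Lemma gexp_cintble gam v t b : 0 < t -> gcontour gam v ->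
  cintble leb (fun u : R => gexp t b (gam u) * v u).
Proof.
move=> t0 G; have [K [c [K0 c0 hK]]] := gexp_bound t0 (nrm_ge0 b) G.
apply: (@velocity_cint _ gam v (gexp t b) K c) => //; first exact: gc_adm G.
  by move=> disp T f; exact: gexp_cmeas.
by move=> u; exact: hK.
Qed.

(** The Cauchy transform of $e^{tw^2+bw}$ divided by its density at the pole. This normalization
    makes the derivative in $z$ independent of the contour. *)
Definition cauchyN gam v t b z :=
  cexp (- (t%:C * z ^+ 2 + b * z)) * pint gam v (fun w => gexp t b w / (z - w)).

(** With $Q(w)=tw^2+bw$, an integration by parts along the contour shows that the derivative of
    [cauchyN] in $z$ is $-2te^{-Q(z)}\int e^{Q(w)}\,\mathrm dw$, free of the pole; the formula
    integrates this over the segment from [z0] to [z1]. *)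
Lemma cauchy_step gam v t b z0 z1 d : 0 < t -> 0 < d -> gcontour gam v ->
  (forall l u, in01 l -> d <= nrm (z0 + l%:C * (z1 - z0) - gam u)) ->
  cauchyN gam v t b z1 - cauchyN gam v t b z0 =
  cint leb (fun l : R => if in01 l then
    (- (2 * t)%:C * (z1 - z0) *
      cexp (- (t%:C * (z0 + l%:C * (z1 - z0)) ^+ 2 + b * (z0 + l%:C * (z1 - z0)))))
     * pint gam v (gexp t b) else 0).
Proof.
move=> t0 d0 gg hd; have ag := gc_adm gg.
have [K [c [K0 c0 hK]]] := gexp_bound t0 (nrm_ge0 b) gg.
have {}hK u : nrm (gexp t b (gam u)) <= K * gau c u by exact: hK.
have [V [V0 hV]] := adm_bd ag; have [s hs] := adm_der ag.
pose zl (l : R) := z0 + l%:C * (z1 - z0); pose zd := z1 - z0.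
pose e l := cexp (- (t%:C * zl l ^+ 2 + b * zl l)).
pose e' l := - ((2 * t)%:C * zl l + b) * zd * e l.
pose g u := gexp t b (gam u).
pose r l u := (zl l - gam u)^-1.
pose A l u := e l * (g u * r l u) * v u.
pose D l u := (e' l * (g u * r l u) + e l * (g u * (- zd * r l u ^+ 2))) * v u.
pose B l u := - zd * (e l * (g u * r l u)).
(* What remains of [D] after the exact part: since $Q'(w)-Q'(z)=2t(w-z)$, the denominator $z-w$
   cancels. *)
pose E l u := - (2 * t)%:C * zd * e l * (g u * v u).
have r0 l u : in01 l -> zl l - gam u != 0.
  by move=> l1; apply: contraTneq (hd l u l1) => ->; rewrite nrm0 -ltNge.
have dzl l : cder zl l zd by exact: cder_lin.
have de l : cder e l (e' l).
  have := cder_cexp (cderN (cderD (cderM (cder_cst t%:C l) (cderM (dzl l) (dzl l)))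
    (cderM (cder_cst b l) (dzl l)))).
  by move/cder_eq; apply; rewrite /e' /e !expr2 realCM rmorph_nat; ring.
have dr l u : in01 l -> cder (r ^~ u) l (- zd * r l u ^+ 2).
  move=> l1; have := cderV (r0 l u l1) (cderB (dzl l) (cder_cst (gam u) l)).
  by move/cder_eq; apply; rewrite subr0 exprVn.
have Me : exists M, 0 <= M /\ forall l, in01 l -> nrm (e l) <= M /\ nrm (e' l) <= M.
  pose Z := nrm z0 + nrm zd.
  have hZ l : in01 l -> nrm (zl l) <= Z.
    move=> /andP[l0 l1]; rewrite (le_trans (nrmD _ _))// lerD2l nrmM nrmC ger0_norm//.
    by rewrite ler_piMl// nrm_ge0.
  have Z0 : 0 <= Z by rewrite addr_ge0// nrm_ge0.
  pose M := expR (t * Z ^+ 2 + nrm b * Z).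
  have M0 : 0 <= M by exact: expR_ge0.
  have eM l : in01 l -> nrm (e l) <= M.
    move=> l1; rewrite /e nrm_cexp ler_expR (le_trans (ler_norm _))//.
    rewrite (le_trans (Re_le_nrm _))// nrmN (le_trans (nrmD _ _))//.
    rewrite (nrmM b) (nrmM t%:C) nrmX nrmC (ger0_norm (ltW t0)) lerD//.
      by rewrite ler_wpM2l ?(ltW t0)// ler_pXn2r ?nnegrE ?nrm_ge0// hZ.
    by rewrite ler_wpM2l ?nrm_ge0// hZ.
  exists (M + (2 * t * Z + nrm b) * nrm zd * M); split.
    by rewrite addr_ge0// !mulr_ge0 ?nrm_ge0// addr_ge0 ?mulr_ge0 ?nrm_ge0// ltW.
  move=> l l1; have h0 : 0 <= (2 * t * Z + nrm b) * nrm zd * M.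
    by rewrite !mulr_ge0 ?nrm_ge0// addr_ge0 ?mulr_ge0 ?nrm_ge0// ltW.
  split; first by rewrite (le_trans (eM l l1))// lerDl.
  rewrite ler_wpDl// /e' (nrmM _ (e l)) (nrmM _ zd) nrmN.
  rewrite ler_pM ?mulr_ge0 ?nrm_ge0 ?eM// ler_wpM2r ?nrm_ge0//.
  rewrite (le_trans (nrmD _ _))// lerD2r (nrmM _ (zl l)) nrmC.
  rewrite ger0_norm ?mulr_ge0 ?(ltW t0)// ler_wpM2l ?mulr_ge0 ?(ltW t0)//.
  exact: hZ.
have [M [M0 hM]] := Me.
have di : 0 <= d^-1 by rewrite invr_ge0 ltW.
have rd l u : in01 l -> nrm (r l u) <= d^-1.
  move=> l1; rewrite /r nrmV lef_pV2 ?posrE ?hd//.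
  exact: lt_le_trans d0 (hd _ _ l1).
have n0 := nrm_ge0 zd.
pose Q := M * d^-1 + M * (nrm zd * d^-1 ^+ 2) + 2 * t * nrm zd * M + nrm zd * M * d^-1.
have Q1 : 0 <= M * d^-1 by rewrite mulr_ge0.
have Q2 : 0 <= M * (nrm zd * d^-1 ^+ 2) by rewrite !mulr_ge0// exprn_ge0.
have Q3 : 0 <= 2 * t * nrm zd * M by rewrite !mulr_ge0// ltW.
have Q4 : 0 <= nrm zd * M * d^-1 by rewrite !mulr_ge0.
have gb u : 0 <= K * gau c u by rewrite mulr_ge0// gau_ge0.
have mg := adm_cmeas ag; have mv := adm_meas ag.
have mu1 : measurable_fun setT (@fst RR RR) by exact: measurable_fst.
have mu2 : measurable_fun setT (@snd RR RR) by exact: measurable_snd.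
have mzl : cmeas (fun lu : RR * RR => zl lu.1).
  by apply: cmeasD; [exact: cmeas_cst|apply: cmeasM; [exact: (cmeasC mu1)|exact: cmeas_cst]].
have me : cmeas (fun lu : RR * RR => e lu.1).
  apply: cmeas_cexp; apply: cmeasN; apply: cmeasD; apply: cmeasM; try exact: cmeas_cst.
    exact: cmeasX.
  by [].
have me' : cmeas (fun lu : RR * RR => e' lu.1).
  apply: cmeasM => //; apply: cmeasM; last exact: cmeas_cst.
  apply: cmeasN; apply: cmeasD; last exact: cmeas_cst.
  by apply: cmeasM => //; exact: cmeas_cst.
have mg2 := cmeas_comp mg mu2; have mv2 := cmeas_comp mv mu2.
have mgg : cmeas (fun lu : RR * RR => g lu.2) by exact: gexp_cmeas.
have mr : cmeas (fun lu : RR * RR => r lu.1 lu.2).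
  by apply: cmeasV; exact: cmeasB.
have mD : cmeas (fun lu : RR * RR => D lu.1 lu.2).
  apply: (cmeasM _ mv2); apply: cmeasD.
    by apply: (cmeasM me'); exact: (cmeasM mgg).
  apply: (cmeasM me); apply: (cmeasM mgg); apply: cmeasM; first exact: cmeas_cst.
  exact: cmeasX.
have mE : cmeas (fun lu : RR * RR => E lu.1 lu.2).
  apply: cmeasM; first by apply: cmeasM => //; exact: cmeas_cst.
  exact: cmeasM.
have mg1 : cmeas (T := RR) g by exact: gexp_cmeas.
have iA l : in01 l -> cintble leb (fun u : R => gexp t b (gam u) / (zl l - gam u) * v u).
  move=> l1; apply: (@cintble_dom R _ RR leb _ (fun u => (d^-1 * V * K) * gau c u)).
  - apply: cmeasM => //; apply: cmeasM => //; apply: cmeasV; exact: cmeasB.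
  - by apply: rintZ; exact: rint_gau.
  - move=> u; rewrite (nrmM _ (v u)) (nrmM (gexp _ _ _)).
    rewrite (_ : _ * gau c u = K * gau c u * d^-1 * V); last by ring.
    by rewrite !ler_pM ?mulr_ge0 ?nrm_ge0 ?rd.
have eA l : in01 l -> cint leb (A l) = cauchyN gam v t b (zl l).
  move=> l1; rewrite /cauchyN /pint -cintZ; last exact: iA.
  by apply: eq_cint => u; rewrite /A /g /r !mulrA.
have z00 : zl 0 = z0 by rewrite /zl mul0r addr0.
have z11 : zl 1 = z1 by rewrite /zl mul1r addrC subrK.
have in0 : in01 (0 : R) by rewrite /in01 lexx ler01.
have in1 : in01 (1 : R) by rewrite /in01 lexx ler01.
have iAA l : in01 l -> cintble leb (A l).
  move=> l1; rewrite (_ : A l = (fun u => e l * (gexp t b (gam u) / (zl l - gam u) * v u))).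
    by apply: cintbleZ; exact: iA.
  by apply/funext => u; rewrite /A /g /r !mulrA.
have DQ l u : in01 l -> nrm (D l u) <= Q * V * K * gau c u.
  move=> l1; have [h1 h2] := hM l l1.
  rewrite /D (nrmM _ (v u)).
  apply: (@le_trans _ _ ((M * (K * gau c u * d^-1) + M * (K * gau c u * (nrm zd * d^-1 ^+ 2))) * V)).
    rewrite ler_pM ?nrm_ge0// (le_trans (nrmD _ _))// lerD//.
      rewrite (nrmM (e' l)) (nrmM (g u)) !ler_pM ?mulr_ge0 ?nrm_ge0 ?rd//.
      exact: hK.
    rewrite (nrmM (e l)) (nrmM (g u)) (nrmM (- zd)) nrmN nrmX.
    rewrite !ler_pM ?mulr_ge0 ?exprn_ge0 ?nrm_ge0 ?rd//.
    exact: hK.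
  have := mulr_ge0 V0 (gb u); rewrite /Q; set Y := V * (K * gau c u) => Y0.
  rewrite [X in X <= _](_ : _ = (M * d^-1 + M * (nrm zd * d^-1 ^+ 2)) * Y); last by rewrite /Y; ring.
  rewrite [X in _ <= X](_ : _ = Q * Y); last by rewrite /Y /Q; ring.
  by rewrite ler_wpM2r// /Q; lra.
have EQ l u : in01 l -> nrm (E l u) <= Q * V * K * gau c u.
  move=> l1; have [h1 h2] := hM l l1.
  rewrite /E (nrmM _ (g u * v u)) (nrmM (g u)) (nrmM _ (e l)) (nrmM _ zd) nrmN nrmC.
  rewrite ger0_norm ?mulr_ge0 ?(ltW t0)//.
  apply: (@le_trans _ _ (2 * t * nrm zd * M * (K * gau c u * V))).
    rewrite !ler_pM ?mulr_ge0 ?nrm_ge0 ?(ltW t0)//.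
    exact: hK.
  have := mulr_ge0 V0 (gb u); set Y := V * (K * gau c u) => Y0.
  rewrite [X in X <= _](_ : _ = (2 * t * nrm zd * M) * Y); last by rewrite /Y; ring.
  rewrite [X in _ <= X](_ : _ = Q * Y); last by rewrite /Y /Q; ring.
  by rewrite ler_wpM2r// /Q; lra.
have Bn l (x : nat -> R) : in01 l -> (forall n, `|x n| = n%:R) ->
    nrm (B l (x n)) @[n --> \oo] --> 0.
  move=> l1 xn; have [h1 _] := hM l l1.
  apply: (@squeeze_cvgr _ _ _ _ (fun=> 0) (fun n => (nrm zd * M * d^-1 * K) * gau c (x n))).
  - apply: nearW => n; rewrite nrm_ge0 /= /B (nrmM (- zd)) (nrmM (e l)) (nrmM (g _)) nrmN.
    rewrite [X in _ <= X](_ : _ = nrm zd * (M * (K * gau c (x n) * d^-1))); last by ring.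
    rewrite !ler_pM ?mulr_ge0 ?nrm_ge0 ?rd//.
    exact: hK.
  - exact: cvg_cst.
  - by rewrite -(mulr0 (nrm zd * M * d^-1 * K)); apply: cvgM; [exact: cvg_cst|exact: cvg_gau].
have := @param_deriv R s A B D E (fun u => Q * V * K * gau c u) (Q * V * K).
rewrite !eA// z00 z11 => ->.
- apply: eq_cint => l; case: ifP => // l1.
  rewrite /pint -cintZ; last exact: gexp_cintble.
  by apply: eq_cint => u; rewrite /E /g /e /zl /zd.
- move=> l u l1.
  have := cderM (cderD (cderM (de l) (cderM (cder_cst (g u) l) (dr l u l1)))
     (cder_cst 0 l)) (cder_cst (v u) l).
  rewrite (_ : (fun u0 => _) = A ^~ u); last by apply/funext => l'; rewrite /A addr0.
  by move/cder_eq; apply; rewrite /D; ring.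
- move=> l u l1.
  have ce := cder_ccontat (de l); have cr := cder_ccontat (dr l u l1).
  have cz := cder_ccontat (dzl l).
  have ce' : ccontat e' l.
    apply: ccontatM => //; apply: ccontatM; last exact: ccontat_cst.
    apply: ccontatN; apply: ccontatD; last exact: ccontat_cst.
    by apply: ccontatM => //; exact: ccontat_cst.
  apply: ccontatM; last exact: ccontat_cst.
  have cgu := @ccontat_cst R (g u) l.
  apply: ccontatD; first exact: (ccontatM ce' (ccontatM cgu cr)).
  by apply: (ccontatM ce); apply: (ccontatM cgu); exact: (ccontatM (ccontat_cst _ _) (ccontatX 2 cr)).
- move=> l u l1; have cg := adm_cont ag u.
  apply: ccontatM; first exact: ccontat_cst.
  apply: ccontatM; first exact: ccontat_cst.
  apply: ccontatM; last first.
    apply: ccontatV; first exact: r0.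
    by apply: ccontatB => //; exact: ccontat_cst.
  apply: ccontat_cexp; apply: ccontatD; apply: ccontatM; try exact: ccontat_cst.
    exact: ccontatX.
  by [].
- move=> l u l1 us; have [dg cv] := hs u us.
  have dgg : cder g u ((2%:R * t%:C * gam u + b) * v u * g u).
    have := cder_cexp (cderD (cderM (cder_cst t%:C u) (cderM dg dg))
      (cderM (cder_cst b u) dg)).
    rewrite (_ : (fun u0 => _) = g); last by apply/funext => u'; rewrite /g /gexp expr2.
    by move/cder_eq; apply; rewrite /g /gexp expr2; ring.
  have drr : cder (r l) u (v u * r l u ^+ 2).
    have := cderV (r0 l u l1) (cderB (cder_cst (zl l) u) dg).
    by move/cder_eq; apply; rewrite sub0r opprK exprVn.
  split.
    have := cderM (cder_cst (- zd) u) (cderM (cder_cst (e l) u) (cderM dgg drr)).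
    move/cder_eq; apply.
    have rr : r l u * (zl l - gam u) = 1 by rewrite mulVf ?r0.
    have -> : D l u - E l u = (e' l * (g u * r l u) + e l * (g u * (- zd * r l u ^+ 2))) * v u
      + (2 * t)%:C * zd * e l * (g u * v u) * (r l u * (zl l - gam u)).
      by rewrite rr /D /E; ring.
    by rewrite /e' realCM rmorph_nat; ring.
  have cg := cder_ccontat dgg; have cr := cder_ccontat drr.
  apply: ccontatB.
    apply: (ccontatM _ cv); apply: ccontatD.
      exact: (ccontatM (ccontat_cst _ _) (ccontatM cg cr)).
    apply: (ccontatM (ccontat_cst _ _)); apply: (ccontatM cg).
    exact: (ccontatM (ccontat_cst _ _) (ccontatX 2 cr)).
  by apply: ccontatM; [exact: ccontat_cst|exact: ccontatM].
- exact: mD.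
- exact: mE.
- by apply: rintZ; exact: rint_gau.
- by move=> u; rewrite ler_piMr ?gau_le1// !mulr_ge0// !addr_ge0.
- exact: DQ.
- exact: EQ.
- by move=> l l1; apply: Bn => // n; rewrite normr_nat.
- by move=> l l1; apply: Bn => // n; rewrite normrN normr_nat.
- exact: iAA.
- exact: iAA.
Qed.

(** Outside $[-T,T]$ the imaginary part of the contour exceeds $|z|+1$ in modulus; inside, the
    distance attains its minimum. *)
Lemma gcontour_dist gam v z : gcontour gam v -> (forall u, z <> gam u) ->
  exists d, 0 < d /\ forall u, d <= nrm (z - gam u).
Proof.
move=> [ag [e [C [e0 C0 hc]]]] hz.
pose T := (C + nrm z + 1) / e.
have nz := nrm_ge0 z.
have T0 : 0 <= T by rewrite divr_ge0 ?(ltW e0)// !addr_ge0.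
have [||m mT hm] := @EVT_min R (fun u => nrm (z - gam u)) (- T) T; first lra.
  apply: continuous_subspaceT => u.
  have [c1 c2] : ccontat (fun u => z - gam u) u.
    by apply: ccontatB; [exact: ccontat_cst|exact: (adm_cont ag)].
  rewrite /continuous_at nrmE; under eq_fun do rewrite nrmE.
  apply: continuous_comp; last exact: sqrt_continuous.
  by apply: cvgD; apply: cvgM.
exists (Num.min (nrm (z - gam m)) 1); split.
  by rewrite lt_min ltr01 andbT nrm_gt0// subr_eq0; apply/eqP/hz.
move=> u; rewrite ge_min.
have [uT|uT] := boolP (u \in `[- T, T]); first by rewrite hm.
apply/orP; right; have [h1 _ _] := hc u.
have uT' : T <= `|u|.
  by rewrite leNgt ltr_norml; apply: contra uT => /andP[h2 h3]; rewrite in_itv /= !ltW.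
have h2 : C + nrm z + 1 <= e * `|u| by rewrite mulrC -ler_pdivrMr.
have h3 := le_trans (ler_norm _) (eq_ind_r (fun x => x <= _) (Im_le_nrm (gam u)) (sgnM_norm u _)).
have := nrm_lerB (gam u) z; rewrite nrm_distC; lra.
Qed.

(** Only the compact piece of the path up to a positive point of the real axis is kept; it has a
    lower bound on its real part. *)
Lemma joined_bounded gam z : joined_to_infinity gam 1 z ->
  exists p : R -> R[i], exists T M : R, [/\ forall t, ccontat p t, p 0 = z,
    0 < T /\ (forall t u, 0 <= t -> p t <> gam u),
    p T = T%:C & forall t, 0 <= t <= T -> - M <= Re (p t)].
Proof.
move=> [p [c1 c2 p0 pg [T [_ hT]]]].
pose T' := Num.max 1 (T + 1).
have T'1 : 0 < T' by rewrite lt_max ltr01.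
have T'0 := ltW T'1.
have [|m mT hm] := @EVT_min R (fun u => Re (p u)) 0 T' T'0.
  by apply: continuous_subspaceT => u; exact: c1.
exists p, T', (- Re (p m)); split => //.
- by move=> t; split; [exact: c1|exact: c2].
- by rewrite hT ?mul1r// lt_max; apply/orP; right; lra.
- by move=> t t0T; rewrite opprK hm// in_itv.
Qed.

(** Composed with the path, retracted to $[0,T]$, the function has derivative $0$ everywhere. *)
Lemma locally_cst_path (D : R[i] -> R[i]) (p : R -> R[i]) (T : R) : 0 <= T ->
  (forall t, ccontat p t) ->
  (forall t, 0 <= t <= T -> exists d : R, 0 < d /\
     forall z, nrm (z - p t) < d -> D z = D (p t)) ->
  D (p 0) = D (p T).
Proof.
move=> T0 cp hD.
pose cl (t : R) := Num.max 0 (Num.min T t).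
have cl0T t : 0 <= cl t <= T by rewrite le_max lexx /= ge_max T0 ge_min lexx.
have ccl : continuous cl.
  move=> t; apply: continuous_max; first exact: cvg_cst.
  by apply: continuous_min; [exact: cvg_cst|exact: cvg_id].
have key (h : R[i] -> R) : h (D (p (cl 0))) = h (D (p (cl T))).
  apply: (@is_derive_0_is_cst _ (fun t => h (D (p (cl t))))) => t.
  have [d [d0 hd]] := hD _ (cl0T t).
  apply: (@near_eq_is_derive _ _ _ (cst (h (D (p (cl t)))))).
  have [c1 c2] := cp (cl t).
  have d2 : 0 < d / 2 by rewrite divr_gt0.
  have c1' := continuous_comp (ccl t) c1; have c2' := continuous_comp (ccl t) c2.
  near=> u; rewrite /cst hd// (le_lt_trans (nrm_le_ReIm _))// !ReImE [d]splitr ltrD//.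
    by near: u; move/cvgrPdistC_lt : c1'; apply.
  by near: u; move/cvgrPdistC_lt : c2'; apply.
have e0 : cl 0 = 0 by rewrite /cl (min_idPr T0) maxxx.
have e1 : cl T = T by rewrite /cl minxx (max_idPr T0).
by apply: cplxP; [have := key (@Re R)|have := key (@Im R)]; rewrite e0 e1.
Unshelve. all: by end_near. Qed.

(** Near every point of the path the increments of the two transforms are given by [cauchy_step];
    they differ only through the pole-free Gaussian integral, which is the same for both contours by
    [gauss_move]. *)
Lemma cauchyN_diff_cst g0 v0 g1 v1 t b (p : R -> R[i]) (T : R) : 0 < t -> 0 <= T ->
  gcontour g0 v0 -> gcontour g1 v1 -> (forall s, ccontat p s) ->
  (forall s u, 0 <= s <= T -> p s <> g0 u) -> (forall s u, 0 <= s <= T -> p s <> g1 u) ->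
  cauchyN g0 v0 t b (p 0) - cauchyN g1 v1 t b (p 0) =
  cauchyN g0 v0 t b (p T) - cauchyN g1 v1 t b (p T).
Proof.
move=> t0 T0 G0 G1 cp p0 p1.
apply: (@locally_cst_path (fun z => cauchyN g0 v0 t b z - cauchyN g1 v1 t b z) p T) => // s sT.
have [d0 [d00 h0]] := gcontour_dist G0 (fun u => p0 s u sT).
have [d1 [d10 h1]] := gcontour_dist G1 (fun u => p1 s u sT).
exists (Num.min d0 d1 / 2); split; first by rewrite divr_gt0// lt_min d00.
move=> z hz.
have near (d : R) g : Num.min d0 d1 <= d -> (forall u : R, d <= nrm (p s - g u)) ->
    forall l u, in01 l -> d / 2 <= nrm (p s + l%:C * (z - p s) - g u).
  move=> dd hd l u /andP[l0 l1].
  have h : nrm (l%:C * (z - p s)) <= d / 2.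
    rewrite nrmM nrmC ger0_norm// (@le_trans _ _ (nrm (z - p s)))//.
      by rewrite ler_piMl// nrm_ge0.
    by rewrite (le_trans (ltW hz))// ler_pM2r.
  have := nrm_lerB (p s - g u) (- (l%:C * (z - p s))).
  rewrite opprK nrmN (_ : p s - g u + _ = p s + l%:C * (z - p s) - g u); last by ring.
  have := hd u; lra.
have e0 := cauchy_step b t0 (_ : 0 < d0 / 2) G0 (near d0 g0 _ h0).
have e1 := cauchy_step b t0 (_ : 0 < d1 / 2) G1 (near d1 g1 _ h1).
have {}e0 := e0 ltac:(by rewrite divr_gt0) ltac:(by rewrite ge_min lexx).
have {}e1 := e1 ltac:(by rewrite divr_gt0) ltac:(by rewrite ge_min lexx orbT).
rewrite -(gauss_move b t0 G0 G1) -e0 in e1.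
rewrite (_ : cauchyN g0 v0 t b z = cauchyN g0 v0 t b (p s) +
   (cauchyN g1 v1 t b z - cauchyN g1 v1 t b (p s))); first by ring.
by rewrite e1; ring.
Qed.

Lemma cauchyN_inj g0 v0 g1 v1 t b z : cauchyN g0 v0 t b z = cauchyN g1 v1 t b z ->
  pint g0 v0 (fun w => gexp t b w / (z - w)) = pint g1 v1 (fun w => gexp t b w / (z - w)).
Proof. by apply: mulfI; exact: cexp_neq0. Qed.

Lemma pole_move' (g0 v0 g1 v1 : R -> R[i]) (t : R) b w (d : R) : 0 < t -> 0 < d ->
  gcontour g0 v0 -> gcontour g1 v1 ->
  (forall l u, in01 l -> d <= nrm (lhom g0 g1 l u - w)) ->
  pint g0 v0 (fun z => gexp t b z / (w - z)) = pint g1 v1 (fun z => gexp t b z / (w - z)).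
Proof.
move=> t0 d0 G0 G1 hd.
have ih g v : gcontour g v -> (forall u, d <= nrm (g u - w)) ->
    pint g v (fun z => gexp t b z / (w - z)) = - pint g v (fun z => gexp t b z / (z - w)).
  move=> G hg; have ag := gc_adm G.
  have [K [c [K0 c0 hK]]] := gexp_bound t0 (nrm_ge0 b) G.
  rewrite -cintN.
    by apply: eq_cint => u; rewrite -(opprB (g u)) invrN mulrN mulNr.
  apply: (@velocity_cint _ g v (fun z => gexp t b z / (z - w)) (K / d) c) => //.
    move=> disp T f mf; apply: cmeasM; first exact: gexp_cmeas.
    by apply: cmeasV; apply: cmeasB => //; exact: cmeas_cst.
  move=> u; rewrite nrmM mulrAC ler_pM ?nrm_ge0 ?hK//.
  by rewrite nrmV lef_pV2 ?posrE// (lt_le_trans d0).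
have in0 : in01 (0 : R) by rewrite /in01 lexx ler01.
have in1 : in01 (1 : R) by rewrite /in01 lexx ler01.
rewrite !ih//; first by congr (- _); exact: (@pole_move _ _ _ _ _ t b w d).
- by move=> u; have := hd 1 u in1; rewrite /lhom mul1r (addrC (g0 u)) subrK.
- by move=> u; have := hd 0 u in0; rewrite /lhom mul0r addr0.
Qed.

Lemma Re_lhom_le (g0 g1 : R -> R[i]) (x : R) l u : in01 l ->
  Re (g0 u) <= x -> Re (g1 u) <= x -> Re (lhom g0 g1 l u) <= x.
Proof.
by move=> /andP[l0 l1] h0 h1; rewrite /lhom !ReImE mul0r subr0; nra.
Qed.

Lemma pole_move_right (g0 v0 g1 v1 : R -> R[i]) (t x : R) b z : 0 < t ->
  gcontour g0 v0 -> gcontour g1 v1 -> x < Re z ->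
  (forall u, Re (g0 u) <= x) -> (forall u, Re (g1 u) <= x) ->
  pint g0 v0 (fun w => gexp t b w / (z - w)) = pint g1 v1 (fun w => gexp t b w / (z - w)).
Proof.
move=> t0 G0 G1 xz h0 h1; apply: (@pole_move' _ _ _ _ _ _ _ (Re z - x)) => //.
  by rewrite subr_gt0.
move=> l u l1; rewrite nrm_distC (le_trans _ (le_trans (ler_norm _) (Re_le_nrm _)))//.
by rewrite ReAdd ReOpp lerD2l lerN2 Re_lhom_le.
Qed.

(* The integrals over both contours, multiplied by exp(-t z^2 - b z), differ by
   a function of z that is locally constant and vanishes far to the right. *)
Lemma cauchy_far g0 v0 t b z : 0 < t -> gcontour g0 v0 -> (forall u, Re (g0 u) <= 0) ->
  joined_to_infinity g0 1 z -> exists M : R, forall g1 v1, gcontour g1 v1 ->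
    (forall u, Re (g1 u) < - M) ->
  pint g0 v0 (fun w => gexp t b w / (z - w)) = pint g1 v1 (fun w => gexp t b w / (z - w)).
Proof.
move=> t0 G0 neg /joined_bounded [p [T [M [cp pz [T0 pg] pT pM]]]].
have T00 := ltW T0; exists (Num.max M 0) => g1 v1 G1 h1.
have {}h1 u : Re (g1 u) < - M /\ Re (g1 u) < 0.
  by have := h1 u; rewrite oppr_max lt_min oppr0 => /andP.
apply: cauchyN_inj; apply/eqP; rewrite -subr_eq0 -pz; apply/eqP.
rewrite (@cauchyN_diff_cst _ _ _ _ _ _ p T)//.
(* At the end of the path the pole is a positive real number while both contours lie in
   $\mathrm{Re}\le0$, so there a straight homotopy does meet no pole. *)
- apply/eqP; rewrite subr_eq0 pT /cauchyN; apply/eqP; congr (_ * _).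
  by apply: (@pole_move_right _ _ _ _ _ 0) => // u; rewrite ltW//; have [] := h1 u.
- by move=> s u /andP[s0 _]; exact: pg.
- move=> s u sT eq; have := pM s sT; rewrite eq.
  by have [] := h1 u; lra.
Qed.

End CauchyKernel.

(** * Nested contour integrals *)

Section Nested.
Context {R : realType}.
Local Notation leb := (@lebesgue_measure R).
Local Notation RR := (measurableTypeR R).
Implicit Types (gam v : R -> R[i]) (t d x u : R) (b z w zeta : R[i]).

Definition ipi : R[i] := (0 +i* (2 * pi))^-1.

Lemma gexpM_cintble gam v t b (Phi : R -> R[i]) (C : R) : 0 < t -> gcontour gam v ->
  cmeas (T := RR) Phi -> (forall u, nrm (Phi u) <= C) ->
  cintble leb (fun u : R => gexp t b (gam u) * Phi u * v u).
Proof.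
move=> t0 G mP hP; have ag := gc_adm G.
have [K [c [K0 c0 hK]]] := gexp_bound t0 (nrm_ge0 b) G.
have [V [V0 hV]] := adm_bd ag.
apply: (@cintble_dom R _ RR leb _ (fun u => (K * C * V) * gau c u)).
- apply: (cmeasM _ (adm_meas ag)); apply: (cmeasM _ mP).
  by apply: gexp_cmeas; exact: adm_cmeas ag.
- by apply: rintZ; exact: rint_gau.
- move=> u; rewrite (nrmM _ (v u)) (nrmM _ (Phi u)).
  rewrite (_ : _ * gau c u = K * gau c u * C * V); last by ring.
  by rewrite !ler_pM ?mulr_ge0 ?nrm_ge0// hK.
Qed.

Lemma nrm_inv_le d z : 0 < d -> d <= nrm z -> nrm z^-1 <= d^-1.
Proof. by move=> d0 dz; rewrite nrmV lef_pV2 ?posrE// (lt_le_trans d0). Qed.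

Lemma nrm_ge_neq0 d z : 0 < d -> d <= nrm z -> z != 0.
Proof. by move=> d0; apply: contraTneq => ->; rewrite nrm0 -ltNge. Qed.

Section Move.
Variables (g0 v0 g1 v1 : R -> R[i]) (t d : R) (b z : R[i]).
Hypotheses (t0 : 0 < t) (d0 : 0 < d) (G0 : gcontour g0 v0) (G1 : gcontour g1 v1).
Hypothesis hz : pint g0 v0 (fun w => gexp t b w / (z - w)) =
  pint g1 v1 (fun w => gexp t b w / (z - w)).
Hypotheses (hz0 : forall u, d <= nrm (z - g0 u)) (hz1 : forall u, d <= nrm (z - g1 u)).

Lemma lhom0E u : lhom g0 g1 0 u = g0 u.
Proof. by rewrite /lhom mul0r addr0. Qed.
Lemma lhom1E u : lhom g0 g1 1 u = g1 u.
Proof. by rewrite /lhom mul1r (addrC (g0 u)) subrK. Qed.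

(* 1 / ((z - xi)(xi - w)) = (1 / (z - xi) + 1 / (xi - w)) / (z - w) *)
Lemma move_pole w : (forall l u, in01 l -> d <= nrm (lhom g0 g1 l u - w)) -> d <= nrm (z - w) ->
  pint g0 v0 (fun xi => gexp t b xi / (z - xi) * (xi - w)^-1) =
  pint g1 v1 (fun xi => gexp t b xi / (z - xi) * (xi - w)^-1).
Proof.
move=> hw zw; have zw0 := nrm_ge_neq0 d0 zw.
have hw0 u : d <= nrm (g0 u - w) by rewrite -lhom0E hw// /in01 lexx ler01.
have hw1 u : d <= nrm (g1 u - w) by rewrite -lhom1E hw// /in01 lexx ler01.
have H g v : gcontour g v -> (forall u, d <= nrm (z - g u)) -> (forall u, d <= nrm (g u - w)) ->
    pint g v (fun xi => gexp t b xi / (z - xi) * (xi - w)^-1) =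
    (pint g v (fun xi => gexp t b xi / (z - xi)) + pint g v (fun xi => gexp t b xi / (xi - w)))
      / (z - w).
  move=> G h1 h2; have mg := adm_cmeas (gc_adm G).
  have i1 : cintble leb (fun u : R => gexp t b (g u) / (z - g u) * v u).
    apply: (@gexpM_cintble _ _ _ _ (fun u => (z - g u)^-1) d^-1) => //.
      by apply: cmeasV; apply: cmeasB => //; exact: cmeas_cst.
    by move=> u; exact: nrm_inv_le.
  have i2 : cintble leb (fun u : R => gexp t b (g u) / (g u - w) * v u).
    apply: (@gexpM_cintble _ _ _ _ (fun u => (g u - w)^-1) d^-1) => //.
      by apply: cmeasV; apply: cmeasB => //; exact: cmeas_cst.
    by move=> u; exact: nrm_inv_le.
  rewrite /pint -cintD// -cintZr; last exact: cintbleD.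
  apply: eq_cint => u; have n1 := nrm_ge_neq0 d0 (h1 u); have n2 := nrm_ge_neq0 d0 (h2 u).
  have e : z - w = (z - g u) + (g u - w) by ring.
  rewrite e in zw0 *; rewrite -mulrDl -mulrDr -!mulrA; congr (_ * _); rewrite mulrCA mulrC.
  rewrite -mulrA; congr (_ * _); field.
  by rewrite n1 n2 zw0.
by rewrite !H// hz (@pole_move _ _ _ _ _ t b w d t0 d0 G0 G1).
Qed.

(** As a function of [xi] the inner nested integral is a superposition of Cauchy kernels with poles
    [w s]; by Fubini the move reduces to one pole at a time. *)
Lemma move_superposition (c : R[i]) (psi w : R -> R[i]) (g : R -> R) :
  cmeas (T := RR) psi -> cmeas (T := RR) w -> rint leb g -> (forall s, nrm (psi s) <= g s) ->
  (forall l u s, in01 l -> d <= nrm (lhom g0 g1 l u - w s)) ->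
  (forall s, d <= nrm (z - w s)) ->
  let Phi xi := c * cint leb (fun s => psi s / (xi - w s)) in
  pint g0 v0 (fun xi => gexp t b xi / (z - xi) * Phi xi) =
  pint g1 v1 (fun xi => gexp t b xi / (z - xi) * Phi xi).
Proof.
move=> mpsi mw ig hpsi hw zw Phi.
have hw0 u s : d <= nrm (g0 u - w s) by rewrite -lhom0E hw// /in01 lexx ler01.
have hw1 u s : d <= nrm (g1 u - w s) by rewrite -lhom1E hw// /in01 lexx ler01.
have H gm v : gcontour gm v -> (forall u, d <= nrm (z - gm u)) ->
    (forall u s, d <= nrm (gm u - w s)) ->
    pint gm v (fun xi => gexp t b xi / (z - xi) * Phi xi) =
    cint leb (fun s => c * psi s * pint gm v (fun xi => gexp t b xi / (z - xi) * (xi - w s)^-1)).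
  move=> G h1 h2; have ag := gc_adm G; have mg := adm_cmeas ag; have mv := adm_meas ag.
  have [K [k [K0 k0 hK]]] := gexp_bound t0 (nrm_ge0 b) G.
  have [V [V0 hV]] := adm_bd ag.
  pose F (us : RR * RR) := gexp t b (gm us.1) / (z - gm us.1) * v us.1 *
     (c * (psi us.2 / (gm us.1 - w us.2))).
  have mu1 : measurable_fun setT (@fst RR RR) by exact: measurable_fst.
  have mu2 : measurable_fun setT (@snd RR RR) by exact: measurable_snd.
  have mg1 := cmeas_comp mg mu1; have mv1 := cmeas_comp mv mu1.
  have mw2 := cmeas_comp mw mu2; have mp2 := cmeas_comp mpsi mu2.
  have mF : cmeas F.
    apply: cmeasM.
      apply: (cmeasM _ mv1); apply: cmeasM; first exact: gexp_cmeas.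
      by apply: cmeasV; apply: (cmeasB _ mg1); exact: cmeas_cst.
    apply: cmeasM; first exact: cmeas_cst.
    by apply: (cmeasM mp2); apply: cmeasV; exact: cmeasB.
  have di : 0 <= d^-1 by rewrite invr_ge0 ltW.
  have g0' s : 0 <= g s by rewrite (le_trans (nrm_ge0 _) (hpsi s)).
  have nF x y : nrm (F (x, y)) <= (K * d^-1 * V * (nrm c * d^-1)) * gau k x * g y.
    rewrite /F /= (nrmM _ (c * _)) (nrmM c) (nrmM (psi y)) (nrmM _ (v x)) (nrmM (gexp _ _ _)).
    rewrite (_ : _ * g y = K * gau k x * d^-1 * V * (nrm c * (g y * d^-1))); last by ring.
    by rewrite !ler_pM ?mulr_ge0 ?nrm_ge0 ?nrm_inv_le// hK.
  have iS u : cintble leb (fun s : R => psi s / (gm u - w s)).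
    apply: (@cintble_dom R _ RR leb _ (fun s => d^-1 * g s)).
    - apply: (cmeasM mpsi); apply: cmeasV; apply: (cmeasB _ mw); exact: cmeas_cst.
    - exact: rintZ.
    - by move=> s; rewrite nrmM mulrC ler_pM ?nrm_ge0// nrm_inv_le.
  transitivity (cint leb (fun u => cint leb (fun s => F (u, s)))).
    apply: eq_cint => u; rewrite /Phi -cintZ//.
    rewrite -mulrA (mulrC _ (v u)) mulrA -cintZ; last exact: cintbleZ.
    by apply: eq_cint => s; rewrite /F /=; ring.
  rewrite (@cfubini R _ _ _ _ leb leb F (fun x => (K * d^-1 * V * (nrm c * d^-1)) * gau k x) g mF)//.
  - apply: eq_cint => s; rewrite /pint -cintZ.
      by apply: eq_cint => u; rewrite /F /=; ring.
    rewrite (_ : (fun u => _) = (fun u =>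
      gexp t b (gm u) * ((z - gm u)^-1 * (gm u - w s)^-1) * v u)); last first.
      by apply/funext => u; rewrite !mulrA.
    apply: (@gexpM_cintble _ _ _ _ _ (d^-1 * d^-1)) => //.
      by apply: cmeasM; apply: cmeasV; apply: cmeasB => //; exact: cmeas_cst.
    by move=> u; rewrite nrmM ler_pM ?nrm_ge0 ?nrm_inv_le.
  - by move=> x; rewrite !mulr_ge0 ?nrm_ge0 ?gau_ge0.
  - by apply: rintZ; exact: rint_gau.
rewrite (H _ _ G0 hz0 hw0) (H _ _ G1 hz1 hw1); apply: eq_cint => s.
by rewrite (@move_pole (w s) (fun l u l1 => hw l u s l1) (zw s)).
Qed.

End Move.

(** The slope $3/4$ exceeds $1/\sqrt3$, so the wedge is eventually to the left of every contour with
    directions $e^{\pm2\pi i/3}$; it is below the aperture $4/5$ of [gcontour], so Gaussian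
    exponentials still decay along it. *)
Definition wedge x u : R[i] := (x - 3/4 * `|u|) +i* u.
Definition wedgev u : R[i] := (- (3/4 * sgn u)) +i* 1.

Definition vline x u : R[i] := x +i* u.

Lemma sgn_mul u : sgn u * u = `|u|.
Proof. rewrite /sgn; case: ifP => [h|/negbT]; first by rewrite mul1r ger0_norm.
by rewrite -ltNge mulN1r => h; rewrite ltr0_norm. Qed.

Lemma wedge_gcontour x : gcontour (wedge x) wedgev.
Proof.
split; [split|].
- move=> u; split => /=; last exact: cvg_id.
  apply: cvgB; first exact: cvg_cst.
  by apply: cvgM; [exact: cvg_cst|exact: norm_continuous].
- exists [:: 0] => u; rewrite inE => u0.
  have sd : \forall y \near u, `|y| = sgn u * y /\ sgn y = sgn u.
    rewrite /sgn; case: (ltgtP 0 u) u0 => // [u0|u0] _.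
    + near=> y; have y0 : 0 < y by near: y; exact: lt_nbhsr.
      by rewrite gtr0_norm// ltW// mul1r.
    + near=> y; have y0 : y < 0 by near: y; exact: lt_nbhsl.
      by rewrite ltr0_norm// leNgt y0 mulN1r.
  split.
    split => /=; last exact: is_derive_id.
    apply: (@near_eq_is_derive _ _ _ (fun y => x - 3/4 * (sgn u * y))).
      by near=> y; have [-> _] : `|y| = sgn u * y /\ sgn y = sgn u by near: y.
    have := is_deriveB (is_derive_cst x u 1) (is_deriveM' (is_derive_cst (3/4 : R) u 1)
      (is_deriveM' (is_derive_cst (sgn u) u 1) (is_derive_id u 1))).
    by move/is_derive_eq; apply; rewrite /= !mul0r !add0r mulr1.
  split => /=; last exact: cvg_cst.
  apply: cvg_near_cst; near=> y.
  by have [_ ->] : `|y| = sgn u * y /\ sgn y = sgn u by near: y.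
- split => /=; last exact: measurable_cst.
  apply: measurableT_comp => //; apply: measurable_funM => //.
  by apply: measurable_fun_ifT => //; exact: measurable_fun_ler.
- exists 2; split => // u; rewrite (le_trans (nrm_le_ReIm _))//= normr1 normrN normrM.
  by rewrite [`|sgn u|](_ : _ = 1) /sgn; [rewrite ger0_norm; lra|case: ifP; rewrite ?normrN ?normr1].
- exists 1, `|x|; split => // u; split; rewrite /= sgn_mul; have := normr_ge0 u;
    have := ler_norm x; have := ler_norm (- x); rewrite normrN; lra.
Unshelve. all: by end_near. Qed.

Lemma vline_gcontour x : gcontour (vline x) (fun=> 'i%C).
Proof.
split; [split|].
- by move=> u; split; [exact: cvg_cst|exact: cvg_id].
- by exists [::] => u _; split; [split; [exact: is_derive_cst|exact: is_derive_id]|exact: ccontat_cst].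
- exact: cmeas_cst.
- by exists (nrm 'i%C); split => //; exact: nrm_ge0.
- exists 1, `|x|; split => // u; split; rewrite /= sgn_mul; have := normr_ge0 u;
    have := ler_norm x; have := ler_norm (- x); rewrite normrN; lra.
Qed.

(* Points with rho z < rho w are separated by the translates of the wedge. *)
Definition rho z : R := - Re z - 3/4 * `|Im z|.

(** [rho] has Lipschitz constant at most $1+\frac34\le2$, so a gap in [rho] is a lower bound on the
    distance. *)
Lemma rho_lip z w : (rho w - rho z) / 2 <= nrm (z - w).
Proof.
rewrite ler_pdivrMr//.
have h1 := le_trans (ler_norm _) (Re_le_nrm (z - w)).
have h2 := Im_le_nrm (z - w); rewrite !ReImE in h1 h2.
have h3 : `|Im z| <= `|Im w| + `|Im z - Im w|.
  by rewrite -{1}(subrK (Im w) (Im z)) addrC ler_normD.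
have h4 := nrm_ge0 (z - w); rewrite /rho; lra.
Qed.

Lemma rho_wedge x u : rho (wedge x u) = - x.
Proof. by rewrite /rho /=; ring. Qed.

Lemma rho_vline x u : rho (vline x u) <= - x.
Proof. by rewrite /rho /=; have := normr_ge0 u; lra. Qed.

Lemma rho_le_sgn z u : rho z <= - Re z - 3/4 * (sgn u * Im z).
Proof. by rewrite /rho; have := ler_norm (sgn u * Im z); rewrite sgnM_norm; lra. Qed.

(** [rho] is concave, so an upper bound for it does not pass to segments; its linear majorant with
    the sign of the common parameter [u] does. *)
Lemma rho_lhom (g0 g1 : R -> R[i]) (M : R) l u : in01 l ->
  - Re (g0 u) - 3/4 * (sgn u * Im (g0 u)) <= M ->
  - Re (g1 u) - 3/4 * (sgn u * Im (g1 u)) <= M -> rho (lhom g0 g1 l u) <= M.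
Proof.
move=> /andP[l0 l1] h0 h1; apply: (le_trans (rho_le_sgn _ u)).
rewrite /lhom !ReImE !mul0r subr0 addr0; set s := sgn u in h0 h1 *.
by nra.
Qed.

Lemma Re_wedge x u : Re (wedge x u) <= x.
Proof. by rewrite /=; have := normr_ge0 u; lra. Qed.

Lemma lhom_wedge x x' l u : lhom (wedge x) (wedge x') l u = wedge (x + l * (x' - x)) u.
Proof. transitivity ((x - 3/4 * `|u| + (l * ((x' - 3/4 * `|u|) - (x - 3/4 * `|u|)) - 0 * (u - u))) +i*
  (u + (l * (u - u) + 0 * ((x' - 3/4 * `|u|) - (x - 3/4 * `|u|))))) => //.
by rewrite /wedge; congr (_ +i* _); ring.
Qed.

Variables al be : nat -> R.

(** The integral over $\xi_{l+1},\dots,\xi_{l+k}$ in $\mathbf T$ with $\xi_l=z$ frozen; [gexp] with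
    these arguments is the ratio $\mathrm F_{l+1}$, from which the cubic terms have cancelled. *)
Fixpoint nest (G V : nat -> R -> R[i]) zeta (k l : nat) z : R[i] :=
  if k is k'.+1 then
    ipi * pint (G l.+1) (V l.+1) (fun xi =>
      gexp (al l.+1 - al l) (be l.+1 - be l)%:C xi / (z - xi) * nest G V zeta k' l.+1 xi)
  else (z - zeta)^-1.

Lemma nestS G V zeta k l z : nest G V zeta k.+1 l z = ipi * pint (G l.+1) (V l.+1) (fun xi =>
  gexp (al l.+1 - al l) (be l.+1 - be l)%:C xi / (z - xi) * nest G V zeta k l.+1 xi).
Proof. by []. Qed.

(** Tips at unit spacing keep successive wedges at distance at least $1/2$ by [rho_lip]. *)
Definition nestW x := nest (fun l => wedge (x - l%:R)) (fun=> wedgev).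

Lemma nestW_cmeas x zeta k l (disp : measure_display) (T : measurableType disp) (f : T -> R[i]) :
  cmeas f -> cmeas (fun y => nestW x zeta k l (f y)).
Proof.
elim: k l disp T f => [|k IH] l disp T f mf.
  by apply: cmeasV; apply: cmeasB => //; exact: cmeas_cst.
apply: cmeasM; first exact: cmeas_cst.
have mu1 : measurable_fun setT (@fst T RR) by exact: measurable_fst.
have mu2 : measurable_fun setT (@snd T RR) by exact: measurable_snd.
have ag := gc_adm (wedge_gcontour (x - l.+1%:R)).
have mg2 := cmeas_comp (adm_cmeas ag) mu2.
have mv2 := cmeas_comp (adm_meas ag) mu2.
apply: (@cmeas_cint R _ _ T RR leb (fun yu => gexp (al l.+1 - al l) (be l.+1 - be l)%:C
    (wedge (x - l.+1%:R) yu.2) / (f yu.1 - wedge (x - l.+1%:R) yu.2) *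
    nestW x zeta k l.+1 (wedge (x - l.+1%:R) yu.2) * wedgev yu.2)).
apply: (cmeasM _ mv2); apply: cmeasM; last exact: IH.
apply: cmeasM; first exact: gexp_cmeas.
by apply: cmeasV; apply: (cmeasB _ mg2); exact: cmeas_comp mf mu1.
Qed.

(** Distance of $z$ from the singularities of [nestW x zeta k l]: the first wedge, or [zeta] when no
    integral is left. *)
Definition far x zeta d k l z : Prop :=
  if k is 0 then d <= nrm (z - zeta) else forall u, d <= nrm (z - wedge (x - l.+1%:R) u).

Lemma far_rho x zeta k l z : Re z <= 0 -> 0 < Re zeta -> rho z <= - (x - l%:R) ->
  far x zeta (Num.min (1/2) (Re zeta)) k l z.
Proof.
move=> z0 zt0 hz; case: k => [|k] /=.
  have := le_trans (ler_norm _) (Re_le_nrm (zeta - z)); rewrite nrm_distC !ReImE.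
  by rewrite ge_min => h; apply/orP; right; lra.
move=> u; have := rho_lip z (wedge (x - l.+1%:R) u); rewrite rho_wedge => h.
rewrite ge_min; apply/orP; left; apply: le_trans h.
by move: hz; rewrite -(natr1 l); lra.
Qed.

Lemma nestW_bound x zeta d k l : 0 < d -> x <= 0 -> 0 < Re zeta ->
  (forall j, (l <= j < l + k)%N -> al j < al j.+1) ->
  exists C, 0 <= C /\ forall z, far x zeta d k l z -> nrm (nestW x zeta k l z) <= C.
Proof.
move=> d0 x0 zt0; elim: k l d d0 => [|k IH] l d d0 hal.
  exists d^-1; split; first by rewrite invr_ge0 ltW.
  by move=> z; exact: nrm_inv_le.
have d'0 : 0 < Num.min (1/2) (Re zeta) by rewrite lt_min zt0 divr_gt0.
have [|C [C0 hC]] := IH l.+1 _ d'0.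
  by move=> j /andP[h1 h2]; apply: hal; rewrite addnS -addSn h2 andbT ltnW.
have G := wedge_gcontour (x - l.+1%:R); have ag := gc_adm G.
have t0 : 0 < al l.+1 - al l by rewrite subr_gt0 hal// leqnn addnS ltnS leq_addr.
have [K [c [K0 c0 hK]]] := gexp_bound t0 (nrm_ge0 (be l.+1 - be l)%:C) G.
have [V [V0 hV]] := adm_bd ag.
pose I := Rintegral leb setT (fun u => K * d^-1 * C * V * gau c u).
have n0 := nrm_ge0 ipi.
exists (nrm ipi * (2 * I)); split.
  rewrite !mulr_ge0//; apply: Rintegral_ge0 => // u _.
  by rewrite !mulr_ge0 ?invr_ge0 ?expR_ge0// ltW.
move=> z hz; rewrite /nestW nestS nrmM ler_wpM2l//; apply: nrm_cint.
- have mg := adm_cmeas ag.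
  apply: (cmeasM _ (adm_meas ag)); apply: cmeasM; last exact: nestW_cmeas.
  apply: cmeasM; first exact: gexp_cmeas.
  by apply: cmeasV; apply: cmeasB => //; exact: cmeas_cst.
- by apply: rintZ; exact: rint_gau.
- move=> u; rewrite (nrmM _ (wedgev u)) (nrmM _ (nest _ _ _ _ _ _)) (nrmM (gexp _ _ _)).
  rewrite (_ : _ * gau c u = K * gau c u * d^-1 * C * V); last by ring.
  rewrite !ler_pM ?mulr_ge0 ?nrm_ge0// ?nrm_inv_le// ?hK//.
  apply: hC; apply: far_rho => //; last by rewrite rho_wedge.
  by rewrite (le_trans (Re_wedge _ _))// subr_le0 (le_trans x0).
Qed.

Lemma nestW_superposition x zeta k l : 0 < Re zeta -> x <= 0 ->
  (forall j, (l <= j < l + k.+1)%N -> al j < al j.+1) ->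
  exists (psi : R -> R[i]) (g : R -> R), [/\ cmeas (T := RR) psi, rint leb g,
    forall s, nrm (psi s) <= g s &
    forall xi, nestW x zeta k.+1 l xi =
      ipi * cint leb (fun s => psi s / (xi - wedge (x - l.+1%:R) s))].
Proof.
move=> zt0 x0 hal.
have G := wedge_gcontour (x - l.+1%:R); have ag := gc_adm G.
have t1 : 0 < al l.+1 - al l by rewrite subr_gt0 hal// leqnn addnS ltnS leq_addr.
have [K [c [K0 c0 hK]]] := gexp_bound t1 (nrm_ge0 (be l.+1 - be l)%:C) G.
have [V [V0 hV]] := adm_bd ag.
have d'0 : 0 < Num.min (1/2) (Re zeta) by rewrite lt_min zt0 divr_gt0.
have [|C [C0 hC]] := @nestW_bound x zeta _ k l.+1 d'0 x0 zt0.
  by move=> j /andP[h1 h2]; apply: hal; rewrite (ltnW h1) addnS -addSn.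
exists (fun s => gexp (al l.+1 - al l) (be l.+1 - be l)%:C (wedge (x - l.+1%:R) s) *
  nestW x zeta k l.+1 (wedge (x - l.+1%:R) s) * wedgev s), (fun s => K * C * V * gau c s).
split.
- apply: (cmeasM _ (adm_meas ag)); apply: cmeasM.
    by apply: gexp_cmeas; exact: adm_cmeas ag.
  by apply: nestW_cmeas; exact: adm_cmeas ag.
- by apply: rintZ; exact: rint_gau.
- move=> s; rewrite (nrmM _ (wedgev s)) (nrmM (gexp _ _ _)).
  rewrite (_ : _ * gau c s = K * gau c s * C * V); last by ring.
  rewrite !ler_pM ?mulr_ge0 ?nrm_ge0// ?hK//.
  apply: hC; apply: far_rho => //; last by rewrite rho_wedge.
  by rewrite (le_trans (Re_wedge _ _))// subr_le0 (le_trans x0).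
- move=> xi; rewrite /nestW nestS; congr (_ * _).
  apply: eq_cint => s; set f := nest _ _ _ _ _ _; set e := gexp _ _ _.
  by rewrite (mulrAC e) (mulrAC (e * f)).
Qed.

(** * Replacing the left contours by wedges *)

Section Straighten.
Variables (m : nat) (G V : nat -> R -> R[i]) (A : R).
Hypothesis hal : forall j, (1 <= j < m)%N -> al j < al j.+1.
Hypothesis hG : forall l, (1 <= l <= m)%N -> gcontour (G l) (V l).
Hypothesis hneg : forall l u, (1 <= l <= m)%N -> Re (G l u) <= 0.
Hypothesis hA : forall l u, (1 <= l <= m)%N ->
  - Re (G l u) - 3/4 * (sgn u * Im (G l u)) <= A.
Hypothesis hj : forall l u, (1 <= l < m)%N -> joined_to_infinity (G l.+1) 1 (G l u).

(** Two moves: [cauchy_far] jumps to a wedge so far left that the joining path of the pole avoids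
    it, and a straight homotopy through parallel wedges, all to the left of the pole, comes back to
    [x]. *)
Lemma cauchy_wedge l t b x u : 0 < t -> (1 <= l < m)%N -> x <= - A - 1 -> x <= 0 ->
  pint (G l.+1) (V l.+1) (fun w => gexp t b w / (G l u - w)) =
  pint (wedge x) wedgev (fun w => gexp t b w / (G l u - w)).
Proof.
move=> t0 lm xA x0; have /andP[l1 l2] := lm.
have lm' : (1 <= l <= m)%N by rewrite l1 ltnW.
have Sm : (1 <= l.+1 <= m)%N by [].
have [M hM] := cauchy_far b t0 (hG Sm) (fun u => hneg u Sm) (hj u lm).
pose x' := Num.min x (- M - 1).
have x'x : x' <= x by rewrite ge_min lexx.
have x'M : x' <= - M - 1 by rewrite ge_min lexx orbT.
rewrite (hM (wedge x') wedgev (wedge_gcontour x')); last first.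
  by move=> s; rewrite (le_lt_trans (Re_wedge _ _))//; lra.
apply: (@pole_move' R _ _ _ _ _ _ _ (1/2)) => //; try exact: wedge_gcontour.
move=> l' s /andP[l'0 l'1]; rewrite nrm_distC lhom_wedge.
apply: (le_trans _ (rho_lip _ _)); rewrite rho_wedge.
have := le_trans (rho_le_sgn (G l u) u) (hA u lm'); nra.
Qed.

(** Induction from the innermost variable: once the inner integrals run over wedges, moving the
    outer contour meets only the pole on the preceding contour, handled by [cauchy_wedge], and poles
    at [zeta] or on the next wedge, which lie on a fixed side of the homotopy. *)
Lemma nest_wedge zeta x : 0 < Re zeta -> x <= - A - 1 -> x <= 0 ->
  forall k l u, (1 <= l)%N -> (l + k <= m)%N ->
  nest G V zeta k l (G l u) = nestW x zeta k l (G l u).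
Proof.
move=> zt0 xA x0; elim=> [//|k IH] l u l1; rewrite addnS => lk.
have lk' : (l < m)%N by rewrite (leq_trans _ lk)// ltnS leq_addr.
have lm : (1 <= l < m)%N by rewrite l1.
have lm' : (1 <= l <= m)%N by rewrite l1 ltnW.
have Sm : (1 <= l.+1 <= m)%N by [].
have t0 : 0 < al l.+1 - al l by rewrite subr_gt0 hal.
rewrite nestS /nestW nestS; congr (_ * _).
transitivity (pint (G l.+1) (V l.+1) (fun xi =>
   gexp (al l.+1 - al l) (be l.+1 - be l)%:C xi / (G l u - xi) * nestW x zeta k l.+1 xi)).
  by apply: eq_cint => s; rewrite IH// addSn.
have GW := wedge_gcontour (x - l.+1%:R).
have xl : x - l.+1%:R <= x by rewrite lerBlDr lerDl.
have rz := le_trans (rho_le_sgn (G l u) u) (hA u lm').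
have hzn s : G l u <> G l.+1 s.
  by have [p [_ _ p0 hp _]] := hj u lm; rewrite -p0; exact: hp.
have [d0 [d00 hd0]] := gcontour_dist (hG Sm) hzn.
pose d := Num.min d0 (Num.min (1/2) (Re zeta)).
have dp : 0 < d by rewrite !lt_min d00 zt0 divr_gt0.
have dle0 : d <= d0 by rewrite ge_min lexx.
have dle1 : d <= 1/2 by rewrite !ge_min lexx orbT.
have dle2 : d <= Re zeta by rewrite !ge_min lexx !orbT.
have hz := cauchy_wedge (be l.+1 - be l)%:C u t0 lm (le_trans xl xA) (le_trans xl x0).
have hz0 s : d <= nrm (G l u - G l.+1 s) by rewrite (le_trans dle0).
have hz1 s : d <= nrm (G l u - wedge (x - l.+1%:R) s).
  rewrite (le_trans dle1)// (le_trans _ (rho_lip _ _))// rho_wedge; lra.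
case: k IH lk => [|k] IH lk.
  apply: (@move_pole _ _ _ _ _ d _ _ t0 dp (hG Sm) GW hz hz0 hz1).
    move=> l' s l'1; rewrite nrm_distC (le_trans dle2)//.
    rewrite (le_trans _ (le_trans (ler_norm _) (Re_le_nrm _)))// ReAdd ReOpp lerDl oppr_ge0.
    by apply: Re_lhom_le => //; [exact: hneg|rewrite (le_trans (Re_wedge _ _))// (le_trans xl)].
  rewrite nrm_distC (le_trans dle2)// (le_trans _ (le_trans (ler_norm _) (Re_le_nrm _)))//.
  by rewrite ReAdd ReOpp lerDl oppr_ge0 hneg.
have hal' j : (l.+1 <= j < l.+1 + k.+1)%N -> al j < al j.+1.
  move=> /andP[h1 h2]; apply: hal; rewrite (leq_ltn_trans _ h1)//=.
  by rewrite (leq_trans h2)// addSn.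
have [psi [g [mpsi ig hpsi eP]]] := nestW_superposition zt0 x0 hal'.
have xl2 : x - l.+2%:R = x - l.+1%:R - 1 by rewrite -[in LHS]natr1; ring.
rewrite -/(nestW x) (funext eP).
apply: (@move_superposition _ _ _ _ _ d _ _ t0 dp (hG Sm) GW hz hz0 hz1 ipi psi
  (wedge (x - l.+2%:R)) g) => //.
- exact: adm_cmeas (gc_adm (wedge_gcontour _)).
- move=> l' s s' l'1; rewrite (le_trans dle1)//.
  apply: (le_trans _ (rho_lip _ _)); rewrite rho_wedge xl2.
  suff : rho (lhom (G l.+1) (wedge (x - l.+1%:R)) l' s) <= - (x - l.+1%:R) by lra.
  apply: rho_lhom => //; first by rewrite (le_trans (hA s Sm))//; lra.
  by rewrite /= sgn_mul; lra.
- by move=> s; rewrite (le_trans dle1)// (le_trans _ (rho_lip _ _))// rho_wedge xl2; lra.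
Qed.

End Straighten.

End Nested.

(** * Laplace integrals over half-lines *)

Section HalfLine.
Context {R : realType}.
Local Notation leb := (@lebesgue_measure R).
Local Notation RR := (measurableTypeR R).
Implicit Types (w z : R[i]) (p b : R).

Lemma rint_exp_abs (d : R) : 0 < d -> rint leb (fun p => expR (- (d * `|p|))).
Proof.
move=> d0; have i1 : rint leb (exponential_pdf d) by exact: integrable_exponential_pdf.
have i2 := rint_opp i1.
apply: (@rint_le _ _ RR leb _ (fun p => d^-1 * (exponential_pdf d p + exponential_pdf d (- p)))).
- apply: measurableT_comp => //; apply: measurableT_comp => //.
  by apply: measurable_funM => //; exact: measurableT_comp.
- by apply: rintZ; exact: rintD.
- move=> p; rewrite ger0_norm ?expR_ge0// -(@ler_pM2l _ d)// mulVKf ?gt_eqF//.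
  have pos q : 0 <= exponential_pdf d q by rewrite exponential_pdf_ge0// ltW.
  have [p0|p0] := leP 0 p.
    by rewrite ler_wpDr// exponential_pdfE// ger0_norm// mulNr.
  by rewrite ler_wpDl// exponential_pdfE ?oppr_ge0 ?(ltW p0)// ltr0_norm// mulNr.
Qed.

Lemma sub_abs_le p b : b <= p -> `|p| - `|b| <= p - b.
Proof. by case: (ler0P p); case: (ler0P b); lra. Qed.

Lemma cder_near (f g : R -> R[i]) t z : (\forall y \near t, f y = g y) ->
  cder f t z -> cder g t z.
Proof.
move=> fg [d1 d2]; split; [apply: near_eq_is_derive d1|apply: near_eq_is_derive d2];
  by apply: filterS fg => y ->.
Qed.

Lemma ccontat_near (f g : R -> R[i]) t : (\forall y \near t, f y = g y) ->
  ccontat f t -> ccontat g t.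
Proof.
move=> fg; have fgt : f t = g t by exact: (nbhs_singleton fg).
by move=> [d1 d2]; split; rewrite -fgt; [apply: cvg_trans d1|apply: cvg_trans d2];
  apply: near_eq_cvg; apply: filterS fg => y ->.
Qed.

Section Half.
Variables (w : R[i]) (b c : R).
Hypotheses (w0 : 0 < Re w) (c1 : `|c| <= 1).

(** The value at the endpoint is a parameter, so that one computation covers the open right ray and,
    after reflection, the closed left ray. *)
Definition half_exp p : R[i] :=
  if b < p then cexp (- ((p - b)%:C * w)) else if p < b then 0 else c%:C.

Lemma half_exp_cmeas : cmeas (T := RR) half_exp.
Proof.
apply: cmeas_if.
- exact: measurable_fun_ltr.
- apply: cmeas_cexp; apply: cmeasN; apply: cmeasM; last exact: cmeas_cst.
  by apply: cmeasC; apply: measurable_funB.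
- apply: cmeas_if; last exact: cmeas_cst; last exact: cmeas_cst.
  exact: measurable_fun_ltr.
Qed.

Lemma half_exp_le p : nrm (half_exp p) <= expR (Re w * `|b|) * expR (- (Re w * `|p|)).
Proof.
rewrite -expRD /half_exp; case: ltP => [bp|pb].
  rewrite nrm_cexp ler_expR !ReImE mul0r subr0.
  have := ler_wpM2r (ltW w0) (sub_abs_le (ltW bp)); lra.
case: ltgtP pb => // [_ _|-> _]; first by rewrite nrm0 expR_ge0.
by rewrite subrr expR0 nrmC.
Qed.

Lemma half_exp_cintble : cintble leb half_exp.
Proof.
apply: (@cintble_dom R _ RR leb _ _ half_exp_cmeas _ half_exp_le).
by apply: rintZ; exact: rint_exp_abs.
Qed.

Lemma cint_half_exp : cint leb half_exp = w^-1.
Proof.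
have w00 : w != 0 by apply: contraTneq w0 => ->; rewrite ltxx.
pose B p := - (cexp (- ((Num.max p b - b)%:C * w)) / w).
rewrite (@cFTC_lim R [:: b] B half_exp _ (expR (Re w * `|b|)) 0 (- w^-1) _
   half_exp_cmeas (rintZ (expR (Re w * `|b|)) (rint_exp_abs w0)) half_exp_le).
- by rewrite sub0r opprK.
- move=> u; apply: ccontatN; apply: ccontatM; last exact: ccontat_cst.
  apply: ccontat_cexp; apply: ccontatN; apply: ccontatM; last exact: ccontat_cst.
  apply: ccontatC; apply: cvgB; last exact: cvg_cst.
  by apply: continuous_max; [exact: cvg_id|exact: cvg_cst].
- by move=> u; rewrite ler_piMr ?expR_ge0// expR_le1 oppr_le0 mulr_ge0// ltW.
- move=> u; rewrite inE => ub.
  have [bu|ub'] := ltP b u.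
    have nb : \forall y \near u, b < y by exact: lt_nbhsr.
    have e1 : half_exp u = cexp (- ((u - b)%:C * w)) by rewrite /half_exp bu.
    have dl : cder (fun y : R => (y - b)%:C * w) u w.
      have := cderM (cderB (@cder_lin R 0 1 u) (cder_cst b%:C u)) (cder_cst w u).
      rewrite (_ : (fun u0 => _) = (fun y : R => (y - b)%:C * w)); last first.
        by apply/funext => y; rewrite add0r mulr1 -realCN -realCD.
      by move/cder_eq; apply; rewrite mulr0 addr0 subr0 mul1r.
    have dB := cderN (cderM (cder_cexp (cderN dl)) (cder_cst w^-1 u)).
    split; [apply: cder_near (cder_eq dB _)|apply: ccontat_near (cder_ccontat (cder_cexp (cderN dl)))].
    + by near=> y; have by' : b < y by [near: y]; rewrite /B (max_idPl (ltW by')).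
    + by rewrite e1 mulr0 addr0 mulNr mulNr opprK mulrAC divff// mul1r.
    + by near=> y; have by' : b < y by [near: y]; rewrite /half_exp by'.
  have {}ub : u < b by rewrite lt_neqAle ub.
  have nb : \forall y \near u, y < b by exact: lt_nbhsl.
  have e1 : half_exp u = 0 by rewrite /half_exp ltNge ub' /= ub.
  rewrite e1; split; [apply: cder_near (cder_cst (- w^-1) u)|apply: ccontat_near (ccontat_cst 0 u)].
  + near=> y; have by' : y < b by [near: y].
    by rewrite /B (max_idPr (ltW by')) subrr mul0r oppr0 cexp0 mul1r.
  + by near=> y; have by' : y < b by [near: y]; rewrite /half_exp ltNge (ltW by') /= by'.
- under eq_fun do rewrite subr0.
  apply: (@squeeze_cvgr _ _ _ _ (fun=> 0) (fun n => expR (Re w * b) * nrm w^-1 * (Re w)^-1 * n%:R^-1)).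
  - near=> n; rewrite nrm_ge0 /= /B nrmN (nrmM (cexp _)) nrm_cexp.
    have bn : b <= n%:R by near: n; exact: nbhs_infty_ger.
    have n1 : (1 : R) <= n%:R by rewrite ler1n; near: n; exact: nbhs_infty_gt.
    rewrite (max_idPl bn) !ReImE mul0r subr0.
    rewrite [X in _ <= X](_ : _ = expR (Re w * b) * (Re w * n%:R)^-1 * nrm w^-1); last by rewrite invfM; ring.
    rewrite ler_wpM2r ?nrm_ge0//.
    rewrite (_ : - _ = Re w * b - Re w * n%:R); last by ring.
    rewrite expRD ler_wpM2l ?expR_ge0// expRN lef_pV2 ?posrE ?expR_gt0 ?mulr_gt0//; last by lra.
    by apply: (le_trans _ (expR_ge1Dx _)); rewrite lerDr.
  - exact: cvg_cst.
  - rewrite -(mulr0 (expR (Re w * b) * nrm w^-1 * (Re w)^-1)); apply: cvgM; first exact: cvg_cst.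
    apply/gtr0_cvgV0; first by near=> n; rewrite ltr0n; near: n; exact: nbhs_infty_gt.
    exact: cvgr_idn.
- apply: cvg_near_cst; near=> n.
  have bn : - n%:R <= b.
    by rewrite lerNl; near: n; exact: nbhs_infty_ger.
  by rewrite /B (max_idPr bn) subrr mul0r oppr0 cexp0 mul1r subrr nrm0.
Unshelve. all: by end_near. Qed.

End Half.

Lemma cint_ray_right w b : 0 < Re w ->
  cint leb (fun p => if b < p then cexp (- ((p - b)%:C * w)) else 0) = w^-1.
Proof.
move=> w0; rewrite -(@cint_half_exp w b 0 w0) ?normr0//.
by apply: eq_cint => p; rewrite /half_exp; case: ltP => //; rewrite if_same.
Qed.

Lemma half_exp_opp w b p :
  half_exp w (- b) 1 (- p) = if p <= b then cexp ((p - b)%:C * w) else 0.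
Proof.
rewrite /half_exp; have [pb|pb|->] := ltgtP p b.
- by rewrite ltrN2 pb -mulNr -realCN opprB opprK addrC.
- by rewrite !ltrN2 pb ltNge (ltW pb).
- by rewrite !ltxx subrr mul0r cexp0.
Qed.

Lemma ray_left_cintble w b : 0 < Re w ->
  cintble leb (fun p => if p <= b then cexp ((p - b)%:C * w) else 0).
Proof.
move=> w0; have c1 : `|1 : R| <= 1 by rewrite normr1.
have [h1 h2] := half_exp_cintble (- b) w0 c1.
by under eq_fun do rewrite -half_exp_opp; split; [exact: (rint_opp h1)|exact: (rint_opp h2)].
Qed.

Lemma cint_ray_left w b : 0 < Re w ->
  cint leb (fun p => if p <= b then cexp ((p - b)%:C * w) else 0) = w^-1.
Proof.
move=> w0; have c1 : `|1 : R| <= 1 by rewrite normr1.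
rewrite -(@cint_half_exp w (- b) 1 w0 c1) -(cint_opp (half_exp_cintble (- b) w0 c1)).
by apply: eq_cint => p; rewrite half_exp_opp.
Qed.

End HalfLine.

(** * The heat kernel as an integral over a vertical line *)

Section HeatLine.
Context {R : realType}.
Local Notation leb := (@lebesgue_measure R).
Local Notation RR := (measurableTypeR R).
Implicit Types (t x p r : R).

Lemma mulCi x : x%:C * 'i%C = 0 +i* x.
Proof. by apply: cplxP; [rewrite ReMul /=|rewrite ImMul /=]; ring. Qed.

Lemma mul_imC x (y : R) : (0 +i* x) * y%:C = 0 +i* (x * y).
Proof. by apply: cplxP; [rewrite ReMul /=|rewrite ImMul /=]; ring. Qed.

(** The line is moved to the saddle point $(p-r)/(2t)$, where the exponential is a real Gaussian in
    the parameter. *)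
Lemma heat_line t x p r : 0 < t ->
  ipi * pint (vline x) (fun=> 'i%C) (gexp t (r - p)%:C) = heat t p r.
Proof.
move=> t0; pose a := - (r - p) / (2 * t).
rewrite (@gauss_move R (vline x) (fun=> 'i%C) (vline a) (fun=> 'i%C) t _ t0) //;
  try exact: vline_gcontour.
pose E := expR (- (p - r) ^+ 2 / (4 * t)).
have -> : pint (vline a) (fun=> 'i%C) (gexp t (r - p)%:C) =
    0 +i* (E * Num.sqrt (pi / t)).
  rewrite -(Rint_gauss 0 t0) -RintegralZl//; last exact: rint_gauss.
  rewrite /pint /cint.
  have e u : gexp t (r - p)%:C (vline a u) * 'i%C = 0 +i* (E * expR (- (t * (u - 0) ^+ 2))).
    have -> : gexp t (r - p)%:C (vline a u) = (E * expR (- (t * (u - 0) ^+ 2)))%:C.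
      have H z : Re z = a -> Im z = u -> t%:C * z ^+ 2 + (r - p)%:C * z =
          (- (p - r) ^+ 2 / (4 * t) - (t * (u - 0) ^+ 2))%:C.
        by move=> hr hi; apply: cplxP; rewrite expr2 !ReImE hr hi /a; field; rewrite gt_eqF.
      by rewrite /E -expRD -cexpC /gexp; congr cexp; exact: H.
    exact: mulCi.
  congr (_ +i* _).
    by under eq_Rintegral do rewrite e /=; rewrite /Rintegral integral0.
  by under eq_Rintegral do rewrite e /=.
rewrite /heat /ipi.
have pi0 : 0 < pi :> R by exact: pi_gt0.
have i0 : (0 +i* (2 * pi)) != 0 :> R[i].
  by rewrite eq_complex /= eqxx /= mulf_neq0// gt_eqF.
apply: (mulfI i0); rewrite mulrA divff// mul1r.
rewrite mul_imC -/E; congr (_ +i* _).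
have s0 : 0 < Num.sqrt (4 * pi * t) by rewrite sqrtr_gt0 !mulr_gt0.
suff -> : Num.sqrt (pi / t) = 2 * pi / Num.sqrt (4 * pi * t) by rewrite /E; field; rewrite gt_eqF.
apply: (mulIf (lt0r_neq0 s0)); rewrite divfK ?gt_eqF// -sqrtrM ?divr_ge0 ?(ltW pi0) ?(ltW t0)//.
rewrite (_ : pi / t * (4 * pi * t) = (2 * pi) ^+ 2); last by field; rewrite gt_eqF.
by rewrite sqrtr_sqr ger0_norm// mulr_ge0// ltW.
Qed.

Definition heatv t p r := (Num.sqrt (4 * pi * t))^-1 * expR (- (p - r) ^+ 2 / (4 * t)).

Lemma heatE t p r : heat t p r = (heatv t p r)%:C. Proof. by []. Qed.

Lemma heatv_ge0 t p r : 0 <= heatv t p r.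
Proof. by rewrite mulr_ge0 ?expR_ge0// invr_ge0 sqrtr_ge0. Qed.

Lemma heatv_expE t p (y : R) r : 0 < t -> heatv t p r * expR (y * r) =
  (Num.sqrt (4 * pi * t))^-1 * expR (y * p + t * y ^+ 2) *
    expR (- ((4 * t)^-1 * (r - (p + 2 * t * y)) ^+ 2)).
Proof.
move=> t0; rewrite /heatv -!mulrA; congr (_ * _); rewrite -!expRD; congr expR.
by field; rewrite gt_eqF.
Qed.

Lemma rint_heatv_exp t p (y : R) : 0 < t -> rint leb (fun r => heatv t p r * expR (y * r)).
Proof.
move=> t0; under eq_fun do rewrite (heatv_expE p y _ t0).
by apply: rintZ; apply: rint_gauss; rewrite invr_gt0 mulr_gt0.
Qed.

Lemma Rint_heatv_exp t p (y : R) : 0 < t ->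
  \int[leb]_r (heatv t p r * expR (y * r)) = expR (y * p + t * y ^+ 2).
Proof.
move=> t0; under eq_Rintegral do rewrite (heatv_expE p y _ t0).
have c0 : 0 < (4 * t)^-1 by rewrite invr_gt0 mulr_gt0.
rewrite RintegralZl//; last exact: rint_gauss.
rewrite Rint_gauss// mulrAC (_ : pi / (4 * t)^-1 = 4 * pi * t); last by rewrite invrK; ring.
by rewrite mulVf ?mul1r// gt_eqF// sqrtr_gt0 !mulr_gt0// pi_gt0.
Qed.

Lemma heat_cmeas (disp : measure_display) (T : measurableType disp) (t : R) (f g : T -> R) :
  measurable_fun setT f -> measurable_fun setT g -> cmeas (fun y => heat t (f y) (g y)).
Proof.
move=> mf mg; apply: cmeasC; apply: measurable_funM => //.
apply: measurableT_comp => //; apply: measurable_funM => //.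
by apply: measurableT_comp => //; apply: measurable_funX; exact: measurable_funB.
Qed.

End HeatLine.

(** * The nested integral as a Laplace transform of heat flow cut by indicators *)

Section PathFactor.
Context {R : realType}.
Local Notation leb := (@lebesgue_measure R).
Local Notation RR := (measurableTypeR R).
Variables al be : nat -> R.

(* The kernel 1_{<= be l} e^{(al (l+1) - al l) d^2} ... 1_{<= be (l+k-1)}
   e^{(al (l+k) - al (l+k-1)) d^2} applied to 1_{> be (l+k)} e^{- (. - be (l+k)) zeta}. *)
Fixpoint hitk (zeta : R[i]) (k l : nat) (p : R) : R[i] :=
  if k is k'.+1 then
    if p <= be l then
      cint leb (fun r => heat (al l.+1 - al l) p r * hitk zeta k' l.+1 r)
    else 0
  else if be l < p then cexp (- ((p - be l)%:C * zeta)) else 0.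

Lemma hitk_cmeas k l (disp : measure_display) (T : measurableType disp)
    (f : T -> R[i]) (g : T -> R) :
  cmeas f -> measurable_fun setT g -> cmeas (fun x => hitk (f x) k l (g x)).
Proof.
elim: k l disp T f g => [|k IH] l disp T f g mf mg.
  apply: cmeas_if; last exact: cmeas_cst.
    exact: measurable_fun_ltr.
  apply: cmeas_cexp; apply: cmeasN; apply: (cmeasM _ mf).
  by apply: cmeasC; apply: measurable_funB.
apply: cmeas_if; last exact: cmeas_cst.
  exact: measurable_fun_ler.
have mu1 : measurable_fun setT (@fst T RR) by exact: measurable_fst.
have mu2 : measurable_fun setT (@snd T RR) by exact: measurable_snd.
apply: (@cmeas_cint R _ _ T RR leb (fun yr => heat (al l.+1 - al l) (g yr.1) yr.2 *
  hitk (f yr.1) k l.+1 yr.2)).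
apply: cmeasM; first by apply: heat_cmeas => //; exact: measurableT_comp mg mu1.
by apply: IH => //; exact: cmeas_comp mf mu1.
Qed.

(** The terminal function is at most $e^{y(p-\beta_{l+k})}$ for every $y\ge0$, and heat flow for
    time $t$ maps $e^{yp}$ to $e^{yp+ty^2}$. The free parameter $y$ is what later produces Gaussian
    decay. The factor $2$ per step is that of [nrm_cint]. *)
Lemma hitk_bound zeta k l p (y : R) : 0 <= Re zeta -> 0 <= y ->
  (forall j, (l <= j < l + k)%N -> al j < al j.+1) ->
  nrm (hitk zeta k l p) <=
    2 ^+ k * expR (y * (p - be (l + k)%N) + (al (l + k)%N - al l) * y ^+ 2).
Proof.
move=> z0 y0; elim: k l p => [|k IH] l p hal.
  rewrite expr0 mul1r addn0 subrr mul0r addr0 /=; case: ltP => [bp|_]; last first.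
    by rewrite nrm0 expR_ge0.
  have pb : 0 <= p - be l by rewrite subr_ge0 ltW.
  rewrite nrm_cexp ler_expR !ReImE mul0r subr0 (@le_trans _ _ 0) ?mulr_ge0//.
  by rewrite oppr_le0 mulr_ge0.
rewrite /=; case: (leP p (be l)) => [_|_]; last by rewrite nrm0 mulr_ge0 ?expR_ge0 ?exprn_ge0.
have t0 : 0 < al l.+1 - al l by rewrite subr_gt0 hal// leqnn addnS ltnS leq_addr.
pose c := 2 ^+ k * expR (- (y * be (l.+1 + k)%N) + (al (l.+1 + k)%N - al l.+1) * y ^+ 2).
have h r : nrm (heat (al l.+1 - al l) p r * hitk zeta k l.+1 r) <=
    c * (heatv (al l.+1 - al l) p r * expR (y * r)).
  rewrite nrmM heatE nrmC ger0_norm ?heatv_ge0// /c.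
  rewrite (_ : _ * (_ * _) = heatv (al l.+1 - al l) p r *
    (2 ^+ k * (expR (- (y * be (l.+1 + k)%N) + (al (l.+1 + k)%N - al l.+1) * y ^+ 2) * expR (y * r)))); last by ring.
  rewrite ler_wpM2l ?heatv_ge0// -expRD (le_trans (IH _ _ _))//.
    by move=> j /andP[h1 h2]; apply: hal; rewrite (ltnW h1) addnS -addSn.
  by rewrite ler_wpM2l ?exprn_ge0// ler_expR; lra.
have hh := @nrm_cint R _ RR leb (fun r => heat (al l.+1 - al l) p r * hitk zeta k l.+1 r)
  (fun r => c * (heatv (al l.+1 - al l) p r * expR (y * r))) _ _ h.
apply: (le_trans (hh _ _)).
- apply: cmeasM; first by apply: heat_cmeas => //; exact: measurable_cst.
  by apply: hitk_cmeas; [exact: cmeas_cst|exact: measurable_id].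
- by apply: rintZ; exact: rint_heatv_exp.
rewrite RintegralZl//; last exact: rint_heatv_exp.
rewrite Rint_heatv_exp// /c; set a := - (y * _) + _; set e := y * p + _.
rewrite (_ : 2 * _ = 2 ^+ k.+1 * (expR a * expR e)); last by rewrite exprS; ring.
rewrite ler_wpM2l ?exprn_ge0// -expRD ler_expR /a /e addnS -addSn; lra.
Qed.

Lemma hitkS_gt zeta k l p : be l < p -> hitk zeta k.+1 l p = 0.
Proof. by move=> h; rewrite /= leNgt h. Qed.

(** Without heat steps the decay on the right comes from [zeta]. With heat steps the support is
    $p\le\beta_l$, and [hitk_bound] at $y=1-x$ turns the factor $e^{xp}$ into $e^p$, which decays on
    the left. *)
Lemma hitk_dom zeta k l (x : R) : 0 < Re zeta -> x <= 0 ->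
  (forall j, (l <= j < l + k)%N -> al j < al j.+1) ->
  exists g : R -> R, rint leb g /\ forall p, expR (x * p) * nrm (hitk zeta k l p) <= g p.
Proof.
move=> z0 x0 hal; case: k hal => [|k] hal.
  exists (fun p => expR (Re zeta * `|be l| + 2 * (- x) * `|be l|) * expR (- ((Re zeta - x) * `|p|))).
  split; first by apply: rintZ; apply: rint_exp_abs; lra.
  move=> p; rewrite -expRD /=; case: ltP => [bp|_]; last by rewrite nrm0 mulr0 expR_ge0.
  rewrite nrm_cexp -!expRD ler_expR !ReImE mul0r subr0.
  have h := sub_abs_le (ltW bp).
  have h1 := ler_wpM2r (ltW z0) h.
  have h2 : (- x) * (`|p| - `|be l|) <= (- x) * (p - be l) by rewrite ler_wpM2l// oppr_ge0.
  have h3 : (-x) * (- be l) <= (- x) * `|be l|.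
    by rewrite ler_wpM2l ?oppr_ge0// -normrN ler_norm.
  lra.
pose b := be (l + k.+1)%N; pose T := al (l + k.+1)%N - al l.
exists (fun p => 2 ^+ k.+1 * expR (- ((1 - x) * b) + T * (1 - x) ^+ 2 + 2 * `|be l|) *
  expR (- (1 * `|p|))).
split; first by apply: rintZ; apply: rint_exp_abs.
move=> p; have [pb|pb] := leP p (be l); last first.
  by rewrite hitkS_gt// nrm0 mulr0 !mulr_ge0 ?expR_ge0 ?exprn_ge0.
have y0 : 0 <= 1 - x by lra.
rewrite mulrC (le_trans (ler_wpM2r (expR_ge0 _) (hitk_bound p (ltW z0) y0 hal)))//.
rewrite -!mulrA ler_wpM2l ?exprn_ge0// -!expRD ler_expR -/b -/T.
have := @sub_abs_le R (- p) (- be l); rewrite lerN2 => /(_ pb); rewrite !normrN.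
have := ler_norm (be l); lra.
Qed.

Lemma hitk_cintble zeta k l (z : R[i]) : 0 < Re zeta -> Re z <= 0 ->
  (forall j, (l <= j < l + k)%N -> al j < al j.+1) ->
  cintble leb (fun p => cexp (p%:C * z) * hitk zeta k l p).
Proof.
move=> zt0 z0 hal; have [g [ig hg]] := hitk_dom zt0 z0 hal.
apply: (@cintble_dom R _ RR leb _ g) => //.
- apply: cmeasM; last by apply: hitk_cmeas; [exact: cmeas_cst|exact: measurable_id].
  by apply: cmeas_cexp; apply: cmeasM; [apply: cmeasC|exact: cmeas_cst].
- by move=> p; rewrite nrmM nrm_cexp !ReImE mul0r subr0 (mulrC p); exact: hg.
Qed.

(* Both contour moves keep the inner poles (on the next wedge, or at zeta) on
   one side; afterwards 1/(z - xi) is an absolutely convergent Laplace integral. *)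
Lemma nestW_hitk zeta x : 0 < Re zeta -> x <= 0 -> forall k l z,
  (forall j, (l <= j < l + k)%N -> al j < al j.+1) ->
  x - l.+1%:R < Re z -> Re z <= 0 ->
  nestW al be x zeta k l z =
  - (cexp (- ((be l)%:C * z)) * cint leb (fun p => cexp (p%:C * z) * hitk zeta k l p)).
Proof.
move=> zt0 x0; elim=> [|k IH] l z hal xz z0.
  have w0 : 0 < Re (zeta - z) by rewrite !ReImE; lra.
  rewrite /nestW /nest.
  transitivity (- (zeta - z)^-1); first by rewrite -(opprB zeta z) invrN.
  congr (- _).
  rewrite -(cint_ray_right (be l) w0) -cintZ; last exact: hitk_cintble.
  apply: eq_cint => p; rewrite /hitk; case: ifP => _; last by rewrite !mulr0.
  by rewrite -!cexpD realCD realCN; congr cexp; ring.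
set x1 := x - l.+1%:R in xz.
have x10 : x1 <= 0 by rewrite subr_le0 (le_trans x0).
pose t := al l.+1 - al l.
have t0 : 0 < t by rewrite subr_gt0 hal// leqnn addnS ltnS leq_addr.
have hal' j : (l.+1 <= j < l.+1 + k)%N -> al j < al j.+1.
  by move=> /andP[h1 h2]; apply: hal; rewrite (ltnW h1) addnS -addSn.
have xl2 : x - l.+2%:R = x1 - 1 by rewrite /x1 -[in LHS]natr1; ring.
have GW := wedge_gcontour x1; have GL := vline_gcontour x1.
pose d := Num.min (Re z - x1) (Num.min (1/2) (Re zeta)).
have dp : 0 < d by rewrite !lt_min zt0 divr_gt0// subr_gt0 xz.
have d1 : d <= Re z - x1 by rewrite ge_min lexx.
have d2 : d <= 1/2 by rewrite !ge_min lexx orbT.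
have d3 : d <= Re zeta by rewrite !ge_min lexx !orbT.
have hw u : Re (wedge x1 u) <= x1 by exact: Re_wedge.
have hl u : Re (vline x1 u) <= x1 by [].
have far_left z1 z2 : d <= Re z1 - Re z2 -> d <= nrm (z1 - z2).
  by move=> h; rewrite (le_trans h)// -ReOpp -ReAdd (le_trans (ler_norm _))// Re_le_nrm.
have hz := pole_move_right (be l.+1 - be l)%:C t0 GW GL xz hw hl.
have hz0 u : d <= nrm (z - wedge x1 u) by apply: far_left; have := hw u; lra.
have hz1 u : d <= nrm (z - vline x1 u) by apply: far_left; have := hl u; lra.
have -> : nestW al be x zeta k.+1 l z = ipi * pint (vline x1) (fun=> 'i%C) (fun xi =>
    gexp t (be l.+1 - be l)%:C xi / (z - xi) * nestW al be x zeta k l.+1 xi).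
  rewrite /nestW nestS -/(nestW al be x); congr (_ * _).
  case: k hal hal' {IH} => [|k] hal hal'.
    apply: (@move_pole _ _ _ _ _ _ d _ _ t0 dp GW GL hz hz0 hz1).
      move=> l' u l'1; rewrite nrm_distC; apply: far_left.
      by have := Re_lhom_le l'1 (hw u) (hl u); lra.
    by rewrite nrm_distC; apply: far_left; lra.
  have [psi [g [mpsi ig hpsi eP]]] := nestW_superposition be zt0 x0 hal'.
  rewrite (funext eP).
  apply: (@move_superposition _ _ _ _ _ _ d _ _ t0 dp GW GL hz hz0 hz1 ipi psi
    (wedge (x - l.+2%:R)) g) => //.
  - exact: adm_cmeas (gc_adm (wedge_gcontour _)).
  - move=> l' s s' l'1; rewrite (le_trans d2)//.
    apply: (le_trans _ (rho_lip _ _)); rewrite rho_wedge xl2.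
    suff : rho (lhom (wedge x1) (vline x1) l' s) <= - x1 by lra.
    apply: rho_lhom => //; first by rewrite /= sgn_mul; lra.
    by rewrite /= sgn_mul; have := normr_ge0 s; lra.
  - move=> s; apply: far_left; have := Re_wedge (x - l.+2%:R) s; lra.
pose xi u := vline x1 u.
(* Here $1/(z-\xi)$ is the integral over $p\le\beta_l$ of [P], and by induction the inner factor is
   an integral over $r$ of [Q]; [E] keeps the Gaussian and the velocity. The integrals are then
   reordered so that the one over the line is done first. *)
pose E u := ipi * (- (gexp t (- (be l))%:C (xi u) * 'i%C)).
pose P u p := if p <= be l then cexp ((p - be l)%:C * (z - xi u)) else 0.
pose Q u r := cexp (r%:C * xi u) * hitk zeta k l.+1 r.
have [gA [iA hA]] := hitk_dom zt0 x10 hal'.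
have hQ u r : nrm (Q u r) <= gA r.
  by rewrite nrmM nrm_cexp !ReImE mul0r subr0 (mulrC r); exact: hA.
have [K [c [K0 c0 hK]]] := gexp_bound t0 (nrm_ge0 (- (be l))%:C) GL.
have mu1 : measurable_fun setT (@fst RR RR) by exact: measurable_fst.
have mu2 : measurable_fun setT (@snd RR RR) by exact: measurable_snd.
have mxi : cmeas (T := RR) xi := adm_cmeas (gc_adm GL).
have mE : cmeas (T := RR) E.
  apply: cmeasM; first exact: cmeas_cst.
  by apply: cmeasN; apply: cmeasM; [exact: gexp_cmeas|exact: cmeas_cst].
have mP : cmeas (fun up : RR * RR => P up.1 up.2).
  apply: cmeas_if; last exact: cmeas_cst.
    by apply: measurable_fun_ler => //; exact: measurable_cst.
  apply: cmeas_cexp; apply: cmeasM.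
    by apply: cmeasC; apply: measurable_funB => //; exact: measurable_cst.
  by apply: cmeasB; [exact: cmeas_cst|exact: cmeas_comp mxi mu1].
have mQ : cmeas (fun ur : RR * RR => Q ur.1 ur.2).
  apply: cmeasM.
    by apply: cmeas_cexp; apply: cmeasM; [exact: cmeasC|exact: cmeas_comp mxi mu1].
  by apply: hitk_cmeas => //; exact: cmeas_cst.
have mQ1 u : cmeas (T := RR) (Q u) by exact: (cmeas_comp mQ (pair1_measurable u)).
have mcQ : cmeas (T := RR) (fun u => cint leb (Q u)) by exact: (cmeas_cint leb mQ).
have iQ u : cintble leb (Q u) by apply: (cintble_dom (mQ1 u) iA); exact: hQ.
have i1 : nrm 'i%C = 1 :> R by rewrite nrmE /= expr0n /= add0r expr1n sqrtr1.
have [KI [KI0 hE]] : exists KI, 0 <= KI /\ forall u, nrm (E u) <= KI * gau c u.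
  exists (nrm (@ipi R) * K); split; first by rewrite mulr_ge0 ?nrm_ge0.
  by move=> u; rewrite nrmM nrmN (nrmM _ 'i%C) i1 mulr1 -mulrA ler_wpM2l ?nrm_ge0// hK.
(* On a vertical line $\mathrm{Re}\,\xi$ is constant, so the modulus of [P] does not depend on [u];
   this gives the product majorant for Fubini. *)
have hP u p : nrm (P u p) = nrm (P 0 p).
  by rewrite /P; case: ifP => // _; rewrite !nrm_cexp !ReImE !mul0r.
have w0 u : 0 < Re (z - xi u) by rewrite ReAdd ReOpp; have := hl u; rewrite -/(xi u); lra.
have iP u : cintble leb (P u) by exact: ray_left_cintble.
have gA0 r : 0 <= gA r by rewrite (le_trans (nrm_ge0 _) (hQ 0 r)).
transitivity (cint leb (fun u => cint leb (fun p => E u * cint leb (Q u) * P u p))).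
  rewrite /pint -cintZ; last first.
    have dz0 : 0 < Num.min (1/2) (Re zeta) by rewrite lt_min zt0 divr_gt0.
    have [Cn [Cn0 hCn]] := nestW_bound be dz0 x0 zt0 hal'.
    rewrite (_ : (fun u => _) = (fun u => gexp t (be l.+1 - be l)%:C (xi u) *
       ((z - xi u)^-1 * nestW al be x zeta k l.+1 (xi u)) * 'i%C)); last first.
      by apply/funext => u; rewrite !mulrA.
    apply: (@gexpM_cintble _ _ _ _ _ _ (d^-1 * Cn)) => //.
      apply: cmeasM; last by apply: nestW_cmeas; exact: mxi.
      by apply: cmeasV; apply: cmeasB => //; exact: cmeas_cst.
    move=> u; rewrite nrmM ler_pM ?nrm_ge0// ?nrm_inv_le//.
    apply: hCn; apply: far_rho => //.
    exact: rho_vline.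
  apply: eq_cint => u; rewrite cintZ// /P cint_ray_left//.
  rewrite IH//; last by rewrite xl2 /=; lra.
  rewrite /E -/(xi u).
  have -> : gexp t (be l.+1 - be l)%:C (xi u) =
    gexp t (- (be l))%:C (xi u) * cexp ((be l.+1)%:C * xi u).
    by rewrite /gexp -cexpD; congr cexp; rewrite realCD realCN; ring.
  rewrite cexpN.
  have := cexp_neq0 ((be l.+1)%:C * xi u); set e := cexp _ => e0.
  rewrite -/(Q u); set q := cint _ _; set f := (z - xi u)^-1; set g' := gexp _ _ _.
  by field.
rewrite (@cfubini R _ _ _ _ leb leb (fun up : RR * RR => E up.1 * cint leb (Q up.1) * P up.1 up.2)
  (fun u => (KI * (2 * Rintegral leb setT gA)) * gau c u) (fun p => nrm (P 0 p)))//.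
- rewrite -cintZ; last exact: hitk_cintble.
  rewrite -cintN; last by apply: cintbleZ; exact: hitk_cintble.
  apply: eq_cint => p /=.
  pose F (ur : RR * RR) := E ur.1 * P ur.1 p * Q ur.1 ur.2.
  have mPp : cmeas (T := RR) (fun u => P u p) by exact: (cmeas_comp mP (pair2_measurable p)).
  have mF : cmeas F.
    apply: (cmeasM _ mQ); apply: cmeasM; first exact: cmeas_comp mE mu1.
    exact: (cmeas_comp mPp mu1).
  transitivity (cint leb (fun u => cint leb (fun r => F (u, r)))).
    apply: eq_cint => u; rewrite mulrAC -cintZ//.
  rewrite (@cfubini R _ _ _ _ leb leb F (fun u => (KI * nrm (P 0 p)) * gau c u) gA)//.
  + have [pb|pb] := leP p (be l); last first.
      rewrite !mulr0 oppr0 -[RHS](@cint0 R _ RR leb); apply: eq_cint => r.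
      rewrite -[RHS](@cint0 R _ RR leb); apply: eq_cint => u.
      by rewrite /F /P /= leNgt pb mulr0 mul0r.
    have ih : cintble leb (fun r => heat t p r * hitk zeta k l.+1 r).
      apply: (@cintble_dom R _ RR leb _ (fun r => 2 ^+ k * (heatv t p r * expR (0 * r)))).
      - apply: cmeasM; first by apply: heat_cmeas => //; exact: measurable_cst.
        by apply: hitk_cmeas => //; exact: cmeas_cst.
      - by apply: rintZ; exact: rint_heatv_exp.
      - move=> r; rewrite nrmM heatE nrmC ger0_norm ?heatv_ge0// mulrC.
        rewrite mul0r expR0 mulr1 ler_wpM2r ?heatv_ge0//.
        have := hitk_bound r (ltW zt0) (lexx 0) hal'.
        by rewrite mul0r expr0n mulr0 addr0 expR0 mulr1.
    (* For fixed $p$ and $r$ the integral over the line contains only $e^{t\xi^2+(r-p)\xi}$, which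
       gives the heat kernel by [heat_line]. *)
    rewrite mulrA -mulNr -cintZ//; apply: eq_cint => r.
    rewrite -(heat_line x1 p r t0) /pint.
    have ig := gexp_cintble (r - p)%:C t0 GL.
    set A := hitk zeta k l.+1 r; set c1 := cexp (- _); set c2 := cexp (_ * z).
    rewrite [RHS](_ : _ = (- (c1 * c2) * A * ipi) *
      cint leb (fun u => gexp t (r - p)%:C (vline x1 u) * 'i%C)); last by ring.
    rewrite -cintZ//; apply: eq_cint => u.
    rewrite /F [X in X = _]/= /P pb /E /Q -/A -/(xi u).
    have e : gexp t (- (be l))%:C (xi u) * cexp ((p - be l)%:C * (z - xi u)) * cexp (r%:C * xi u) =
        c1 * c2 * gexp t (r - p)%:C (xi u).
      by rewrite /c1 /c2 /gexp -!cexpD; congr cexp; rewrite !realCD !realCN; ring.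
    rewrite [RHS](_ : _ = - ipi * A * 'i%C * (c1 * c2 * gexp t (r - p)%:C (xi u))); last by ring.
    by rewrite -e; ring.
  + by move=> u; rewrite !mulr_ge0 ?nrm_ge0 ?gau_ge0.
  + by apply: rintZ; exact: rint_gau.
  + move=> u r; rewrite /F /= (nrmM _ (Q u r)) (nrmM (E u)) hP.
    rewrite (_ : _ * gA r = KI * gau c u * nrm (P 0 p) * gA r); last by ring.
    by rewrite !ler_pM ?mulr_ge0 ?nrm_ge0.
- apply: (cmeasM _ mP); apply: cmeasM; first exact: cmeas_comp mE mu1.
  exact: (cmeas_comp mcQ mu1).
- move=> u; rewrite !mulr_ge0 ?nrm_ge0 ?gau_ge0//.
  by apply: Rintegral_ge0.
- by move=> p; exact: nrm_ge0.
- by apply: rintZ; exact: rint_gau.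
- exact: cintble_nrm.
- move=> u p; rewrite /= (nrmM _ (P u p)) (nrmM (E u)) hP.
  rewrite (_ : _ * gau c u = KI * gau c u * (2 * Rintegral leb setT gA)); last by ring.
  rewrite !ler_pM ?mulr_ge0 ?nrm_ge0//.
  exact: (@nrm_cint R _ RR leb (Q u) gA).
Qed.

End PathFactor.

(** * Fredholm series of a product *)

Section Hadamard.
Context {R : realType}.
Local Open Scope sesquilinear_scope.

Lemma nrm_conj (z : R[i]) : nrm (Num.conj z) = nrm z.
Proof. by case: z => a b; rewrite !nrmE /= sqrrN. Qed.

Lemma mul_conj_nrm (z : R[i]) : z * Num.conj z = (nrm z ^+ 2)%:C.
Proof. by apply: cplxP; rewrite nrm_sqr; case: z => a b /=; ring. Qed.

(** Gram-Schmidt writes $A=LU$ with $L$ lower triangular and $U$ unitary. Then $|\det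
    A|=\prod|L_{ii}|$, and $|L_{ii}|$ is at most the norm of the $i$-th row of $L$, which equals
    that of $A$ because $LL^*=AA^*$. *)
Lemma hadamard n (A : 'M[R[i]]_n) (C : R) : 0 <= C -> (forall i j, nrm (A i j) <= C) ->
  nrm (\det A) <= (Num.sqrt n%:R * C) ^+ n.
Proof.
move=> C0 hA; pose U := schmidt A; pose L := A *m U ^t*.
have UU : U *m U ^t* = 1%:M by apply/unitarymxP; exact: schmidt_unitarymx.
have UU' : U ^t* *m U = 1%:M by exact: mulmx1C.
have AE : A = L *m U by rewrite /L -mulmxA UU' mulmx1.
have Ltri : is_trig_mx L.
  apply/is_trig_mxP => i j ij.
  have : (row i A <= kermx ((row j U) ^t*))%MS.
    apply: (submx_trans (row_schmidt_sub A i)); apply/sumsmx_subP => k ki.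
    rewrite genmxE; apply/sub_kermxP; apply/matrixP => a b.
    have := congr1 (fun f => fun_of_matrix f k j) UU.
    have kj : (k == j) = false.
      by apply/negbTE; rewrite neq_ltn (leq_ltn_trans ki ij).
    rewrite !mxE kj => h; rewrite -[RHS]h; apply: eq_bigr => s _; rewrite !mxE//.
  move/sub_kermxP => /(congr1 (fun f => fun_of_matrix f 0 0)); rewrite !mxE => h.
  rewrite -[RHS]h; apply: eq_bigr => s _; rewrite !mxE//.
have LL i : nrm (L i i) <= Num.sqrt n%:R * C.
  rewrite -(@ler_pXn2r _ 2)// ?nnegrE ?nrm_ge0 ?mulr_ge0 ?sqrtr_ge0//.
  have e : L *m L ^t* = A *m A ^t*.
    have H (B : matrix R[i] n n) : (B *m U) *m (B *m U) ^t* = B *m B ^t*.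
      by rewrite trmx_mul map_mxM -mulmxA (mulmxA U) UU mul1mx.
    by rewrite -(H L) -AE.
  have e2 (M : 'M[R[i]]_n) : (M *m M ^t*) i i = (\sum_j nrm (M i j) ^+ 2)%:C.
    rewrite mxE rmorph_sum; apply: eq_bigr => j _.
    by rewrite !mxE mul_conj_nrm.
  have := congr1 (fun f => Re (fun_of_matrix f i i)) e; rewrite !e2 !ReC => {}e.
  rewrite (@le_trans _ _ (\sum_j nrm (L i j) ^+ 2))//.
    by rewrite (bigD1 i)//= lerDl sumr_ge0// => j _; rewrite exprn_ge0// nrm_ge0.
  rewrite e exprMn sqr_sqrtr ?ler0n// (@le_trans _ _ (\sum_(j < n) C ^+ 2))//.
    by apply: ler_sum => j _; rewrite ler_pXn2r ?nnegrE ?nrm_ge0.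
  by rewrite sumr_const card_ord mulr_natl.
have dU : nrm (\det U) = 1.
  have := congr1 (fun M => nrm (\det M)) UU.
  rewrite det_mulmx det1 nrm1 nrmM det_map_mx det_tr nrm_conj -expr2 => /eqP.
  by rewrite sqrp_eq1 ?nrm_ge0// => /eqP.
rewrite AE det_mulmx nrmM dU mulr1 det_trig// nrm_prod.
rewrite -[X in _ <= _ ^+ X](card_ord n) -prodr_const.
by apply: ler_prod => i _; rewrite nrm_ge0 LL.
Qed.

(** Compare squares: $k^k/k!\le e^k$, and with $x=4ec^2$ also
    $e^kc^{2k}/k!=4^{-k}x^k/k!\le4^{-k}e^x$. The square root gives $K=e^{x/2}$ and the ratio
    $1/2$. *)
Lemma hadamard_series (c : R) : 0 <= c ->
  exists K : R, 0 <= K /\ forall k : nat, (k`!%:R)^-1 * (Num.sqrt k%:R * c) ^+ k <= K * (1/2) ^+ k.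
Proof.
move=> c0; pose x := (2 * c * expR (1/2)) ^+ 2.
have x0 : 0 <= x by exact: sqr_ge0.
have pw (y : R) (k : nat) : 0 <= y -> y ^+ k / k`!%:R <= expR y.
  move=> y0; case: k => [|k]; first by rewrite expr0 fact0 divr1 -[1]addr0 (le_trans _ (expR_ge1Dx _))// lerD2l.
  by apply: le_trans (expR_ge1Dxn k y0); rewrite lerDr.
exists (Num.sqrt (expR x)); split; first exact: sqrtr_ge0.
move=> k; have f0 : 0 < k`!%:R :> R by rewrite ltr0n fact_gt0.
have sX (a : R) (n : nat) : 0 <= a -> Num.sqrt a ^+ n = Num.sqrt (a ^+ n).
  move=> a0; elim: n => [|n IH]; first by rewrite !expr0 sqrtr1.
  by rewrite !exprS IH sqrtrM.
have kc : 0 <= k%:R * c ^+ 2 :> R by rewrite mulr_ge0// sqr_ge0.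
have -> : Num.sqrt k%:R * c = Num.sqrt (k%:R * c ^+ 2).
  by rewrite sqrtrM// sqrtr_sqr ger0_norm.
have h4 : 1/2 = Num.sqrt ((1/2) ^+ 2) :> R by rewrite sqrtr_sqr ger0_norm ?divr_ge0.
rewrite sX// h4 sX ?sqr_ge0// -sqrtrM ?expR_ge0//.
have -> : (k`!%:R)^-1 = Num.sqrt ((k`!%:R)^-1 ^+ 2) :> R.
  by rewrite sqrtr_sqr ger0_norm// invr_ge0 ltW.
rewrite -sqrtrM ?sqr_ge0// ler_wsqrtr//.
have h1 := pw k%:R k (ler0n _ _); have h2 := pw x k x0.
rewrite [X in X <= _](_ : _ = (k%:R ^+ k / k`!%:R) * ((c ^+ 2) ^+ k / k`!%:R)); last first.
  by rewrite exprMn expr2; ring.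
apply: (@le_trans _ _ (expR k%:R * ((c ^+ 2) ^+ k / k`!%:R))).
  by rewrite ler_wpM2r// divr_ge0 ?exprn_ge0 ?sqr_ge0.
have -> : expR (k%:R : R) = expR (1/2) ^+ 2 ^+ k.
  by rewrite -!expRM_natl; congr expR; field.
apply: le_trans (ler_wpM2r _ h2); last by rewrite exprn_ge0// sqr_ge0.
rewrite le_eqVlt; apply/orP; left; apply/eqP.
have h : 4 ^+ k * (1/2) ^+ 2 ^+ k = 1 :> R.
  by rewrite -exprMn (_ : 4 * _ = 1) ?expr1n//; field.
have -> : x = 4 * (expR (1/2) ^+ 2 * c ^+ 2) by rewrite /x; ring.
move: h; set q := (1/2) ^+ 2; set e := expR (1/2) ^+ 2; set c' := c ^+ 2 => h.
move: q e c' h => q e c' h.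
rewrite !exprMn (_ : _ * q ^+ k = e ^+ k * (c' ^+ k / k`!%:R) * (4 ^+ k * q ^+ k)); last by ring.
by rewrite h mulr1.
Qed.

Lemma geometric_cvg (D : nat -> R) (K : R) : (forall k, `|D k| <= K * (1/2) ^+ k) ->
  cvgn (fun n => \sum_(k < n) D k).
Proof.
move=> hD.
have : cvgn (series D).
  apply: normed_cvg.
  apply: (@series_le_cvg _ _ (fun k => K * (1/2) ^+ k)) => //.
  - by move=> k; apply: normr_ge0.
  - by move=> k; apply: le_trans (hD k); exact: normr_ge0.
  - by apply: (@is_cvg_geometric_series R K (1/2)); rewrite ger0_norm ?divr_ge0//; lra.
suff -> : (fun n => \sum_(k < n) D k) = series D by [].
by apply/funext => n; rewrite /series /= big_mkord.
Qed.

End Hadamard.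

(* What is used of an integral I over X; g is the weight that dominates the
   integrands. *)
Section IntegralFunctional.
Context {R : realType}.

Definition dominated d (X : measurableType d) (g : X -> R) (F : X -> R[i]) (C : R) :=
  cmeas F /\ forall x, nrm (F x) <= C * g x.

Record ifun d (X : measurableType d) (I : (X -> R[i]) -> R[i]) (g : X -> R) (H : R) : Prop := IFun {
  if_ge0 : forall x, 0 <= g x;
  if_H : 0 <= H;
  if_meas : forall d' (T : measurableType d') (F : T * X -> R[i]), cmeas F ->
    cmeas (fun t => I (fun x => F (t, x)));
  if_add : forall F1 F2 C1 C2, dominated g F1 C1 -> dominated g F2 C2 ->
    I (fun x => F1 x + F2 x) = I F1 + I F2;
  if_scale : forall c F C, dominated g F C -> I (fun x => c * F x) = c * I F;
  if_bd : forall F C, dominated g F C -> nrm (I F) <= H * C }.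

Section Iterated.
Context d (X : measurableType d) (I : (X -> R[i]) -> R[i]) (g : X -> R) (H : R).
Hypothesis hI : ifun I g H.
Local Notation J := (iterated_int I).

Definition tprod k (xs : k.-tuple X) : R := \prod_(a < k) g (tnth xs a).

Lemma tprod_cons k x (xs : k.-tuple X) : tprod [tuple of x :: xs] = g x * tprod xs.
Proof.
by rewrite /tprod big_ord_recl tnth0; congr (_ * _); apply: eq_bigr => i _; rewrite tnthS.
Qed.

Lemma tprod_ge0 k (xs : k.-tuple X) : 0 <= tprod xs.
Proof. by apply: prodr_ge0 => i _; exact: if_ge0 hI _. Qed.

Lemma iter_meas k d' (T : measurableType d') (F : T * k.-tuple X -> R[i]) : cmeas F ->
  cmeas (fun t => J (fun xs => F (t, xs))).
Proof.
elim: k d' T F => [|k IH] d' T F mF /=.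
  by apply: (cmeas_comp mF); apply: pair2_measurable.
apply: (if_meas hI (F := fun tx => J (fun xs => F (tx.1, [tuple of tx.2 :: xs])))).
apply: (IH _ _ (fun q => F (q.1.1, [tuple of q.1.2 :: q.2]))).
apply: (cmeas_comp mF); apply/measurable_fun_pairP; split => /=.
  exact: (measurableT_comp measurable_fst measurable_fst).
apply: measurable_cons; last exact: measurable_snd.
exact: (measurableT_comp measurable_snd measurable_fst).
Qed.

Lemma iter_bd k (F : k.-tuple X -> R[i]) (C : R) : cmeas F ->
  (forall xs, nrm (F xs) <= C * tprod xs) -> nrm (J F) <= H ^+ k * C.
Proof.
elim: k F C => [|k IH] F C mF hF /=.
  by rewrite expr0 mul1r (le_trans (hF _))// /tprod big_ord0 mulr1.
rewrite exprS -mulrA; apply: (if_bd hI); split.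
  apply: (iter_meas (F := fun q => F [tuple of q.1 :: q.2])).
  by apply: (cmeas_comp mF); apply: measurable_cons.
move=> x; rewrite -mulrA; apply: IH.
  apply: (cmeas_comp mF); apply: measurable_cons => //; exact: measurable_cst.
by move=> xs; rewrite (le_trans (hF _))// tprod_cons mulrA.
Qed.

Lemma consL_meas k (F : k.+1.-tuple X -> R[i]) (x : X) : cmeas F ->
  cmeas (fun xs : k.-tuple X => F [tuple of x :: xs]).
Proof.
by move=> mF; apply: (cmeas_comp mF); apply: measurable_cons => //; exact: measurable_cst.
Qed.

Lemma cons_meas k (F : k.+1.-tuple X -> R[i]) : cmeas F ->
  cmeas (fun x => J (fun xs : k.-tuple X => F [tuple of x :: xs])).
Proof.
move=> mF; apply: (iter_meas (F := fun q => F [tuple of q.1 :: q.2])).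
by apply: (cmeas_comp mF); apply: measurable_cons.
Qed.

Lemma consL_bd k (F : k.+1.-tuple X -> R[i]) (C : R) :
  (forall xs, nrm (F xs) <= C * tprod xs) ->
  forall x (xs : k.-tuple X), nrm (F [tuple of x :: xs]) <= (C * g x) * tprod xs.
Proof. by move=> hF x xs; rewrite (le_trans (hF _))// tprod_cons mulrA. Qed.

Lemma cons_dom k (F : k.+1.-tuple X -> R[i]) (C : R) : cmeas F ->
  (forall xs, nrm (F xs) <= C * tprod xs) ->
  dominated g (fun x => J (fun xs : k.-tuple X => F [tuple of x :: xs])) (H ^+ k * C).
Proof.
move=> mF hF; split; first exact: cons_meas.
by move=> x; rewrite -mulrA; apply: iter_bd; [exact: consL_meas|exact: consL_bd].
Qed.

Lemma iter_eq k (F1 F2 : k.-tuple X -> R[i]) : (forall xs, F1 xs = F2 xs) -> J F1 = J F2.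
Proof. by move=> /funext ->. Qed.

Lemma iter_add k (F1 F2 : k.-tuple X -> R[i]) (C1 C2 : R) : cmeas F1 -> cmeas F2 ->
  (forall xs, nrm (F1 xs) <= C1 * tprod xs) -> (forall xs, nrm (F2 xs) <= C2 * tprod xs) ->
  J (fun xs => F1 xs + F2 xs) = J F1 + J F2.
Proof.
elim: k F1 F2 C1 C2 => [//|k IH] F1 F2 C1 C2 m1 m2 h1 h2 /=.
rewrite -(if_add hI (cons_dom m1 h1) (cons_dom m2 h2)); congr I; apply/funext => x.
by apply: (IH _ _ (C1 * g x) (C2 * g x)); [exact: consL_meas|exact: consL_meas|
  exact: consL_bd|exact: consL_bd].
Qed.

Lemma iter_scale k c (F : k.-tuple X -> R[i]) (C : R) : cmeas F ->
  (forall xs, nrm (F xs) <= C * tprod xs) -> J (fun xs => c * F xs) = c * J F.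
Proof.
elim: k F C => [//|k IH] F C mF hF /=.
rewrite -(if_scale hI c (cons_dom mF hF)); congr I; apply/funext => x.
by apply: (IH _ (C * g x)); [exact: consL_meas|exact: consL_bd].
Qed.

Lemma iter_sum k (T : Type) (r : seq T) (c : T -> R[i]) (F : T -> k.-tuple X -> R[i]) (C : R) :
  0 <= C -> (forall s, cmeas (F s)) -> (forall s xs, nrm (F s xs) <= C * tprod xs) ->
  J (fun xs => \sum_(s <- r) c s * F s xs) = \sum_(s <- r) c s * J (F s).
Proof.
move=> C0 mF hF; elim: r => [|s r IH].
  rewrite big_nil; have m0 : cmeas (fun _ : k.-tuple X => 0 : R[i]) by exact: cmeas_cst.
  transitivity (J (fun xs : k.-tuple X => 0 * (0 : R[i]))).
    by apply: iter_eq => xs; rewrite big_nil mul0r.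
  rewrite (@iter_scale k 0 (fun=> 0) 0 m0) ?mul0r// => xs.
  by rewrite nrm0 mul0r.
rewrite big_cons -IH -(iter_scale (c s) (mF s) (hF s)).
rewrite -(@iter_add _ _ _ (nrm (c s) * C) (\sum_(s <- r) nrm (c s) * C)).
- by apply: iter_eq => xs; rewrite big_cons.
- by apply: cmeasM => //; exact: cmeas_cst.
- by apply: cmeas_sum => a; apply: cmeasM => //; exact: cmeas_cst.
- by move=> xs; rewrite nrmM -mulrA ler_wpM2l ?nrm_ge0.
- move=> xs; rewrite (le_trans (nrm_sum _ _ _))// mulr_suml; apply: ler_sum => a _.
  by rewrite nrmM -mulrA ler_wpM2l ?nrm_ge0.
Qed.

Lemma iter_prod k (f : 'I_k -> X -> R[i]) (C : 'I_k -> R) : (forall a, dominated g (f a) (C a)) ->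
  \prod_(a < k) I (f a) = J (fun xs => \prod_(a < k) f a (tnth xs a)).
Proof.
elim: k f C => [|k IH] f C hf; first by rewrite /= !big_ord0.
rewrite big_ord_recl (IH (fun a => f (lift ord0 a)) (fun a => C (lift ord0 a)))//.
have mf (a : 'I_k) : cmeas (fun xs : k.-tuple X => f (lift ord0 a) (tnth xs a)).
  by apply: cmeas_comp (measurable_tnth a); have [] := hf (lift ord0 a).
have bf (xs : k.-tuple X) : nrm (\prod_(a < k) f (lift ord0 a) (tnth xs a)) <=
    (\prod_(a < k) C (lift ord0 a)) * tprod xs.
  rewrite nrm_prod -big_split /=; apply: ler_prod => a _.
  by rewrite nrm_ge0 /=; have [_] := hf (lift ord0 a).
set V := J _; rewrite mulrC -(if_scale hI V (hf ord0)) /=; congr I; apply/funext => x.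
rewrite mulrC -(iter_scale (f ord0 x) (cmeas_prod _ _ mf) bf).
apply: iter_eq => xs; rewrite big_ord_recl tnth0; congr (_ * _).
by apply: eq_bigr => a _; rewrite tnthS.
Qed.

End Iterated.

Section Exchange.
Context d1 (X1 : measurableType d1) (I1 : (X1 -> R[i]) -> R[i]) (g1 : X1 -> R) (H1 : R).
Context d2 (X2 : measurableType d2) (I2 : (X2 -> R[i]) -> R[i]) (g2 : X2 -> R) (H2 : R).
Hypotheses (hI1 : ifun I1 g1 H1) (hI2 : ifun I2 g2 H2).
Hypothesis hex : forall (F : X1 * X2 -> R[i]) (C : R), cmeas F ->
  (forall x y, nrm (F (x, y)) <= C * (g1 x * g2 y)) ->
  I1 (fun x => I2 (fun y => F (x, y))) = I2 (fun y => I1 (fun x => F (x, y))).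

Lemma exchange1 k (F : X1 * k.-tuple X2 -> R[i]) (C : R) : cmeas F ->
  (forall x ys, nrm (F (x, ys)) <= C * (g1 x * tprod g2 ys)) ->
  I1 (fun x => iterated_int I2 (fun ys => F (x, ys))) =
  iterated_int I2 (fun ys => I1 (fun x => F (x, ys))).
Proof.
elim: k F C => [|k IH] F C mF hF //=.
have mF' : cmeas (fun q : (X1 * X2) * k.-tuple X2 => F (q.1.1, [tuple of q.1.2 :: q.2])).
  apply: (cmeas_comp mF); apply: measurable_fun_pair.
    exact: (measurableT_comp measurable_fst measurable_fst).
  apply: measurable_cons; last exact: measurable_snd.
  exact: (measurableT_comp measurable_snd measurable_fst).
rewrite (hex (F := fun xy => iterated_int I2 (fun ys => F (xy.1, [tuple of xy.2 :: ys])))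
  (C := H2 ^+ k * C)).
- congr I2; apply/funext => y.
  apply: (IH (fun q => F (q.1, [tuple of y :: q.2])) (C * g2 y)).
    apply: (cmeas_comp mF); apply: measurable_fun_pair; first exact: measurable_fst.
    by apply: measurable_cons; [exact: measurable_cst|exact: measurable_snd].
  by move=> x ys; rewrite (le_trans (hF _ _))// tprod_cons le_eqVlt; apply/orP; left; apply/eqP; ring.
- exact: (iter_meas hI2 mF').
- move=> x y; rewrite -mulrA; apply: (iter_bd hI2).
    apply: (cmeas_comp mF); apply: measurable_fun_pair; first exact: measurable_cst.
    by apply: measurable_cons => //; exact: measurable_cst.
  by move=> ys; rewrite (le_trans (hF _ _))// tprod_cons le_eqVlt; apply/orP; left; apply/eqP; ring.
Qed.

Lemma exchange j k (F : j.-tuple X1 * k.-tuple X2 -> R[i]) (C : R) : cmeas F ->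
  (forall xs ys, nrm (F (xs, ys)) <= C * (tprod g1 xs * tprod g2 ys)) ->
  iterated_int I1 (fun xs => iterated_int I2 (fun ys => F (xs, ys))) =
  iterated_int I2 (fun ys => iterated_int I1 (fun xs => F (xs, ys))).
Proof.
elim: j F C => [|j IH] F C mF hF //=.
have mF' : cmeas (fun q : (X1 * k.-tuple X2) * j.-tuple X1 => F ([tuple of q.1.1 :: q.2], q.1.2)).
  apply: (cmeas_comp mF); apply: measurable_fun_pair.
    apply: measurable_cons; last exact: measurable_snd.
    exact: (measurableT_comp measurable_fst measurable_fst).
  exact: (measurableT_comp measurable_snd measurable_fst).
transitivity (I1 (fun x => iterated_int I2 (fun ys => iterated_int I1 (fun xs => F ([tuple of x :: xs], ys))))).
  congr I1; apply/funext => x.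
  apply: (IH (fun q => F ([tuple of x :: q.1], q.2)) (C * g1 x)).
    apply: (cmeas_comp mF); apply: measurable_fun_pair; last exact: measurable_snd.
    by apply: measurable_cons; [exact: measurable_cst|exact: measurable_fst].
  by move=> xs ys; rewrite (le_trans (hF _ _))// tprod_cons le_eqVlt; apply/orP; left; apply/eqP; ring.
apply: (exchange1 (F := fun q => iterated_int I1 (fun xs => F ([tuple of q.1 :: xs], q.2)))
  (C := H1 ^+ j * C)).
  exact: (iter_meas hI1 mF').
move=> x ys; rewrite -mulrA; apply: (iter_bd hI1).
  apply: (cmeas_comp mF); apply: measurable_fun_pair; last exact: measurable_cst.
  by apply: measurable_cons => //; exact: measurable_cst.
by move=> xs; rewrite (le_trans (hF _ _))// tprod_cons le_eqVlt; apply/orP; left; apply/eqP; ring.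
Qed.

End Exchange.

(** * Equality of the Fredholm series of $-AB$ and of the transpose of $-BA$ *)

Section Swap.
Context d1 (X1 : measurableType d1) (I1 : (X1 -> R[i]) -> R[i]) (H1 : R).
Context d2 (X2 : measurableType d2) (I2 : (X2 -> R[i]) -> R[i]) (H2 : R).
Variables (a b : X1 -> R) (h : X2 -> R).
Variables (A : X1 -> X2 -> R[i]) (B : X2 -> X1 -> R[i]).
Variables (S : X1 -> X1 -> R[i]) (T : X2 -> X2 -> R[i]).
Hypotheses (a0 : forall p, 0 < a p) (b0 : forall p, 0 < b p).
Let g1 p := a p * b p.
Hypotheses (hI1 : ifun I1 g1 H1) (hI2 : ifun I2 h H2).
Hypothesis hex : forall (F : X1 * X2 -> R[i]) (C : R), cmeas F ->
  (forall x y, nrm (F (x, y)) <= C * (g1 x * h y)) ->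
  I1 (fun x => I2 (fun y => F (x, y))) = I2 (fun y => I1 (fun x => F (x, y))).
Hypothesis mA : cmeas (fun q : X1 * X2 => A q.1 q.2).
Hypothesis mB : cmeas (fun q : X2 * X1 => B q.1 q.2).
Hypothesis hA : forall p y, nrm (A p y) <= a p.
Hypothesis hB : forall y q, nrm (B y q) <= h y * b q.
Hypothesis hS : forall p q, S p q = - I2 (fun y => A p y * B y q).
Hypothesis hT : forall x y, T x y = - I1 (fun p => A p x * B y p).

Let h0 y : 0 <= h y := if_ge0 hI2 y.

(** The integrand for the permutation [s] after both the determinant and the compositions are
    expanded; it is common to the two series. *)
Let P k (s : {perm 'I_k}) (xs : k.-tuple X1) (ys : k.-tuple X2) : R[i] :=
  \prod_(e < k) (A (tnth xs e) (tnth ys e) * B (tnth ys e) (tnth xs (s e))).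

(** The sign of the permutation together with the $k$ minus signs in the definitions of [S] and
    [T]. *)
Let sg k (s : {perm 'I_k}) : R[i] := (-1) ^+ s * (-1) ^+ k.

Let AB_meas d (Z : measurableType d) (p q : Z -> X1) (x y : Z -> X2) :
  measurable_fun setT p -> measurable_fun setT q -> measurable_fun setT x ->
  measurable_fun setT y -> cmeas (fun z => A (p z) (x z) * B (y z) (q z)).
Proof.
move=> mp mq mx my; apply: cmeasM.
  by apply: (cmeas_comp mA (g := fun z => (p z, x z))); exact: measurable_fun_pair.
by apply: (cmeas_comp mB (g := fun z => (y z, q z))); exact: measurable_fun_pair.
Qed.

Let P_meas k (s : {perm 'I_k}) : cmeas (fun q : k.-tuple X1 * k.-tuple X2 => P s q.1 q.2).
Proof.
have m1 e : measurable_fun setT (fun q : k.-tuple X1 * k.-tuple X2 => tnth q.1 e).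
  exact: (measurableT_comp (measurable_tnth e) measurable_fst).
have m2 e : measurable_fun setT (fun q : k.-tuple X1 * k.-tuple X2 => tnth q.2 e).
  exact: (measurableT_comp (measurable_tnth e) measurable_snd).
by apply: cmeas_prod => e; exact: AB_meas.
Qed.

(** Reindexing by [s] turns $\prod b(x_{s(e)})$ into $\prod b(x_e)$, so the majorant is the same for
    every permutation. *)
Let P_bd k (s : {perm 'I_k}) xs ys : nrm (P s xs ys) <= tprod g1 xs * tprod h ys.
Proof.
rewrite nrm_prod (@le_trans _ _ (\prod_(e < k) (a (tnth xs e) * (h (tnth ys e) * b (tnth xs (s e))))))//.
  by apply: ler_prod => e _; rewrite nrm_ge0 nrmM ler_pM ?nrm_ge0.
rewrite !big_split /= /tprod /g1 big_split /=.
rewrite (reindex_inj (@perm_inj _ s) (F := fun e => b (tnth xs e))) /=.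
by rewrite mulrCA !mulrA (mulrC _ (\prod_(i < k) h _)) !mulrA.
Qed.

Let det_sum d (Z : measurableType d) (K : Z -> Z -> R[i]) k (zs : k.-tuple Z)
    (V : {perm 'I_k} -> R[i]) :
  (forall s : {perm 'I_k}, \prod_(e < k) (- K (tnth zs e) (tnth zs (s e))) = V s) ->
  \det (\matrix_(e < k, f < k) K (tnth zs e) (tnth zs f)) = \sum_(s : {perm 'I_k}) sg s * V s.
Proof.
move=> hV; rewrite /determinant; apply: eq_bigr => s _; rewrite -hV /sg -mulrA; congr (_ * _).
rewrite prodrN card_ord mulrA -expr2 sqrr_sign mul1r.
by apply: eq_bigr => e _; rewrite mxE.
Qed.

Lemma swap_left k : iterated_int I1 (fun xs : k.-tuple X1 =>
    \det (\matrix_(e < k, f < k) S (tnth xs e) (tnth xs f))) =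
  \sum_(s : {perm 'I_k}) sg s * iterated_int I2 (fun ys => iterated_int I1 (fun xs => P s xs ys)).
Proof.
have E xs : \det (\matrix_(e < k, f < k) S (tnth xs e) (tnth xs f)) =
    \sum_(s : {perm 'I_k}) sg s * iterated_int I2 (fun ys => P s xs ys).
  apply: det_sum => s.
  rewrite -(iter_prod hI2 (f := fun e y => A (tnth xs e) y * B y (tnth xs (s e)))
    (C := fun e => a (tnth xs e) * b (tnth xs (s e)))).
    by apply: eq_bigr => e _; rewrite hS opprK.
  move=> e; split; first by apply: AB_meas => //; exact: measurable_cst.
  move=> y; rewrite nrmM (_ : _ * _ * h y = a (tnth xs e) * (h y * b (tnth xs (s e)))); last by ring.
  by rewrite ler_pM ?nrm_ge0.
under iter_eq do rewrite E.
rewrite (@iter_sum _ _ I1 _ _ hI1 k _ _ _ _ (H2 ^+ k)).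
- apply: eq_bigr => s _; congr (_ * _).
  apply: (exchange hI1 hI2 hex (F := fun q => P s q.1 q.2) (C := 1)) => //.
  by move=> xs ys; rewrite mul1r P_bd.
- by rewrite exprn_ge0// (if_H hI2).
- by move=> s; exact: (iter_meas hI2 (P_meas s)).
- move=> s xs; apply: (iter_bd hI2).
    by apply: (cmeas_comp (P_meas s) (g := fun ys => (xs, ys)));
      apply: measurable_fun_pair => //; exact: measurable_cst.
  exact: P_bd.
Qed.

(** [T] is transposed with respect to $BA$, so its expansion yields the inverse permutation; the sum
    is unchanged because inversion preserves signs. *)
Let Q_eq k (s : {perm 'I_k}) xs ys :
  \prod_(e < k) (A (tnth xs e) (tnth ys e) * B (tnth ys (s e)) (tnth xs e)) = P s^-1%g xs ys.
Proof.
rewrite /P !big_split /=; congr (_ * _).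
rewrite (reindex_inj (@perm_inj _ s^-1%g)) /=.
by apply: eq_bigr => e _; rewrite permKV.
Qed.

Lemma swap_right k : iterated_int I2 (fun ys : k.-tuple X2 =>
    \det (\matrix_(e < k, f < k) T (tnth ys e) (tnth ys f))) =
  \sum_(s : {perm 'I_k}) sg s * iterated_int I2 (fun ys => iterated_int I1 (fun xs => P s xs ys)).
Proof.
have E ys : \det (\matrix_(e < k, f < k) T (tnth ys e) (tnth ys f)) =
    \sum_(s : {perm 'I_k}) sg s * iterated_int I1 (fun xs => P s^-1%g xs ys).
  apply: det_sum => s.
  under [RHS]iter_eq do rewrite -Q_eq.
  rewrite -(iter_prod hI1 (f := fun e p => A p (tnth ys e) * B (tnth ys (s e)) p)
    (C := fun e => h (tnth ys (s e)))).
    by apply: eq_bigr => e _; rewrite hT opprK.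
  move=> e; split; first by apply: AB_meas => //; exact: measurable_cst.
  move=> p; rewrite nrmM /g1 (_ : h _ * _ = a p * (h (tnth ys (s e)) * b p)); last by ring.
  by rewrite ler_pM ?nrm_ge0.
under iter_eq do rewrite E.
rewrite (@iter_sum _ _ I2 _ _ hI2 k _ _ _ _ (H1 ^+ k)).
- rewrite (reindex_inj invg_inj); apply: eq_bigr => s _; rewrite invgK; congr (_ * _).
  by rewrite /sg odd_permV.
- by rewrite exprn_ge0// (if_H hI1).
- move=> s; apply: (iter_meas hI1 (F := fun q => P s^-1%g q.2 q.1)).
  apply: (cmeas_comp (P_meas s^-1%g) (g := fun q => (q.2, q.1))).
  by apply: measurable_fun_pair; [exact: measurable_snd|exact: measurable_fst].
- move=> s ys; apply: (iter_bd hI1).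
    by apply: (cmeas_comp (P_meas s^-1%g) (g := fun xs => (xs, ys)));
      apply: measurable_fun_pair => //; exact: measurable_cst.
  by move=> xs; rewrite mulrC P_bd.
Qed.

Lemma S_bd p q : nrm (S p q) <= H2 * (a p * b q).
Proof.
rewrite hS nrmN; apply: (if_bd hI2); split.
  by apply: AB_meas => //; exact: measurable_cst.
move=> y; rewrite nrmM (_ : _ * _ * h y = a p * (h y * b q)); last by ring.
by rewrite ler_pM ?nrm_ge0.
Qed.

Lemma S_meas : cmeas (fun q : X1 * X1 => S q.1 q.2).
Proof.
under eq_fun do rewrite hS; apply: cmeasN.
apply: (if_meas hI2 (F := fun q : (X1 * X1) * X2 => A q.1.1 q.2 * B q.2 q.1.2)).
apply: AB_meas; try exact: measurable_snd.
  exact: (measurableT_comp measurable_fst measurable_fst).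
exact: (measurableT_comp measurable_snd measurable_fst).
Qed.

(** Hadamard's inequality is applied to the matrix divided by $a(p)b(q)$, whose entries are at most
    [H2]. Each weight occurs once per row or column, so the division takes exactly the factor
    [tprod g1] out of the determinant. *)
Lemma det_S_bd k : nrm (iterated_int I1 (fun xs : k.-tuple X1 =>
    \det (\matrix_(e < k, f < k) S (tnth xs e) (tnth xs f)))) <=
  (Num.sqrt k%:R * (H1 * H2)) ^+ k.
Proof.
have H20 := if_H hI2.
have -> : Num.sqrt k%:R * (H1 * H2) = H1 * (Num.sqrt k%:R * H2) by ring.
rewrite exprMn; apply: (iter_bd hI1).
  rewrite /determinant; apply: cmeas_sum => s; apply: cmeasM; first exact: cmeas_cst.
  apply: cmeas_prod => e; under eq_fun do rewrite mxE.
  by apply: (cmeas_comp S_meas (g := fun xs => (tnth xs e, tnth xs (s e))));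
    apply: measurable_fun_pair; exact: measurable_tnth.
move=> xs.
pose M := \matrix_(e < k, f < k) (S (tnth xs e) (tnth xs f) / (a (tnth xs e) * b (tnth xs f))%:C).
have hM : nrm (\det M) <= (Num.sqrt k%:R * H2) ^+ k.
  apply: hadamard => // e f; rewrite mxE nrmM nrmV nrmC ger0_norm; last by rewrite mulr_ge0// ltW.
  by rewrite ler_pdivrMr ?mulr_gt0// S_bd.
have -> : \det (\matrix_(e < k, f < k) S (tnth xs e) (tnth xs f)) = \det M * (tprod g1 xs)%:C.
  rewrite /determinant big_distrl /=; apply: eq_bigr => s _; rewrite -mulrA; congr (_ * _).
  have -> : tprod g1 xs = \prod_(e < k) (a (tnth xs e) * b (tnth xs (s e))).
    rewrite /tprod /g1 !big_split /=; congr (_ * _).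
    exact: (reindex_inj (@perm_inj _ s)).
  rewrite rmorph_prod -big_split /=; apply: eq_bigr => e _; rewrite !mxE divfK//.
  by rewrite realC_eq0 mulf_neq0// gt_eqF.
by rewrite nrmM nrmC ger0_norm ?(tprod_ge0 hI1)// ler_wpM2r ?(tprod_ge0 hI1).
Qed.

Theorem fredholm_swap : [/\ fredholm_cvg I1 S, fredholm_cvg I2 T &
  fredholm_det I1 S = fredholm_det I2 T].
Proof.
have E n : fredholm_sum I1 S n = fredholm_sum I2 T n.
  by apply: eq_bigr => k _; rewrite swap_left swap_right.
have cS : fredholm_cvg I1 S.
  have H0 : 0 <= H1 * H2 by rewrite mulr_ge0 ?(if_H hI1) ?(if_H hI2).
  have [K [K0 hK]] := hadamard_series H0.
  pose D (k : nat) := (k`!%:R)^-1 * iterated_int I1 (fun xs : k.-tuple X1 =>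
      \det (\matrix_(e < k, f < k) S (tnth xs e) (tnth xs f))).
  have hD k : nrm (D k) <= K * (1/2) ^+ k.
    rewrite (le_trans _ (hK k))// nrmM nrmV -(rmorph_nat (real_complex R)) nrmC ger0_norm ?ler0n//.
    by rewrite ler_wpM2l ?invr_ge0 ?ler0n// det_S_bd.
  have raddf (f : R[i] -> R) (f0 : f 0 = 0) (fD : forall x y, f (x + y) = f x + f y) n :
      f (fredholm_sum I1 S n) = \sum_(k < n) f (D k).
    by rewrite /fredholm_sum; elim/big_rec2 : _ => // i x y _ <-; rewrite fD.
  split.
    under eq_fun do rewrite (raddf (@Re R) (@Re0 R) (@ReAdd R)).
    by apply: (@geometric_cvg R (fun k => Re (D k)) K) => k; exact: le_trans (Re_le_nrm _) (hD k).
  under eq_fun do rewrite (raddf (@Im R) (@Im0 R) (@ImAdd R)).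
  by apply: (@geometric_cvg R (fun k => Im (D k)) K) => k; exact: le_trans (Im_le_nrm _) (hD k).
(* The partial sums coincide, so convergence for [T] is inherited from [S]. *)
split => //; first by move: cS; rewrite /fredholm_cvg; under eq_fun do rewrite E; under [in X in _ /\ X]eq_fun do rewrite E.
by rewrite /fredholm_det (funext E).
Qed.

End Swap.
End IntegralFunctional.

(** * Hitting times of the hypograph *)

Section Hitting.
Context {R : realType} d (Omega : measurableType d).
Local Notation RR := (measurableTypeR R).
Variables (W : R -> Omega -> R) (h : R -> \bar R) (L H : R).
Hypothesis mW : forall t, measurable_fun setT (W t).
Hypothesis cW : forall w t, W u w @[u --> t] --> W t w.
Hypothesis L0 : 0 <= L.
Hypothesis hH : forall x, (h x <= H%:E)%E.
Hypothesis hL : forall x, h x != -oo%E -> `|x| <= L.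
Hypothesis husc : forall x (r : R), (h x < r%:E)%E -> \forall y \near x, (h y < r%:E)%E.
Implicit Types (s t a x : R) (w : Omega).

Definition hits s w t : Prop := ((s + W t w)%:E <= h t)%E.

(** A level strictly between $\mathfrak h(x)$ and the path separates them near $x$: semicontinuity
    keeps $\mathfrak h$ below it and continuity keeps the path above it by a margin. *)
Lemma nohit_near s w x : ~ hits s w x ->
  exists e : R, 0 < e /\ \forall y \near x, (h y < (s + W y w - e)%:E)%E.
Proof.
rewrite /hits => /negP; rewrite -ltNge => hx.
have [r hr rs] : exists2 r : R, (h x < r%:E)%E & r < s + W x w.
  move: hx; case: (h x) (hH x) => [v| |] // _ hx.
    exists ((v + (s + W x w)) / 2); rewrite ?lte_fin; move: hx; rewrite lte_fin; lra.
  by exists (s + W x w - 1); rewrite ?ltNyr//; lra.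
exists ((s + W x w - r) / 2); split; first by lra.
have n1 := husc hr.
have n2 : \forall y \near x, `|W x w - W y w| < (s + W x w - r) / 2.
  by have /cvgrPdist_lt := @cW w x; apply; lra.
near=> y; have h1 : (h y < r%:E)%E by near: y.
have h2 : `|W x w - W y w| < (s + W x w - r) / 2 by near: y.
apply: (lt_le_trans h1); rewrite lee_fin; move: h2; rewrite ltr_norml => /andP[]; lra.
Unshelve. all: by end_near. Qed.

Definition hit_by a : set (RR * Omega) :=
  [set q | exists t, 0 <= t <= a /\ hits q.1 q.2 t].

(* For every point of the hypograph over [0, a] some selected point is close to
   it and not much lower, so the event is decided by countably many times. *)
Definition hit_pick a (q : rat * rat * rat) : R :=
  match pselect (exists t, [/\ ratr q.1.1 < t < ratr q.1.2, 0 <= t <= a & ((ratr q.2)%:E < h t)%E]) with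
  | left p => projT1 (cid p)
  | right _ => a
  end.

(** A true hit makes a picked time a near-hit for each tolerance $1/(n+1)$. Conversely, without a
    hit [nohit_near] and the compactness of $[0,a]$ give a uniform margin, which excludes near-hits
    of small tolerance. *)
Lemma hit_by_meas a : 0 <= a -> measurable (hit_by a).
Proof.
move=> a0; rewrite (_ : hit_by a = \bigcap_n \bigcup_(q in [set: rat * rat * rat])
    [set p : RR * Omega | ((p.1 + W (hit_pick a q) p.2 - n.+1%:R^-1)%:E < h (hit_pick a q))%E]).
  apply: bigcap_measurable => // n _.
  apply: countable_bigcupT_measurable => // q.
  rewrite (_ : [set p | _] = setT `&` (fun p : RR * Omega =>
    ((p.1 + W (hit_pick a q) p.2 - n.+1%:R^-1)%:E < h (hit_pick a q))%E) @^-1` [set true]).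
    apply: (measurable_fun_lte _ _ measurableT) => //.
    apply/measurable_EFinP; apply: measurable_funB => //; apply: measurable_funD => //.
    exact: measurableT_comp (mW _) measurable_snd.
  by rewrite setTI; apply/seteqP; split=> p /=.
have pickP q : 0 <= hit_pick a q <= a.
  rewrite /hit_pick; case: pselect => [p|_]; last by rewrite a0 lexx.
  by case: (cid p) => x /= [].
apply/seteqP; split=> [[s w] [t [/andP[t0 ta] ht]] n _|[s w] hn].
  have n0 : 0 < n.+1%:R^-1 :> R by rewrite invr_gt0.
  move: (n.+1%:R^-1 : R) n0 => ee ee0; have e0 : 0 < ee / 2 by lra.
  have /cvgrPdist_lt /(_ _ e0) [de /= de0 hde] := @cW w t.
  have [q1 /andP[tq1 q1t]] : exists q : rat, ratr q \in `]t - de, t[.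
    by apply: rat_in_itvoo; lra.
  have [q2 /andP[tq2 q2t]] : exists q : rat, ratr q \in `]t, t + de[.
    by apply: rat_in_itvoo; lra.
  have [v hv] : exists v, h t = v%:E.
    move: ht (hH t); rewrite /hits /=; case: (h t) => [v| |] //= _ _; by exists v.
  have [q3 /andP[tq3 q3t]] : exists q : rat, ratr q \in `](v - ee / 2), v[.
    by apply: rat_in_itvoo; lra.
  rewrite !bnd_simp in tq1 q1t tq2 q2t tq3 q3t.
  exists (q1, q2, q3) => //=; rewrite /hit_pick; case: pselect => [p|[]]; last first.
    by exists t; rewrite q1t tq2 t0 ta hv lte_fin q3t.
  case: (cid p) => y /= [/andP[y1 y2] _ hy]; apply: le_lt_trans hy; rewrite lee_fin.
  have := hde y; rewrite /= => /(_ _)/wrap[]; first by rewrite ltr_norml; apply/andP; split; lra.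
  by move: ht; rewrite /hits hv lee_fin /= ltr_norml => ht /andP[y3 y4]; lra.
apply: contrapT => no.
have /compact_near_coveringP cov := @segment_compact R 0 a.
have [] := cov nat \oo (fun n y => (h y < (s + W y w - n.+1%:R^-1)%:E)%E) _.
  move=> x /=; rewrite in_itv /= => xa.
  have [e [e0 [de /= de0 hde]]] : exists e : R, 0 < e /\ \forall y \near x, (h y < (s + W y w - e)%:E)%E.
    by apply: nohit_near => hx; apply: no; exists x.
  have hn1 : \forall n \near \oo, n.+1%:R^-1 < e by exact: near_infty_natSinv_lt (PosNum e0).
  exists (ball x de, [set n : nat | n.+1%:R^-1 < e]); first by split=> //; exact: nbhsx_ballx.
  move=> [y n] /= [y1 y2]; apply: (lt_trans (hde _ y1)); rewrite lte_fin.
  by move: (n.+1%:R^-1 : R) y2 => e' y2; lra.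
move=> N _ hN; have [q _ /=] := hn N I.
have := hN N; rewrite /= => /(_ (leqnn _) (hit_pick a q)).
rewrite /= in_itv /= => /(_ (pickP q)) h1 h2.
by have := lt_trans h1 h2; rewrite ltxx.
Qed.

Lemma hits_range s w t : hits s w t -> `|t| <= L /\ s + W t w <= H.
Proof.
move=> ht; split; last by rewrite -lee_fin; exact: le_trans ht (hH t).
apply: hL; apply/eqP => E; move: ht; rewrite /hits E => /(lt_le_trans (ltNyr _)).
by rewrite ltxx.
Qed.

Definition tau (q : RR * Omega) : \bar R := tau_plus h (fun t => q.1 + W t q.2).

Lemma tau_ge0 q : (0 <= tau q)%E.
Proof. by apply: le_ereal_inf_tmp => _ [t [t0 _] <-]; rewrite lee_fin. Qed.

(** The hitting set is closed: if its infimum were not a hit, [nohit_near] would exclude hits just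
    above it. *)
Lemma tau_attained s w : (tau (s, w) < +oo)%E ->
  exists a, [/\ tau (s, w) = a%:E, 0 <= a <= L & hits s w a].
Proof.
rewrite /tau /tau_plus /=.
set S := [set a : R | 0 <= a /\ _].
have [[a0 Sa0]|S0] := pselect (S !=set0); last first.
  rewrite (_ : S = set0) ?image_set0 ?ereal_inf0 ?ltxx//.
  by apply/seteqP; split=> // x Sx; case: S0; exists x.
have lbS : lbound S 0 by move=> x [].
have hlbS : has_lbound S by exists 0.
have S0 : S !=set0 by exists a0.
rewrite ereal_inf_EFin// => _.
have i0 : 0 <= inf S by exact: lb_le_inf.
have hit : hits s w (inf S).
  apply: contrapT => /nohit_near[e [e0 [de /= de0 hde]]].
  have [x Sx xd] := inf_adherent de0 (conj S0 hlbS).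
  have := hde x; rewrite /= => /(_ _)/wrap[].
    rewrite ltr_norml; have := ge_inf hlbS Sx; lra.
  move=> /lt_trans /(_ (_ : ((s + W x w - e)%:E < (s + W x w)%:E)%E))/wrap[].
    by rewrite lte_fin; lra.
  by rewrite ltNge; case: Sx => _ ->.
exists (inf S); split=> //.
by have [] := hits_range hit; rewrite ger0_norm// i0.
Qed.

Lemma tau_le q a : (tau q <= a%:E)%E <-> hit_by a q.
Proof.
case: q => s w; split=> [ta|[t [/andP[t0 ta] ht]]].
  have [b [e /andP[b0 bL] hb]] := tau_attained (le_lt_trans ta (ltry _)).
  by exists b; rewrite b0 /=; split=> //; move: ta; rewrite e lee_fin.
apply: (@le_trans _ _ t%:E); last by rewrite lee_fin.
by apply: ereal_inf_lbound; exists t.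
Qed.

Lemma tau_meas : measurable_fun setT tau.
Proof.
apply: (measurability _ (ErealGenOInfty.measurableE R)) => // _ [_ [r ->] <-].
rewrite setTI (_ : tau @^-1` _ = if 0 <= r then ~` hit_by r else setT).
  by case: ifPn => r0 //; apply: measurableC; exact: hit_by_meas.
apply/seteqP; split=> q /=; rewrite in_itv /= andbT; case: ifPn => r0 //.
- by move=> rt /tau_le; rewrite leNgt rt.
- by move=> nh; rewrite ltNge; apply/negP => /tau_le.
- by move=> _; apply: lt_le_trans (tau_ge0 q); rewrite lte_fin ltNge.
Qed.

(** The random time is rounded down to multiples of $1/(n+1)$; the process at a countably valued
    time is measurable, and continuity of paths passes to the limit. *)
Lemma process_meas (dd : measure_display) (T : measurableType dd) (f : T -> R) (g : T -> Omega) :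
  measurable_fun setT f -> (forall z, 0 <= f z) -> measurable_fun setT g ->
  measurable_fun setT (fun z => W (f z) (g z)).
Proof.
move=> mf f0 mg.
pose ap n z := (Num.truncn (n.+1%:R * f z))%:R / n.+1%:R : R.
apply: (@measurable_fun_cvg _ _ _ _ (fun n z => W (ap n z) (g z))) => //; last first.
  move=> z _; apply: (cvg_comp (fun n => ap n z) (fun u => W u (g z))); last exact: cW.
  apply/cvgrPdist_le => e e0.
  have hn1 : \forall n \near \oo, n.+1%:R^-1 < e by exact: near_infty_natSinv_lt (PosNum e0).
  near=> n; have hn : n.+1%:R^-1 < e by near: n.
  have n0 : 0 < n.+1%:R :> R by [].
  have /Num.Theory.truncn_itv/andP[t1 t2] : 0 <= n.+1%:R * f z by rewrite mulr_ge0.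
  have -> : f z - ap n z = (n.+1%:R * f z - (Num.truncn (n.+1%:R * f z))%:R) * n.+1%:R^-1.
    by rewrite /ap mulrBl mulrAC divff ?mul1r// lt0r_neq0.
  rewrite ger0_norm; last by rewrite mulr_ge0// subr_ge0.
  apply: le_trans (ltW hn); rewrite -[leRHS]mul1r ler_pM2r ?invr_gt0//.
  by move: t2; rewrite -natr1; lra.
move=> n _ A mA; rewrite setTI.
rewrite (_ : _ @^-1` A = \bigcup_k ([set z | Num.truncn (n.+1%:R * f z) = k] `&`
   g @^-1` (W (k%:R / n.+1%:R) @^-1` A))); last first.
  apply/seteqP; split=> [z Az|z [k _ [/= <-]]] //.
  by exists (Num.truncn (n.+1%:R * f z)).
apply: bigcup_measurable => k _; apply: measurableI; last first.
  rewrite -[X in measurable X]setTI; apply: mg => //.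
  by rewrite -[X in measurable X]setTI; apply: mW.
rewrite (_ : [set z | _] = setT `&` (fun z => (n.+1%:R * f z < k.+1%:R) &&
    ((k == 0)%N || ~~ (n.+1%:R * f z < k.-1.+1%:R))) @^-1` [set true]).
  have mlt (j : nat) : measurable_fun setT (fun z => n.+1%:R * f z < j%:R).
    by apply: measurable_fun_ltr => //; apply: measurable_funM.
  suff : measurable_fun setT (fun z => (n.+1%:R * f z < k.+1%:R) &&
    ((k == 0)%N || ~~ (n.+1%:R * f z < k.-1.+1%:R))) by apply.
  apply: measurable_and => //; apply: measurable_or => //.
  by apply: measurable_neg.
rewrite setTI; apply/seteqP; split=> z /=; rewrite -!Num.Theory.truncn_le_nat -ltnNge.
  by case: (k) => [|j] ->; rewrite leqnn //= leqnn.
move=> /andP[k1]; case: eqP => [k0 _|/eqP k0].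
  by apply/eqP; rewrite eqn_leq k1 k0.
by rewrite /= prednK ?lt0n// => k2; apply/eqP; rewrite eqn_leq k1.
Unshelve. all: by end_near. Qed.

End Hitting.

(** * Exponential moments of Brownian paths *)

Section Moments.
Context {R : realType}.
Local Notation RR := (measurableTypeR R).
Local Notation leb := (@lebesgue_measure R).

Lemma integral_normal_prob (m s : R) (f : RR -> \bar R) : (forall x, (0 <= f x)%E) ->
  measurable_fun setT f ->
  (\int[normal_prob m s]_x f x = \int[leb]_x (f x * (normal_pdf m s x)%:E))%E.
Proof.
move=> f0 mf; have dom := normal_prob_dominates m s.
rewrite -(Radon_Nikodym_SigmaFinite.change_of_variables dom f0 measurableT mf).
have mpdf : measurable_fun [set: RR] (EFin \o normal_pdf m s).
  by apply/measurable_EFinP; exact: measurable_normal_pdf.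
have irn := Radon_Nikodym_SigmaFinite.f_integrable dom.
apply: ae_eq_integral => //.
- by apply: emeasurable_funM => //; exact: measurable_int irn.
- exact: emeasurable_funM.
apply: ae_eqe_mul2l => /=; apply: integral_ae_eq => //=.
by move=> A _ mA; rewrite -(Radon_Nikodym_SigmaFinite.f_integral dom).
Qed.

(** The density has exponent $-x^2/(4\delta)$. The condition on [la] leaves at least
    $-x^2/(8\delta)$, so the integral is at most $\sqrt2$ times that of a probability density. *)
Lemma gauss_moment (de la : R) : 0 < de -> 0 <= la -> 8 * la * de <= 1 ->
  (\int[normal_prob 0 (Num.sqrt (2 * de))]_x (expR (la * x ^+ 2))%:E <= 2%:E)%E.
Proof.
move=> de0 la0 lade.
have m1 (c : R) : measurable_fun [set: RR] (fun x : RR => (expR (c * x ^+ 2))%:E).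
  apply/measurable_EFinP; apply: measurableT_comp => //.
  by apply: measurable_funM => //; exact: measurable_funX.
rewrite integral_normal_prob//.
have s0 : Num.sqrt (2 * de) != 0 by rewrite gt_eqF// sqrtr_gt0; lra.
pose c := (8 * de)^-1; have c0 : 0 < c by rewrite invr_gt0; lra.
have c1 : Num.sqrt (pi / c) = Num.sqrt 2 * Num.sqrt (4 * pi * de) :> R.
  rewrite -sqrtrM//; congr Num.sqrt; rewrite /c; field; exact: lt0r_neq0.
have k0 : 0 < Num.sqrt (4 * pi * de) :> R by rewrite sqrtr_gt0 !mulr_gt0// pi_gt0.
apply: (@le_trans _ _ (\int[leb]_x ((Num.sqrt (4 * pi * de))^-1 *
    expR (- (c * (x - 0) ^+ 2)))%:E)%E).
  apply: ge0_le_integral => //.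
  - move=> x _; rewrite -EFinM lee_fin mulr_ge0 ?expR_ge0//; exact: normal_pdf_ge0.
  - apply: emeasurable_funM => //.
    by apply/measurable_EFinP; exact: measurable_normal_pdf.
  - apply/measurable_EFinP; apply: measurable_funM => //.
    exact: rint_meas (rint_gauss 0 c0).
  move=> x _; rewrite -EFinM lee_fin.
  have c'0 : 0 < (4 * de)^-1 by rewrite invr_gt0; lra.
  have := @gau_normal R (4 * de)^-1 0 x c'0.
  rewrite (_ : (2 * (4 * de)^-1)^-1 = 2 * de); last by field; exact: lt0r_neq0.
  rewrite (_ : pi / (4 * de)^-1 = 4 * pi * de); last by field; exact: lt0r_neq0.
  rewrite subr0 => e; rewrite -(@ler_pM2l _ (Num.sqrt (4 * pi * de)))// mulrCA -e.
  rewrite mulVKf ?gt_eqF// -expRD ler_expR -mulNr -mulrDl -mulNr.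
  rewrite ler_wpM2r ?sqr_ge0//.
  have : la <= c by rewrite -[c]mul1r ler_pdivlMr; lra.
  have : (4 * de)^-1 = 2 * c by rewrite /c; field; exact: lt0r_neq0.
  by move: (c) => q; lra.
have ig : rint leb (fun x => (Num.sqrt (4 * pi * de))^-1 * expR (- (c * (x - 0) ^+ 2))).
  by apply: rintZ; exact: rint_gauss.
rewrite -[leLHS]fineK; last exact: integrable_fin_num ig.
rewrite lee_fin -/(Rintegral _ _ _) RintegralZl//; last exact: rint_gauss.
rewrite Rint_gauss// c1 mulrC mulfK ?gt_eqF//.
by rewrite -(@ler_pXn2r _ 2) ?nnegrE ?sqrtr_ge0// sqr_sqrtr// expr2; lra.
Qed.

(** The weights $(4/5)^i/5$ have sum at most $1$. With $cx^2=\ln y$ either alternative says that the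
    $i$-th increment is at most its weight times $x$, the first one because $\ln y\ge1$; summation
    gives $x$. *)
Lemma chaining_sum (n : nat) (dd : nat -> R) (c y : R) : 0 < c -> expR 1 <= y ->
  (forall i, (i < n)%N -> 0 <= dd i) ->
  (forall i, (i < n)%N -> c * (dd i / ((4 / 5) ^+ i / 5)) ^+ 2 <= 1 \/
     expR (c * (dd i / ((4 / 5) ^+ i / 5)) ^+ 2) <= y) ->
  expR (c * (\sum_(i < n) dd i) ^+ 2) <= y.
Proof.
move=> c0 y1 d0 hd.
have y0 : 0 < y by exact: lt_le_trans (expR_gt0 1) y1.
have u1 : 1 <= ln y by rewrite -(@expRK R 1) ler_ln ?posrE ?expR_gt0.
pose x := Num.sqrt (ln y / c).
have x0 : 0 <= x by exact: sqrtr_ge0.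
have x2 : c * x ^+ 2 = ln y.
  by rewrite sqr_sqrtr ?divr_ge0 ?(ltW c0)//; [rewrite mulrC divfK// gt_eqF|lra].
have hx i : (i < n)%N -> dd i <= (4 / 5) ^+ i / 5 * x.
  move=> ni; have w0 : 0 < (4 / 5 : R) ^+ i / 5 by rewrite divr_gt0// exprn_gt0//; lra.
  rewrite mulrC -ler_pdivrMr// -(@ler_pXn2r _ 2) ?nnegrE ?divr_ge0 ?d0 ?(ltW w0)//.
  rewrite -(ler_pM2l c0) x2; have [h|h] := hd i ni; first exact: le_trans h u1.
  by rewrite -[leLHS]expRK ler_ln ?posrE ?expR_gt0.
have sx : \sum_(i < n) dd i <= x.
  apply: (@le_trans _ _ (\sum_(i < n) ((4 / 5) ^+ i / 5 * x))).
    by apply: ler_sum => i _; exact: hx.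
  rewrite -mulr_suml -mulr_suml -[leRHS]mul1r ler_wpM2r//.
  have := @subrX1 R (4 / 5) n.
  have : 0 <= (4 / 5 : R) ^+ n by rewrite exprn_ge0//; lra.
  by move: (_ ^+ n) (\sum_(i < n) _) => a b; lra.
have s0 : 0 <= \sum_(i < n) dd i by apply: sumr_ge0 => i _; exact: d0.
rewrite -[leRHS](lnK y0) ler_expR -x2 ler_pM2l//.
by rewrite ler_pXn2r ?nnegrE.
Qed.

End Moments.

Section Chaining.
Context {R : realType} d (Omega : measurableType d) (P : probability Omega R).
Variables (W : R -> Omega -> R) (L : R).
Hypothesis mW : forall t, measurable_fun setT (W t).
Hypothesis cW : forall w t, W u w @[u --> t] --> W t w.
Hypothesis W0 : forall w, W 0 w = 0.
Hypothesis L0 : 0 < L.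
Hypothesis hG : forall s t la : R, 0 <= la -> 8 * la * `|t - s| <= 1 ->
  (\int[P]_w (expR (la * (W t w - W s w) ^+ 2))%:E <= 2%:E)%E.

(** The constant meets the condition of [hG] at every level. An increment at level $i$ has duration
    $L/2^{i+1}$ and weight $(4/5)^i/5$, and with the factor $2i+1$ the condition reads
    $2i+1\le8(32/25)^i$, where $32/25=2(4/5)^2$; this follows from Bernoulli's inequality. *)
Let c := (800 * L)^-1.
Let wt i : R := (4 / 5) ^+ i / 5.
Let pt i k : R := k%:R / 2 ^+ i * L.
Let inc i k w := W (pt i.+1 k.+1) w - W (pt i.+1 k) w.
(** If a scaled increment $v$ of level $i$ is at least $1$, then $e^{-2i+(2i+1)v}\ge e^v$, so [X i]
    dominates $e^v$. The prefactor $e^{-2i}$ outweighs the $2^{i+1}$ summands and makes the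
    expectations summable. *)
Let X i w := expR (- (2 * i%:R)) *
  \sum_(k < 2 ^ i.+1) expR ((2 * i%:R + 1) * (c * (inc i k w / wt i) ^+ 2)).

Let c0 : 0 < c. Proof. by rewrite /c invr_gt0 mulr_gt0 ?ltr0n. Qed.
Let wt0 i : 0 < wt i. Proof. by rewrite divr_gt0// exprn_gt0//; lra. Qed.

Let X_ge0 i w : 0 <= X i w.
Proof. by rewrite mulr_ge0 ?expR_ge0// sumr_ge0// => k _; exact: expR_ge0. Qed.

Let e1 : 2 <= expR 1 :> R. Proof. by have := @expR_ge1Dx R 1; lra. Qed.

Let minc i k : measurable_fun setT (inc i k).
Proof. exact: measurable_funB. Qed.

Let mX i : measurable_fun setT (X i).
Proof.
apply: measurable_funM => //; apply: measurable_sum => k.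
apply: measurableT_comp => //; apply: measurable_funM => //; apply: measurable_funM => //.
by apply: measurable_funX; apply: measurable_funM.
Qed.

(** Chaining along the binary expansion of $t/L$: consecutive approximations are equal or are
    neighbours on the finer grid, so each step is one of the increments [inc]. *)
Lemma dyadic_bound t w n : 0 <= t < L ->
  expR (c * (W (pt n (Num.truncn (2 ^+ n * (t / L)))) w) ^+ 2) <= expR 1 + \sum_(i < n) X i w.
Proof.
move=> /andP[t0 tL].
have x0 : 0 <= t / L by rewrite divr_ge0// ltW.
have x1 : t / L < 1 by rewrite ltr_pdivrMr// mul1r.
move: (t / L) x0 x1 => x x0 x1.
pose f i := Num.truncn (2 ^+ i * x).
have fx i : (f i)%:R <= 2 ^+ i * x < (f i).+1%:R.
  by apply: Num.Theory.truncn_itv; rewrite mulr_ge0// exprn_ge0.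
have f2 i : f i.+1 = (f i).*2 \/ f i.+1 = (f i).*2.+1.
  have /andP[a1 a2] := fx i; have /andP[b1 b2] := fx i.+1.
  move: b1 b2; rewrite exprS -mulrA; move: (2 ^+ i * x) a1 a2 => y.
  rewrite -!natr1 => a1 a2 b1 b2.
  have h1 : ((f i).*2 < (f i.+1).+1)%N by rewrite -(ltr_nat R) -muln2 natrM -natr1; lra.
  have h2 : (f i.+1 < (f i).*2.+2)%N by rewrite -(ltr_nat R) -!natr1 -muln2 natrM; lra.
  move: h1; rewrite ltnS leq_eqVlt => /orP[/eqP ->|h1]; first by left.
  by right; apply/eqP; rewrite eqn_leq -ltnS h2.
have fb i : (f i < 2 ^ i)%N.
  rewrite -(ltr_nat R) natrX; have /andP[a1 _] := fx i; apply: (le_lt_trans a1).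
  by rewrite -[ltRHS]mulr1 ltr_pM2l// exprn_gt0.
have p2 i k : pt i.+1 k.*2 = pt i k.
  by rewrite /pt -muln2 natrM exprS; field; rewrite expf_neq0.
pose dd i := `|W (pt i.+1 (f i.+1)) w - W (pt i (f i)) w|.
have tel : `|W (pt n (f n)) w| <= \sum_(i < n) dd i.
  have {1}-> : W (pt n (f n)) w = \sum_(i < n) (W (pt i.+1 (f i.+1)) w - W (pt i (f i)) w).
    rewrite -(big_mkord xpredT (fun i => W (pt i.+1 (f i.+1)) w - W (pt i (f i)) w)).
    rewrite telescope_sumr// (_ : f 0%N = 0%N) ?/pt ?mul0r ?W0 ?subr0//.
    by have := fb 0%N; rewrite expn0 ltnS leqn0 => /eqP.
  exact: ler_norm_sum.
set y := _ + _; have Xy i : (i < n)%N -> X i w <= y - expR 1.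
  move=> ni; rewrite /y addrAC subrr add0r (bigD1 (Ordinal ni))//= lerDl.
  by apply: sumr_ge0 => j _; exact: X_ge0.
have y1 : expR 1 <= y by rewrite lerDl sumr_ge0// => j _; exact: X_ge0.
apply: (@le_trans _ _ (expR (c * (\sum_(i < n) dd i) ^+ 2))).
  rewrite ler_expR (ler_pM2l c0) -[X in X <= _]real_normK ?num_real//.
  by rewrite ler_pXn2r ?nnegrE// sumr_ge0// => j _; exact: normr_ge0.
apply: (chaining_sum c0) => // [i _|i ni]; first exact: normr_ge0.
rewrite -/(wt i); set u := c * _.
have [|u1] := leP u 1; first by left.
right; have [k kb ek] : exists2 k, (k < 2 ^ i.+1)%N & dd i = `|inc i k w|.
  have [e|e] := f2 i.
    by exfalso; move: u1; rewrite /u /dd e p2 subrr normr0 mul0r expr0n mulr0 ltr10.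
  exists (f i).*2; first by rewrite expnS mul2n ltn_double.
  by rewrite /dd /inc e p2.
apply: (@le_trans _ _ (X i w)); last by have := Xy i ni; have := expR_gt0 (1:R); lra.
rewrite /X (bigD1 (Ordinal kb))//= mulrDr; apply: ler_wpDr.
  by rewrite mulr_ge0 ?expR_ge0// sumr_ge0// => j _; exact: expR_ge0.
rewrite -expRD ler_expR.
have -> : c * (inc i k w / wt i) ^+ 2 = u.
  by rewrite /u ek !expr_div_n real_normK ?num_real.
have : 0 <= i%:R :> R by [].
by move: (i%:R) => a a0; nra.
Qed.

Lemma level_moment i : (\int[P]_w (X i w)%:E <= (4 * 2^-1 ^+ i)%:E)%E.
Proof.
have ET k w : 0 <= expR ((2 * i%:R + 1) * (c * (inc i k w / wt i) ^+ 2)) by exact: expR_ge0.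
have mE k : measurable_fun setT (fun w => expR ((2 * i%:R + 1) * (c * (inc i k w / wt i) ^+ 2))).
  apply: measurableT_comp => //; apply: measurable_funM => //; apply: measurable_funM => //.
  by apply: measurable_funX; apply: measurable_funM.
under eq_integral do rewrite /X EFinM.
rewrite ge0_integralZl//; first last.
- by move=> w _; rewrite lee_fin sumr_ge0.
- by apply/measurable_EFinP; apply: measurable_sum => k; exact: mE.
under eq_integral do rewrite -sumEFin.
rewrite ge0_integral_sum//; last first.
  by move=> k; apply/measurable_EFinP; exact: mE.
apply: (@le_trans _ _ ((expR (- (2 * i%:R)))%:E * \sum_(k < 2 ^ i.+1) 2%:E)%E).
  apply: lee_wpmul2l; first by rewrite lee_fin expR_ge0.
  apply: lee_sum => k _.
  pose la := (2 * i%:R + 1) * c / wt i ^+ 2.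
  rewrite (eq_integral (fun w => (expR (la * (inc i k w) ^+ 2))%:E)); last first.
    move=> w _; congr (expR _)%:E; rewrite /la; field.
    by rewrite lt0r_neq0.
  apply: hG.
    have c1 : 0 <= c := ltW c0; have i0 : 0 <= i%:R :> R by [].
    have w1 : 0 <= (wt i ^+ 2)^-1 by rewrite invr_ge0 sqr_ge0.
    by rewrite /la -mulrA; apply: mulr_ge0; [lra|exact: mulr_ge0].
  have bern : 1 + 7 / 25 * i%:R <= (32 / 25) ^+ i :> R.
    elim: (i) => [|n IH]; first by rewrite expr0; lra.
    have n0 : 0 <= n%:R :> R by [].
    apply: (@le_trans _ _ (32 / 25 * (1 + 7 / 25 * n%:R))); first by rewrite -natr1; lra.
    by rewrite exprS ler_pM2l//; lra.
  have r0 : 0 < (4 / 5 : R) ^+ i by rewrite exprn_gt0//; lra.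
  have t0 : 0 < (2 : R) ^+ i by rewrite exprn_gt0.
  have -> : pt i.+1 k.+1 - pt i.+1 k = L / (2 * 2 ^+ i).
    by rewrite /pt exprS -natr1; field; rewrite lt0r_neq0.
  rewrite ger0_norm; last by rewrite divr_ge0 ?(ltW L0)// mulr_ge0// ltW.
  have -> : 8 * la * (L / (2 * 2 ^+ i)) = (2 * i%:R + 1) / (8 * (32 / 25) ^+ i).
    have -> : (32 / 25 : R) ^+ i = ((4 / 5) ^+ i) ^+ 2 * 2 ^+ i.
      by rewrite -exprM mulnC exprM -exprMn; congr (_ ^+ i); rewrite expr2; field.
    rewrite /la /c /wt; field.
    by rewrite !lt0r_neq0.
  have i0 : 0 <= i%:R :> R by [].
  rewrite ler_pdivrMr ?mulr_gt0 ?exprn_gt0//; lra.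
rewrite sumEFin -EFinM lee_fin sumr_const card_ord -[_ *+ (2 ^ _)]mulr_natr natrX exprS.
have e4 : 4 ^+ i <= expR (2 * i%:R) :> R.
  rewrite mulrC expRM_natl; apply: lerXn2r; rewrite ?nnegrE ?expR_ge0//.
  have -> : 2 = 1 + 1 :> R by [].
  by rewrite expRD; move: e1; move: (expR 1) => e e1'; nra.
rewrite expRN exprVn.
have t0 : 0 < (2 : R) ^+ i by rewrite exprn_gt0.
have e44 : 4 ^+ i = 2 ^+ i * 2 ^+ i :> R by rewrite -exprMn; congr (_ ^+ i); lra.
rewrite ler_pdivrMl ?expR_gt0// mulrCA mulrA.
rewrite mulrA ler_pdivlMr//.
move: e4; rewrite e44; move: (2 ^+ i) t0 => a a0 e4.
by rewrite -!mulrA; nra.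
Qed.

Let pow2_small (e : R) : 0 < e -> \forall n \near \oo, (2 ^+ n)^-1 < e.
Proof.
move=> e0; near=> n; apply: (@le_lt_trans _ _ n.+1%:R^-1).
  by rewrite lef_pV2 ?posrE ?exprn_gt0// -natrX ler_nat ltn_expl.
by near: n; exact: near_infty_natSinv_lt (PosNum e0).
Unshelve. all: by end_near. Qed.

(** A maximal inequality stated for measurable functions below the value at some time, which may
    depend on the path; this avoids the measurability of the supremum. The majorant $e+\sum_iX_i$
    has expectation at most $e+\sum_i4\cdot2^{-i}=e+8$. *)
Lemma path_sup_moment : exists c M : R, 0 < c /\ forall g : Omega -> R,
  measurable_fun setT g -> (forall w, 0 <= g w) ->
  (forall w, exists2 t, 0 <= t < L & g w <= expR (c * (W t w) ^+ 2)) ->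
  rint P g /\ \int[P]_w g w <= M.
Proof.
exists c, (expR 1 + 8); split=> // g mg g0 hg.
have dom w : ((g w)%:E <= (expR 1)%:E + \sum_(i <oo) (X i w)%:E)%E.
  set S := (\sum_(i <oo) _)%E.
  have S0 : (0 <= S)%E by apply: nneseries_ge0 => i _ _; rewrite lee_fin.
  have pS n : ((\sum_(i < n) X i w)%:E <= S)%E.
    rewrite -sumEFin -(big_mkord xpredT (fun i => (X i w)%:E)).
    by apply: nneseries_lim_ge => i _ _; rewrite lee_fin.
  move: S0 pS; case: S => [v _ pS| |] //; last by move=> _ _; rewrite addey// leey.
  have [t tL gt] := hg w.
  rewrite -EFinD lee_fin (le_trans gt)//.
  have t0 : 0 <= t by case/andP: tL.
  pose tn n := pt n (Num.truncn (2 ^+ n * (t / L))).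
  have ctn : tn n @[n --> \oo] --> t.
    apply/cvgrPdist_le => e e0.
    have el : 0 < e / L by rewrite divr_gt0.
    near=> n.
    have n0 : 0 < (2 : R) ^+ n by rewrite exprn_gt0.
    have hn : (2 ^+ n)^-1 < e / L by near: n; exact: pow2_small.
    have /Num.Theory.truncn_itv/andP[t1 t2] : 0 <= 2 ^+ n * (t / L).
      by rewrite !mulr_ge0 ?invr_ge0// ltW.
    have -> : t - tn n = (2 ^+ n * (t / L) - (Num.truncn (2 ^+ n * (t / L)))%:R) * (L * (2 ^+ n)^-1).
      by rewrite /tn /pt; field; rewrite !lt0r_neq0.
    have l1 : 0 < L * (2 ^+ n)^-1 by rewrite divr_gt0.
    rewrite ger0_norm; last by rewrite mulr_ge0 ?subr_ge0// ltW.
    apply: (@le_trans _ _ (1 * (L * (2 ^+ n)^-1))).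
      by rewrite ler_pM2r//; move: t2; rewrite -natr1; lra.
    by rewrite mul1r mulrC -ler_pdivlMr// ltW.
  have cE : expR (c * (W (tn n) w) ^+ 2) @[n --> \oo] --> expR (c * (W t w) ^+ 2).
    apply: (cvg_comp (fun n => tn n) (fun u => expR (c * (W u w) ^+ 2))); first exact: ctn.
    apply: (cvg_comp (fun u => c * (W u w) ^+ 2) expR); last exact: continuous_expR.
    by apply: cvgMl_tmp; apply: cvgM; exact: cW.
  rewrite -(cvg_lim _ cE)//; apply: limr_le; first exact: cvgP cE.
  apply: nearW => n; apply: (le_trans (dyadic_bound w n tL)).
  by rewrite lerD2l -lee_fin.
have mS : measurable_fun setT (fun w => (\sum_(i <oo) (X i w)%:E)%E).
  apply: (@ge0_emeasurable_sum _ _ _ _ (fun i w => (X i w)%:E) xpredT).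
    by move=> i w _ _; rewrite lee_fin.
  by move=> i _; apply/measurable_EFinP; exact: mX.
have S0 w : (0 <= \sum_(i <oo) (X i w)%:E)%E by apply: nneseries_ge0 => i _ _; rewrite lee_fin.
have IS : (\int[P]_w ((expR 1)%:E + \sum_(i <oo) (X i w)%:E) <= (expR 1 + 8)%:E)%E.
  rewrite ge0_integralD//.
  have -> : (\int[P]_w (expR 1)%:E = (expR 1)%:E)%E.
    by rewrite integral_cst//= probability_setT mule1.
  rewrite EFinD leeD2l//.
  rewrite integral_nneseries; last 3 first.
  - exact: measurableT.
  - by move=> i; apply/measurable_EFinP; exact: mX.
  - by move=> i w _; rewrite lee_fin.
  apply: lime_le; first by apply: is_cvg_nneseries => i _ _; apply: integral_ge0 => w _; rewrite lee_fin.
  apply: nearW => n.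
  apply: (@le_trans _ _ (\sum_(0 <= i < n) (4 * 2^-1 ^+ i)%:E)%E).
    by apply: lee_sum => i _; exact: level_moment.
  rewrite sumEFin lee_fin -mulr_sumr big_mkord.
  have := @subrX1 R 2^-1 n; have : 0 <= (2^-1 : R) ^+ n by rewrite exprn_ge0.
  by move: (_ ^+ n) (\sum_(i < n) _) => a b; lra.
have Ig : (\int[P]_w (g w)%:E <= (expR 1 + 8)%:E)%E.
  apply: le_trans IS; apply: ge0_le_integral => //.
  - by move=> w _; rewrite lee_fin.
  - by apply/measurable_EFinP; exact: mg.
  - by apply: emeasurable_funD => //; exact: mS.
have rg : rint P g.
  apply/integrableP; split; first exact/measurable_EFinP.
  under eq_integral do rewrite /= ger0_norm//.
  by apply: le_lt_trans Ig _; exact: ltry.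
split=> //; rewrite -lee_fin /Rintegral fineK//; exact: integrable_fin_num rg.
Unshelve. all: by end_near. Qed.

End Chaining.

(** * Growth of the hitting expectations in the starting point *)

Section HittingTransform.
Context {R : realType} d (Omega : measurableType d) (P : probability Omega R).
Local Notation RR := (measurableTypeR R).
Local Notation leb := (@lebesgue_measure R).

(* The path started at s hits at time tp (s, w), at height bp (s, w), when
   hp (s, w) holds. *)
Record hitdata (hp : RR * Omega -> bool) (tp bp : RR * Omega -> R) (L H c M : R) : Prop := Hitdata {
  hd_mh : measurable_fun setT hp;
  hd_mt : measurable_fun setT tp;
  hd_mb : measurable_fun setT bp;
  hd_c : 0 < c;
  hd_L : 0 <= L;
  hd_t : forall q, hp q -> 0 <= tp q <= L;
  hd_b : forall q, hp q -> bp q <= H;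
  hd_G : forall s, let G := fun w => if hp (s, w) then expR (c * (bp (s, w) - s) ^+ 2) else 0 in
    rint P G /\ \int[P]_w G w <= M }.

Definition Ehit (hp : RR * Omega -> bool) (tp bp : RR * Omega -> R) (xi : R[i]) (s : R) : R[i] :=
  cint P (fun w => if hp (s, w)
    then cexp (- (tp (s, w))%:C * xi ^+ 2 - (bp (s, w))%:C * xi) else 0).

Variables (hp : RR * Omega -> bool) (tp bp : RR * Omega -> R) (L H c M : R).
Hypothesis hd : hitdata hp tp bp L H c M.

Lemma hit_integrand_cmeas (disp : measure_display) (T : measurableType disp)
    (f : T -> R[i]) (g : T -> RR) (e : T -> Omega) :
  cmeas f -> measurable_fun setT g -> measurable_fun setT e ->
  cmeas (fun x => if hp (g x, e x)
    then cexp (- (tp (g x, e x))%:C * f x ^+ 2 - (bp (g x, e x))%:C * f x) else 0).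
Proof.
move=> mf mg me.
have mq : measurable_fun setT (fun x => (g x, e x)) by exact: measurable_fun_pair.
apply: cmeas_if; last exact: cmeas_cst.
  exact: measurableT_comp (hd_mh hd) mq.
apply: cmeas_cexp; apply: cmeasB; apply: cmeasM => //.
- by apply: cmeasN; apply: cmeasC; exact: measurableT_comp (hd_mt hd) mq.
- exact: cmeasX.
- by apply: cmeasC; exact: measurableT_comp (hd_mb hd) mq.
Qed.

Lemma Ehit_cmeas (disp : measure_display) (T : measurableType disp) (f : T -> R[i]) (g : T -> RR) :
  cmeas f -> measurable_fun setT g -> cmeas (fun x => Ehit hp tp bp (f x) (g x)).
Proof.
move=> mf mg.
have m1 : measurable_fun setT (@fst T Omega) by exact: measurable_fst.
apply: (@cmeas_cint R _ _ T Omega P (fun q : T * Omega => if hp (g q.1, q.2)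
    then cexp (- (tp (g q.1, q.2))%:C * f q.1 ^+ 2 - (bp (g q.1, q.2))%:C * f q.1) else 0)).
apply: (hit_integrand_cmeas (f := fun q => f q.1) (g := fun q => g q.1)).
- exact: cmeas_comp mf m1.
- exact: measurableT_comp mg m1.
- exact: measurable_snd.
Qed.

(** The quadratic term in the distance from the start to the hitting point is paid for by the moment
    in [hd_G]. *)
Lemma Ehit_bound_of (xi : R[i]) (s E : R) :
  (forall t b, 0 <= t <= L -> b <= H ->
    Re (- t%:C * xi ^+ 2 - b%:C * xi) <= E + c * (b - s) ^+ 2) ->
  nrm (Ehit hp tp bp xi s) <= 2 * M * expR E.
Proof.
move=> hE; have [iG IG] := hd_G hd s.
apply: (@le_trans _ _ (2 * \int[P]_w (expR E *
    (if hp (s, w) then expR (c * (bp (s, w) - s) ^+ 2) else 0)))).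
  apply: nrm_cint.
  - have m1 : measurable_fun setT (fun _ : Omega => s : RR) by exact: measurable_cst.
    exact: (hit_integrand_cmeas (cmeas_cst Omega xi) m1 (@measurable_id _ Omega setT)).
  - exact: rintZ.
  move=> w; case: ifPn => hw; last by rewrite nrm0 mulr0.
  by rewrite nrm_cexp -expRD ler_expR; apply: hE; [exact: (hd_t hd hw)|exact: (hd_b hd hw)].
by rewrite RintegralZl// -mulrA ler_pM2l// mulrC ler_pM2r ?expR_gt0.
Qed.

Lemma hit_moment_ge0 : 0 <= M.
Proof.
have [iG IG] := hd_G hd 0; apply: le_trans IG.
by apply: Rintegral_ge0 => w _; case: ifP => // _; exact: expR_ge0.
Qed.

(** With $D=b-s$, $aD\le a^2/(4c)+cD^2$ trades a linear exponent for the moment. Since $b\le H$, a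
    start high above must fall far, which gives decay at any rate $y$ as $s\to+\infty$. As
    $s\to-\infty$ the height is compared with $s$ itself, which gives decay at rate
    $|\mathrm{Re}\,\xi|$. *)
Lemma Ehit_bounds : exists K, 0 <= K /\ forall (xi : R[i]) s, Re xi <= 0 ->
  (forall y, 0 <= y -> nrm (Ehit hp tp bp xi s) <=
     K * expR (K * (nrm xi ^+ 2 + y ^+ 2)) * expR (- (y * s))) /\
  nrm (Ehit hp tp bp xi s) <= K * expR (K * nrm xi ^+ 2) * expR (- (Re xi * s)).
Proof.
have M0 := hit_moment_ge0; have c0 := hd_c hd; have L0 := hd_L hd.
pose c' := (4 * c)^-1; have c'0 : 0 < c' by rewrite invr_gt0 mulr_gt0.
have cc (a D : R) : a * D <= c' * a ^+ 2 + c * D ^+ 2.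
  have : 0 <= c * (D - a / (2 * c)) ^+ 2 by rewrite mulr_ge0 ?sqr_ge0// ltW.
  have -> : c * (D - a / (2 * c)) ^+ 2 = c * D ^+ 2 - a * D + c' * a ^+ 2.
    by rewrite /c'; field; exact: lt0r_neq0.
  lra.
pose K := 2 * M * expR (2 * H ^+ 2) + L + 1 + c'.
have e1 : 1 <= expR (2 * H ^+ 2) by rewrite -expR0 ler_expR mulr_ge0 ?sqr_ge0.
have M1 : 0 <= 2 * M * expR (2 * H ^+ 2) by rewrite !mulr_ge0 ?expR_ge0.
have M2 : 2 * M <= 2 * M * expR (2 * H ^+ 2).
  by rewrite -[leLHS]mulr1 ler_wpM2l ?mulr_ge0.
have K0 : 0 <= K by rewrite /K; lra.
have KL : L + 1 <= K by rewrite /K; lra.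
have KL' : L + c' <= K by rewrite /K; lra.
have Kc : 1 + c' <= K by rewrite /K; lra.
have KM : 2 * M * expR (2 * H ^+ 2) <= K by rewrite /K; lra.
clearbody K; exists K; split=> // xi s x0.
have nx := nrm_sqr xi; have n0 := nrm_ge0 xi.
have base t b E : 0 <= t <= L -> - b * Re xi <= E - L * nrm xi ^+ 2 + c * (b - s) ^+ 2 ->
    Re (- t%:C * xi ^+ 2 - b%:C * xi) <= E + c * (b - s) ^+ 2.
  move=> /andP[t0 tL] h; rewrite expr2 !ReImE.
  move: h nx; set v := Im xi; set x := Re xi; move=> h nx.
  have : t * v ^+ 2 <= L * nrm xi ^+ 2.
    by apply: ler_pM; rewrite ?sqr_ge0// nx lerDr sqr_ge0.
  have : 0 <= t * x ^+ 2 by rewrite mulr_ge0 ?sqr_ge0.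
  lra.
have xn : (Re xi) ^+ 2 <= nrm xi ^+ 2 by rewrite nx lerDl sqr_ge0.
split=> [y y0|].
  apply: (@le_trans _ _ (2 * M * expR ((L + 1) * nrm xi ^+ 2 + 2 * H ^+ 2 +
      (1 + c') * y ^+ 2 - y * s))).
    apply: Ehit_bound_of => t b tL bH; apply: base => //.
    have h1 := cc (- y) (b - s).
    have h2 : b * (y - Re xi) <= H * (y - Re xi) by rewrite ler_wpM2r//; lra.
    have h3 : H * y <= H ^+ 2 + y ^+ 2 by have := sqr_ge0 (H - y); nra.
    have h4 : - H * Re xi <= H ^+ 2 + (Re xi) ^+ 2 by have := sqr_ge0 (H + Re xi); nra.
    rewrite sqrrN in h1; move: h1 h2 h3 h4 xn.
    move: (y ^+ 2) (H ^+ 2) ((b - s) ^+ 2) (Re xi ^+ 2) (nrm xi ^+ 2) => y2 H2 D2 x2 n2.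
    nra.
  rewrite (_ : _ - y * s = 2 * H ^+ 2 + ((L + 1) * nrm xi ^+ 2 + (1 + c') * y ^+ 2) - y * s); last ring.
  rewrite 2!expRD mulrA ler_wpM2r ?expR_ge0// [leLHS]mulrA.
  apply: ler_pM => //; rewrite ?expR_ge0// ler_expR mulrDr.
  by apply: lerD; rewrite ler_wpM2r ?sqr_ge0.
apply: (@le_trans _ _ (2 * M * expR ((L + c') * nrm xi ^+ 2 - Re xi * s))).
  apply: Ehit_bound_of => t b tL bH; apply: base => //.
  have h1 := cc (- Re xi) (b - s); rewrite sqrrN in h1.
  have h2 : c' * Re xi ^+ 2 <= c' * nrm xi ^+ 2 by rewrite ler_wpM2l// ltW.
  move: h1 h2; move: (c' * Re xi ^+ 2) => a h1 h2; lra.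
rewrite expRD mulrA ler_wpM2r ?expR_ge0// ler_pM ?expR_ge0 ?mulr_ge0//.
  exact: le_trans M2 KM.
by rewrite ler_expR ler_wpM2r ?sqr_ge0.
Qed.

End HittingTransform.

(** * Decay of the integrand of chi *)

Section Chi.
Context {R : realType}.
Local Notation RR := (measurableTypeR R).
Local Notation leb := (@lebesgue_measure R).
Implicit Types (xi eta : R[i]) (s y : R).

Definition hitbounded (E : R[i] -> R -> R[i]) (K : R) := forall xi s, Re xi <= 0 ->
  (forall y, 0 <= y -> nrm (E xi s) <= K * expR (K * (nrm xi ^+ 2 + y ^+ 2)) * expR (- (y * s))) /\
  nrm (E xi s) <= K * expR (K * nrm xi ^+ 2) * expR (- (Re xi * s)).

Definition hitmeas (E : R[i] -> R -> R[i]) := forall (disp : measure_display)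
  (T : measurableType disp) (f : T -> R[i]) (g : T -> RR),
  cmeas f -> measurable_fun setT g -> cmeas (fun x => E (f x) (g x)).

Lemma hitbounded_le E K K' : K <= K' -> hitbounded E K -> hitbounded E K'.
Proof.
move=> KK' h xi s x0; have [h1 h2] := h xi s x0.
have K0 : 0 <= K.
  rewrite leNgt; apply/negP => Kn; have := le_trans (nrm_ge0 _) h2.
  by rewrite leNgt -mulrA nmulr_rlt0// mulr_gt0 ?expR_gt0.
have st a : 0 <= a -> K * expR (K * a) <= K' * expR (K' * a).
  by move=> a0; apply: ler_pM; rewrite ?expR_ge0// ler_expR ler_wpM2r.
split=> [y y0|]; [apply: le_trans (h1 y y0) _|apply: le_trans h2 _];
  by rewrite ler_wpM2r ?expR_ge0// st// ?addr_ge0 ?sqr_ge0.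
Qed.

Variables (E1 E2 : R[i] -> R -> R[i]) (K del : R).
Hypotheses (mE1 : hitmeas E1) (mE2 : hitmeas E2).
Hypotheses (bE1 : hitbounded E1 K) (bE2 : hitbounded E2 K).
Hypotheses (K0 : 0 <= K) (del0 : 0 < del) (del1 : del <= 1).

Let C := 2 * K * expR (2 * K) + K ^+ 2 * expR K + 2 * K.

(** For $s\ge0$ the growth of $e^{s\eta}$ is beaten by the decay of [E] at rate
    $y=\mathrm{Re}\,\eta+1$; for $s<0$ the exponential itself decays and [E] is bounded. *)
Let cross_bound (E : R[i] -> R -> R[i]) eta xi s : hitbounded E K ->
  del <= Re eta -> Re xi <= 0 ->
  nrm (cexp (s%:C * eta) * E xi s) <=
  C * expR (C * (nrm eta ^+ 2 + nrm xi ^+ 2)) * expR (- (del * `|s|)).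
Proof.
move=> bE e1 x0; have [h1 h2] := bE xi s x0.
have C1 : K * expR (2 * K) <= C.
  rewrite /C -2!mulrA; have : 0 <= K ^+ 2 * expR K by rewrite mulr_ge0 ?sqr_ge0 ?expR_ge0.
  have : 0 <= K * expR (2 * K) by rewrite mulr_ge0 ?expR_ge0.
  by move: K0; lra.
have C2 : 2 * K <= C.
  rewrite /C; have : 0 <= K ^+ 2 * expR K by rewrite mulr_ge0 ?sqr_ge0 ?expR_ge0.
  have : 0 <= 2 * K * expR (2 * K) by rewrite !mulr_ge0 ?expR_ge0.
  by move: K0; lra.
have en := Re_le_nrm eta.
have n2 : 0 <= nrm eta ^+ 2 + nrm xi ^+ 2 by rewrite addr_ge0 ?sqr_ge0.
have fin X : X <= K * (nrm eta ^+ 2 *+ 2 + nrm xi ^+ 2 + 2) - del * `|s| ->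
    K * expR X <= C * expR (C * (nrm eta ^+ 2 + nrm xi ^+ 2)) * expR (- (del * `|s|)).
  move=> hX; apply: (@le_trans _ _ (K * expR (2 * K) * expR (2 * K * (nrm eta ^+ 2 + nrm xi ^+ 2)) * expR (- (del * `|s|)))).
    rewrite -2!mulrA ler_wpM2l// -!expRD ler_expR; apply: le_trans hX _.
    have : 0 <= K * nrm xi ^+ 2 by rewrite mulr_ge0 ?sqr_ge0.
    by rewrite mulr2n; move: (nrm eta ^+ 2) (nrm xi ^+ 2) => a b; lra.
  rewrite ler_wpM2r ?expR_ge0//; apply: ler_pM; rewrite ?mulr_ge0 ?expR_ge0//.
  by rewrite ler_expR ler_wpM2r.
have eta2 : (Re eta + 1) ^+ 2 <= nrm eta ^+ 2 *+ 2 + 2.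
  have : Re eta ^+ 2 <= nrm eta ^+ 2 by rewrite nrm_sqr lerDl sqr_ge0.
  have := sqr_ge0 (Re eta - 1); rewrite mulr2n; move: (nrm eta ^+ 2) => a; nra.
rewrite nrmM nrm_cexp !ReImE mul0r subr0.
have [s0|s0] := leP 0 s.
  have y0 : 0 <= Re eta + 1 by move: del0; lra.
  apply: (@le_trans _ _ (expR (s * Re eta) * (K * expR (K * (nrm xi ^+ 2 + (Re eta + 1) ^+ 2)) * expR (- ((Re eta + 1) * s))))).
    by rewrite ler_wpM2l ?expR_ge0// h1.
  have ee a b e : expR a * (K * expR b * expR e) = K * expR (a + b + e) by rewrite !expRD; ring.
  rewrite ee; apply: fin; rewrite ger0_norm//.
  have h3 := ler_wpM2l K0 eta2.
  have h4 : del * s <= s by rewrite ler_piMl.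
  move: h3; rewrite mulr2n; move: (nrm eta ^+ 2) (nrm xi ^+ 2) ((Re eta + 1) ^+ 2) => a b e; lra.
apply: (@le_trans _ _ (expR (s * Re eta) * (K * expR (K * nrm xi ^+ 2)))).
  rewrite ler_wpM2l ?expR_ge0//; have := h1 0 (lexx _).
  by rewrite mul0r oppr0 expR0 mulr1 expr0n addr0.
rewrite mulrCA -expRD; apply: fin; rewrite ltr0_norm//.
have h3 : s * Re eta <= s * del by rewrite ler_wnM2l// ltW.
have h4 : 0 <= K * (nrm eta ^+ 2 *+ 2 + 2) by rewrite mulr_ge0// addr_ge0// mulrn_wge0// sqr_ge0.
by move: h3 h4; rewrite mulr2n; move: (nrm eta ^+ 2) (nrm xi ^+ 2) => a b; lra.
Qed.

(** [E1] alone decays on both sides, by its first bound with $y=1$ for $s\ge0$ and by its second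
    bound for $s<0$; [E2] is merely bounded. *)
Let both_bound eta xi s : del <= Re eta -> Re xi <= - del ->
  nrm (E1 xi s * E2 (- eta) s) <=
  C * expR (C * (nrm eta ^+ 2 + nrm xi ^+ 2)) * expR (- (del * `|s|)).
Proof.
move=> e1 x1.
have [h1 h2] := bE1 s (ltac:(move: del0; lra) : Re xi <= 0).
have [h3 _] := @bE2 (- eta) s ltac:(rewrite !ReImE; move: del0; lra).
have {}h3 : nrm (E2 (- eta) s) <= K * expR (K * nrm eta ^+ 2).
  by have := h3 0 (lexx _); rewrite mul0r oppr0 expR0 mulr1 expr0n addr0 nrmN.
have n2 : 0 <= nrm eta ^+ 2 + nrm xi ^+ 2 by rewrite addr_ge0 ?sqr_ge0.
have C1 : K ^+ 2 * expR K <= C.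
  rewrite /C; have : 0 <= 2 * K * expR (2 * K) by rewrite !mulr_ge0 ?expR_ge0.
  by move: K0; lra.
have C2 : K <= C.
  rewrite /C; have : 0 <= K ^+ 2 * expR K by rewrite mulr_ge0 ?sqr_ge0 ?expR_ge0.
  have : 0 <= 2 * K * expR (2 * K) by rewrite !mulr_ge0 ?expR_ge0.
  by move: K0; lra.
have hs : nrm (E1 xi s) <= K * expR (K * nrm xi ^+ 2 + K - del * `|s|).
  have [s0|s0] := leP 0 s.
    apply: le_trans (h1 1 ler01) _; rewrite -mulrA -expRD ler_wpM2l// ler_expR ger0_norm//.
    by rewrite mul1r expr1n mulrDr mulr1 lerD2l lerN2 ler_piMl.
  apply: le_trans h2 _; rewrite -mulrA -expRD ler_wpM2l// ler_expR ltr0_norm//.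
  have : Re xi * s >= - del * s by rewrite ler_wnM2r// ltW.
  by move: K0; move: (nrm xi ^+ 2) => a; lra.
rewrite nrmM; apply: (@le_trans _ _ (K * expR (K * nrm xi ^+ 2 + K - del * `|s|) * (K * expR (K * nrm eta ^+ 2)))).
  by apply: ler_pM; rewrite ?nrm_ge0.
rewrite mulrACA -expRD.
rewrite (_ : K * nrm xi ^+ 2 + K - del * `|s| + K * nrm eta ^+ 2 = K + K * (nrm eta ^+ 2 + nrm xi ^+ 2) - del * `|s|); last ring.
rewrite 2!expRD mulrA ler_wpM2r ?expR_ge0// mulrA -expr2.
by apply: ler_pM; rewrite ?mulr_ge0 ?sqr_ge0 ?expR_ge0// ler_expR ler_wpM2r.
Qed.

(** The three summands of the integrand of $\chi_{\mathfrak h}$, all indices above $1$ giving the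
    product. [E2] stands for the hitting expectation of the time-reversed data, with $E^-$ at $\eta$
    equal to [E2] at $-\eta$. *)
Definition theta (i : nat) eta xi s : R[i] :=
  if i is 0 then cexp (s%:C * eta) * E1 xi s
  else if i is 1 then cexp (- s%:C * xi) * E2 (- eta) s
  else E1 xi s * E2 (- eta) s.

Lemma theta_bound : exists C, 0 <= C /\ forall i eta xi s, del <= Re eta -> Re xi <= - del ->
  nrm (theta i eta xi s) <= C * expR (C * (nrm eta ^+ 2 + nrm xi ^+ 2)) * expR (- (del * `|s|)).
Proof.
exists C; split.
  by rewrite /C !addr_ge0 ?mulr_ge0 ?sqr_ge0 ?expR_ge0.
move=> [|[|i]] eta xi s e1 x1 /=.
- by apply: cross_bound => //; move: del0; lra.
(* The second summand is the first one under $(\eta,\xi)\mapsto(-\xi,-\eta)$. *)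
- rewrite -realCN -(opprK xi) mulrN -mulNr -realCN opprK.
  rewrite opprK [nrm eta ^+ 2 + _]addrC -(nrmN eta) -(nrmN xi).
  by apply: cross_bound => //; rewrite !ReImE; move: del0; lra.
- exact: both_bound.
Qed.

Lemma theta_cmeas i (disp : measure_display) (T : measurableType disp) (f g : T -> R[i]) (e : T -> RR) :
  cmeas f -> cmeas g -> measurable_fun setT e -> cmeas (fun x => theta i (f x) (g x) (e x)).
Proof.
move=> mf mg me; case: i => [|[|i]] /=; apply: cmeasM.
- by apply: cmeas_cexp; apply: cmeasM => //; exact: cmeasC.
- exact: mE1.
- by apply: cmeas_cexp; apply: cmeasM => //; apply: cmeasN; exact: cmeasC.
- by apply: mE2 => //; exact: cmeasN.
- exact: mE1.
- by apply: mE2 => //; exact: cmeasN.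
Qed.

End Chi.

(** * Airy integrals of hitting expectations *)

Section Rapid.
Context {R : realType}.
Local Notation RR := (measurableTypeR R).
Local Notation leb := (@lebesgue_measure R).
Implicit Types (z kap : R[i]) (x y e A : R) (G v : R -> R[i]).

Definition phi kap x y z : R[i] := cexp (kap * z ^+ 3 + x%:C * z ^+ 2 + y%:C * z).

(** The cubic term dominates every quadratic $A|G|^2$; this room later absorbs the growth
    $e^{A|z|^2}$ of the hitting expectations and of [chi]. *)
Definition rapid kap G v := [/\ cmeas (T := RR) G, cmeas (T := RR) v &
  forall A, 0 <= A -> exists K, 0 <= K /\ forall u,
    expR (Re (kap * G u ^+ 3) + A * nrm (G u) ^+ 2) * nrm (v u) <= K * gau 1 u].

Lemma mulr_le_sqr e x y : 0 < e -> x * y <= e * x ^+ 2 + (4 * e)^-1 * y ^+ 2.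
Proof.
move=> e0; have : 0 <= e * (x - y / (2 * e)) ^+ 2 by rewrite mulr_ge0 ?sqr_ge0// ltW.
have -> : e * (x - y / (2 * e)) ^+ 2 = e * x ^+ 2 - x * y + (4 * e)^-1 * y ^+ 2.
  by field; exact: lt0r_neq0.
lra.
Qed.

Lemma mulr_le4 (a b c d g K E : R) : 0 <= b -> 0 <= c -> 0 <= d ->
  a <= E * d -> E * c * b <= K * g -> a * b * c <= K * d * g.
Proof.
move=> b0 c0 d0 h1 h2; apply: (@le_trans _ _ (E * d * b * c)).
  by rewrite ler_wpM2r// ler_wpM2r.
have -> : E * d * b * c = E * c * b * d by ring.
by rewrite [leRHS]mulrAC ler_wpM2r.
Qed.

Lemma Re_sqr_bound z x : Re (x%:C * z ^+ 2) <= `|x| * nrm z ^+ 2.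
Proof.
rewrite !ReImE mul0r subr0; apply: le_trans (ler_norm _) _; rewrite normrM ler_wpM2l//.
by have := Re_le_nrm (z ^+ 2); rewrite nrmX expr2 ReMul.
Qed.

Lemma nrm_phi_le kap x y z e : 0 < e ->
  nrm (phi kap x y z) <= expR (Re (kap * z ^+ 3) + (`|x| + (4 * e)^-1) * nrm z ^+ 2) * expR (e * y ^+ 2).
Proof.
move=> e0; rewrite nrm_cexp -expRD ler_expR ReAdd ReAdd -addrA -addrA lerD2l mulrDl -addrA.
apply: lerD; first exact: Re_sqr_bound.
rewrite !ReImE mul0r subr0.
have := mulr_le_sqr y (Re z) e0.
have : (4 * e)^-1 * Re z ^+ 2 <= (4 * e)^-1 * nrm z ^+ 2.
  by rewrite ler_wpM2l// ?invr_ge0 ?mulr_ge0 ?(ltW e0)// nrm_sqr lerDl sqr_ge0.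
move: ((4 * e)^-1 * _) ((4 * e)^-1 * _) => a b; lra.
Qed.

(** In $\mathrm{Re}\,z\le0$ the factor $e^{yz}$ is bounded for $y\ge0$, so only negative $y$ costs;
    this is the origin of the one-sided weight in [Num.min q 0]. *)
Lemma nrm_phi_le_neg kap x y z e : 0 < e -> Re z <= 0 ->
  nrm (phi kap x y z) <= expR (Re (kap * z ^+ 3) + (`|x| + (4 * e)^-1) * nrm z ^+ 2) *
    expR (e * (Num.min y 0) ^+ 2).
Proof.
move=> e0 z0; apply: le_trans _ (nrm_phi_le _ _ _ _ e0).
rewrite !nrm_cexp ler_expR !(ReAdd, ReMul _%:C z) ReC ImC mul0r !subr0 lerD2l.
by case: (lerP y 0) => h; rewrite ?lexx// mul0r mulr_ge0_le0// ltW.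
Qed.

Lemma rapid_phi kap G v x A e : rapid kap G v -> 0 <= A -> 0 < e ->
  exists K, 0 <= K /\ forall u y,
    nrm (phi kap x y (G u) * v u) * expR (A * nrm (G u) ^+ 2) <= K * expR (e * y ^+ 2) * gau 1 u.
Proof.
move=> [_ _ h] A0 e0.
have [|K [K0 hK]] := h (`|x| + (4 * e)^-1 + A).
  by rewrite !addr_ge0// invr_ge0 mulr_ge0// ltW.
exists K; split=> // u y; rewrite nrmM.
apply: (mulr_le4 _ _ _ (nrm_phi_le kap x y (G u) e0)); rewrite ?nrm_ge0 ?expR_ge0//.
by rewrite -expRD -addrA -mulrDl.
Qed.

Lemma rapid_phi_neg kap G v x A e : rapid kap G v -> 0 <= A -> 0 < e ->
  (forall u, Re (G u) <= 0) ->
  exists K, 0 <= K /\ forall u y,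
    nrm (phi kap x y (G u) * v u) * expR (A * nrm (G u) ^+ 2) <=
    K * expR (e * (Num.min y 0) ^+ 2) * gau 1 u.
Proof.
move=> [_ _ h] A0 e0 G0.
have [|K [K0 hK]] := h (`|x| + (4 * e)^-1 + A).
  by rewrite !addr_ge0// invr_ge0 mulr_ge0// ltW.
exists K; split=> // u y; rewrite nrmM.
apply: (mulr_le4 _ _ _ (nrm_phi_le_neg kap x y e0 (G0 u))); rewrite ?nrm_ge0 ?expR_ge0//.
by rewrite -expRD -addrA -mulrDl.
Qed.

Lemma phi_cmeas kap x (disp : measure_display) (T : measurableType disp) (f : T -> R[i]) (g : T -> R) :
  cmeas f -> measurable_fun setT g -> cmeas (fun t => phi kap x (g t) (f t)).
Proof.
move=> mf mg; apply: cmeas_cexp; apply: cmeasD; first apply: cmeasD.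
- by apply: cmeasM; [exact: cmeas_cst|exact: cmeasX].
- by apply: cmeasM; [exact: cmeas_cst|exact: cmeasX].
- by apply: cmeasM => //; exact: cmeasC.
Qed.

End Rapid.

Section HitFubini.
Context {R : realType} d (Omega : measurableType d) (P : probability Omega R).
Local Notation RR := (measurableTypeR R).
Local Notation leb := (@lebesgue_measure R).
Variables (hp : RR * Omega -> bool) (tp bp : RR * Omega -> R) (L H c M : R).
Hypothesis hd : hitdata P hp tp bp L H c M.

Lemma hit_fubini (f Z : R -> R[i]) (g : R -> R) (s : R) :
  cmeas (T := RR) f -> cmeas (T := RR) Z -> (forall u, Re (Z u) <= 0) -> rint leb g ->
  (forall u, nrm (f u) * expR ((L + 1) * nrm (Z u) ^+ 2) <= g u) ->
  cint P (fun w => if hp (s, w) then ipi * cint leb (fun u => f u *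
      cexp (- (tp (s, w))%:C * Z u ^+ 2 - (bp (s, w))%:C * Z u)) else 0) =
  ipi * cint leb (fun u => f u * Ehit P hp tp bp (Z u) s).
Proof.
move=> mf mZ Z0 ig hg.
pose I (q : Omega * RR) := f q.2 * (if hp (s, q.1)
    then cexp (- (tp (s, q.1))%:C * Z q.2 ^+ 2 - (bp (s, q.1))%:C * Z q.2) else 0).
have m2 : measurable_fun setT (@snd Omega RR) by exact: measurable_snd.
have mI : cmeas I.
  apply: cmeasM; first exact: cmeas_comp mf m2.
  apply: (hit_integrand_cmeas hd (f := fun q => Z q.2) (g := fun=> s) (e := fst)).
  - exact: cmeas_comp mZ m2.
  - exact: measurable_cst.
  - exact: measurable_fst.
have g0 u : 0 <= g u by apply: le_trans (hg u); rewrite mulr_ge0 ?nrm_ge0 ?expR_ge0.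
(* From $-b\,\mathrm{Re}\,Z\le-H\,\mathrm{Re}\,Z\le H^2+|Z|^2$; the $|Z|^2$ is the $1$ in
   [L + 1]. *)
pose D := expR (H ^+ 2).
have hit_le w u : nrm (if hp (s, w) then
    cexp (- (tp (s, w))%:C * Z u ^+ 2 - (bp (s, w))%:C * Z u) else 0) <=
    D * expR ((L + 1) * nrm (Z u) ^+ 2).
  case: ifPn => hw; last by rewrite nrm0 mulr_ge0 ?expR_ge0.
  rewrite nrm_cexp -expRD ler_expR.
  have /andP[t0 tL] := hd_t hd hw; have bH := hd_b hd hw.
  rewrite ReAdd; have h1 := Re_sqr_bound (Z u) (- tp (s, w)).
  rewrite realCN normrN ger0_norm// in h1.
  have h2 : tp (s, w) * nrm (Z u) ^+ 2 <= L * nrm (Z u) ^+ 2 by rewrite ler_wpM2r ?sqr_ge0.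
  have h3 : Re (- ((bp (s, w))%:C * Z u)) <= H ^+ 2 + nrm (Z u) ^+ 2.
    rewrite !ReImE mul0r subr0.
    have h4 : bp (s, w) * - Re (Z u) <= H * - Re (Z u) by rewrite ler_wpM2r// oppr_ge0.
    have := sqr_ge0 (H + Re (Z u)); have := sqr_ge0 (Im (Z u)); rewrite nrm_sqr.
    have := sqr_ge0 H; have := sqr_ge0 (Re (Z u)); move: h4.
    move: (Im (Z u) ^+ 2) => v2; nra.
  move: h1 h2 h3; rewrite mulrDl mul1r; lra.
have bI w u : nrm (I (w, u)) <= D * g u.
  rewrite nrmM; apply: (@le_trans _ _ (nrm (f u) * (D * expR ((L + 1) * nrm (Z u) ^+ 2)))).
    by rewrite ler_wpM2l ?nrm_ge0.
  by rewrite mulrCA ler_wpM2l ?expR_ge0.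
have cI w : cintble leb (fun u => I (w, u)).
  apply: (@cintble_dom R _ RR leb _ (fun u => D * g u)) => //; last exact: rintZ.
  have mw : measurable_fun setT (fun u : RR => (w, u)) by exact: measurable_fun_pair.
  exact: cmeas_comp mI mw.
have r1 : rint P (fun=> D).
  apply/integrableP; split; first exact/measurable_EFinP.
  rewrite integral_cst//= probability_setT mule1 ltry//.
transitivity (cint P (fun w => ipi * cint leb (fun u => I (w, u)))).
  apply: eq_cint => w; rewrite /I /=; case: ifPn => // _.
  have -> : cint leb (fun u : RR => f u * 0) = 0.
    by rewrite -[RHS](@cint0 _ _ RR leb); apply: eq_cint => u; rewrite mulr0.
  by rewrite mulr0.
rewrite cintZ; last first.
  apply: (@cintble_dom _ _ _ _ _ (fun=> 2 * \int[leb]_u (D * g u))).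
  - exact: (@cmeas_cint R _ _ Omega RR leb I mI).
  - apply/integrableP; split; first exact/measurable_EFinP.
    rewrite integral_cst//= probability_setT mule1 ltry//.
  move=> w; apply: (@nrm_cint R _ RR leb) => //; last exact: rintZ.
  by have [/cintble_meas] := (cI w, tt).
congr (_ * _); rewrite (@cfubini R _ _ Omega RR P leb I (fun=> D) g mI)//; last by move=> w; exact: expR_ge0.
apply: eq_cint => u; rewrite /I /= cintZ//.
apply: (@cintble_dom _ _ _ _ _ (fun=> D * expR ((L + 1) * nrm (Z u) ^+ 2))) => //.
  apply: (hit_integrand_cmeas hd (f := fun=> Z u) (g := fun=> s) (e := id)) => //.
apply/integrableP; split; first exact/measurable_EFinP.
by rewrite integral_cst//= probability_setT mule1 ltry.
Qed.

End HitFubini.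

(** * Contour integrals of the three parts of chi *)

Section Weights.
Context {R : realType}.
Local Notation RR := (measurableTypeR R).
Local Notation leb := (@lebesgue_measure R).
Implicit Types (eta xi : R[i]).

Record rapidw (f G : R -> R[i]) : Prop := Rapidw {
  rw_f : cmeas (T := RR) f;
  rw_G : cmeas (T := RR) G;
  rw_bd : forall A, 0 <= A -> exists K, 0 <= K /\ forall u,
    nrm (f u) * expR (A * nrm (G u) ^+ 2) <= K * gau 1 u }.

Lemma rapidw_int f G (A : R) : rapidw f G -> 0 <= A ->
  exists B, 0 <= B /\ forall (F : R -> R[i]) D, cmeas (T := RR) F -> 0 <= D ->
    (forall v, nrm (F v) <= D * expR (A * nrm (G v) ^+ 2)) ->
    cintble leb (fun v : R => f v * F v) /\ nrm (cint leb (fun v : R => f v * F v)) <= B * D.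
Proof.
move=> [mf mG h] A0; have [K [K0 hK]] := h A A0.
have ig : rint leb (gau 1 : R -> R) by apply: rint_gau.
exists (2 * \int[leb]_u (K * gau 1 u)); split.
  by rewrite mulr_ge0// Rintegral_ge0// => u _; rewrite mulr_ge0 ?gau_ge0.
move=> F D mF D0 hF.
have bd v : nrm (f v * F v) <= D * (K * gau 1 v).
  rewrite nrmM; apply: le_trans (ler_wpM2l (nrm_ge0 _) (hF v)) _.
  by rewrite mulrCA ler_wpM2l.
have iD : rint leb (fun v => D * (K * gau 1 v)) by do 2 apply: rintZ.
split.
  by apply: (@cintble_dom R _ RR leb _ (fun v => D * (K * gau 1 v))) => //; exact: cmeasM.
apply: le_trans (@nrm_cint R _ RR leb _ (fun v => D * (K * gau 1 v)) (cmeasM mf mF) iD bd) _.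
by rewrite RintegralZl//; [rewrite [leRHS]mulrAC -mulrA [D * _]mulrC|exact: rintZ].
Qed.

Variables (E1 E2 : R[i] -> R -> R[i]) (K del : R).
Hypotheses (mE1 : hitmeas E1) (mE2 : hitmeas E2).
Hypotheses (bE1 : hitbounded E1 K) (bE2 : hitbounded E2 K).
Hypotheses (K0 : 0 <= K) (del0 : 0 < del) (del1 : del <= 1).
Local Notation theta := (theta E1 E2).

Definition Th i eta xi := cint leb (theta i eta xi).

Lemma Th_cmeas i (disp : measure_display) (T : measurableType disp) (f g : T -> R[i]) :
  cmeas f -> cmeas g -> cmeas (fun x => Th i (f x) (g x)).
Proof.
move=> mf mg; have m1 : measurable_fun setT (@fst T RR) by exact: measurable_fst.
apply: (@cmeas_cint R _ _ T RR leb (fun q => theta i (f q.1) (g q.1) q.2)).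
apply: theta_cmeas => //; [exact: cmeas_comp mf m1|exact: cmeas_comp mg m1].
Qed.

Lemma Th_bound : exists C, 0 <= C /\ forall i eta xi, del <= Re eta -> Re xi <= - del ->
  cintble leb (theta i eta xi) /\
  nrm (Th i eta xi) <= C * expR (C * (nrm eta ^+ 2 + nrm xi ^+ 2)).
Proof.
have [C [C0 hC]] := theta_bound bE1 bE2 K0 del0 del1.
have ie := rint_exp_abs del0.
pose I := 2 * \int[leb]_s expR (- (del * `|s|)).
have I0 : 0 <= I by rewrite mulr_ge0// Rintegral_ge0// => s _; exact: expR_ge0.
exists (C * I + C); split; first by rewrite addr_ge0// mulr_ge0.
move=> i eta xi h1 h2.
have mt : cmeas (T := RR) (theta i eta xi).
  by apply: (theta_cmeas mE1 mE2 i (f := fun=> eta) (g := fun=> xi)) => //; exact: cmeas_cst.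
have bd s : nrm (theta i eta xi s) <=
    C * expR (C * (nrm eta ^+ 2 + nrm xi ^+ 2)) * expR (- (del * `|s|)) by exact: hC.
split; first by apply: (@cintble_dom R _ RR leb _ _ mt (rintZ _ ie) bd).
apply: le_trans (@nrm_cint R _ RR leb _ _ mt (rintZ _ ie) bd) _.
rewrite RintegralZl// mulrCA -/I mulrAC.
have CI : 0 <= C * I by exact: mulr_ge0.
apply: ler_pM; [exact: CI|exact: expR_ge0|by rewrite lerDl|].
by rewrite ler_expR ler_wpM2r ?addr_ge0 ?sqr_ge0// lerDr.
Qed.

Variables (fR GR fL GL : R -> R[i]).
Hypotheses (wR : rapidw fR GR) (wL : rapidw fL GL).
Hypotheses (hGR : forall u, del <= Re (GR u)) (hGL : forall u, Re (GL u) <= - del).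

Definition inner i eta := cint leb (fun v => fL v * Th i eta (GL v)).

Lemma inner_cmeas i (disp : measure_display) (T : measurableType disp) (f : T -> R[i]) :
  cmeas f -> cmeas (fun x => inner i (f x)).
Proof.
move=> mf; have m1 : measurable_fun setT (@fst T RR) by exact: measurable_fst.
have m2 : measurable_fun setT (@snd T RR) by exact: measurable_snd.
apply: (@cmeas_cint R _ _ T RR leb (fun q => fL q.2 * Th i (f q.1) (GL q.2))).
apply: cmeasM; first exact: cmeas_comp (rw_f wL) m2.
by apply: Th_cmeas; [exact: cmeas_comp mf m1|exact: cmeas_comp (rw_G wL) m2].
Qed.

Lemma inner_bound : exists C, 0 <= C /\ forall i eta, del <= Re eta ->
  cintble leb (fun v => fL v * Th i eta (GL v)) /\
  nrm (inner i eta) <= C * expR (C * nrm eta ^+ 2).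
Proof.
have [C [C0 hC]] := Th_bound; have [B [B0 hB]] := rapidw_int wL C0.
exists (B * C + C); split; first by rewrite addr_ge0// mulr_ge0.
move=> i eta he.
have D0 : 0 <= C * expR (C * nrm eta ^+ 2) by rewrite mulr_ge0 ?expR_ge0.
have mT : cmeas (T := RR) (fun v => Th i eta (GL v)).
  by apply: Th_cmeas; [exact: cmeas_cst|exact: rw_G wL].
have [|h1 h2] := hB _ _ mT D0.
  by move=> v; have [_] := hC i eta (GL v) he (hGL v); rewrite mulrDr expRD mulrA.
split=> //; apply: le_trans h2 _; rewrite mulrA.
apply: ler_pM; rewrite ?mulr_ge0 ?expR_ge0//; first by rewrite lerDl.
by rewrite ler_expR ler_wpM2r ?sqr_ge0// lerDr mulr_ge0.
Qed.

Lemma outer_cintble i : cintble leb (fun u => fR u * inner i (GR u)).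
Proof.
have [C [C0 hC]] := inner_bound; have [B [B0 hB]] := rapidw_int wR C0.
have mF : cmeas (T := RR) (fun u => inner i (GR u)) by apply: inner_cmeas; exact: rw_G wR.
by apply: (proj1 (hB _ C mF C0 _)) => u; have [_] := hC i (GR u) (hGR u).
Qed.

Definition subweight f (a : R -> R -> R[i]) := cmeas (T := (RR * RR)%type) (fun q => a q.1 q.2) /\
  forall s, cintble leb (fun u : R => f u * a u s).

(** A composition of kernels is an integral over $s$ of a product of two contour integrals. The
    Gaussian weights on the contours and the factor $e^{-\delta|s|}$ of [theta_bound] allow the
    integral over $s$ to be done first, which produces [Th]. *)
Lemma theta_fubini i a b : subweight fR a -> subweight fL b ->
  (forall u v s, a u s * b v s = theta i (GR u) (GL v) s) ->
  cint leb (fun s : R => (ipi * cint leb (fun u : R => fR u * a u s)) *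
    (ipi * cint leb (fun v : R => fL v * b v s))) =
  ipi * (ipi * cint leb (fun u => fR u * inner i (GR u))).
Proof.
move=> [ma ia] [mb ib] ab.
have [C [C0 hC]] := theta_bound bE1 bE2 K0 del0 del1.
have ie := rint_exp_abs del0.
have [KR [KR0 hKR]] := rw_bd wR C0; have [KL [KL0 hKL]] := rw_bd wL C0.
have ig : rint leb (gau 1 : R -> R) by apply: rint_gau.
pose N u v s := fR u * (fL v * theta i (GR u) (GL v) s).
have bN u v s : nrm (N u v s) <= (C * KR * KL) * (gau 1 u * gau 1 v * expR (- (del * `|s|))).
  rewrite /N !nrmM; have ht := hC i (GR u) (GL v) s (hGR u) (hGL v).
  apply: le_trans (ler_wpM2l (nrm_ge0 (fR u)) (ler_wpM2l (nrm_ge0 (fL v)) ht)) _.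
  rewrite mulrDr expRD.
  have -> : forall x y e1 e2 e3 : R, x * (y * (C * (e1 * e2) * e3)) = C * ((x * e1) * (y * e2)) * e3.
    by move=> *; ring.
  have -> : C * KR * KL * (gau 1 u * gau 1 v * expR (- (del * `|s|))) =
     C * ((KR * gau 1 u) * (KL * gau 1 v)) * expR (- (del * `|s|)) by ring.
  rewrite ler_wpM2r ?expR_ge0// ler_wpM2l//.
  by apply: ler_pM; rewrite ?mulr_ge0 ?nrm_ge0 ?expR_ge0.
have mN (disp : measure_display) (T : measurableType disp) (x y e : T -> RR) :
    measurable_fun setT x -> measurable_fun setT y -> measurable_fun setT e ->
    cmeas (fun t => N (x t) (y t) (e t)).
  move=> mx my me; apply: cmeasM; first exact: cmeas_comp (rw_f wR) mx.
  apply: cmeasM; first exact: cmeas_comp (rw_f wL) my.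
  by apply: theta_cmeas => //; [exact: cmeas_comp (rw_G wR) mx|exact: cmeas_comp (rw_G wL) my].
pose F s u := cint leb (fun v => N u v s).
pose I := 2 * (C * KR * KL) * \int[leb]_v gau 1 v.
have I0 : 0 <= I by rewrite !mulr_ge0// Rintegral_ge0// => v _; exact: gau_ge0.
have bF s u : nrm (F s u) <= expR (- (del * `|s|)) * (I * gau 1 u).
  pose c := C * KR * KL * (gau 1 u * expR (- (del * `|s|))).
  apply: le_trans (@nrm_cint R _ RR leb _ (fun v => c * gau 1 v) _ (rintZ c ig) _) _.
  - by apply: (mN _ _ (fun=> u) id (fun=> s)).
  - by move=> v; apply: le_trans (bN u v s) _; rewrite /c le_eqVlt; apply/orP; left; apply/eqP; ring.
  by rewrite RintegralZl// /c /I le_eqVlt; apply/orP; left; apply/eqP; ring.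
have mF : cmeas (fun q : RR * RR => F q.1 q.2).
  apply: (@cmeas_cint R _ _ (RR * RR)%type RR leb (fun q => N q.1.2 q.2 q.1.1)).
  apply: mN; first exact: (measurableT_comp measurable_snd measurable_fst).
    exact: measurable_snd.
  exact: (measurableT_comp measurable_fst measurable_fst).
have E s : (ipi * cint leb (fun u : R => fR u * a u s)) * (ipi * cint leb (fun v : R => fL v * b v s)) =
    ipi * ipi * cint leb (F s).
  rewrite mulrACA; congr (_ * _); rewrite -(cintZr _ (ia s)); apply: eq_cint => u.
  rewrite -(cintZ _ (ib s)); apply: eq_cint => v.
  by rewrite /N -ab; ring.
rewrite (@eq_cint R _ RR leb _ _ E) cintZ; last first.
  apply: (@cintble_dom R _ RR leb _ (fun s => 2 * \int[leb]_u (I * gau 1 u) * expR (- (del * `|s|)))).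
  - exact: (@cmeas_cint R _ _ RR RR leb (fun q => F q.1 q.2)).
  - exact: rintZ.
  move=> s; rewrite -mulrA [\int[_]_(_ in _) _ * _]mulrC -RintegralZl//; last exact: rintZ.
  apply: (@nrm_cint R _ RR leb) => //; last by do 2 apply: rintZ.
  by apply: (cmeas_comp mF (g := fun u => (s, u))); exact: measurable_fun_pair.
rewrite mulrA; congr (_ * _).
rewrite (@cfubini R _ _ RR RR leb leb (fun q => F q.1 q.2) (fun s => expR (- (del * `|s|))) (fun u => I * gau 1 u))//=.
- apply: eq_cint => u; rewrite /F.
  pose c := C * KR * KL * gau 1 u.
  have c0 : 0 <= c by rewrite !mulr_ge0 ?gau_ge0.
  rewrite (@cfubini R _ _ RR RR leb leb (fun q => N u q.2 q.1) (fun s => c * expR (- (del * `|s|))) (gau 1))//=.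
  + have [C' [_ hI]] := inner_bound; have [iI _] := hI i (GR u) (hGR u).
    rewrite /inner -(cintZ _ iI); apply: eq_cint => v.
    have [C2 [_ hT]] := Th_bound; have [iT _] := hT i (GR u) (GL v) (hGR u) (hGL v).
    rewrite /N /Th cintZ; last exact: cintbleZ.
    by rewrite cintZ.
  + by apply: (mN _ _ (fun=> u)).
  + by move=> s; rewrite mulr_ge0 ?expR_ge0.
  + by move=> s; exact: gau_ge0.
  + exact: rintZ.
  + move=> s v; apply: le_trans (bN u v s) _; rewrite /c le_eqVlt; apply/orP; left; apply/eqP; ring.
- by move=> s; rewrite mulr_ge0 ?gau_ge0.
- exact: rintZ.
Qed.

End Weights.

(** * The directions of the contours *)

Section Angles.
Context {R : realType}.

Lemma cos_triple (x : R) : cos (x + (x + x)) = 4 * cos x ^+ 3 - 3 * cos x.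
Proof.
rewrite !cosD sinD; have := cos2Dsin2 x; move: (cos x) (sin x) => c s h.
have -> : 4 * c ^+ 3 - 3 * c = 4 * c ^+ 3 - 3 * c * (c ^+ 2 + s ^+ 2) by rewrite h mulr1.
ring.
Qed.

(** For $x=\pi/3$ the triple-angle formula with $\cos3x=-1$ gives $(c+1)(2c-1)^2=0$. *)
Lemma cos_sin_2pi3 : cos (2 * pi / 3) = - (1/2) :> R /\ 0 < sin (2 * pi / 3) :> R /\
  sin (2 * pi / 3) ^+ 2 = 3/4 :> R.
Proof.
have pi0 := @pi_gt0 R; pose x : R := pi / 3.
have x0 : 0 < x < pi by rewrite /x; apply/andP; split; lra.
have e : 2 * pi / 3 = pi - x :> R by rewrite /x; field.
have s0 : 0 < sin x by apply: sin_gt0_pi.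
have c1 : cos x = 1/2.
  have h := cos_triple x; rewrite (_ : x + (x + x) = pi) in h; last by rewrite /x; field.
  rewrite cospi in h; have := cos2Dsin2 x; move: (cos x) (sin x) s0 h => c s s0 h1 h2.
  have : (c + 1) * (2 * c - 1) ^+ 2 = 0 by move: h1; rewrite !exprS expr0; lra.
  move/eqP; rewrite mulf_eq0 sqrf_eq0 => /orP[/eqP h3|/eqP h3]; last lra.
  have hc : c = -1 by lra.
  have : s ^+ 2 = 0 by move: h2; rewrite hc sqrrN expr1n; lra.
  by move=> /eqP; rewrite sqrf_eq0 => /eqP h4; move: s0; rewrite h4 ltxx.
have -> : sin (2 * pi / 3) = sin x :> R by rewrite e sinB sinpi cospi; ring.
have -> : cos (2 * pi / 3) = - cos x :> R by rewrite e cosB sinpi cospi; ring.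
have := cos2Dsin2 x; rewrite c1 => h; split=> //; split=> //.
by move: h; move: (sin x ^+ 2) => a; rewrite expr2; lra.
Qed.

(** For $x=\pi/5$, $\cos3x=-\cos2x$ gives $4c^2-2c-1=0$, which confines $c$ to $(0.8,\,0.82)$. The
    inequalities place the reflected right contour in the cone of slopes $\frac12$ to $\frac32$. *)
Lemma cos_sin_pi5 : [/\ 0 < cos (pi / 5) :> R, 0 < sin (pi / 5) :> R,
  sin (pi / 5) < cos (pi / 5) :> R & cos (pi / 5) < 3/2 * sin (pi / 5) :> R].
Proof.
have pi0 := @pi_gt0 R; pose x : R := pi / 5.
have x0 : 0 < x < pi by rewrite /x; apply/andP; split; lra.
have s0 : 0 < sin x by apply: sin_gt0_pi.
have c0 : 0 < cos x by apply: cos_gt0_pihalf; rewrite /x; apply/andP; split; lra.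
have h := cos_triple x.
rewrite (_ : x + (x + x) = pi - (x + x)) in h; last by rewrite /x; field.
rewrite cosB cospi sinpi cosD in h; have := cos2Dsin2 x.
rewrite -/x; move: (cos x) (sin x) s0 c0 h => c s s0 c0 h1 h2.
have h3 : 4 * c ^+ 2 - 2 * c - 1 = 0.
  have : (c + 1) * (4 * c ^+ 2 - 2 * c - 1) = 0.
    by move: h1 h2; rewrite !exprS expr0; nra.
  by move/eqP; rewrite mulf_eq0 => /orP[/eqP h|/eqP//]; lra.
have c1 : c < 82/100 by rewrite ltNge; apply/negP => hc; nra.
have c2 : 8/10 < c by rewrite ltNge; apply/negP => hc; nra.
by split=> //; rewrite ltNge; apply/negP => hc; nra.
Qed.

End Angles.

Section ContourFacts.
Context {R : realType}.
Local Notation RR := (measurableTypeR R).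
Local Notation leb := (@lebesgue_measure R).
Implicit Types (G v : R -> R[i]).

Definition kapL : R[i] := - (3^-1)%:C.
Definition kapR : R[i] := (3^-1)%:C.

(** The slopes $1/\sqrt3\approx0.58$ of the left contours and $\cot(\pi/5)\approx1.38$ of the
    reflected right contour both lie between $\frac12$ and $\frac32$, so contours of both kinds can
    be deformed into each other. *)
Record acontour G v : Prop := Acontour {
  ac_adm : adm G v;
  ac_cone : exists e C, [/\ 0 < e, 0 <= C & cone (1/2) (3/2) e C G] }.

Lemma acontour_rapid G v : acontour G v -> rapid kapL G v.
Proof.
move=> [ag [e [C [e0 C0 hc]]]]; split; [exact: adm_cmeas ag|exact: adm_meas ag|].
move=> A A0; have [K hK] := airy_bound e0 C0 A0; have [V [V0 hV]] := adm_bd ag.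
exists (expR K * V); split; first by rewrite mulr_ge0 ?expR_ge0.
move=> u; rewrite mulrAC; apply: ler_pM; rewrite ?expR_ge0 ?nrm_ge0//.
by rewrite /gau mul1r -expRD ler_expR; exact: hK.
Qed.

Lemma left_acontour G : is_contour (2 * pi / 3) G -> acontour G (velocity G).
Proof.
move=> /is_contour_vlim hv; have [ec [s0 s2]] := @cos_sin_2pi3 R.
split; first exact: vlim_adm hv.
by apply: (vlim_cone hv s0); rewrite ec; nra.
Qed.

Lemma left_gcontour G : is_contour (2 * pi / 3) G -> gcontour G (velocity G).
Proof.
move=> /is_contour_vlim hv; have [ec [s0 s2]] := @cos_sin_2pi3 R.
split; first exact: vlim_adm hv.
by apply: (vlim_cone hv s0); rewrite ec; nra.
Qed.

Lemma left_slope G : is_contour (2 * pi / 3) G ->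
  exists A, forall u, - Re (G u) - 3/4 * (sgn u * Im (G u)) <= A.
Proof.
move=> /is_contour_vlim hv; have [ec [s0 s2]] := @cos_sin_2pi3 R.
have [|C [C0 hC]] := @vlim_lin R _ _ _ _ 1 (3/4) 0 hv; first by rewrite ec; nra.
by exists C => u; have := hC u; rewrite mul0r mul1r; lra.
Qed.

Lemma left_neg G : is_contour (2 * pi / 3) G -> (forall t, Re (G t) < 0) ->
  exists del, 0 < del /\ forall u, Re (G u) <= - del.
Proof.
move=> /is_contour_vlim hv; have [ec _] := @cos_sin_2pi3 R.
by apply: (vlim_neg hv); rewrite ec; lra.
Qed.

Lemma right_acontour G : is_contour (pi / 5) G ->
  acontour (fun u => - G (- u)) (fun u => velocity G (- u)).
Proof.
move=> /is_contour_vlim /vlim_refl hv; have [c0 s0 h1 h2] := @cos_sin_pi5 R.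
split; first exact: vlim_adm hv.
by apply: (vlim_cone hv s0); lra.
Qed.

Lemma right_rapid G : is_contour (pi / 5) G -> rapid kapR G (velocity G).
Proof.
move=> hG; have [_ _ h] := acontour_rapid (right_acontour hG).
have ag := vlim_adm (is_contour_vlim hG).
split; [exact: adm_cmeas ag|exact: adm_meas ag|] => A A0.
have [K [K0 hK]] := h A A0; exists K; split=> // u.
have := hK (- u); rewrite !opprK nrmN /gau sqrrN.
by rewrite (_ : kapL * (- G u) ^+ 3 = kapR * G u ^+ 3)// /kapL /kapR; ring.
Qed.

Lemma right_pos G : is_contour (pi / 5) G -> (forall t, 0 < Re (G t)) ->
  exists del, 0 < del /\ forall u, del <= Re (G u).
Proof.
move=> /is_contour_vlim /vlim_refl hv G0; have [c0 _ _ _] := @cos_sin_pi5 R.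
have [||del [d0 hd]] := vlim_neg hv; first by lra.
  by move=> u; rewrite ReOpp; have := G0 (- u); lra.
by exists del; split=> // u; have := hd (- u); rewrite opprK ReOpp; lra.
Qed.

Lemma rapid_cintble kap G v x y : rapid kap G v ->
  cintble leb (fun u => phi kap x y (G u) * v u).
Proof.
move=> hr; have [mG mv _] := hr.
have [K [K0 hK]] := rapid_phi x hr (lexx 0) ltr01.
apply: (@cintble_dom R _ RR leb _ (fun u => K * expR (1 * y ^+ 2) * gau 1 u)).
- by apply: cmeasM => //; apply: phi_cmeas => //; exact: measurable_cst.
- by apply: rintZ; exact: rint_gau.
by move=> u; have := hK u y; rewrite mul0r expR0 mulr1.
Qed.

(* Reflection through the origin turns the right contour into a left one. *)
Lemma Sk_left gR G v x p q : is_contour (pi / 5) gR -> acontour G v ->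
  Sk gR 1 x p q = ipi * pint G v (phi kapL x (q - p)).
Proof.
move=> hR hG; rewrite /Sk contour_intE; congr (_ * _).
have [aR cR] := right_acontour hR; have [aG cG] := hG.
rewrite /phi -(airy_move x (q - p) aR aG cR cG) /pint.
transitivity (cint leb (fun u => phi kapR x (p - q) (gR u) * velocity gR u)).
  by apply: eq_cint => u; rewrite /phi /kapR mul1r.
rewrite -(cint_opp (rapid_cintble x (p - q) (right_rapid hR))).
apply: eq_cint => u; congr (cexp _ * _); rewrite /kapR !rCE.
ring.
Qed.

End ContourFacts.

(** * Initial data and Brownian hitting times *)

Section InitialDataFacts.
Context {R : realType}.
Implicit Types (h : R -> \bar R) (x r : R).

Lemma UCc_refl h : UCc h -> UCc (fun x => h (- x)).
Proof.
move=> [lsc hoo [x0 hx0] [A [cA hA]]]; split=> //.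
- move=> x a ax; have [V nV hV] := lsc (- x) a ax.
  exists (-%R @^-1` V); last by move=> y; exact: hV.
  by have cN : {for x, continuous (-%R : R -> R)} by [exact: opp_continuous]; exact: cN.
- by exists (- x0); rewrite opprK.
- exists (-%R @^-1` A); split; last by move=> x; exact: hA.
  have -> : -%R @^-1` A = -%R @` A.
    by apply/seteqP; split=> [x Ax|_ [y Ay <-]] /=; [exists (- x); rewrite ?opprK|rewrite opprK].
  apply: continuous_compact => //; apply: continuous_subspaceT; exact: opp_continuous.
Qed.

Lemma UCc_usc h : UCc h -> forall x r, (h x < r%:E)%E -> \forall y \near x, (h y < r%:E)%E.
Proof.
move=> [lsc _ _ _] x r hr; have [V nV hV] : exists2 V, nbhs x V &
    forall y, V y -> ((- r)%:E < - h y)%E.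
  by apply: lsc; rewrite EFinN lteN2.
by apply: filterS nV => y /hV; rewrite EFinN lteN2.
Qed.

(** Semicontinuity bounds $\mathfrak h$ from above locally, and the compact set outside which it is
    $-\infty$ makes the bound uniform. *)
Lemma UCc_bounds h : UCc h -> exists L H, [/\ 0 <= L, forall x, (h x <= H%:E)%E &
  forall x, h x != -oo%E -> `|x| <= L].
Proof.
move=> hh; have husc := UCc_usc hh; case: hh => [_ hoo _ [A [cA hA]]].
have [M [_ hM]] := compact_bounded cA.
have A_le x : A x -> `|x| <= `|M| + 1.
  by move=> Ax; apply: hM Ax; rewrite (le_lt_trans (ler_norm M))// ltrDl.
have hlt x : exists r, (h x < r%:E)%E.
  by move: (hoo x); case: (h x) => [v| |] // _; [exists (v + 1); rewrite lte_fin ltrDl|exists 0; rewrite ltNyr].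
have /compact_near_coveringP cov := cA.
have [] := cov R (+oo)%R (fun H x => (h x <= H%:E)%E) _.
  move=> x _; have [r hr] := hlt x.
  exists ([set y | (h y < r%:E)%E], [set m : R | r <= m]).
    by split; [exact: husc hr|exact: (nbhs_pinfty_ge (num_real r))].
  by move=> [y m] /= [h1 h2]; apply: (le_trans (ltW h1)); rewrite lee_fin.
move=> H [_ hH]; exists (`|M| + 1), (H + 1); split; first by rewrite addr_ge0.
- move=> x; have [Ax|nAx] := pselect (A x); last by rewrite hA// leNye.
  by apply: (hH (H + 1)) => //; rewrite ltrDl.
- move=> x hx; apply: A_le; apply: contrapT => /hA e; by rewrite e eqxx in hx.
Qed.

End InitialDataFacts.

Section BrownianHitting.
Context {R : realType} d (Omega : measurableType d) (P : probability Omega R).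
Local Notation RR := (measurableTypeR R).
Local Notation leb := (@lebesgue_measure R).

(** Stable under time reversal, so that one argument serves both hitting times. *)
Definition gauss_increments (W : R -> Omega -> R) := forall s t la : R, 0 <= la ->
  8 * la * `|t - s| <= 1 -> (\int[P]_w (expR (la * (W t w - W s w) ^+ 2))%:E <= 2%:E)%E.

Lemma brownian_increments (W : R -> {RV P >-> R}) : two_sided_brownian W ->
  gauss_increments (fun t => W t : Omega -> R).
Proof.
move=> [_ _ hlaw _] s t la la0.
wlog: s t / s <= t => [hw|].
  have [st|/ltW ts] := leP s t; first exact: hw.
  rewrite distrC => h; have := hw t s ts h; congr (_ <= _)%E.
  by apply: eq_integral => w _; rewrite -sqrrN opprB.
rewrite le_eqVlt => /orP[/eqP -> _|st hla].
  under eq_integral do rewrite subrr expr0n mulr0 expR0.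
  by rewrite integral_cst//= probability_setT mule1 lee_fin; lra.
rewrite ger0_norm in hla; last by rewrite subr_ge0 ltW.
have ts0 : 0 < t - s by rewrite subr_gt0.
pose D w := W t w - W s w : RR.
have mD : measurable_fun setT D by exact: measurable_funB.
have mf : measurable_fun [set: RR] (fun x : RR => (expR (la * x ^+ 2))%:E).
  apply/measurable_EFinP; apply: measurableT_comp => //.
  by apply: measurable_funM => //; exact: measurable_funX.
apply: le_trans _ (gauss_moment ts0 la0 hla).
have -> : (\int[P]_w (expR (la * (W t w - W s w) ^+ 2))%:E =
    \int[pushforward P D]_x (expR (la * x ^+ 2))%:E)%E.
  by rewrite ge0_integral_pushforward// => x _; rewrite lee_fin expR_ge0.
rewrite (eq_measure_integral (normal_prob 0 (Num.sqrt (2 * (t - s)))))//.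
by move=> A mA _; exact: (hlaw s t A st mA).
Qed.

Variables (W : R -> Omega -> R) (h : R -> \bar R) (L H : R).
Hypothesis mW : forall t, measurable_fun setT (W t).
Hypothesis cW : forall w t, W u w @[u --> t] --> W t w.
Hypothesis W0 : forall w, W 0 w = 0.
Hypothesis hG : gauss_increments W.
Hypothesis L0 : 0 <= L.
Hypothesis hH : forall x, (h x <= H%:E)%E.
Hypothesis hL : forall x, h x != -oo%E -> `|x| <= L.
Hypothesis husc : forall x (r : R), (h x < r%:E)%E -> \forall y \near x, (h y < r%:E)%E.

Definition hitp (q : RR * Omega) : bool := (tau W h q < +oo)%E.
Definition hitt (q : RR * Omega) : R := fine (tau W h q).
Definition hitb (q : RR * Omega) : R := q.1 + W (hitt q) q.2.

Lemma brownian_hitdata : exists c M, hitdata P hitp hitt hitb L H c M.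
Proof.
(* [path_sup_moment] wants a positive horizon and times strictly below it, while [L] may be $0$ and
   the hit may occur at [L]. *)
have L1 : 0 < L + 1 by move: L0; lra.
have [c [M [c0 hM]]] := path_sup_moment mW cW W0 L1 hG.
have mtau := tau_meas mW cW hH hL husc.
have mp : measurable_fun setT hitp by apply: measurable_fun_lte.
have mt : measurable_fun setT hitt by exact: measurableT_comp.
have t0 q : 0 <= hitt q by apply: fine_ge0; exact: tau_ge0.
have mb : measurable_fun setT hitb.
  by apply: measurable_funD => //; exact: (process_meas mW cW).
have att q : hitp q -> 0 <= hitt q <= L /\ hitb q <= H.
  case: q => s w hq; have [a [e aL ha]] := tau_attained cW hH hL husc hq.
  rewrite /hitb /hitt e /=; split=> //; exact: (hits_range hH hL ha).2.
exists c, M; split=> //; try by move=> q /att[].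
move=> s G; apply: hM.
- apply: measurable_fun_ifT.
  + by apply: (measurableT_comp mp); exact: measurable_fun_pair.
  + apply: measurableT_comp => //; apply: measurable_funM => //.
    apply: measurable_funX; apply: measurable_funB => //.
    by apply: (measurableT_comp mb); exact: measurable_fun_pair.
  + exact: measurable_cst.
- by move=> w; rewrite /G; case: ifP => // _; exact: expR_ge0.
move=> w; rewrite /G; case: ifPn => hw; last first.
  by exists 0; rewrite ?expR_ge0// lexx L1.
have [/andP[a0 aL] _] := att _ hw.
exists (hitt (s, w)); first by rewrite a0 /=; lra.
by rewrite /hitb /= addrAC subrr add0r.
Qed.

End BrownianHitting.

Section TauMinus.
Context {R : realType}.

Lemma tau_minusE (h : R -> \bar R) (b : R -> R) :
  tau_minus h b = (- tau_plus (fun x => h (- x))%R (fun t => b (- t))%R)%E.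
Proof.
rewrite /tau_minus /tau_plus /ereal_inf oppeK; congr ereal_sup.
apply/seteqP; split=> [_ [a [a0 ha] <-]|_ [_ [a [a0 ha] <-] <-]].
  exists (- a)%:E; last by rewrite EFinN oppeK.
  by exists (- a) => //; split; rewrite ?oppr_ge0 ?opprK.
by exists (- a); rewrite ?EFinN//; split; rewrite ?oppr_le0.
Qed.

Lemma phi_sub kap (x y t b : R) z :
  phi kap (x - t) (y - b) z = phi kap x y z * cexp (- t%:C * z ^+ 2 - b%:C * z).
Proof. by rewrite /phi -cexpD; congr cexp; rewrite !rCE; ring. Qed.

Lemma rapid_rapidw kap G v x y : rapid (R := R) kap G v ->
  rapidw (fun u => phi kap x y (G u) * v u) G.
Proof.
move=> hr; have [mG mv _] := hr; split=> //.
  by apply: cmeasM => //; apply: phi_cmeas => //; exact: measurable_cst.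
move=> A A0; have [K [K0 hK]] := rapid_phi x hr A0 ltr01.
exists (K * expR (1 * y ^+ 2)); split; first by rewrite mulr_ge0 ?expR_ge0.
by move=> u; exact: hK.
Qed.

End TauMinus.

Section HitFacts.
Context {R : realType} d (Omega : measurableType d) (P : probability Omega R).
Local Notation RR := (measurableTypeR R).
Local Notation leb := (@lebesgue_measure R).
Variables (W : R -> {RV P >-> R}) (h : R -> \bar R) (gR G1 : R -> R[i]).
Hypotheses (hW : two_sided_brownian W) (hh : UCc h).
Hypotheses (hgR : is_contour (pi / 5) gR) (hgRpos : forall t, 0 < Re (gR t)).
Hypotheses (hG1 : is_contour (2 * pi / 3) G1) (hG1neg : forall t, Re (G1 t) < 0).

Let W' t : Omega -> R := W (- t).
Let h' x := h (- x).

Section Generic.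
Variables (hp : RR * Omega -> bool) (tp bp : RR * Omega -> R) (L H c M : R).
Hypothesis hd : hitdata P hp tp bp L H c M.

(** Shifting the arguments of the Airy kernel by the hitting time and height multiplies the
    integrand over [G1] by the hitting exponential ([phi_sub]), and Fubini takes the expectation
    inside. The contour has to be in $\mathrm{Re}\le0$, where heights bounded above control that
    exponential. *)
Lemma Sk_hit_left x s q :
  cint P (fun w => if hp (s, w) then Sk gR 1 (x - tp (s, w)) (bp (s, w)) q else 0) =
  ipi * cint leb (fun u => phi kapL x q (G1 u) * velocity G1 u * Ehit P hp tp bp (G1 u) s).
Proof.
have hr := acontour_rapid (left_acontour hG1).
have L1 : 0 <= L + 1 by rewrite addr_ge0// (hd_L hd).
have [mG mv _] := hr; have [B [B0 hB]] := rapid_phi x hr L1 ltr01.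
have mf : cmeas (T := RR) (fun u => phi kapL x q (G1 u) * velocity G1 u).
  by apply: cmeasM => //; apply: phi_cmeas => //; exact: measurable_cst.
have ig : rint leb (fun u => B * expR (1 * q ^+ 2) * gau 1 u) by apply: rintZ; exact: rint_gau.
apply: etrans (hit_fubini hd s mf mG (fun u => ltW (hG1neg u)) ig (fun u => hB u q)).
apply: eq_cint => w; case: ifP => // _.
rewrite (Sk_left _ _ _ hgR (left_acontour hG1)); apply: (congr1 (fun z => ipi * z)).
by apply: eq_cint => u; rewrite phi_sub mulrAC.
Qed.

Lemma Sk_hit_right a s p :
  cint P (fun w => if hp (s, w) then Sk gR 1 (- a + - tp (s, w)) (bp (s, w)) p else 0) =
  ipi * cint leb (fun u => phi kapR (- a) (- p) (gR u) * velocity gR u *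
    Ehit P hp tp bp (- gR u) s).
Proof.
have hr := right_rapid hgR.
have L1 : 0 <= L + 1 by rewrite addr_ge0// (hd_L hd).
have [mG mv _] := hr; have [B [B0 hB]] := rapid_phi (- a) hr L1 ltr01.
have mf : cmeas (T := RR) (fun u => phi kapR (- a) (- p) (gR u) * velocity gR u).
  by apply: cmeasM => //; apply: phi_cmeas => //; exact: measurable_cst.
have ig : rint leb (fun u => B * expR (1 * (- p) ^+ 2) * gau 1 u) by apply: rintZ; exact: rint_gau.
have Z0 u : Re (- gR u) <= 0 by rewrite ReOpp oppr_le0 ltW.
have hB' u : nrm (phi kapR (- a) (- p) (gR u) * velocity gR u) * expR ((L + 1) * nrm (- gR u) ^+ 2) <=
    B * expR (1 * (- p) ^+ 2) * gau 1 u by rewrite nrmN; exact: hB.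
apply: etrans (hit_fubini hd s mf (cmeasN mG) Z0 ig hB').
apply: eq_cint => w; case: ifP => // _.
rewrite /Sk contour_intE; apply: (congr1 (fun z => ipi * z)); apply: eq_cint => u.
rewrite [RHS]mulrAC; apply: (congr1 (fun z => z * _)); rewrite /phi -cexpD.
by apply: (congr1 cexp); rewrite /kapR mul1r !rCE; ring.
Qed.

End Generic.

(** At $-\xi$ the expectation for $\boldsymbol\tau_-$ is the transform [Ehit] of the time-reversed
    path and data, so it obeys the same bounds as [Eplus]. *)
Definition Emrefl xi s := Eminus W h (- xi) s.

Lemma hit_plus_facts : exists K, [/\ 0 <= K, hitmeas (Eplus W h), hitbounded (Eplus W h) K &
  forall x s q, Shypo_plus W h gR 1 x s q =
    ipi * cint leb (fun u => phi kapL x q (G1 u) * velocity G1 u * Eplus W h (G1 u) s)].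
Proof.
have [L [H [L0 hH hL]]] := UCc_bounds hh; have husc := UCc_usc hh.
have [W0 cW _ _] := hW; have hG := brownian_increments hW.
have mW t : measurable_fun setT (W t) by [].
have [c [M hd]] := brownian_hitdata mW cW W0 hG L0 hH hL husc.
have [K [K0 hK]] := Ehit_bounds hd.
exists K; split=> //; first by move=> disp T f g; exact: (Ehit_cmeas hd).
by move=> x s q; exact: (Sk_hit_left hd).
Qed.

Lemma hit_minus_facts : exists K, [/\ 0 <= K, hitmeas Emrefl, hitbounded Emrefl K &
  forall a s p, Shypo_minus W h gR 1 (- a) s p =
    ipi * cint leb (fun u => phi kapR (- a) (- p) (gR u) * velocity gR u * Emrefl (- gR u) s)].
Proof.
have hh' := UCc_refl hh.
have [L [H [L0 hH hL]]] := UCc_bounds hh'; have husc := UCc_usc hh'.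
have [W0 cW _ _] := hW; have hG := brownian_increments hW.
have mW t : measurable_fun setT (W' t) by [].
have cW' w t : W' u w @[u --> t] --> W' t w.
  apply: (cvg_comp (fun u : R => - u) (fun u => W u w)); last exact: cW.
  exact: opp_continuous.
have W0' w : W' 0 w = 0 by rewrite /W' oppr0.
have hG' : gauss_increments P W'.
  move=> s t la la0 hla; apply: hG => //.
  by rewrite opprK addrC -distrC.
have [c [M hd]] := brownian_hitdata mW cW' W0' hG' L0 hH hL husc.
pose hp := hitp W' h'; pose tp := hitt W' h'; pose bp := hitb W' h'.
have E Phi s : expect_hit_minus W h Phi s =
    cint P (fun w => if hp (s, w) then Phi (- tp (s, w)) (bp (s, w)) else 0).
  apply: eq_cint => w; cbv zeta; rewrite tau_minusE /hp /hitp /tp /bp /hitb /hitt /tau.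
  by rewrite lteNr /= fineN.
have EE xi s : Emrefl xi s = Ehit P hp tp bp xi s.
  rewrite /Emrefl /Eminus E; apply: eq_cint => w; case: ifP => // _.
  by congr cexp; rewrite sqrrN mulrN realCN.
have [K [K0 hK]] := Ehit_bounds hd.
exists K; split=> //.
- move=> disp T f g mf mg; under eq_fun do rewrite EE; exact: (Ehit_cmeas hd).
- by move=> xi s; rewrite EE; exact: hK.
move=> a s p; rewrite /Shypo_minus E; apply: etrans (Sk_hit_right hd a s p) _.
by apply: (congr1 (fun z => ipi * z)); apply: eq_cint => u; rewrite EE.
Qed.

End HitFacts.

Section ThSplit.
Context {R : realType}.
Local Notation leb := (@lebesgue_measure R).

Lemma Th_split (E1 E2 : R[i] -> R -> R[i]) eta xi :
  (forall i, cintble leb (theta E1 E2 i eta xi)) ->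
  cint leb (fun s => theta E1 E2 0 eta xi s + theta E1 E2 1 eta xi s - theta E1 E2 2 eta xi s) =
  Th E1 E2 0 eta xi + Th E1 E2 1 eta xi - Th E1 E2 2 eta xi.
Proof.
move=> hi; rewrite cintB; [|exact: cintbleD (hi 0%N) (hi 1%N)|exact: (hi 2%N)].
by rewrite (cintD (hi 0%N) (hi 1%N)).
Qed.

Lemma nrm_three (z1 z2 z3 : R[i]) (X : R) : nrm z1 <= X -> nrm z2 <= X -> nrm z3 <= X ->
  nrm (z1 + z2 - z3) <= 3 * X.
Proof.
move=> h1 h2 h3; apply: le_trans (nrmB _ _) _; apply: le_trans (lerD (nrmD _ _) (lexx _)) _.
lra.
Qed.

Lemma nrm_cexp_line (s : R) (z : R[i]) :
  nrm (cexp (s%:C * z)) <= expR (s ^+ 2) * expR (1 * nrm z ^+ 2).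
Proof.
rewrite nrm_cexp -expRD ler_expR !ReImE mul0r subr0 mul1r nrm_sqr.
have := sqr_ge0 (s - Re z); have := sqr_ge0 (Im z); have := sqr_ge0 s; have := sqr_ge0 (Re z); nra.
Qed.

Lemma cint_three (f g0 g1 g2 : R -> R[i]) : cintble leb (fun u => f u * g0 u) ->
  cintble leb (fun u => f u * g1 u) -> cintble leb (fun u => f u * g2 u) ->
  cintble leb (fun u => f u * (g0 u + g1 u - g2 u)) /\
  cint leb (fun u => f u * (g0 u + g1 u - g2 u)) =
    cint leb (fun u => f u * g0 u) + cint leb (fun u => f u * g1 u) - cint leb (fun u => f u * g2 u).
Proof.
move=> i0 i1 i2; split.
  have := cintbleB (cintbleD i0 i1) i2.
  by under eq_fun do rewrite -mulrDr -mulrBr.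
rewrite -(cintD i0 i1) -(cintB (cintbleD i0 i1) i2).
by apply: eq_cint => u; rewrite -mulrDr -mulrBr.
Qed.

End ThSplit.

(** * The kernel $\mathbf K[a]$ as a double contour integral of chi *)

Section KbackChi.
Context {R : realType} d (Omega : measurableType d) (P : probability Omega R).
Local Notation RR := (measurableTypeR R).
Local Notation leb := (@lebesgue_measure R).
Variables (W : R -> {RV P >-> R}) (h : R -> \bar R) (gR G1 : R -> R[i]).
Hypotheses (hW : two_sided_brownian W) (hh : UCc h).
Hypotheses (hgR : is_contour (pi / 5) gR) (hgRpos : forall t, 0 < Re (gR t)).
Hypotheses (hG1 : is_contour (2 * pi / 3) G1) (hG1neg : forall t, Re (G1 t) < 0).

Let fL (x q v : R) := phi kapL x q (G1 v) * velocity G1 v.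
Let fR (a p u : R) := phi kapR (- a) (- p) (gR u) * velocity gR u.

Lemma separation : exists del, [/\ 0 < del, del <= 1, forall u, del <= Re (gR u) &
  forall u, Re (G1 u) <= - del].
Proof.
have [d1 [d10 h1]] := right_pos hgR hgRpos; have [d2 [d20 h2]] := left_neg hG1 hG1neg.
exists (Num.min 1 (Num.min d1 d2)); split.
- by rewrite !lt_min ltr01 d10.
- by rewrite ge_min lexx.
- by move=> u; apply: le_trans (h1 u); rewrite !ge_min lexx orbT.
- by move=> u; apply: le_trans (h2 u) _; rewrite lerN2 !ge_min lexx !orbT.
Qed.

Lemma hit_facts : exists K, [/\ 0 <= K, hitmeas (Eplus W h) /\ hitmeas (Emrefl W h) &
  hitbounded (Eplus W h) K /\ hitbounded (Emrefl W h) K].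
Proof.
have [K1 [K10 m1 b1 _]] := hit_plus_facts hW hh hgR hG1 hG1neg.
have [K2 [K20 m2 b2 _]] := hit_minus_facts hW hh hgR hgRpos.
exists (K1 + K2); split; [exact: addr_ge0|by []|].
by split; [apply: hitbounded_le b1|apply: hitbounded_le b2]; rewrite ?lerDl ?lerDr.
Qed.

Lemma chi_Th del K eta xi : 0 < del -> del <= 1 -> 0 <= K ->
  hitmeas (Eplus W h) -> hitmeas (Emrefl W h) ->
  hitbounded (Eplus W h) K -> hitbounded (Emrefl W h) K ->
  del <= Re eta -> Re xi <= - del ->
  chi W h eta xi = Th (Eplus W h) (Emrefl W h) 0 eta xi + Th (Eplus W h) (Emrefl W h) 1 eta xi -
    Th (Eplus W h) (Emrefl W h) 2 eta xi.
Proof.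
move=> d0 d1 K0 m1 m2 b1 b2 h1 h2.
have [C [C0 hC]] := Th_bound m1 m2 b1 b2 K0 d0 d1.
apply: etrans (Th_split (fun i => (hC i eta xi h1 h2).1)).
by apply: eq_cint => s; rewrite /theta /Emrefl opprK.
Qed.

Lemma chi_cmeas (disp : measure_display) (T : measurableType disp) (f g : T -> R[i]) :
  cmeas f -> cmeas g -> cmeas (fun x => chi W h (f x) (g x)).
Proof.
move=> mf mg; have [K [K0 [m1 m2] _]] := hit_facts.
have n1 : measurable_fun setT (@fst T RR) by exact: measurable_fst.
have n2 : measurable_fun setT (@snd T RR) by exact: measurable_snd.
have mf1 := cmeas_comp mf n1; have mg1 := cmeas_comp mg n1.
have cs : cmeas (fun q : T * RR => q.2%:C) by apply: cmeasC.
have E2 : cmeas (fun q : T * RR => Eminus W h (f q.1) q.2).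
  have := m2 _ _ _ _ (cmeasN mf1) n2.
  by rewrite /Emrefl; under eq_fun do rewrite opprK.
have E1 : cmeas (fun q : T * RR => Eplus W h (g q.1) q.2) by exact: m1.
apply: (@cmeas_cint R _ _ T RR leb (fun q => cexp (q.2%:C * f q.1) * Eplus W h (g q.1) q.2 +
  cexp (- q.2%:C * g q.1) * Eminus W h (f q.1) q.2 - Eplus W h (g q.1) q.2 * Eminus W h (f q.1) q.2)).
apply: cmeasB; last exact: cmeasM.
apply: cmeasD; apply: cmeasM => //; apply: cmeas_cexp; apply: cmeasM => //.
exact: cmeasN.
Qed.

Lemma chi_bound del : 0 < del -> del <= 1 -> exists C, 0 <= C /\ forall eta xi,
  del <= Re eta -> Re xi <= - del ->
  nrm (chi W h eta xi) <= C * expR (C * (nrm eta ^+ 2 + nrm xi ^+ 2)).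
Proof.
move=> d0 d1; have [K [K0 [m1 m2] [b1 b2]]] := hit_facts.
have [C [C0 hC]] := Th_bound m1 m2 b1 b2 K0 d0 d1.
exists (3 * C); split; first by rewrite mulr_ge0.
move=> eta xi h1 h2; rewrite (chi_Th d0 d1 K0 m1 m2 b1 b2 h1 h2).
apply: (@le_trans _ _ (3 * (C * expR (C * (nrm eta ^+ 2 + nrm xi ^+ 2))))).
  by apply: nrm_three; [exact: (hC 0%N eta xi h1 h2).2|exact: (hC 1%N eta xi h1 h2).2|
    exact: (hC 2%N eta xi h1 h2).2].
rewrite mulrA ler_wpM2l ?mulr_ge0// ler_expR ler_wpM2r ?addr_ge0 ?sqr_ge0//.
by move: C0; move: (C) => c; lra.
Qed.

(* Bq eta q / f_j(eta) is the factor B(j, eta; q) of S = - A B. *)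
Definition Bq (x : R) (eta : R[i]) (q : R) : R[i] :=
  ipi * cint leb (fun v => fL x q v * chi W h eta (G1 v)).

Lemma Bq_cmeas x (disp : measure_display) (T : measurableType disp) (f : T -> R[i]) (g : T -> R) :
  cmeas f -> measurable_fun setT g -> cmeas (fun t => Bq x (f t) (g t)).
Proof.
move=> mf mg; have [mG mv _] := acontour_rapid (left_acontour hG1).
have n1 : measurable_fun setT (@fst T RR) by exact: measurable_fst.
have n2 : measurable_fun setT (@snd T RR) by exact: measurable_snd.
apply: cmeasM; first exact: cmeas_cst.
apply: (@cmeas_cint R _ _ T RR leb (fun t => fL x (g t.1) t.2 * chi W h (f t.1) (G1 t.2))).
apply: cmeasM; first apply: cmeasM.
- by apply: phi_cmeas; [exact: cmeas_comp mG n2|exact: measurableT_comp mg n1].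
- exact: cmeas_comp mv n2.
- by apply: chi_cmeas; [exact: cmeas_comp mf n1|exact: cmeas_comp mG n2].
Qed.

(** On [G1] the factor $e^{q\xi}$ is bounded for $q\ge0$, so growth is confined to negative [q]. The
    rate [e] is arbitrary because Airy decay absorbs any multiple of $|\xi|^2$; later it is matched
    with the decay of [hitk]. *)
Lemma Bq_bound x e del : 0 < e -> 0 < del -> del <= 1 -> (forall u, Re (G1 u) <= - del) ->
  exists C, 0 <= C /\ forall eta q, del <= Re eta ->
    cintble leb (fun v => fL x q v * chi W h eta (G1 v)) /\
    nrm (Bq x eta q) <= C * expR (C * nrm eta ^+ 2) * expR (e * Num.min q 0 ^+ 2).
Proof.
move=> e0 d0 d1 hG; have [C [C0 hC]] := chi_bound d0 d1.
have hr := acontour_rapid (left_acontour hG1); have [mG mv _] := hr.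
have [K [K0 hK]] := rapid_phi_neg x hr C0 e0 (fun u => ltW (hG1neg u)).
have ig : rint leb (gau 1 : R -> R) by apply: rint_gau.
pose I := \int[leb]_v gau (1 : R) v.
have I0 : 0 <= I by rewrite Rintegral_ge0// => v _; exact: gau_ge0.
pose D := nrm (ipi : R[i]) * (2 * (C * K) * I).
have D0 : 0 <= D.
  apply: mulr_ge0; first exact: nrm_ge0.
  by rewrite !mulr_ge0.
exists (D + C); split; first exact: addr_ge0.
move=> eta q he.
pose c := C * K * expR (C * nrm eta ^+ 2) * expR (e * Num.min q 0 ^+ 2).
have mF : cmeas (T := RR) (fun v => fL x q v * chi W h eta (G1 v)).
  apply: cmeasM; last by apply: chi_cmeas => //; exact: cmeas_cst.
  by apply: cmeasM => //; apply: phi_cmeas => //; exact: measurable_cst.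
have bF v : nrm (fL x q v * chi W h eta (G1 v)) <= c * gau 1 v.
  rewrite nrmM; apply: le_trans (ler_wpM2l (nrm_ge0 _) (hC eta (G1 v) he (hG v))) _.
  rewrite mulrDr expRD.
  have -> : forall y e1 e2 : R, y * (C * (e1 * e2)) = C * e1 * (y * e2) by move=> *; ring.
  have -> : c * gau 1 v = C * expR (C * nrm eta ^+ 2) * (K * expR (e * Num.min q 0 ^+ 2) * gau 1 v).
    by rewrite /c; move: (expR _) (expR _) (gau _ _) => *; ring.
  by rewrite ler_wpM2l ?mulr_ge0 ?expR_ge0//; exact: hK.
have ic : rint leb (fun v => c * gau 1 v) by exact: rintZ.
split; first exact: (@cintble_dom R _ RR leb _ _ mF ic bF).
rewrite /Bq [leLHS]nrmM.
apply: le_trans (ler_wpM2l (nrm_ge0 _) (@nrm_cint R _ RR leb _ _ mF ic bF)) _.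
rewrite RintegralZl// -/I.
have -> : nrm (ipi : R[i]) * (2 * (c * I)) = D * expR (C * nrm eta ^+ 2) * expR (e * Num.min q 0 ^+ 2).
  by rewrite /D /c; ring.
rewrite ler_wpM2r ?expR_ge0//; apply: ler_pM; [exact: D0|exact: expR_ge0|by rewrite lerDl|].
by rewrite ler_expR ler_wpM2r ?sqr_ge0// lerDr.
Qed.

Lemma subweight_of f G a : rapidw f G -> cmeas (T := (RR * RR)%type) (fun q => a q.1 q.2) ->
  (forall s, exists D A, [/\ 0 <= D, 0 <= A & forall u, nrm (a u s) <= D * expR (A * nrm (G u) ^+ 2)]) ->
  subweight f a.
Proof.
move=> rw ma ha; split=> // s; have [D [A [D0 A0 hD]]] := ha s.
have [B [B0 hB]] := rapidw_int rw A0.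
apply: (proj1 (hB (fun u => a u s) D _ D0 hD)).
by apply: (cmeas_comp ma (g := fun u => (u, s))); exact: measurable_fun_pair.
Qed.

(** The three compositions in $\mathbf K[a]$ are the three parts of [theta]: index $1$ for
    $\boldsymbol\tau_-$ alone, $0$ for $\boldsymbol\tau_+$ alone, $2$ for both. Their signed sum
    assembles [chi]. *)
Lemma Kback_chi x a p q :
  Kback W h gR x a p q = ipi * cint leb (fun u => fR a p u * Bq x (gR u) q).
Proof.
have [del [d0 d1 hR hL]] := separation.
have [K [K0 [m1 m2] [b1 b2]]] := hit_facts.
have [_ [_ _ _ sp]] := hit_plus_facts hW hh hgR hG1 hG1neg.
have [_ [_ _ _ sm]] := hit_minus_facts hW hh hgR hgRpos.
have rL := acontour_rapid (left_acontour hG1); have rR := right_rapid hgR.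
have wL : rapidw (fL x q) G1 by exact: rapid_rapidw.
have wR : rapidw (fR a p) gR by exact: rapid_rapidw.
have [mGR _ _] := rR; have [mGL _ _] := rL.
have n1 : measurable_fun setT (@fst RR RR) by exact: measurable_fst.
have n2 : measurable_fun setT (@snd RR RR) by exact: measurable_snd.
have cs : cmeas (fun q : RR * RR => q.2%:C) by apply: cmeasC.
have sE E f G : rapidw f G -> hitmeas E -> hitbounded E K -> (forall u, Re (G u) <= 0) ->
    subweight f (fun u s => E (G u) s).
  move=> rw mE bE G0; apply: (subweight_of rw).
    by apply: mE => //; exact: cmeas_comp (rw_G rw) n1.
  move=> s; exists K, K; split=> // u; have [+ _] := bE (G u) s (G0 u).
  by move=> /(_ 0 (lexx _)); rewrite mul0r oppr0 expR0 mulr1 expr0n addr0.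
have sX (f G : R -> R[i]) : rapidw f G -> subweight f (fun u s => cexp (s%:C * G u)).
  move=> rw; apply: (subweight_of rw).
    by apply: cmeas_cexp; apply: cmeasM => //; exact: cmeas_comp (rw_G rw) n1.
  move=> s; exists (expR (s ^+ 2)), 1; split; [exact: expR_ge0|exact: ler01|].
  by move=> u; exact: nrm_cexp_line.
have rwN (f G : R -> R[i]) : rapidw f G -> rapidw f (fun u => - G u).
  move=> [mf mG hb]; split=> //; first exact: cmeasN.
  by move=> A /hb[B [B0 hB]]; exists B; split=> // u; rewrite nrmN.
have SR s : Sk gR 1 (- a) s p = ipi * cint leb (fun u => fR a p u * cexp (s%:C * gR u)).
  rewrite /Sk contour_intE; apply: (congr1 (fun z => ipi * z)); apply: eq_cint => u.
  rewrite [RHS]mulrAC; apply: (congr1 (fun z => z * _)); rewrite /phi -cexpD.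
  by apply: (congr1 cexp); rewrite /kapR mul1r !rCE; ring.
have SL s : Sk gR 1 x s q = ipi * cint leb (fun v => fL x q v * cexp (s%:C * - G1 v)).
  rewrite (Sk_left _ _ _ hgR (left_acontour hG1)); apply: (congr1 (fun z => ipi * z)).
  apply: eq_cint => v; rewrite [RHS]mulrAC; apply: (congr1 (fun z => z * _)).
  by rewrite /phi -cexpD; apply: (congr1 cexp); rewrite !rCE; ring.
have L0 u : Re (G1 u) <= 0 by exact: ltW.
have R0 u : Re (- gR u) <= 0 by rewrite ReOpp oppr_le0 ltW.
have tf i a' b' := theta_fubini m1 m2 b1 b2 K0 d0 d1 wR wL hR hL (i := i) (a := a') (b := b').
pose inn i := inner (Eplus W h) (Emrefl W h) (fL x q) G1 i.
pose J i := ipi * (ipi * cint leb (fun u => fR a p u * inn i (gR u))).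
have k1 : kcomp (kadj (Shypo_minus W h gR 1 (- a))) (Sk gR 1 x) p q = J 1%N.
  rewrite /J -(tf 1%N (fun u s => Emrefl W h (- gR u) s) (fun v s => cexp (s%:C * - G1 v))).
  - by apply: eq_cint => s; rewrite /kadj sm SL.
  - exact: (sE _ _ _ (rwN _ _ wR)).
  - exact: (sX _ _ (rwN _ _ wL)).
  - by move=> u v s; rewrite /theta mulrC mulrN mulNr.
have k0 : kcomp (kadj (Sk gR 1 (- a))) (Shypo_plus W h gR 1 x) p q = J 0%N.
  rewrite /J -(tf 0%N (fun u s => cexp (s%:C * gR u)) (fun v s => Eplus W h (G1 v) s)).
  - by apply: eq_cint => s; rewrite /kadj sp SR.
  - exact: sX.
  - exact: sE.
  - by move=> u v s.
have k2 : kcomp (kadj (Shypo_minus W h gR 1 (- a))) (Shypo_plus W h gR 1 x) p q = J 2%N.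
  rewrite /J -(tf 2%N (fun u s => Emrefl W h (- gR u) s) (fun v s => Eplus W h (G1 v) s)).
  - by apply: eq_cint => s; rewrite /kadj sm sp.
  - exact: (sE _ _ _ (rwN _ _ wR)).
  - exact: sE.
  - by move=> u v s; rewrite /theta mulrC.
have oi i := outer_cintble m1 m2 b1 b2 K0 d0 d1 wR wL hR hL i.
have [C [C0 hC]] := inner_bound m1 m2 b1 b2 K0 d0 d1 wL hL.
have ii i u := (hC i (gR u) (hR u)).1.
have io u : inn 0%N (gR u) + inn 1%N (gR u) - inn 2%N (gR u) =
    cint leb (fun v => fL x q v * chi W h (gR u) (G1 v)).
  rewrite /inn /inner -(cintD (ii 0%N u) (ii 1%N u)) -(cintB (cintbleD (ii 0%N u) (ii 1%N u)) (ii 2%N u)).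
  apply: eq_cint => v; rewrite (chi_Th d0 d1 K0 m1 m2 b1 b2 (hR u) (hL v)).
  by rewrite -mulrDr -mulrBr.
have [oo co] := cint_three (oi 0%N) (oi 1%N) (oi 2%N).
transitivity (J 1%N + J 0%N - J 2%N); first by rewrite /Kback k0 k1 k2.
rewrite /J.
have -> : forall c0 c1 c2 : R[i], ipi * (ipi * c1) + ipi * (ipi * c0) - ipi * (ipi * c2) =
    ipi * (ipi * (c0 + c1 - c2)) by move=> *; ring.
rewrite -co; apply: (congr1 (fun z => ipi * z)); rewrite -(cintZ _ oo).
apply: eq_cint => u; rewrite [LHS]mulrCA; apply: (congr1 (fun z => fR a p u * z)).
by rewrite io.
Qed.

End KbackChi.

(** * The path kernel *)

Section GaussComplex.
Context {R : realType}.
Local Notation RR := (measurableTypeR R).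
Local Notation leb := (@lebesgue_measure R).
Implicit Types (s t p r : R) (c z eta : R[i]).

Lemma gauss_complex_cintble s c : 0 < s ->
  cintble leb (fun u => cexp (- (s * u ^+ 2)%:C + u%:C * c)).
Proof.
move=> s0; apply: (@cintble_dom R _ RR leb _ (fun u =>
  expR (Re c ^+ 2 / (4 * s)) * expR (- (s * (u - Re c / (2 * s)) ^+ 2)))).
- apply: cmeas_cexp; apply: cmeasD.
    by apply: cmeasN; apply: cmeasC; apply: measurable_funM => //; exact: measurable_funX.
  by apply: cmeasM; [exact: cmeasC|exact: cmeas_cst].
- by apply: rintZ; exact: rint_gauss.
move=> u; rewrite nrm_cexp -expRD ler_expR !ReImE mul0r subr0 le_eqVlt; apply/orP; left; apply/eqP.
by field; exact: lt0r_neq0.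
Qed.

(** With $b=-ic$ this is the integral of $e^{sz^2+bz}$ over the imaginary axis; moving the line
    through the saddle point leaves a real Gaussian. *)
Lemma gauss_complex s c : 0 < s ->
  cint leb (fun u => cexp (- (s * u ^+ 2)%:C + u%:C * c)) =
  (Num.sqrt (pi / s))%:C * cexp ((4 * s)^-1%:C * c ^+ 2).
Proof.
move=> s0; pose b := - ('i%C * c).
have Reb : Re b = Im c by rewrite /b; case: (c) => x y /=; ring.
have Imb : Im b = - Re c by rewrite /b; case: (c) => x y /=; ring.
pose x := - Re b / (2 * s).
have E0 : cint leb (fun u => gexp s b (vline 0 u) * 'i%C) = cint leb (fun u => gexp s b (vline x u) * 'i%C).
  exact: (gauss_move b s0 (vline_gcontour 0) (vline_gcontour x)).
have fin (K : R[i]) : cint leb (fun u => K * (expR (- (s * (u - Re c / (2 * s)) ^+ 2)))%:C) =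
    K * (Num.sqrt (pi / s))%:C.
  have ig := rint_gauss (Re c / (2 * s)) s0.
  have ci : cintble leb (fun u => (expR (- (s * (u - Re c / (2 * s)) ^+ 2)))%:C).
    split; first exact: ig.
    by have [] := @cintble0 R _ RR leb.
  rewrite cintZ//; congr (_ * _); apply: cplxP => /=; first exact: Rint_gauss.
  exact: (congr1 (fun z => Im z) (@cint0 _ _ RR leb)).
have i0 : 'i%C != 0 :> R[i] by rewrite eq_complex /= oner_eq0 andbF.
have Ev : forall y u (K : R[i]), Re b = Im c -> Im b = - Re c -> (forall z, Re z = y -> Im z = u ->
    s%:C * z ^+ 2 + b * z = K) -> gexp s b (vline y u) * 'i%C = 'i%C * cexp K.
  by move=> y u K _ _ hz; rewrite mulrC -(hz (vline y u)).
have L u : gexp s b (vline 0 u) * 'i%C = 'i%C * cexp (- (s * u ^+ 2)%:C + u%:C * c).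
  apply: Ev => // z Rz Iz; move: b Reb Imb {x E0} => b Reb Imb.
  by apply: cplxP; rewrite !expr2 !ReImE Rz Iz Reb Imb; ring.
have M u : gexp s b (vline x u) * 'i%C =
    'i%C * cexp ((4 * s)^-1%:C * c ^+ 2) * (expR (- (s * (u - Re c / (2 * s)) ^+ 2)))%:C.
  rewrite -mulrA -cexpC -cexpD; apply: Ev => // z; rewrite /x; move: b Reb Imb {x E0 L} => b Reb Imb Rz Iz.
  by apply: cplxP; rewrite !expr2 !ReImE Rz Iz Reb Imb; field; exact: lt0r_neq0.
apply: (mulfI i0).
have cc := gauss_complex_cintble c s0.
rewrite -(cintZ _ cc) -(@eq_cint R _ RR leb _ _ L) E0 (@eq_cint R _ RR leb _ _ M) fin.
by ring.
Qed.

Lemma heat_exp_complex t p eta : 0 < t ->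
  cint leb (fun r => heat t p r * cexp (- (r%:C * eta))) =
  cexp (- (p%:C * eta) + t%:C * eta ^+ 2).
Proof.
move=> t0; pose k := (Num.sqrt (4 * pi * t))^-1 * expR (- (p ^+ 2 / (4 * t))).
pose s := (4 * t)^-1; have s0 : 0 < s by rewrite invr_gt0 mulr_gt0.
pose c := (p / (2 * t))%:C - eta.
have E r : heat t p r * cexp (- (r%:C * eta)) = k%:C * cexp (- (s * r ^+ 2)%:C + r%:C * c).
  rewrite heatE /heatv /k !realCM -!mulrA; congr (_ * _).
  rewrite -!cexpC -!cexpD; congr cexp; rewrite /s /c.
  apply: cplxP; rewrite !ReImE /=; field; exact: lt0r_neq0.
have cc := gauss_complex_cintble c s0.
rewrite (@eq_cint R _ RR leb _ _ E) cintZ// gauss_complex//.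
have -> : pi / s = 4 * pi * t by rewrite /s invrK; ring.
have k0 : Num.sqrt (4 * pi * t) != 0 :> R by rewrite gt_eqF// sqrtr_gt0 !mulr_gt0// pi_gt0.
rewrite /k mulrA -realCM mulrAC mulVf// mul1r -cexpC -cexpD; congr cexp.
by rewrite /s /c; apply: cplxP; rewrite !expr2 !ReImE /=; field; exact: lt0r_neq0.
Qed.

Lemma heatv_exp_sqr t p : 0 < t -> rint leb (fun r => heatv t p r * expR ((8 * t)^-1 * r ^+ 2)).
Proof.
move=> t0; rewrite (_ : (fun r => _) = (fun r => (Num.sqrt (4 * pi * t))^-1 * expR (p ^+ 2 / (4 * t)) *
    expR (- ((8 * t)^-1 * (r - 2 * p) ^+ 2)))).
  by apply: rintZ; apply: rint_gauss; rewrite invr_gt0 mulr_gt0.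
apply/funext => r; rewrite /heatv -!mulrA; congr (_ * _); rewrite -!expRD; congr expR.
by field; exact: lt0r_neq0.
Qed.

Lemma heat_fubini t p (g : R -> R -> R[i]) (B : R -> R[i]) (g1 g2 : R -> R) : 0 < t ->
  cmeas (T := (RR * RR)%type) (fun q => g q.1 q.2) -> cmeas (T := RR) B ->
  (forall r, 0 <= g1 r) -> (forall u, 0 <= g2 u) -> rint leb g1 -> rint leb g2 ->
  (forall r u, heatv t p r * nrm (g r u * B u) <= g1 r * g2 u) ->
  cintble leb (fun r => heat t p r * (ipi * cint leb (fun u => g r u * B u))) /\
  cint leb (fun r => heat t p r * (ipi * cint leb (fun u => g r u * B u))) =
    ipi * cint leb (fun u => cint leb (fun r => heat t p r * g r u) * B u).
Proof.
move=> t0 mg mB g10 g20 i1 i2 hg.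
have n1 : measurable_fun setT (@fst RR RR) by exact: measurable_fst.
have n2 : measurable_fun setT (@snd RR RR) by exact: measurable_snd.
pose N r u := heat t p r * (g r u * B u).
have mgB : cmeas (fun q : RR * RR => g q.1 q.2 * B q.2).
  by apply: cmeasM => //; exact: cmeas_comp mB n2.
have mN : cmeas (fun q : RR * RR => N q.1 q.2).
  by apply: cmeasM => //; apply: heat_cmeas => //; exact: measurable_cst.
have bN r u : nrm (N r u) <= g1 r * g2 u.
  by rewrite /N nrmM heatE nrmC ger0_norm ?heatv_ge0.
have cB r : cintble leb (fun u => g r u * B u).
  have h0 : 0 < heatv t p r.
    by rewrite /heatv mulr_gt0 ?expR_gt0// invr_gt0 sqrtr_gt0 !mulr_gt0// pi_gt0.
  apply: (@cintble_dom R _ RR leb _ (fun u => g1 r / heatv t p r * g2 u)).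
  - by apply: (cmeas_comp mgB (g := fun u => (r, u))); exact: measurable_fun_pair.
  - exact: rintZ.
  - by move=> u; rewrite mulrAC ler_pdivlMr// mulrC.
have E r : heat t p r * (ipi * cint leb (fun u => g r u * B u)) = ipi * cint leb (N r).
  by rewrite mulrCA -(cintZ _ (cB r)).
have cN : cintble leb (fun r => cint leb (N r)).
  apply: (@cintble_dom R _ RR leb _ (fun r => 2 * \int[leb]_u g2 u * g1 r)).
  - exact: (@cmeas_cint R _ _ RR RR leb (fun q => N q.1 q.2)).
  - exact: rintZ.
  move=> r; rewrite -mulrA [\int[_]_(_ in _) _ * _]mulrC -RintegralZl//.
  apply: (@nrm_cint R _ RR leb) => //; last exact: rintZ.
  by apply: (cmeas_comp mN (g := fun u => (r, u))); exact: measurable_fun_pair.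
split; first by under eq_fun do rewrite E; exact: cintbleZ.
rewrite (@eq_cint R _ RR leb _ _ E) (cintZ _ cN); apply: (congr1 (fun z => ipi * z)).
rewrite (@cfubini R _ _ RR RR leb leb (fun q => N q.1 q.2) g1 g2)//=.
apply: eq_cint => u; have [B0|Bu] := eqVneq (B u) 0.
  rewrite B0 mulr0 -[RHS](@cint0 _ _ RR leb); apply: eq_cint => r.
  by rewrite /N B0 !mulr0.
rewrite -cintZr; first by apply: eq_cint => r; rewrite /N mulrA.
apply: (@cintble_dom R _ RR leb _ (fun r => g2 u / nrm (B u) * g1 r)).
- apply: cmeasM; first by apply: heat_cmeas => //; exact: measurable_cst.
  by apply: (cmeas_comp mg (g := fun r => (r, u))); exact: measurable_fun_pair.
- exact: rintZ.
move=> r; have := bN r u; rewrite /N mulrA nrmM => h.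
by rewrite mulrAC ler_pdivlMr ?nrm_gt0// [leRHS]mulrC.
Qed.

End GaussComplex.

Section PathFormula.
Context {R : realType} d (Omega : measurableType d) (P : probability Omega R).
Local Notation RR := (measurableTypeR R).
Local Notation leb := (@lebesgue_measure R).
Variables (W : R -> {RV P >-> R}) (h : R -> \bar R) (gR G1 : R -> R[i]).
Hypotheses (hW : two_sided_brownian W) (hh : UCc h).
Hypotheses (hgR : is_contour (pi / 5) gR) (hgRpos : forall t, 0 < Re (gR t)).
Hypotheses (hG1 : is_contour (2 * pi / 3) G1) (hG1neg : forall t, Re (G1 t) < 0).
Variables (al be : nat -> R) (m : nat).
Hypothesis hal : forall j, (1 <= j < m)%N -> al j < al j.+1.

Local Notation BQ := (Bq W h G1 (al 1%N)).

(* [bfac a b q u] is f_j(eta)^-1 * Bq eta q * eta' for a = alpha_j, b = beta_j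
   and eta = gR u. *)
Definition bfac (a b q u : R) : R[i] :=
  phi kapR (- a) (- b) (gR u) * velocity gR u * BQ (gR u) q.

Lemma bfac_cmeas (disp : measure_display) (T : measurableType disp) a b (f g : T -> RR) :
  measurable_fun setT f -> measurable_fun setT g -> cmeas (fun x => bfac a b (f x) (g x)).
Proof.
move=> mf mg; have [mG mv _] := right_rapid hgR.
apply: cmeasM; first apply: cmeasM.
- by apply: phi_cmeas; [exact: cmeas_comp mG mg|exact: measurable_cst].
- exact: cmeas_comp mv mg.
- by apply: (Bq_cmeas hW hh hgR hgRpos hG1 hG1neg) => //; exact: cmeas_comp mG mg.
Qed.

Lemma bfac_bound a b A e : 0 <= A -> 0 < e -> exists K, 0 <= K /\ forall q u,
  nrm (bfac a b q u) * expR (A * nrm (gR u) ^+ 2) <= K * expR (e * Num.min q 0 ^+ 2) * gau 1 u.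
Proof.
move=> A0 e0; have [del [d0 d1 hR hL]] := separation hgR hgRpos hG1 hG1neg.
have [C [C0 hC]] := Bq_bound hW hh hgR hgRpos hG1 hG1neg (al 1%N) e0 d0 d1 hL.
have CA : 0 <= C + A by exact: addr_ge0.
have [K [K0 hK]] := rapid_phi (- a) (right_rapid hgR) CA ltr01.
exists (C * (K * expR (1 * (- b) ^+ 2))); split; first by rewrite !mulr_ge0 ?expR_ge0.
move=> q u; rewrite /bfac nrmM.
have h1 := (hC (gR u) q (hR u)).2; have h2 := hK u (- b).
have -> : C * (K * expR (1 * (- b) ^+ 2)) * expR (e * Num.min q 0 ^+ 2) * gau 1 u =
    C * expR (e * Num.min q 0 ^+ 2) * (K * expR (1 * (- b) ^+ 2) * gau 1 u).
  by move: (expR _) (expR _) (gau _ _) => *; ring.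
apply: le_trans _ (ler_wpM2l _ h2); last by rewrite mulr_ge0 ?expR_ge0.
apply: le_trans (ler_wpM2r (expR_ge0 _) (ler_wpM2l (nrm_ge0 _) h1)) _.
rewrite mulrDl expRD le_eqVlt; apply/orP; left; apply/eqP.
by move: (nrm _) (expR _) (expR _) (expR _) => *; ring.
Qed.

Lemma Kback_bfac a p q : Kback W h gR (al 1%N) a p q = ipi * cint leb (bfac a p q).
Proof. exact: Kback_chi. Qed.

Lemma bfac_shift a b b' q u :
  bfac a b q u = cexp (- ((b - b')%:C * gR u)) * bfac a b' q u.
Proof.
have E : phi kapR (- a) (- b) (gR u) = cexp (- ((b - b')%:C * gR u)) * phi kapR (- a) (- b') (gR u).
  by rewrite /phi -cexpD; congr cexp; rewrite !rCE; ring.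
by rewrite /bfac E -!mulrA.
Qed.

Let gR0 u : 0 <= Re (gR u). Proof. exact: ltW. Qed.

(** Heat flow multiplies $e^{-r\eta}$ by $e^{t\eta^2}$, which changes the quadratic coefficient from
    $-\alpha_{l+1}$ to $-\alpha_l$: it undoes one step of the backward flow. *)
Lemma heat_Kback l p q : (1 <= l < m)%N ->
  cintble leb (fun r => heat (al l.+1 - al l) p r * Kback W h gR (al 1%N) (al l.+1) r q) /\
  cint leb (fun r => heat (al l.+1 - al l) p r * Kback W h gR (al 1%N) (al l.+1) r q) =
    Kback W h gR (al 1%N) (al l) p q.
Proof.
move=> hl; set t := al l.+1 - al l; have t0 : 0 < t by rewrite subr_gt0 hal.
(* From $-r\,\mathrm{Re}\,\eta\le\frac{r^2}{8t}+2t(\mathrm{Re}\,\eta)^2$: half of the heat Gaussian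
   controls the first term, the Airy decay the second. *)
have A0 : 0 <= 2 * t by rewrite mulr_ge0// ltW.
have [K [K0 hK]] := bfac_bound (al l.+1) 0 A0 ltr01.
have [mG mv _] := right_rapid hgR.
have [] := @heat_fubini R t p (fun r u => cexp (- (r%:C * gR u))) (bfac (al l.+1) 0 q)
   (fun r => heatv t p r * expR ((8 * t)^-1 * r ^+ 2))
   (fun u => K * expR (1 * Num.min q 0 ^+ 2) * gau 1 u) t0.
- apply: cmeas_cexp; apply: cmeasN; apply: cmeasM.
    by apply: cmeasC; exact: measurable_fst.
  by apply: (cmeas_comp mG); exact: measurable_snd.
- by apply: bfac_cmeas => //; exact: measurable_cst.
- by move=> r; rewrite mulr_ge0 ?heatv_ge0 ?expR_ge0.
- by move=> u; rewrite !mulr_ge0 ?expR_ge0.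
- exact: heatv_exp_sqr.
- by apply: rintZ; exact: rint_gau.
- move=> r u; rewrite -[leRHS]mulrA ler_wpM2l ?heatv_ge0// nrmM nrm_cexp.
  apply: le_trans _ (ler_wpM2l (expR_ge0 _) (hK q u)).
  rewrite mulrCA [leLHS]mulrC ler_wpM2l ?nrm_ge0// -expRD ler_expR.
  rewrite ReOpp !ReImE mul0r subr0.
  have e8 : 0 < (8 * t)^-1 by rewrite invr_gt0 mulr_gt0.
  have := mulr_le_sqr r (- Re (gR u)) e8.
  have -> : (4 * (8 * t)^-1)^-1 = 2 * t by field; exact: lt0r_neq0.
  have : 2 * t * Re (gR u) ^+ 2 <= 2 * t * nrm (gR u) ^+ 2.
    by rewrite ler_wpM2l// nrm_sqr lerDl sqr_ge0.
  by rewrite sqrrN; move: (2 * t * _) (2 * t * _) ((8 * t)^-1 * _) => x y z; lra.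
have E r : Kback W h gR (al 1%N) (al l.+1) r q =
    ipi * cint leb (fun u => cexp (- (r%:C * gR u)) * bfac (al l.+1) 0 q u).
  rewrite Kback_bfac; apply: (congr1 (fun z => ipi * z)); apply: eq_cint => u.
  by rewrite (bfac_shift _ r 0) subr0.
move=> h1 h2; split; first by under eq_fun do rewrite E.
under (@eq_cint R _ RR leb) => r do rewrite E.
rewrite h2 Kback_bfac; apply: (congr1 (fun z => ipi * z)); apply: eq_cint => u.
rewrite heat_exp_complex// (bfac_shift (al l) p 0) subr0 cexpD -[LHS]mulrA.
apply: (congr1 (fun z => _ * z)).
have E' : phi kapR (- al l) (- 0) (gR u) = cexp (t%:C * gR u ^+ 2) * phi kapR (- al l.+1) (- 0) (gR u).
  by rewrite /phi -cexpD; congr cexp; rewrite /t !rCE; ring.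
by rewrite /bfac E' -!mulrA.
Qed.

Lemma heat_hitk j l b p q : (1 <= l)%N -> (l + j < m)%N ->
  cintble leb (fun r => heat (al l.+1 - al l) p r *
    (ipi * cint leb (fun u => hitk al be (gR u) j l.+1 r * bfac (al (l.+1 + j)%N) b q u))) /\
  cint leb (fun r => heat (al l.+1 - al l) p r *
    (ipi * cint leb (fun u => hitk al be (gR u) j l.+1 r * bfac (al (l.+1 + j)%N) b q u))) =
  ipi * cint leb (fun u => cint leb (fun r => heat (al l.+1 - al l) p r * hitk al be (gR u) j l.+1 r) *
    bfac (al (l.+1 + j)%N) b q u).
Proof.
move=> l1 ljm; set t := al l.+1 - al l.
have t0 : 0 < t by rewrite subr_gt0 hal// l1 (leq_ltn_trans (leq_addr j l)).
have [K [K0 hK]] := bfac_bound (al (l.+1 + j)%N) b (lexx 0) ltr01.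
have [mG mv _] := right_rapid hgR.
apply: (@heat_fubini R t p (fun r u => hitk al be (gR u) j l.+1 r) _
   (fun r => heatv t p r * expR (0 * r))
   (fun u => 2 ^+ j * (K * expR (1 * Num.min q 0 ^+ 2) * gau 1 u)) t0).
- by apply: hitk_cmeas; [apply: (cmeas_comp mG); exact: measurable_snd|exact: measurable_fst].
- by apply: bfac_cmeas => //; exact: measurable_cst.
- by move=> r; rewrite mulr_ge0 ?heatv_ge0 ?expR_ge0.
- by move=> u; rewrite !mulr_ge0 ?exprn_ge0 ?expR_ge0.
- exact: rint_heatv_exp.
- by apply: rintZ; apply: rintZ; exact: rint_gau.
move=> r u; rewrite mul0r expR0 mulr1 ler_wpM2l ?heatv_ge0// nrmM.
apply: ler_pM; rewrite ?nrm_ge0//.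
  have := @hitk_bound R al be (gR u) j l.+1 r 0 (gR0 u) (lexx 0).
  rewrite mul0r expr0n mulr0 addr0 expR0 mulr1; apply=> i /andP[li ilj].
  by apply: hal; rewrite (leq_trans _ li)//= (leq_trans ilj)// addSn.
by have := hK q u; rewrite mul0r expR0 mulr1.
Qed.

(** Induction on [k] through $\mathbf 1_{\le\beta_l}=1-\mathbf 1_{>\beta_l}$. For $p>\beta_l$ the
    kernel [Kback] is the integral of $e^{-(p-\beta_l)\eta}$ against [bfac], which is the term
    $j=0$. For $p\le\beta_l$ the heat step takes [Kback] from $\alpha_{l+1}$ to $\alpha_l$ and turns
    the term $j$ into the term $j+1$. *)
Lemma path_formula k l p q : (1 <= l)%N -> (l + k <= m)%N ->
  path_kernel W h gR al be l k p q = Kback W h gR (al 1%N) (al l) p q -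
  \sum_(j < k.+1) ipi * cint leb (fun u =>
    hitk al be (gR u) j l p * bfac (al (l + j)%N) (be (l + j)%N) q u).
Proof.
have h0 n l' p' u : hitk al be (gR u) (@ord0 n) l' p' =
  if be l' < p' then cexp (- ((p' - be l')%:C * gR u)) else 0 by [].
elim: k l p => [|k IH] l p l1 lkm.
  rewrite big_ord1 addn0 [path_kernel _ _ _ _ _ _ _ _ _]/=/kindic.
  have [pb|bp] := leP p (be l).
    rewrite (@eq_cint R _ RR leb _ (fun=> 0)); first by rewrite cint0 mulr0 subr0.
    by move=> u; rewrite h0 ltNge pb mul0r.
  rewrite Kback_bfac; apply/esym/eqP; rewrite subr_eq0; apply/eqP.
  apply: (congr1 (fun z => ipi * z)); apply: eq_cint => u.
  by rewrite (bfac_shift _ p (be l)) h0 bp.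
have hl : (1 <= l < m)%N by rewrite l1 (leq_trans _ lkm)// addnS ltnS leq_addr.
have -> : path_kernel W h gR al be l k.+1 p q = if p <= be l then
    kcomp (heat (al l.+1 - al l)) (path_kernel W h gR al be l.+1 k) p q else 0 by [].
rewrite big_ord_recl addn0.
have [pb|bp] := leP p (be l); last first.
  rewrite big1 => [|j _]; last first.
    rewrite (@eq_cint R _ RR leb _ (fun=> 0)); first by rewrite cint0 mulr0.
    by move=> u; rewrite lift0 hitkS_gt// mul0r.
  rewrite addr0 Kback_bfac; apply/esym/eqP; rewrite subr_eq0; apply/eqP.
  apply: (congr1 (fun z => ipi * z)); apply: eq_cint => u.
  by rewrite (bfac_shift _ p (be l)) h0 bp.
have z0 : ipi * cint leb (fun u => hitk al be (gR u) (@ord0 k.+1) l p * bfac (al l) (be l) q u) = 0.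
  rewrite (@eq_cint R _ RR leb _ (fun=> 0)); first by rewrite cint0 mulr0.
  by move=> u; rewrite h0 ltNge pb mul0r.
rewrite z0 add0r.
have hj (j : 'I_k.+1) : (l + j < m)%N.
  by rewrite (leq_trans _ lkm)// addnS ltnS leq_add2l -ltnS.
have [iK eK] := heat_Kback p q hl.
pose Tj (j : 'I_k.+1) r := heat (al l.+1 - al l) p r * (ipi * cint leb (fun u =>
  hitk al be (gR u) j l.+1 r * bfac (al (l.+1 + j)%N) (be (l.+1 + j)%N) q u)).
have iT j : cintble leb (Tj j) by exact: (heat_hitk _ _ _ l1 (hj j)).1.
have E r : heat (al l.+1 - al l) p r * path_kernel W h gR al be l.+1 k r q =
    heat (al l.+1 - al l) p r * Kback W h gR (al 1%N) (al l.+1) r q - \sum_j Tj j r.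
  by rewrite IH ?addSn -?addnS// mulrBr big_distrr.
rewrite /kcomp (@eq_cint R _ RR leb _ _ E) cintB//; last exact: cintble_sum.
rewrite eK cint_sum//; congr (_ - _); apply: eq_bigr => j _.
rewrite /Tj (heat_hitk _ _ _ l1 (hj j)).2 lift0 addnS.
apply: (congr1 (fun z => ipi * z)); apply: eq_cint => u.
by rewrite /= pb.
Qed.

Lemma Sker_formula p q : (0 < m)%N -> Sker W h gR m al be p q =
  - \sum_(j < m) ipi * cint leb (fun u =>
    hitk al be (gR u) j 1 p * bfac (al j.+1) (be j.+1) q u).
Proof.
case: m hal path_formula => // n _ pf _; rewrite /Sker [n.+1.-1]/= pf// addrA addNr add0r.
by congr (- _); apply: eq_bigr => j _; rewrite add1n.
Qed.

End PathFormula.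

(** * The kernel T *)

Section HitDecay.
Context {R : realType}.
Implicit Types (zeta : R[i]) (p : R).
Variables (al be : nat -> R) (m : nat) (del : R).
Hypothesis hal : forall j, (1 <= j < m)%N -> al j < al j.+1.
Hypothesis del0 : 0 < del.

Let abs_le_sum (f : nat -> R) j : (j < m)%N -> `|f j| <= \sum_(i < m) `|f i|.
Proof.
by move=> jm; rewrite (bigD1 (Ordinal jm))//= lerDl sumr_ge0.
Qed.

(** On the left, [hitk_bound] is used with $y$ proportional to $-p$, which gives a Gaussian; [b] and
    [T] make its rate uniform over all indices below [m]. On the right the terminal exponential
    gives the decay, or the support ends at $\beta_1$. *)
Lemma hitk_decay : exists e C, [/\ 0 < e, 0 < C & forall zeta j p, del <= Re zeta -> (j < m)%N ->
  nrm (hitk al be zeta j 1 p) <= C * expR (- (del * `|p|)) * expR (- (e * Num.min p 0 ^+ 2))].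
Proof.
pose b := \sum_(i < m) `|be i.+1|; pose T := 1 + \sum_(i < m) `|al i.+1 - al 1%N|.
have b0 : 0 <= b by apply: sumr_ge0.
have T0 : 0 < T by rewrite ltr_wpDr// sumr_ge0.
have hb j : (j < m)%N -> `|be j.+1| <= b by exact: (abs_le_sum (fun i => be i.+1)).
have hT j : (j < m)%N -> al j.+1 - al 1%N <= T.
  move=> jm; rewrite (le_trans (ler_norm _))// (le_trans (abs_le_sum (fun i => al i.+1 - al 1%N) jm))//.
  by rewrite lerDr.
pose s := (4 * T)^-1; have s0 : 0 < s by rewrite invr_gt0 mulr_gt0.
pose e := s / 4; have e0 : 0 < e by rewrite divr_gt0.
(* The maximum over $q$ of $(2sb+\delta)q-\frac34sq^2$. *)
pose Kc := (2 * s * b + del) ^+ 2 / (3 * s).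
have Kc0 : 0 <= Kc by rewrite divr_ge0 ?sqr_ge0// mulr_ge0// ltW.
pose E := Kc + 3 * del * b + e * b ^+ 2.
have db0 : 0 <= del * b by rewrite mulr_ge0// ltW.
have eb0 : 0 <= e * b ^+ 2 by rewrite mulr_ge0 ?sqr_ge0// ltW.
exists e, (2 ^+ m * expR E); split => //; first by rewrite mulr_gt0 ?exprn_gt0 ?expR_gt0.
move=> zeta j p hz jm.
rewrite -[leRHS]mulrA -[leRHS]mulrA -!expRD.
have p2 : 2 ^+ j <= 2 ^+ m :> R by rewrite ler_eXn2l ?ltr1n// ltnW.
suff h x : nrm (hitk al be zeta j 1 p) <= 2 ^+ j * expR x ->
    x <= E + (- (del * `|p|) - e * Num.min p 0 ^+ 2) ->
    nrm (hitk al be zeta j 1 p) <= 2 ^+ m * expR (E + (- (del * `|p|) - e * Num.min p 0 ^+ 2)).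
  have hz0 : 0 <= Re zeta by apply: le_trans hz; exact: ltW.
  case: j jm p2 h => [|j] jm p2 h.
    have hb0 := hb 0%N jm; move: (hb0); rewrite ler_norml => /andP[hb1 hb2].
    rewrite /=; case: ifPn => hp; last by rewrite nrm0 mulr_ge0 ?exprn_ge0 ?expR_ge0.
    move: (h (- ((p - be 1%N) * del))); rewrite /= hp; apply.
      rewrite expr0 mul1r nrm_cexp ler_expR !ReImE mul0r subr0 lerN2 ler_wpM2l//.
      by rewrite subr_ge0 ltW.
    have hm : Num.min p 0 ^+ 2 <= b ^+ 2.
      by rewrite -[leLHS]sqrrN ler_pXn2r// ?nnegrE ?oppr_ge0 ?ge_min ?lexx ?orbT//;
        case: (lerP p 0) => h'; move: hp hb1; lra.
    have hpp : `|p| <= p + 2 * b.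
      by rewrite ler_norml; apply/andP; split; move: hp hb1 b0; lra.
    have h1 : e * Num.min p 0 ^+ 2 <= e * b ^+ 2 by rewrite ler_wpM2l// ltW.
    have h2 : del * `|p| <= del * (p + 2 * b) by rewrite ler_wpM2l// ltW.
    have h3 : del * be 1%N <= del * b by rewrite ler_wpM2l// ltW.
    move: h1 h2 h3; rewrite /E => h1 h2 h3; move: Kc0; lra.
  case: (ltP (be 1%N) p) => hp; first by rewrite hitkS_gt// nrm0 mulr_ge0 ?exprn_ge0 ?expR_ge0.
  have hl i : (1 <= i < 1 + j.+1)%N -> al i < al i.+1.
    by rewrite add1n => /andP[i1 i2]; apply: hal; rewrite i1 (leq_trans i2).
  have hbj := hb _ jm; have hTj := hT _ jm.
  move: h; case: (leP p 0) => hp0 h.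
    pose q := - p; have q0 : 0 <= q by rewrite oppr_ge0.
    (* With $y=2sq$ and $s=1/(4T)$ the exponent $-yq+Ty^2$ equals $-sq^2$; a quarter of it is kept
       as the weight, and the rest absorbs the linear terms. *)
    have y0 : 0 <= 2 * s * q by rewrite !mulr_ge0// ltW.
    apply: (h _ (hitk_bound be (l := 1%N) p hz0 y0 hl)).
    rewrite ler0_norm// -/q (_ : p ^+ 2 = q ^+ 2); last by rewrite sqrrN.
    have h1 : 2 * s * q * - be j.+2 <= 2 * s * q * b.
      by rewrite ler_wpM2l// (le_trans (ler_norm _))// normrN.
    have h2 : (al j.+2 - al 1%N) * (2 * s * q) ^+ 2 <= T * (2 * s * q) ^+ 2.
      by rewrite ler_wpM2r// sqr_ge0.
    have h3 : T * (2 * s * q) ^+ 2 = s * q ^+ 2.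
      by rewrite /s; field; rewrite gt_eqF.
    have h4 : (2 * s * b + del) * q <= 3 / 4 * s * q ^+ 2 + Kc.
      have : 0 <= 3 / 4 * s * (q - 2 * (2 * s * b + del) / (3 * s)) ^+ 2.
        by rewrite mulr_ge0 ?sqr_ge0// mulr_ge0// ltW.
      rewrite (_ : _ * _ ^+ 2 = 3 / 4 * s * q ^+ 2 + Kc - (2 * s * b + del) * q); last first.
        by rewrite /Kc; field; rewrite gt_eqF.
      by rewrite subr_ge0.
    rewrite !add1n -[p]opprK -/q /E.
    have h5 (S Q q' B B' D K t Y X eb db : R) : S * q' * - B' <= S * q' * B -> t * Y <= X ->
        X = S / 2 * Q -> Q = q' * q' -> (S * B + D) * q' <= 3 / 8 * S * Q + K -> 0 <= db -> 0 <= eb ->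
        S * q' * (- q' - B') + t * Y <= K + 3 * db + eb + (- (D * q') - S / 8 * Q).
      by move=> k1 k2 k3 k4 k5 k6 k7; nra.
    rewrite (_ : e = 2 * s / 8) -?(mulrA 3); last by rewrite /e; field.
    apply: (h5 _ _ q b _ _ Kc _ _ (T * (2 * s * q) ^+ 2)) => //.
    - by rewrite h3; field.
    - by rewrite (_ : 3 / 8 * (2 * s) = 3 / 4 * s)//; field.
    - by rewrite mulr_ge0 ?sqr_ge0// divr_ge0// mulr_ge0// ltW.
  apply: (h _ (hitk_bound be (l := 1%N) p hz0 (lexx 0) hl)).
  rewrite mul0r expr0n mulr0 addr0 gtr0_norm// /E.
  have : del * p <= del * b.
    by rewrite ler_wpM2l ?(ltW del0)// (le_trans hp)// (le_trans (ler_norm _))// hb// (leq_trans _ jm).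
  by rewrite mulr0; move: Kc0 eb0 db0; lra.
move=> h1 h2; apply: (le_trans h1); apply: ler_pM; rewrite ?exprn_ge0 ?expR_ge0//.
by rewrite ler_expR.
Qed.

End HitDecay.

Section IteratedContours.
Context {R : realType}.
Implicit Types (z zeta eta w : R[i]).

Lemma eq_contour_ints (gs : seq (R -> R[i])) (F F' : seq R[i] -> R[i]) :
  (forall zs, size zs = size gs -> F zs = F' zs) -> contour_ints gs F = contour_ints gs F'.
Proof.
elim: gs F F' => [|g gs IH] F F' h /=; first exact: h.
congr (contour_int g _); apply/funext => z; apply: IH => zs hs.
by apply: h => /=; rewrite hs.
Qed.

Variables al be : nat -> R.

(** The integrand of [nest] with all its variables listed. *)
Fixpoint chain zeta (l : nat) z (ws : seq R[i]) : R[i] :=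
  if ws is w :: ws' then
    gexp (al l.+1 - al l) (be l.+1 - be l)%:C w / (z - w) * chain zeta l.+1 w ws'
  else (z - zeta)^-1.

Lemma FratioS l z : (1 <= l)%N ->
  Fratio al be l.+1 z = gexp (al l.+1 - al l) (be l.+1 - be l)%:C z.
Proof.
move=> l1; rewrite /Fratio ltnNge l1 /= /fexp -cexpB /gexp; apply: (congr1 cexp).
by rewrite !realCD !realCN; ring.
Qed.

(** Regroups the quotient of products in $\mathbf T$ so that each ratio $\mathrm F_{l+1}$ is paired
    with the Cauchy denominator to its left. *)
Lemma chainE zeta l z ws : (1 <= l)%N ->
  (\prod_(j < (size ws).+1) Fratio al be (l + j) (nth 0 (z :: ws) j)) /
  ((\prod_(j < size ws) (nth 0 (z :: ws) j - nth 0 (z :: ws) j.+1)) *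
    (nth 0 (z :: ws) (size ws) - zeta)) = Fratio al be l z * chain zeta l z ws.
Proof.
elim: ws l z => [|w ws IH] l z l1.
  by rewrite big_ord_recl big_ord0 mulr1 big_ord0 mul1r /= addn0.
rewrite big_ord_recl [X in _ / (X * _)]big_ord_recl /= addn0.
have := IH l.+1 w isT; rewrite FratioS// mulrA -mulrA !invfM => h.
rewrite [RHS](_ : _ = Fratio al be l z * ((z - w)^-1 *
  (gexp (al l.+1 - al l) (be l.+1 - be l)%:C w * chain zeta l.+1 w ws))); last by ring.
rewrite -h.
under eq_bigr do rewrite /bump leq0n add1n addnS -addSn /=.
pose P := \prod_(j < (size ws).+1) Fratio al be (l.+1 + j) (nth 0 (w :: ws) j).
pose Q := \prod_(j < size ws) (nth 0 (w :: ws) j - nth 0 (w :: ws) j.+1).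
rewrite -/P -/Q; set D := (_ - zeta)^-1.
change (Fratio al be l z * P * ((z - w)^-1 / Q * D) = Fratio al be l z * ((z - w)^-1 * (P * (Q^-1 * D)))).
ring.
Qed.

End IteratedContours.

Section NestedContours.
Context {R : realType}.
Local Notation leb := (@lebesgue_measure R).
Local Notation RR := (measurableTypeR R).
Variables (al be : nat -> R) (gL : nat -> R -> R[i]) (m : nat).
Hypothesis hal : forall j, (1 <= j < m)%N -> al j < al j.+1.
Hypothesis hgL : forall l, (1 <= l <= m)%N -> is_contour (2 * pi / 3) (gL l).
Hypothesis hneg : forall l u, (1 <= l <= m)%N -> Re (gL l u) <= 0.
Hypothesis hj : forall l u, (1 <= l < m)%N -> joined_to_infinity (gL l.+1) 1 (gL l u).

Local Notation nestL := (nest al be gL (fun l => velocity (gL l))).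

Lemma slopes : exists A, 0 <= A /\ forall l u, (1 <= l <= m)%N ->
  - Re (gL l u) - 3/4 * (sgn u * Im (gL l u)) <= A.
Proof.
have /choice[f hf] : forall l, exists a : R, (1 <= l <= m)%N -> forall u,
    - Re (gL l u) - 3/4 * (sgn u * Im (gL l u)) <= a.
  move=> l; case: (boolP (1 <= l <= m)%N) => hl; last by exists 0.
  by have [A hA] := left_slope (hgL hl); exists A.
exists (\sum_(l < m.+1) `|f l|); split; first exact: sumr_ge0.
move=> l u hl; rewrite (le_trans (hf l hl u))// (le_trans (ler_norm _))//.
have lm : (l < m.+1)%N by rewrite ltnS; case/andP: hl.
by rewrite (bigD1 (Ordinal lm))//= lerDl sumr_ge0.
Qed.

Let hG l : (1 <= l <= m)%N -> gcontour (gL l) (velocity (gL l)).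
Proof. by move=> hl; apply: left_gcontour; exact: hgL. Qed.

Lemma nest_nestW zeta (x0 : R) : 0 < Re zeta -> exists x : R, [/\ x <= x0, x <= 0 &
  forall k l u, (1 <= l)%N -> (l + k <= m)%N ->
    nestL zeta k l (gL l u) = nestW al be x zeta k l (gL l u) /\ rho (gL l u) <= - (x - l%:R)].
Proof.
move=> zt0; have [A [A0 hA]] := slopes.
pose x := Num.min (- A - 1) (Num.min x0 0).
have xA : x <= - A - 1 by rewrite ge_min lexx.
have xx0 : x <= x0 by rewrite !ge_min lexx !orbT.
have x0' : x <= 0 by rewrite !ge_min lexx !orbT.
exists x; split => // k l u l1 lk.
have lm : (1 <= l <= m)%N by rewrite l1 (leq_trans _ lk)// leq_addr.
split; first exact: (nest_wedge be hal hG hneg hA hj zt0 xA x0' u l1 lk).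
have h1 := le_trans (rho_le_sgn (gL l u) u) (hA l u lm).
have : 0 <= l%:R :> R by [].
by move: h1 xA; lra.
Qed.

(** Transferred from the wedges: on the original contours only the equality with [nestW] is known,
    and [nestW] has explicit bounds. *)
Lemma nest_bounded zeta k l : 0 < Re zeta -> (1 <= l)%N -> (l + k <= m)%N ->
  cmeas (T := RR) (fun u => nestL zeta k l (gL l u)) /\
  exists C, forall u, nrm (nestL zeta k l (gL l u)) <= C.
Proof.
move=> zt0 l1 lk; have [x [_ x0 hx]] := nest_nestW 0 zt0.
have lm : (1 <= l <= m)%N by rewrite l1 (leq_trans _ lk)// leq_addr.
have E : (fun u => nestL zeta k l (gL l u)) = (fun u => nestW al be x zeta k l (gL l u)).
  by apply/funext => u; have [] := hx k l u l1 lk.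
split; first by rewrite E; apply: nestW_cmeas; exact: adm_cmeas (gc_adm (hG lm)).
have d0 : 0 < Num.min (1/2) (Re zeta) by rewrite lt_min zt0 divr_gt0.
have hal' j : (l <= j < l + k)%N -> al j < al j.+1.
  by move=> /andP[j1 j2]; apply: hal; rewrite (leq_trans l1 j1) (leq_trans j2 lk).
have [C [_ hC]] := nestW_bound be d0 x0 zt0 hal'.
exists C => u; have [-> hr] := hx k l u l1 lk.
by apply: hC; apply: far_rho => //; exact: hneg.
Qed.

(** The factor [c] collects the outer variables, which is what the induction needs. *)
Lemma contour_chain zeta k l u c : 0 < Re zeta -> (1 <= l)%N -> (l + k <= m)%N ->
  contour_ints [seq gL j | j <- iota l.+1 k] (fun zs => c * chain al be zeta l (gL l u) zs) =
  c * nestL zeta k l (gL l u).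
Proof.
move=> zt0; elim: k l u c => [//|k IH] l u c l1; rewrite addnS -addSn => lk.
have lm : (1 <= l < m)%N by rewrite l1 (leq_trans _ lk)// addSn ltnS leq_addr.
have Sm : (1 <= l.+1 <= m)%N by have /andP[] := lm.
have t0 : 0 < al l.+1 - al l by rewrite subr_gt0 hal.
rewrite nestS.
pose Phi s := (gL l u - gL l.+1 s)^-1 * nestL zeta k l.+1 (gL l.+1 s).
have G := hG Sm; have mg := adm_cmeas (gc_adm G).
have [mN [C hC]] := nest_bounded zt0 (isT : (1 <= l.+1)%N) lk.
have [d [d0 hd]] : exists d, 0 < d /\ forall s, d <= nrm (gL l u - gL l.+1 s).
  apply: (gcontour_dist G) => s; have [q [_ _ <- hq _]] := hj u lm.
  exact: hq (lexx 0).
have iF : cintble leb (fun s => gexp (al l.+1 - al l) (be l.+1 - be l)%:C (gL l.+1 s) * Phi s *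
    velocity (gL l.+1) s).
  apply: (@gexpM_cintble R _ _ _ _ Phi (d^-1 * C)) => //.
    by apply: cmeasM mN; apply: cmeasV; apply: cmeasB => //; exact: cmeas_cst.
  move=> s; rewrite nrmM; apply: ler_pM; rewrite ?nrm_ge0//.
  exact: nrm_inv_le.
transitivity (ipi * cint leb (fun s => c *
    (gexp (al l.+1 - al l) (be l.+1 - be l)%:C (gL l.+1 s) * Phi s * velocity (gL l.+1) s))).
  apply: (congr1 (fun z => ipi * z)); apply: (@eq_cint R _ RR leb _ _) => s.
  rewrite [RHS]mulrA; apply: (congr1 (fun z => z * velocity (gL l.+1) s)).
  rewrite /Phi [RHS]mulrA [RHS]mulrA -[c * _ * _]mulrA -IH//.
  apply: (@eq_contour_ints _ [seq gL j | j <- iota l.+2 k]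
    (fun zs => c * chain al be zeta l (gL l u) (gL l.+1 s :: zs))) => zs _ /=.
  by rewrite [in LHS]mulrA.
rewrite cintZ// mulrCA; apply: (congr1 (fun z => c * (ipi * z))).
by apply: (@eq_cint R _ RR leb _ _) => s; rewrite /Phi [in LHS]mulrA.
Qed.

End NestedContours.

Lemma ipi_neq0 {R : realType} : ipi != 0 :> R[i].
Proof.
rewrite /ipi invr_eq0; apply/negP => /eqP/(congr1 (@complex.Im R)) /= /eqP.
by rewrite mulf_eq0 pnatr_eq0 /= gt_eqF// pi_gt0.
Qed.

Section LeftKernel.
Context {R : realType} d (Omega : measurableType d) (P : probability Omega R).
Local Notation RR := (measurableTypeR R).
Local Notation leb := (@lebesgue_measure R).
Variables (W : R -> {RV P >-> R}) (h : R -> \bar R) (gR : R -> R[i]) (gL : nat -> R -> R[i]).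
Hypotheses (hW : two_sided_brownian W) (hh : UCc h).
Hypotheses (hgR : is_contour (pi / 5) gR) (hgRpos : forall t, 0 < Re (gR t)).
Variables (al be : nat -> R) (m : nat).
Hypothesis hal : forall j, (1 <= j < m)%N -> al j < al j.+1.
Hypothesis m0 : (0 < m)%N.
Hypothesis hgL : forall l, (1 <= l <= m)%N -> is_contour (2 * pi / 3) (gL l).
Hypothesis hneg : forall l u, (1 <= l <= m)%N -> Re (gL l u) < 0.
Hypothesis hj : forall l u, (1 <= l < m)%N -> joined_to_infinity (gL l.+1) 1 (gL l u).

Local Notation nestL := (nest al be gL (fun l => velocity (gL l))).
Local Notation BQ := (Bq W h (gL 1%N) (al 1%N)).

Let hneg' l u : (1 <= l <= m)%N -> Re (gL l u) <= 0.
Proof. by move=> hl; apply: ltW; exact: hneg. Qed.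

Lemma Tker_nest k zeta j eta : (k < m)%N -> 0 < Re zeta ->
  Tker W h al be gL (k.+1, zeta) (j, eta) =
  ipi * cint leb (fun u => fexp al be 1 (gL 1%N u) * chi W h eta (gL 1%N u) *
    nestL zeta k 1 (gL 1%N u) * velocity (gL 1%N) u) * (fexp al be j eta)^-1.
Proof.
move=> km zt0; rewrite /Tker; apply: (congr1 (fun z => z * (fexp al be j eta)^-1)).
apply: (congr1 (fun z => ipi * z)); apply: (@eq_cint R _ RR leb _ _) => u.
apply: (congr1 (fun z => z * velocity (gL 1%N) u)).
rewrite -(contour_chain be hal hgL hneg' hj (l := 1%N) u (fexp al be 1 (gL 1%N u) * chi W h eta (gL 1%N u)) zt0) ?add1n//.
apply: eq_contour_ints => zs; rewrite size_map size_iota => sz.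
rewrite !big_add1 /= !big_mkord.
have := chainE al be zeta (gL 1%N u) zs (isT : (1 <= 1)%N); rewrite sz.
under eq_bigr do rewrite add1n.
set X := \prod_(_ < _) _; set Y := (X in _ / X); set c := chi _ _ _ _ => H.
have -> : fexp al be 1 (gL 1%N u) * c * chain al be zeta 1 (gL 1%N u) zs =
  fexp al be 1 (gL 1%N u) * chain al be zeta 1 (gL 1%N u) zs * c by rewrite mulrAC.
by rewrite -[RHS](congr1 (fun z => z * c) H) mulrAC.
Qed.

Lemma hitk_Bq_cintble del zeta eta k : 0 < del -> del <= 1 -> (forall u, Re (gL 1%N u) <= - del) ->
  del <= Re zeta -> del <= Re eta -> (k < m)%N ->
  cintble leb (fun p => hitk al be zeta k 1 p * BQ eta p).
Proof.
move=> d0 d1 hL hz he km.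
have h1m : (1 <= 1 <= m)%N by [].
have [e [C [e0 C0 hC]]] := hitk_decay be hal d0.
have [K [K0 hK]] := Bq_bound hW hh hgR hgRpos (hgL h1m) (fun u => hneg u h1m) (al 1%N) e0 d0 d1 hL.
apply: (@cintble_dom R _ RR leb _ (fun p => C * (K * expR (K * nrm eta ^+ 2)) * expR (- (del * `|p|)))).
- apply: cmeasM; first by apply: hitk_cmeas => //; exact: cmeas_cst.
  by apply: (Bq_cmeas hW hh hgR hgRpos (hgL h1m) (fun u => hneg u h1m)) => //; exact: cmeas_cst.
- by apply: rintZ; exact: rint_exp_abs.
- move=> p; rewrite nrmM.
  apply: le_trans (ler_pM (nrm_ge0 _) (nrm_ge0 _) (hC zeta k p hz km) (hK eta p he).2) _.
  set E1 := expR (e * _); have -> : expR (- (e * Num.min p 0 ^+ 2)) = E1^-1 by rewrite expRN.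
  have : E1 != 0 by rewrite gt_eqF// expR_gt0.
  move: E1 (expR _) (expR _) => E1 E2 E3 E10; rewrite le_eqVlt; apply/orP; left; apply/eqP.
  by field.
Qed.

Lemma left_fubini del zeta eta k : 0 < del -> del <= 1 -> (forall u, Re (gL 1%N u) <= - del) ->
  del <= Re zeta -> del <= Re eta -> (k < m)%N ->
  cint leb (fun u => cint leb (fun p => - hitk al be zeta k 1 p *
    (phi kapL (al 1%N) p (gL 1%N u) * velocity (gL 1%N) u * chi W h eta (gL 1%N u)))) =
  cint leb (fun p => cint leb (fun u => - hitk al be zeta k 1 p *
    (phi kapL (al 1%N) p (gL 1%N u) * velocity (gL 1%N) u * chi W h eta (gL 1%N u)))).
Proof.
move=> d0 d1 hL hz he km.
have h1m : (1 <= 1 <= m)%N by [].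
have hG1 := hgL h1m; have hn u := hneg u h1m.
have [e [C [e0 C0 hC]]] := hitk_decay be hal d0.
have [D [D0 hD]] := chi_bound hW hh hgR hgRpos hG1 hn d0 d1.
have hr := acontour_rapid (left_acontour hG1); have [mG mv _] := hr.
have [K [K0 hK]] := rapid_phi_neg (al 1%N) hr D0 e0 (fun u => ltW (hn u)).
pose c := C * (D * expR (D * nrm eta ^+ 2) * K).
have c0 : 0 <= c by rewrite !mulr_ge0 ?expR_ge0// ltW.
apply: (@cfubini R _ _ RR RR leb leb (fun up => - hitk al be zeta k 1 up.2 *
    (phi kapL (al 1%N) up.2 (gL 1%N up.1) * velocity (gL 1%N) up.1 * chi W h eta (gL 1%N up.1)))
  (fun u => c * gau 1 u) (fun p => expR (- (del * `|p|)))).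
- have mu1 : measurable_fun setT (@fst RR RR) by exact: measurable_fst.
  have mu2 : measurable_fun setT (@snd RR RR) by exact: measurable_snd.
  apply: cmeasM; first by apply: cmeasN; apply: hitk_cmeas => //; exact: cmeas_cst.
  apply: cmeasM; last first.
    by apply: (chi_cmeas hW hh hgR hgRpos hG1 hn); [exact: cmeas_cst|exact: cmeas_comp mG mu1].
  by apply: cmeasM; [apply: phi_cmeas => //; exact: cmeas_comp mG mu1|exact: cmeas_comp mv mu1].
- by move=> u; rewrite mulr_ge0 ?gau_ge0.
- by move=> p; exact: expR_ge0.
- by apply: rintZ; exact: rint_gau.
- exact: rint_exp_abs.
move=> u p /=; rewrite nrmM nrmN [nrm (_ * chi _ _ _ _)]nrmM.
have k1 := hC zeta k p hz km; have k2 := hK u p; have k3 := hD eta (gL 1%N u) he (hL u).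
rewrite mulrDr expRD in k3.
have k4 : nrm (phi kapL (al 1%N) p (gL 1%N u) * velocity (gL 1%N) u) * nrm (chi W h eta (gL 1%N u)) <=
    D * expR (D * nrm eta ^+ 2) * (K * expR (e * Num.min p 0 ^+ 2) * gau 1 u).
  apply: le_trans (ler_wpM2l (nrm_ge0 _) k3) _.
  have -> : forall y e1 e2 : R, y * (D * (e1 * e2)) = D * e1 * (y * e2) by move=> *; ring.
  by rewrite ler_wpM2l ?mulr_ge0 ?expR_ge0.
apply: le_trans (ler_pM (nrm_ge0 _) (mulr_ge0 (nrm_ge0 _) (nrm_ge0 _)) k1 k4) _.
set E1 := expR (e * _); have -> : expR (- (e * Num.min p 0 ^+ 2)) = E1^-1 by rewrite expRN.
have : E1 != 0 by rewrite gt_eqF// expR_gt0.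
rewrite /c; move: E1 (expR _) (expR _) (gau _ _) => E1 E2 E3 g E10; rewrite le_eqVlt; apply/orP; left; apply/eqP.
by field.
Qed.

(** The position [x] of the wedges depends on [u]: they have to lie to the left of the current
    point, whose real part has no lower bound along the contour. The result does not involve [x]. *)
Lemma nest_hitk zeta k u : 0 < Re zeta -> (k < m)%N ->
  nestL zeta k 1 (gL 1%N u) = - (cexp (- ((be 1%N)%:C * gL 1%N u)) *
    cint leb (fun p => cexp (p%:C * gL 1%N u) * hitk al be zeta k 1 p)).
Proof.
move=> zt0 km; have h1m : (1 <= 1 <= m)%N by [].
have [x [xu x0 hx]] := nest_nestW be hal hgL hneg' hj (Re (gL 1%N u)) zt0.
have [-> _] := hx k 1%N u isT (ltac:(by rewrite add1n)).
apply: nestW_hitk => //; last exact: hneg'.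
  by move=> j /andP[j1 j2]; apply: hal; rewrite j1 (leq_trans j2).
by move: xu; set y := Re _; rewrite -natr1; lra.
Qed.

(** Inserting the Laplace transform of [hitk] and exchanging the integrals leaves, for fixed [p],
    the integral over $\xi_1$ that defines [Bq]; [left_fubini] rests on the decay of [hitk] beating
    the growth in [p]. *)
Lemma Tker_hitk del zeta eta k j : 0 < del -> del <= 1 -> (forall u, Re (gL 1%N u) <= - del) ->
  del <= Re zeta -> del <= Re eta -> (k < m)%N ->
  Tker W h al be gL (k.+1, zeta) (j, eta) =
  - cint leb (fun p => hitk al be zeta k 1 p * ((fexp al be j eta)^-1 * BQ eta p)).
Proof.
move=> d0 d1 hL hz he km; have zt0 := lt_le_trans d0 hz.
have h1m : (1 <= 1 <= m)%N by [].
have iB := hitk_Bq_cintble d0 d1 hL hz he km.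
pose X p := cint leb (fun u => phi kapL (al 1%N) p (gL 1%N u) * velocity (gL 1%N) u * chi W h eta (gL 1%N u)).
have BX p : BQ eta p = ipi * X p by [].
rewrite (Tker_nest j eta km zt0).
transitivity (ipi * cint leb (fun p => - hitk al be zeta k 1 p * X p) * (fexp al be j eta)^-1).
  apply: (congr1 (fun z => ipi * z * (fexp al be j eta)^-1)).
  have [C0 [_ hX]] := Bq_bound hW hh hgR hgRpos (hgL h1m) (fun u => hneg u h1m) (al 1%N) ltr01 d0 d1 hL.
  transitivity (cint leb (fun p => cint leb (fun u => - hitk al be zeta k 1 p *
    (phi kapL (al 1%N) p (gL 1%N u) * velocity (gL 1%N) u * chi W h eta (gL 1%N u))))); last first.
    apply: (@eq_cint R _ RR leb _ _) => p; rewrite cintZ//; exact: (hX eta p he).1.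
  rewrite -(left_fubini d0 d1 hL hz he km).
  apply: (@eq_cint R _ RR leb _ _) => u.
  have hal' j' : (1 <= j' < 1 + k)%N -> al j' < al j'.+1.
    by move=> /andP[j1 j2]; apply: hal; rewrite j1 (leq_trans j2).
  have ih := hitk_cintble be zt0 (hneg' u h1m) hal'.
  rewrite (nest_hitk u zt0 km).
  set c := fexp al be 1 (gL 1%N u) * cexp (- ((be 1%N)%:C * gL 1%N u)) * velocity (gL 1%N) u * chi W h eta (gL 1%N u).
  have -> : forall f ch e I v : R[i], f * ch * - (e * I) * v = - (f * e * v * ch) * I by move=> *; ring.
  rewrite -/c -cintZ//; apply: (@eq_cint R _ RR leb _ _) => p.
  (* The $e^{-\beta_1\xi}$ of the Laplace formula cancels the linear term of $\mathrm f_1$, and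
     $e^{p\xi}$ takes its place. *)
  have -> : phi kapL (al 1%N) p (gL 1%N u) = fexp al be 1 (gL 1%N u) *
      cexp (- ((be 1%N)%:C * gL 1%N u)) * cexp (p%:C * gL 1%N u).
    by rewrite -!cexpD /phi; apply: (congr1 cexp); rewrite /kapL; ring.
  by rewrite /c; move: (fexp _ _ _ _) (cexp _) (cexp _) (hitk _ _ _ _ _ _) (chi _ _ _ _) => *; ring.
have -> : cint leb (fun p => - hitk al be zeta k 1 p * X p) =
    - ipi^-1 * cint leb (fun p => hitk al be zeta k 1 p * BQ eta p).
  rewrite -cintZ//; apply: (@eq_cint R _ RR leb _ _) => p; rewrite BX.
  have -> : forall a b x y : R[i], - a * (b * (x * y)) = (- b * y) * (x * a) by move=> *; ring.
  by rewrite mulfV ?mulr1// ipi_neq0.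
have -> : cint leb (fun p => hitk al be zeta k 1 p * ((fexp al be j eta)^-1 * BQ eta p)) =
    (fexp al be j eta)^-1 * cint leb (fun p => hitk al be zeta k 1 p * BQ eta p).
  by rewrite -cintZ//; apply: (@eq_cint R _ RR leb _ _) => p; rewrite mulrCA.
have -> : forall a b x y : R[i], a * (- b * x) * y = - ((a * b) * (y * x)) by move=> *; ring.
by rewrite mulfV ?mul1r// ipi_neq0.
Qed.

End LeftKernel.

(** * Comparison of the Fredholm series *)

Section DiscreteParameter.
Context {R : realType}.

Lemma cmeas_nat (disp : measure_display) (T : measurableType disp) (f : T -> nat) (G : nat -> T -> R[i]) :
  measurable_fun setT f -> (forall n, cmeas (G n)) -> cmeas (fun x => G (f x) x).
Proof.
move=> mf mG.
have H (g : nat -> T -> R) : (forall n, measurable_fun setT (g n)) ->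
    measurable_fun setT (fun x => g (f x) x).
  move=> mg _ A mA; rewrite setTI.
  rewrite (_ : _ @^-1` A = \bigcup_n ((f @^-1` [set n]) `&` (g n @^-1` A))).
    apply: bigcup_measurable => n _; apply: measurableI.
      by rewrite -[X in measurable X]setTI; exact: mf.
    by rewrite -[X in measurable X]setTI; exact: mg.
  apply/seteqP; split=> [x /= hx|x /= [n _ [/= <-]]//].
  by exists (f x).
by split; [apply: (H (fun n x => Re (G n x))) => n; have [] := mG n|
  apply: (H (fun n x => Im (G n x))) => n; have [] := mG n].
Qed.

End DiscreteParameter.

Section Functionals.
Context {R : realType}.
Local Notation RR := (measurableTypeR R).
Local Notation leb := (@lebesgue_measure R).

Lemma dominated_cintble (g : R -> R) (F : RR -> R[i]) C : rint leb g -> dominated g F C ->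
  cintble leb F.
Proof. by move=> ig [mF hF]; apply: (@cintble_dom R _ RR leb _ _ mF _ hF); exact: rintZ. Qed.

Lemma cint_ifun (g : R -> R) : (forall x, 0 <= g x) -> rint leb g ->
  ifun (X := RR) (cint leb) g (2 * \int[leb]_x g x).
Proof.
move=> g0 ig; split => //.
- by rewrite mulr_ge0// Rintegral_ge0.
- by move=> d' T F mF; exact: (@cmeas_cint R _ _ T RR leb F).
- by move=> F1 F2 C1 C2 h1 h2; apply: cintD;
  [exact: dominated_cintble ig h1|exact: dominated_cintble ig h2].
- by move=> c F C hF; apply: cintZ; exact: dominated_cintble ig hF.
move=> F C [mF hF].
apply: le_trans (@nrm_cint R _ RR leb _ _ mF (rintZ C ig) hF) _.
by rewrite RintegralZl// mulrCA mulrC -mulrA.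
Qed.

Variables (m : nat) (v : R -> R[i]).
Hypothesis mv : cmeas (T := RR) v.

(** The measure on $\{1,\dots,m\}\times\Gamma_{1,\mathrm R}$ pulled back to the parameter of the
    contour; [nat * RR] carries the measurable structure needed for iterated integrals. *)
Definition sum_cint (F : nat * RR -> R[i]) : R[i] :=
  \sum_(1 <= i < m.+1) ipi * cint leb (fun u => F (i, u) * v u).

Variable w : nat * RR -> R.
Hypothesis w0 : forall y, 0 <= w y.
Hypothesis iw : forall i, rint leb (fun u => w (i, u) * nrm (v u)).

Lemma slice_cmeas (F : nat * RR -> R[i]) i : cmeas F -> cmeas (T := RR) (fun u => F (i, u)).
Proof. by move=> mF; apply: (cmeas_comp mF); apply: pair1_measurable. Qed.

Lemma slice_dom (F : nat * RR -> R[i]) C i : dominated w F C ->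
  dominated (fun u => w (i, u) * nrm (v u)) (fun u => F (i, u) * v u) C.
Proof.
move=> [mF hF]; split; first by apply: cmeasM => //; exact: slice_cmeas.
by move=> u; rewrite nrmM mulrA ler_wpM2r// nrm_ge0.
Qed.

Lemma sum_cint_ifun : ifun sum_cint w
  (\sum_(1 <= i < m.+1) nrm (ipi : R[i]) * (2 * \int[leb]_u (w (i, u) * nrm (v u)))).
Proof.
have ii i F C : dominated w F C -> cintble leb (fun u => F (i, u) * v u).
  by move=> hF; apply: (dominated_cintble (iw i)); exact: slice_dom hF.
split => //.
- by apply: sumr_ge0 => i _; rewrite !mulr_ge0 ?nrm_ge0// Rintegral_ge0// => u _; rewrite mulr_ge0// nrm_ge0.
- move=> d' T F mF; apply: cmeas_sum => i; apply: cmeasM; first exact: cmeas_cst.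
  apply: (@cmeas_cint R _ _ T RR leb (fun q => F (q.1, (i, q.2)) * v q.2)).
  apply: cmeasM; last by apply: (cmeas_comp mv); exact: measurable_snd.
  apply: (cmeas_comp mF); apply: measurable_fun_pair; first exact: measurable_fst.
  by apply: measurable_fun_pair; [exact: measurable_cst|exact: measurable_snd].
- move=> F1 F2 C1 C2 h1 h2; rewrite /sum_cint -big_split /=; apply: eq_bigr => i _.
  rewrite -mulrDr -cintD; [|exact: ii h1|exact: ii h2].
  by apply: (congr1 (fun z => ipi * z)); apply: (@eq_cint R _ RR leb _ _) => u; rewrite mulrDl.
- move=> c F C hF; rewrite /sum_cint mulr_sumr; apply: eq_bigr => i _.
  rewrite [RHS]mulrCA; apply: (congr1 (fun z => ipi * z)).
  rewrite -cintZ; last exact: ii hF.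
  by apply: (@eq_cint R _ RR leb _ _) => u; rewrite mulrA.
move=> F C hF; apply: le_trans (nrm_sum _ _ _) _; rewrite mulr_suml; apply: ler_sum => i _.
rewrite nrmM -mulrA ler_wpM2l ?nrm_ge0//.
have := if_bd (cint_ifun (fun u => mulr_ge0 (w0 (i, u)) (nrm_ge0 (v u))) (iw i)) (slice_dom i hF).
by [].
Qed.

Lemma sum_cint_exchange (g : R -> R) (F : RR * (nat * RR) -> R[i]) C :
  (forall x, 0 <= g x) -> rint leb g -> 0 <= C -> cmeas F ->
  (forall x y, nrm (F (x, y)) <= C * (g x * w y)) ->
  cint leb (fun x => sum_cint (fun y => F (x, y))) = sum_cint (fun y => cint leb (fun x => F (x, y))).
Proof.
move=> g0 ig C0 mF hF.
have mFi i : cmeas (T := (RR * RR)%type) (fun q => F (q.1, (i, q.2)) * v q.2).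
  apply: cmeasM; last by apply: (cmeas_comp mv); exact: measurable_snd.
  apply: (cmeas_comp mF); apply: measurable_fun_pair; first exact: measurable_fst.
  by apply: measurable_fun_pair; [exact: measurable_cst|exact: measurable_snd].
have hFi i x u : nrm (F (x, (i, u)) * v u) <= C * g x * (w (i, u) * nrm (v u)).
  by rewrite nrmM [leRHS]mulrA ler_wpM2r ?nrm_ge0// -mulrA.
have iC : rint leb (fun x => C * g x) by exact: rintZ.
have icx i : cintble leb (fun x => cint leb (fun u => F (x, (i, u)) * v u)).
  have hI := cint_ifun (fun u => mulr_ge0 (w0 (i, u)) (nrm_ge0 (v u))) (iw i).
  apply: (@cintble_dom R _ RR leb _ (fun x => (2 * \int[leb]_u (w (i, u) * nrm (v u))) * (C * g x))).
  - exact: (@cmeas_cint R _ _ RR RR leb (fun q => F (q.1, (i, q.2)) * v q.2)).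
  - exact: rintZ.
  - move=> x; apply: (if_bd hI); split; last exact: hFi.
    by apply: (cmeas_comp (mFi i) (g := fun u : RR => (x, u))); apply: pair1_measurable.
rewrite /sum_cint cint_sum; last by move=> i _; apply: cintbleZ.
apply: eq_bigr => i _; rewrite cintZ//; apply: (congr1 (fun z => ipi * z)).
rewrite (@cfubini R _ _ RR RR leb leb (fun q => F (q.1, (i, q.2)) * v q.2) _ _ (mFi i)
  (fun x => mulr_ge0 C0 (g0 x)) (fun u => mulr_ge0 (w0 (i, u)) (nrm_ge0 (v u))) iC (iw i) (hFi i)).
apply: (@eq_cint R _ RR leb _ _) => u; apply: (@cintZr R _ RR leb (v u) (fun x => F (x, (i, u)))).
apply: (@cintble_dom R _ RR leb _ (fun x => (C * w (i, u)) * g x)).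
- by apply: (cmeas_comp mF (g := fun x : RR => (x, (i, u)))); apply: measurable_fun_pair => //; exact: measurable_cst.
- exact: rintZ.
- by move=> x; rewrite mulrAC -mulrA.
Qed.

End Functionals.

Section Reindex.
Context {R : realType}.
Local Notation RR := (measurableTypeR R).
Variables (m : nat) (g : R -> R[i]).

Let lift (y : nat * RR) : nat * R[i] := (y.1, g y.2).
Let I := sum_cint m (velocity g).

Lemma sum_contour_intE (F : nat * R[i] -> R[i]) :
  sum_contour_int g m F = I (fun y => F (lift y)).
Proof. by []. Qed.

(** The sum visits only the indices from $1$ to $m$, so the integrands have to be compared there
    alone. *)
Lemma iterated_sum_contour k (F : k.-tuple (nat * R[i]) -> R[i]) (F' : k.-tuple (nat * RR) -> R[i]) :
  (forall ys, (forall a, (1 <= (tnth ys a).1 <= m)%N) -> F [tuple of map lift ys] = F' ys) ->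
  iterated_int (sum_contour_int g m) F = iterated_int I F'.
Proof.
elim: k F F' => [|k IH] F F' hF /=.
  by rewrite -hF; [congr F; exact: val_inj|case].
rewrite sum_contour_intE /I /sum_cint big_nat [RHS]big_nat; apply: eq_bigr => i hi.
apply: (congr1 (fun z => ipi * z)).
apply: (@eq_cint R _ RR (@lebesgue_measure R) _ _) => u.
apply: (congr1 (fun z => z * velocity g u)); apply: IH => ys hys.
rewrite -hF; first by congr F; exact: val_inj.
by move=> a; case: (unliftP ord0 a) => [b ->|->]; rewrite ?tnthS ?tnth0//=.
Qed.

Lemma fredholm_sum_contour (K : nat * R[i] -> nat * R[i] -> R[i]) (K' : nat * RR -> nat * RR -> R[i]) n :
  (forall x y, (1 <= x.1 <= m)%N -> (1 <= y.1 <= m)%N -> K (lift x) (lift y) = K' x y) ->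
  fredholm_sum (sum_contour_int g m) K n = fredholm_sum I K' n.
Proof.
move=> hK; apply: eq_bigr => k _; apply: (congr1 (fun z => _ * z)).
apply: iterated_sum_contour => ys hys; apply: (congr1 determinant).
by apply/matrixP => a b; rewrite !mxE !tnth_map hK.
Qed.

End Reindex.

Section Main.
Context {R : realType} d (Omega : measurableType d) (P : probability Omega R).
Local Notation RR := (measurableTypeR R).
Local Notation leb := (@lebesgue_measure R).
Variables (W : R -> {RV P >-> R}) (h : R -> \bar R) (gR : R -> R[i]) (gL : nat -> R -> R[i]).
Hypotheses (hW : two_sided_brownian W) (hh : UCc h).
Hypotheses (hgR : is_contour (pi / 5) gR) (hgRpos : forall t, 0 < Re (gR t)).
Variables (al be : nat -> R) (m : nat).
Hypothesis hal : forall j, (1 <= j < m)%N -> al j < al j.+1.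
Hypothesis m0 : (0 < m)%N.
Hypothesis hgL : forall l, (1 <= l <= m)%N -> is_contour (2 * pi / 3) (gL l).
Hypothesis hneg : forall l u, (1 <= l <= m)%N -> Re (gL l u) < 0.
Hypothesis hj : forall l u, (1 <= l < m)%N -> joined_to_infinity (gL l.+1) 1 (gL l u).

Let hG1 : is_contour (2 * pi / 3) (gL 1%N). Proof. by apply: hgL. Qed.
Let hG1n u : Re (gL 1%N u) < 0. Proof. by apply: hneg. Qed.

(** The index is shifted by one because [hitk] counts heat steps. The cut-off outside $1,\dots,m$
    makes the bound of [hitk_decay] valid for all indices. *)
Let Afac (p : RR) (y : nat * RR) : R[i] :=
  if (1 <= y.1 <= m)%N then hitk al be (gR y.2) y.1.-1 1 p else 0.
Let Bfac (y : nat * RR) (q : RR) : R[i] :=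
  (fexp al be y.1 (gR y.2))^-1 * Bq W h (gL 1%N) (al 1%N) (gR y.2) q.

Lemma fexp_inv j z : (fexp al be j z)^-1 = phi kapR (- al j) (- be j) z.
Proof.
rewrite /fexp -cexpN /phi; apply: (congr1 cexp); rewrite /kapR !realCN; ring.
Qed.

Lemma Afac_cmeas : cmeas (fun q : RR * (nat * RR) => Afac q.1 q.2).
Proof.
have [mG _ _] := right_rapid hgR.
apply: (@cmeas_nat R _ _ (fun q : RR * (nat * RR) => q.2.1) (fun n q =>
  if (1 <= n <= m)%N then hitk al be (gR q.2.2) n.-1 1 q.1 else 0)).
  exact: (measurableT_comp measurable_fst measurable_snd).
move=> n; case: (1 <= n <= m)%N; last exact: cmeas_cst.
apply: hitk_cmeas; last exact: measurable_fst.
apply: (cmeas_comp mG (g := fun q : RR * (nat * RR) => q.2.2)).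
exact: (measurableT_comp measurable_snd measurable_snd).
Qed.

Lemma Bfac_cmeas : cmeas (fun q : (nat * RR) * RR => Bfac q.1 q.2).
Proof.
have [mG _ _] := right_rapid hgR.
have mGq : cmeas (fun q : (nat * RR) * RR => gR q.1.2).
  apply: (cmeas_comp mG (g := fun q : (nat * RR) * RR => q.1.2)).
  exact: (measurableT_comp measurable_snd measurable_fst).
apply: cmeasM; last first.
  by apply: (Bq_cmeas hW hh hgR hgRpos hG1 hG1n) => //; exact: measurable_snd.
rewrite (_ : (fun q => _) = (fun q : (nat * RR) * RR =>
  phi kapR (- al q.1.1) (- be q.1.1) (gR q.1.2))); last first.
  by apply/funext => q; rewrite fexp_inv.
apply: (@cmeas_nat R _ _ (fun q : (nat * RR) * RR => q.1.1) (fun n q =>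
  phi kapR (- al n) (- be n) (gR q.1.2))).
  exact: (measurableT_comp measurable_fst measurable_fst).
by move=> n; apply: phi_cmeas => //; exact: measurable_cst.
Qed.

Theorem path_integral_contour :
  [/\ fredholm_cvg (cint leb) (Sker W h gR m al be),
      fredholm_cvg (sum_contour_int gR m) (Tker W h al be gL) &
      fredholm_det (cint leb) (Sker W h gR m al be) =
      fredholm_det (sum_contour_int gR m) (Tker W h al be gL)].
Proof.
have [del [d0 d1 hR hL]] := separation hgR hgRpos hG1 hG1n.
have [e [C [e0 C0 hC]]] := hitk_decay be hal d0.
have [K [K0 hK]] := Bq_bound hW hh hgR hgRpos hG1 hG1n (al 1%N) e0 d0 d1 hL.
have [mG mv _] := right_rapid hgR.
(* The Gaussians in [a] and [b] are inverse to each other, so $a\,b=Ce^{-\delta|p|}$ is integrable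
   although [b] is unbounded. *)
pose a (p : RR) := C * expR (- (del * `|p|)) * expR (- (e * Num.min p 0 ^+ 2)).
pose b (q : RR) := expR (e * Num.min q 0 ^+ 2).
(* The part of the bound on [Bfac] that depends on $(j,\eta)$; Airy decay makes it integrable
   against the velocity. *)
pose w (y : nat * RR) := nrm (phi kapR (- al y.1) (- be y.1) (gR y.2)) * (K * expR (K * nrm (gR y.2) ^+ 2)).
pose T' x y := - cint leb (fun p => Afac p x * Bfac y p).
have a0 p : 0 < a p by rewrite !mulr_gt0 ?expR_gt0.
have b0 p : 0 < b p by exact: expR_gt0.
have w0 y : 0 <= w y by rewrite mulr_ge0 ?nrm_ge0// mulr_ge0 ?expR_ge0.
have ig : rint leb (fun p => a p * b p).
  rewrite (_ : (fun p => _) = (fun p => C * expR (- (del * `|p|)))).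
    by apply: rintZ; exact: rint_exp_abs.
  by apply/funext => p; rewrite /a /b -mulrA -expRD addNr expR0 mulr1.
have g0 p : 0 <= a p * b p by rewrite ltW// mulr_gt0.
have iw i : rint leb (fun u => w (i, u) * nrm (velocity gR u)).
  have [M [M0 hM]] := rapid_phi (- al i) (right_rapid hgR) K0 ltr01.
  apply: (@rint_le R _ RR leb _ (fun u => K * (M * expR (1 * (- be i) ^+ 2)) * gau 1 u)).
  - apply: measurable_funM; last exact: (cmeas_nrm mv).
    apply: measurable_funM.
      by apply: (@cmeas_nrm R _ RR (fun u => phi kapR (- al i) (- be i) (gR u)));
        apply: phi_cmeas => //; exact: measurable_cst.
    apply: measurable_funM; first exact: measurable_cst.
    apply: (@measurableT_comp _ _ _ RR RR RR expR _ (fun u => K * nrm (gR u) ^+ 2)).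
      exact: measurable_expR.
    apply: measurable_funM; first exact: measurable_cst.
    by apply: measurable_funX; exact: (cmeas_nrm mG).
  - by apply: rintZ; exact: rint_gau.
  move=> u; rewrite ger0_norm; last by rewrite mulr_ge0 ?nrm_ge0.
  have := hM u (- be i); rewrite nrmM => k1.
  have -> : w (i, u) = nrm (phi kapR (- al i) (- be i) (gR u)) * (K * expR (K * nrm (gR u) ^+ 2)) by [].
  move: k1; move: (nrm (phi _ _ _ _)) (nrm (velocity _ _)) (expR _) (expR _) (gau _ _) => x1 x2 x3 x4 x5 k1.
  rewrite (_ : _ * x2 = K * (x1 * x2 * x4)); last by ring.
  by rewrite -[leRHS]mulrA ler_wpM2l.
have hI1 := cint_ifun g0 ig; have hI2 := sum_cint_ifun m mv w0 iw.
have hA p y : nrm (Afac p y) <= a p.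
  rewrite /Afac; case: ifP => [/andP[y1 y2]|_]; last by rewrite nrm0 ltW.
  by apply: hC; [exact: hR|rewrite prednK].
have hB y q : nrm (Bfac y q) <= w y * b q.
  rewrite nrmM fexp_inv /w -mulrA ler_wpM2l ?nrm_ge0//.
  exact: (hK _ q (hR _)).2.
have hS p q : Sker W h gR m al be p q = - sum_cint m (velocity gR) (fun y => Afac p y * Bfac y q).
  rewrite (Sker_formula hW hh hgR hgRpos hG1 hG1n be hal p q m0) /sum_cint big_add1 big_mkord.
  apply: (congr1 -%R); apply: eq_bigr => j _; apply: (congr1 (fun z => ipi * z)).
  apply: (@eq_cint R _ RR leb _ _) => u; rewrite /Afac /Bfac /= ltn_ord /= fexp_inv /bfac.
  move: (hitk _ _ _ _ _ _) (phi _ _ _ _) (Bq _ _ _ _ _ _) => *; ring.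
have hex (F : RR * (nat * RR) -> R[i]) C' : cmeas F ->
    (forall x y, nrm (F (x, y)) <= C' * (a x * b x * w y)) ->
    cint leb (fun x => sum_cint m (velocity gR) (fun y => F (x, y))) =
    sum_cint m (velocity gR) (fun y => cint leb (fun x => F (x, y))).
  move=> mF hF.
  apply: (sum_cint_exchange (g := fun p => a p * b p) m mv w0 iw (C := `|C'|) g0 ig (normr_ge0 _) mF).
  move=> x y; apply: le_trans (hF x y) _; rewrite ler_wpM2r ?ler_norm//.
  by rewrite mulr_ge0.
have [cS cT eq] := fredholm_swap a0 b0 hI1 hI2 hex Afac_cmeas Bfac_cmeas hA hB hS (fun x y => erefl (T' x y)).
have hT x y : (1 <= x.1 <= m)%N -> (1 <= y.1 <= m)%N ->
    Tker W h al be gL (x.1, gR x.2) (y.1, gR y.2) = T' x y.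
  case: x y => [[//|i] u] [j s] hi hj'.
  rewrite (Tker_hitk hW hh hgR hgRpos be hal m0 hgL hneg hj j d0 d1 hL (hR u) (hR s) (hi : (i < m)%N)).
  by apply: (congr1 -%R); apply: (@eq_cint R _ RR leb _ _) => p; rewrite /Afac (hi : (1 <= (i.+1, u).1 <= m)%N).
have E n : fredholm_sum (sum_contour_int gR m) (Tker W h al be gL) n =
    fredholm_sum (sum_cint m (velocity gR)) T' n by exact: fredholm_sum_contour.
have ER : (fun n => fredholm_sum (sum_contour_int gR m) (Tker W h al be gL) n) =
    (fun n => fredholm_sum (sum_cint m (velocity gR)) T' n) by apply/funext.
split; first exact: cS.
- case: cT => c1 c2; split.
    by rewrite (_ : (fun n => _) = (fun n => Re (fredholm_sum (sum_cint m (velocity gR)) T' n)))//;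
      apply/funext => n; rewrite E.
  by rewrite (_ : (fun n => _) = (fun n => Im (fredholm_sum (sum_cint m (velocity gR)) T' n)))//;
      apply/funext => n; rewrite E.
rewrite /fredholm_det in eq *; rewrite eq.
by congr (limn _ +i* limn _); apply/funext => n; rewrite E.
Qed.

End Main.

Theorem mainTheorem12 (R : realType)
  (d : measure_display) (Omega : measurableType d) (P : probability Omega R)
  (W : R -> {RV P >-> R}) (hW : two_sided_brownian W)
  (h : R -> \bar R) (hh : UCc h)
  (m : nat) (hm : (0 < m)%N)
  (alpha beta : nat -> R)
  (halpha : forall i j : nat, (1 <= i)%N -> (i < j)%N -> (j <= m)%N ->
     alpha i < alpha j)
  (gL : nat -> R -> complex R) (gR : R -> complex R)
  (hgL : forall l : nat, (1 <= l <= m)%N -> is_contour (2 * pi / 3) (gL l))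
  (hgLneg : forall (l : nat) (t : R), (1 <= l <= m)%N -> complex.Re (gL l t) < 0)
  (hgLord : forall k l : nat, (1 <= k)%N -> (k < l)%N -> (l <= m)%N ->
     left_of (gL l) (gL k))
  (hgR : is_contour (pi / 5) gR)
  (hgRpos : forall t : R, 0 < complex.Re (gR t)) :
  let S := Sker W h gR m alpha beta in
  let T := Tker W h alpha beta gL in
  let intR := cint (@lebesgue_measure R) in
  let intG := sum_contour_int gR m in
  [/\ fredholm_cvg intR S,
      fredholm_cvg intG T &
      fredholm_det intR S = fredholm_det intG T].
Proof.
apply: (path_integral_contour hW hh hgR hgRpos beta _ hm hgL (fun l u => hgLneg l u)).
- by move=> j /andP[j1 jm]; exact: halpha.
- by move=> l u /andP[l1 lm]; exact: (hgLord l l.+1 l1 (ltnSn l) lm).2.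
Qed.
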